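(* Let $q=2^n>2$ be not a square, $k=\mathbb{F}_q$, and $m=\lfloor 2\sqrt{q}\rfloor$. If $m\equiv1,5,7\pmod 8$, there exists a genus $3$ curve $C$ over $k$ with $\#C(k)=q+1+3m$ (defect $0$). If $m\equiv0,2,6\pmod8$, there exists a genus $3$ curve $C$ over $k$ with $\#C(k)=q+1+3m-3$ (defect $3$).
   Context: A curve means a smooth, projective, absolutely irreducible curve. The defect of a genus $3$ curve $C/k$ is $q+1+3m-\#C(k)$. *)

(* Defs.v *)
From HB Require Import structures.
From mathcomp Require Import all_boot all_order all_algebra all_field.
From mathcomp Require Export mpoly.

Set Implicit Arguments.
Unset Strict Implicit.
Unset Printing Implicit Defensive.

Import Order.TTheory GRing.Theory Num.Theory.
Local Open Scope ring_scope.

Definition kbar (k : finFieldType) : closedFieldType :=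
  projT1 (countable_algebraic_closure k).

Definition to_kbar (k : finFieldType) : {rmorphism k -> kbar k} :=
  sval (projT2 (countable_algebraic_closure k)).

Lemma to_kbar_integral (k : finFieldType) : integralRange (to_kbar k).
Proof. exact: svalP (projT2 (countable_algebraic_closure k)). Qed.

(* [x] is a vector of homogeneous coordinates of a point of the common zero
   locus of [s] in the projective space of dimension N. *)
Definition proj_zero (K : fieldType) (N : nat) (s : seq {mpoly K[N.+1]})
    (x : 'rV[K]_N.+1) : bool :=
  (x != 0) && all (fun p : {mpoly K[N.+1]} => p.@[x 0] == 0) s.

Definition all_homog (K : fieldType) (N : nat) (s : seq {mpoly K[N.+1]}) : Prop :=
  forall p, p \in s -> exists d : nat, p \is d.-homog.

(* Zariski irreducibility: the locus is nonempty and, when it is covered by two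
   closed subsets, it lies in one of them. *)
Definition proj_irreducible (K : fieldType) (N : nat)
    (s : seq {mpoly K[N.+1]}) : Prop :=
  (exists x, proj_zero s x) /\
  forall s1 s2 : seq {mpoly K[N.+1]}, all_homog s1 -> all_homog s2 ->
    (forall x, proj_zero s x -> proj_zero s1 x \/ proj_zero s2 x) ->
    (forall x, proj_zero s x -> proj_zero s1 x) \/
    (forall x, proj_zero s x -> proj_zero s2 x).

Definition jacobian (K : fieldType) (N : nat) (s : seq {mpoly K[N.+1]})
    (x : 'rV[K]_N.+1) : 'M[K]_(size s, N.+1) :=
  \matrix_(i < size s, j < N.+1) (s`_i)^`M(j).@[x 0].

Definition in_ideal (K : fieldType) (n : nat) (s : seq {mpoly K[n]})
    (p : {mpoly K[n]}) : Prop :=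
  exists g : 'I_(size s) -> {mpoly K[n]}, p = \sum_(i < size s) g i * s`_i.

(* [h] is the dimension of the degree [d] part of the homogeneous coordinate
   ring k[x_0..x_N]/(s). *)
Definition hilbert_value (K : fieldType) (N : nat) (s : seq {mpoly K[N.+1]})
    (d h : nat) : Prop :=
  exists2 I_d : {vspace dhomog N.+1 K d},
    forall p : dhomog N.+1 K d, p \in I_d <-> in_ideal s (val p) &
    (h + \dim I_d)%N = \dim {: dhomog N.+1 K d}.

Definition hilbert_polynomial (K : fieldType) (N : nat)
    (s : seq {mpoly K[N.+1]}) (P : {poly rat}) : Prop :=
  exists d0 : nat, forall d, (d0 <= d)%N ->
    exists2 h : nat, hilbert_value s d h & P.[d%:R] = h%:R.

(* A smooth, projective, absolutely irreducible curve over k, embedded as the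
   closed subscheme Proj k[x_0..x_N]/(curve_eqs) of projective N-space. *)
Record curve (k : finFieldType) : Type := Curve {
  curve_N : nat;
  curve_eqs : seq {mpoly k[curve_N.+1]};
  curve_geom_eqs := map (map_mpoly (to_kbar k)) curve_eqs;
  curve_homog : all_homog curve_eqs;
  (* the dimension is the degree of the Hilbert polynomial *)
  curve_dim1 : exists2 P, hilbert_polynomial curve_eqs P & size P = 2%N;
  curve_abs_irr : proj_irreducible curve_geom_eqs;
  (* Jacobian criterion: the rank is the codimension N - 1 at every geometric
     point *)
  curve_smooth : forall x, proj_zero curve_geom_eqs x ->
    (\rank (jacobian curve_geom_eqs x)).+1 = curve_N
}.

(* For a smooth projective absolutely irreducible curve the genus equals the
   arithmetic genus 1 - P(0), with P the Hilbert polynomial. *)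
Definition has_genus (k : finFieldType) (C : curve k) (g : nat) : Prop :=
  exists2 P, hilbert_polynomial (curve_eqs C) P & g%:R = 1 - P.[0].

(* C(k): nonzero solution vectors modulo scaling by k^*. *)
Definition rational_points (k : finFieldType) (C : curve k) :
    {set {set 'rV[k]_(curve_N C).+1}} :=
  [set [set a *: x | a : k & a != 0]
     | x : 'rV[k]_(curve_N C).+1 & proj_zero (curve_eqs C) x].

(* The integer part of 2 sqrt(q); sqrtC q is the nonnegative real root. *)
Definition weil_m (q : nat) : int := Num.floor (2 * sqrtC (q%:R : algC)).

Definition defect (k : finFieldType) (C : curve k) : int :=
  #|k|%:Z + 1 + 3 * weil_m #|k| - #|rational_points C|%:Z.

(* Main.v *)
(* For a, b, c in k = F_q, q = 2^n, the plane quartic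
     z^4 + (x^2+xy+y^2) z^2 + xy(x+y) z + a (x^2+xy)^2 + b (x^2+xy) y^2 + c y^4 = 0
   is smooth as soon as a (b^2 + c) <> 0.  Its part depending on z is additive in z with kernel
   {0, x, y, x+y}, so the number of points over a given x : y is governed by three Artin-Schreier
   characters, and summing over x yields
     q + 1 - 3 K(s)  points for (a, b, c) = (1, 0, s^2),
     q + 1 + 3 K(r)  points for (a, b, c) = (r^2, r, 0) with Tr r = 0,
   where K is the Kloosterman sum.  As K = 3 mod 4, and K(r) = 7 mod 8 forces Tr r = 0, it suffices to
   find, for every t = 1 mod 4 with t^2 < 4q, an s in k^* with K(s) = -t.

   This s is the reduction of a point with complex multiplication.  Choose tau with
   2q tau^2 + (t-2q) tau - b = 0, b = (t-q-1)/2; then alpha = 2q tau + t - q has norm q, trace t, and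
   maps <1, tau> onto <1, q tau>.  The functions x and d below, ratios of theta constants and theta
   functions, satisfy d^2 x = (1 + 4x)(x + 4s), which for d = 1 + 2y reads y^2 + y = x + s/x + 4s.  The
   n isogenies z |-> 2z from C/<1, 2^i tau> to C/<1, 2^(i+1) tau> close up into multiplication by
   alpha.  At a place dividing 2 and the conjugate of alpha, each of them reduces to the Frobenius.
   Hence the points z with conj(alpha) z = z (resp. -z), of which there are q+1-t (resp. q+1+t), reduce
   to distinct x in k with Tr(x + s/x) = 0 (resp. 1), possibly exchanged, up to z = -z and apart
   from the pole and the zero of x.  These lower bounds add up to q - 1, so they are equalities. *)

From HB Require Import structures.
Require Import Defs.
From mathcomp Require Import complex generic_quotient.
From mathcomp Require Import boolp classical_sets reals Rstruct topology normedtype sequences.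
From mathcomp Require Import derive exp trigo.
From mathcomp Require Import all_boot all_order all_algebra all_fingroup all_solvable all_field.
From mathcomp Require Import zify ring lra.

Set Implicit Arguments.
Unset Strict Implicit.
Unset Printing Implicit Defensive.
Import Order.TTheory GRing.Theory Num.Theory.
Import numFieldNormedType.Exports.
Local Open Scope ring_scope.
Local Notation pi := trigo.pi.

(** * Summable families of complex numbers *)

(** The sum K(s) is minus the Frobenius trace of the elliptic curve y^2 + y = x + s/x, so a curve
    with a prescribed trace has to be produced. The obstacle is to pass from complex tori to
    characteristic 2 without models or good reduction. What passes is only a list of polynomial
    relations between x, d, s and the multipliers mu along the closed chain of n isogenies, read in
    a valuation ring of the complex numbers. Integrality is not taken from modular forms: it comes
    from the chain closing up, because a quantity that shrinks at every step and returns to its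
    initial value is 0.

    The equation of tau is dictated by level structure. The functions x and d depend on the half
    periods, so the matrix relating alpha <1, tau> to <1, q tau> must be the identity modulo 2.
    Invariance then follows from a Liouville-type argument that uses averages over half periods
    instead of complex analysis. It determines d only up to a sign, which is the origin of the
    possible exchange; the congruence K = 3 mod 4 removes it.

    For even m the trace m - 1 is realised. Trace 3 mod 8 is out of reach: K(s) = 3 mod 8 forces Tr
    s = 1, against the condition on the second quartic. *)

Section Norm.
Variable R : realType.
Local Notation C := R[i].
Local Notation nrm := (@Normc.normc R).

Lemma nrm0 : nrm 0 = 0. Proof. exact: Normc.normc0. Qed.
Lemma nrm1 : nrm 1 = 1. Proof. exact: Normc.normc1. Qed.
Lemma nrmM x y : nrm (x * y) = nrm x * nrm y. Proof. exact: Normc.normcM. Qed.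
Lemma nrmV x : nrm x^-1 = (nrm x)^-1. Proof. exact: Normc.normcV. Qed.
Lemma nrmD x y : nrm (x + y) <= nrm x + nrm y. Proof. exact: le_normcD. Qed.
Lemma nrmN x : nrm (- x) = nrm x. Proof. exact: normcN. Qed.
Lemma nrm_eq0 x : (nrm x == 0) = (x == 0).
Proof.
apply/eqP/eqP => [/Normc.eq0_normc //|->]; exact: nrm0.
Qed.
Lemma nrm_ge0 x : 0 <= nrm x.
Proof. by case: x => a b; rewrite /Normc.normc sqrtr_ge0. Qed.
Lemma nrm_gt0 x : (0 < nrm x) = (x != 0).
Proof. by rewrite lt0r nrm_eq0 nrm_ge0 andbT. Qed.
Lemma nrmBC x y : nrm (x - y) = nrm (y - x).
Proof. by rewrite -nrmN opprB. Qed.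
Lemma nrm_tri x y z : nrm (x - z) <= nrm (x - y) + nrm (y - z).
Proof. by apply: le_trans (nrmD _ _); rewrite addrA subrK. Qed.
Lemma nrm_lbound x y : nrm x - nrm y <= nrm (x - y).
Proof. by rewrite lerBlDr; apply: le_trans (nrmD _ _); rewrite subrK. Qed.
Lemma nrmX x n : nrm (x ^+ n) = nrm x ^+ n.
Proof. by elim: n => [|n IH]; rewrite ?expr0 ?nrm1 // !exprS nrmM IH. Qed.
Lemma nrmXz x (n : int) : nrm (x ^ n) = nrm x ^ n.
Proof.
by case: n => n; rewrite ?NegzE -?exprnN -?exprnP ?nrmV nrmX.
Qed.
Lemma nrm_sum (I : Type) (r : seq I) (P : pred I) (f : I -> C) :
  nrm (\sum_(i <- r | P i) f i) <= \sum_(i <- r | P i) nrm (f i).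
Proof.
elim/big_ind2: _ => [|x1 x2 y1 y2 h1 h2|//]; first by rewrite nrm0.
by apply: le_trans (nrmD _ _) _; rewrite lerD.
Qed.
Lemma nrm_real (x : R) : nrm (real_complex R x) = `|x|.
Proof. by rewrite /Normc.normc /= expr0n /= addr0 sqrtr_sqr. Qed.
Lemma nrm_nat n : nrm n%:R = n%:R.
Proof. by rewrite -(rmorph_nat (real_complex R)) nrm_real normr_nat. Qed.
Lemma nrm_Re (x : C) : `|complex.Re x| <= nrm x.
Proof.
case: x => a b /=; rewrite -sqrtr_sqr ler_wsqrtr // lerDl sqr_ge0 //.
Qed.
Lemma nrm_Im (x : C) : `|complex.Im x| <= nrm x.
Proof.
case: x => a b /=; rewrite -sqrtr_sqr ler_wsqrtr // lerDr sqr_ge0 //.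
Qed.

End Norm.

Section HasSum.
Variable R : realType.
Local Notation C := R[i].
Local Notation nrm := (@Normc.normc R).

(** Unconditional summation along finite subfamilies ordered by inclusion. No enumeration of the
    index type is fixed, so reindexing by a bijection and splitting over a disjoint sum are
    immediate, also for families over pairs of integers. *)
Definition has_sum (I : eqType) (f : I -> C) (l : C) :=
  forall e : R, 0 < e -> exists A : seq I, forall B, uniq B ->
    {subset A <= B} -> nrm (\sum_(i <- B) f i - l) < e.

Definition sum_bounded (I : eqType) (m : I -> R) (M : R) :=
  (forall i, 0 <= m i) /\
  forall B : seq I, uniq B -> \sum_(i <- B) m i <= M.

Lemma eq_has_sum (I : eqType) (f g : I -> C) l :
  f =1 g -> has_sum f l -> has_sum g l.
Proof.
move=> fg hf e e0; have [A hA] := hf e e0; exists A => B uB sB.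
by rewrite -(eq_bigr _ (fun i _ => fg i)) hA.
Qed.

Lemma has_sum_unique (I : eqType) (f : I -> C) l l' :
  has_sum f l -> has_sum f l' -> l = l'.
Proof.
move=> hf hf'; apply/eqP; rewrite -subr_eq0 -nrm_eq0; apply/eqP.
apply/le_anti; rewrite nrm_ge0 andbT; apply/ler_addgt0Pr => e e0.
rewrite add0r; have e20 : 0 < e / 2 by lra.
have [A hA] := hf _ e20; have [A' hA'] := hf' _ e20.
have uB : uniq (undup (A ++ A')) by exact: undup_uniq.
have h1 := hA _ uB; have h2 := hA' _ uB.
apply: le_trans (nrm_tri _ (\sum_(i <- undup (A ++ A')) f i) _) _.
rewrite nrmBC [leRHS](splitr e); apply: lerD; apply: ltW; [apply: h1|apply: h2].
  by move=> x xA; rewrite mem_undup mem_cat xA.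
by move=> x xA; rewrite mem_undup mem_cat xA orbT.
Qed.

Lemma has_sumD (I : eqType) (f g : I -> C) a b :
  has_sum f a -> has_sum g b -> has_sum (fun i => f i + g i) (a + b).
Proof.
move=> hf hg e e0; have e20 : 0 < e / 2 by lra.
have [A hA] := hf _ e20; have [A' hA'] := hg _ e20.
exists (A ++ A') => B uB sB; rewrite big_split /= opprD addrACA.
apply: le_lt_trans (nrmD _ _) _; rewrite [ltRHS](splitr e); apply: ltrD.
  by apply: hA => // x xA; apply: sB; rewrite mem_cat xA.
by apply: hA' => // x xA; apply: sB; rewrite mem_cat xA orbT.
Qed.

Lemma has_sumZ (I : eqType) (f : I -> C) a c :
  has_sum f a -> has_sum (fun i => c * f i) (c * a).
Proof.
move=> hf e e0; have d0 : 0 < e / (nrm c + 1).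
  by rewrite divr_gt0 // ltr_wpDl ?nrm_ge0.
have [A hA] := hf _ d0; exists A => B uB sB.
rewrite -mulr_sumr -mulrBr nrmM.
have := hA _ uB sB; rewrite ltr_pdivlMr ?ltr_wpDl ?nrm_ge0 // => h.
apply: le_lt_trans h; rewrite mulrC ler_wpM2l ?nrm_ge0 // lerDl //.
Qed.

Lemma has_sum_reindex (I J : eqType) (h : J -> I) (f : I -> C) l :
  bijective h -> has_sum f l -> has_sum (f \o h) l.
Proof.
move=> [g hK gK] hf e e0; have [A hA] := hf _ e0.
exists (map g A) => B uB sB.
have := hA (map h B); rewrite map_inj_uniq; last exact: can_inj hK.
rewrite big_map; apply=> // x xA; rewrite -(gK x); apply: map_f.
by apply: sB; apply: map_f.
Qed.

Lemma has_sum_sum (I J : eqType) (f : I + J -> C) a b :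
  has_sum (f \o inl) a -> has_sum (f \o inr) b -> has_sum f (a + b).
Proof.
move=> hf hg e e0; have e20 : 0 < e / 2 by lra.
have [A hA] := hf _ e20; have [A' hA'] := hg _ e20.
exists (map inl A ++ map inr A') => B uB sB.
pose l (x : I + J) := if x is inl i then Some i else None.
pose r (x : I + J) := if x is inr i then Some i else None.
have perm : perm_eq B (map inl (pmap l B) ++ map inr (pmap r B)).
  elim: {uB sB} B => [|[i|j] B IH] //=; first by rewrite perm_cons.
  apply: (@perm_trans _ (inr j :: (map inl (pmap l B) ++ map inr (pmap r B)))).
    by rewrite perm_cons.
  by rewrite perm_sym; apply/permPl; exact: (perm_catCA _ [:: inr j]).
rewrite (perm_big _ perm) big_cat !big_map /= opprD addrACA.
apply: le_lt_trans (nrmD _ _) _; rewrite [ltRHS](splitr e); apply: ltrD.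
  apply: hA; first by apply: (@pmap_uniq _ _ l inl) => // -[].
  move=> x xA; have := sB (inl x); rewrite mem_cat map_f //= => /(_ isT) h.
  by rewrite mem_pmap; apply/mapP; exists (inl x).
apply: hA'; first by apply: (@pmap_uniq _ _ r inr) => // -[].
move=> x xA; have := sB (inr x); rewrite mem_cat (map_f inr xA) orbT => /(_ isT) h.
by rewrite mem_pmap; apply/mapP; exists (inr x).
Qed.

Lemma big_sub_split (V : nmodType) (I : eqType) (F : I -> V) (A B : seq I) :
  uniq A -> uniq B -> {subset A <= B} ->
  \sum_(i <- B) F i = \sum_(i <- A) F i + \sum_(i <- B | i \notin A) F i.
Proof.
move=> uA uB sAB; rewrite (bigID (mem A)) /=; congr (_ + _).
rewrite -big_filter; apply: perm_big; apply: uniq_perm; rewrite ?filter_uniq //.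
move=> x; rewrite mem_filter; apply/andP/idP => [[//]|xA]; split=> //.
exact: sAB.
Qed.

Lemma sum_bounded_mono (I : eqType) (m : I -> R) (A B : seq I) :
  (forall i, 0 <= m i) -> uniq A -> uniq B -> {subset A <= B} ->
  \sum_(i <- A) m i <= \sum_(i <- B) m i.
Proof.
move=> m0 uA uB sAB; rewrite (big_sub_split _ uA uB sAB) lerDl.
by apply: sumr_ge0.
Qed.

Lemma sum_bounded_le (I : eqType) (m m' : I -> R) (M : R) :
  (forall i, 0 <= m' i <= m i) -> sum_bounded m M -> sum_bounded m' M.
Proof.
move=> h [_ hM]; split=> [i|B uB]; first by case/andP: (h i).
by apply: le_trans (hM B uB); apply: ler_sum => i _; case/andP: (h i).
Qed.

Lemma sum_bounded_tail (I : eqType) (m : I -> R) (M e : R) :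
  sum_bounded m M -> 0 < e -> exists A : seq I, uniq A /\
    forall B, uniq B -> {subset A <= B} ->
      \sum_(i <- B) m i <= \sum_(i <- A) m i + e.
Proof.
move=> [m0 hM] e0.
pose E : set R := [set x | exists B : seq I, uniq B /\ x = \sum_(i <- B) m i]%classic.
have hE : has_sup E.
  split; first by exists 0; exists [::]; rewrite big_nil.
  by exists M => x [B [uB ->]]; apply: hM.
have [_ [A [uA ->]] hA] := sup_adherent e0 hE.
exists A; split=> // B uB _.
have : \sum_(i <- B) m i <= sup E by apply: sup_upper_bound => //; exists B.
by move: hA; rewrite ltrBlDr => /ltW h h'; apply: le_trans h' h.
Qed.

Lemma has_sum_nonneg (I : eqType) (m : I -> R) (M : R) :
  sum_bounded m M -> exists l : R, has_sum (fun i => real_complex R (m i)) (real_complex R l).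
Proof.
move=> [m0 hM].
pose E : set R := [set x | exists B : seq I, uniq B /\ x = \sum_(i <- B) m i]%classic.
have hE : has_sup E.
  split; first by exists 0; exists [::]; rewrite big_nil.
  by exists M => x [B [uB ->]]; apply: hM.
exists (sup E) => e e0.
have [_ [A [uA ->]] hA] := sup_adherent e0 hE.
exists A => B uB sAB.
rewrite -rmorph_sum -rmorphB nrm_real.
have h1 : \sum_(i <- B) m i <= sup E by apply: sup_upper_bound => //; exists B.
have h2 := sum_bounded_mono m0 uA uB sAB.
rewrite ler0_norm ?subr_le0 // opprB; lra.
Qed.

(** Real and imaginary parts are treated separately; a real family [r] is written as
    [(|r| + r) - |r|], a difference of two bounded nonnegative families, whose sums are suprema of
    finite sums. *)
Lemma has_sum_exists (I : eqType) (f : I -> C) (M : R) :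
  sum_bounded (nrm \o f) M -> exists l, has_sum f l.
Proof.
move=> hM.
have real (r : I -> R) : (forall i, `|r i| <= nrm (f i)) ->
    exists l, has_sum (fun i => real_complex R (r i)) l.
  move=> hr.
  have [|l1 h1] := @has_sum_nonneg I (fun i => `|r i|) M.
    by apply: (sum_bounded_le _ hM) => i; rewrite normr_ge0 /=.
  have [|l2 h2] := @has_sum_nonneg I (fun i => `|r i| + r i) (2 * M).
    split=> [i|B uB]; first by have := ler_norm (- r i); rewrite normrN; lra.
    apply: (@le_trans _ _ (\sum_(i <- B) 2 * nrm (f i))).
      apply: ler_sum => i _; have := ler_norm (r i); have := hr i; lra.
    by rewrite -mulr_sumr ler_wpM2l //; apply: hM.2.
  exists (real_complex R l2 + (-1) * real_complex R l1).
  apply: eq_has_sum (has_sumD h2 (has_sumZ (-1) h1)) => i.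
  by rewrite mulN1r -rmorphB addrAC subrr add0r.
have [l1 h1] := real (fun i => complex.Re (f i)) (fun i => nrm_Re _).
have [l2 h2] := real (fun i => complex.Im (f i)) (fun i => nrm_Im _).
exists (l1 + 'i%C * l2); apply: eq_has_sum (has_sumD h1 (has_sumZ 'i%C h2)) => i.
by rewrite -complexE.
Qed.

Lemma has_sum_norm_le (I : eqType) (f : I -> C) (l : C) (m : I -> R) (M : R) :
  (forall i, nrm (f i) <= m i) -> sum_bounded m M -> has_sum f l -> nrm l <= M.
Proof.
move=> fm [m0 hM] hf; apply/ler_addgt0Pr => e e0.
have [A hA] := hf _ e0.
have h : nrm (\sum_(i <- undup A) f i - l) < e.
  by apply: hA; [exact: undup_uniq|move=> x; rewrite mem_undup].
have h1 := nrm_sum (undup A) xpredT f.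
have h2 : \sum_(i <- undup A) nrm (f i) <= M.
  apply: le_trans (hM _ (undup_uniq A)); exact: ler_sum.
have h3 := nrm_tri 0 (\sum_(i <- undup A) f i) l.
move: h3; rewrite !sub0r !nrmN; lra.
Qed.

(* The family is compared with its value on a finite set outside which the majorant is small. *)
Lemma has_sum_near_partial (I : eqType) (f : I -> C) (l : C) (m : I -> R) (A : seq I) (e : R) :
  (forall i, nrm (f i) <= m i) -> (forall i, 0 <= m i) -> uniq A ->
  (forall B, uniq B -> {subset A <= B} ->
      \sum_(i <- B) m i <= \sum_(i <- A) m i + e) ->
  has_sum f l -> nrm (\sum_(i <- A) f i - l) <= e.
Proof.
move=> fm m0 uA hA hf; apply/ler_addgt0Pr => d d0.
have [B hB] := hf _ d0.
pose B' := undup (A ++ B).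
have sA : {subset A <= B'} by move=> x xA; rewrite mem_undup mem_cat xA.
have sB : {subset B <= B'} by move=> x xA; rewrite mem_undup mem_cat xA orbT.
have uB : uniq B' by exact: undup_uniq.
have h1 := hB _ uB sB.
have h2 := hA _ uB sA.
apply: le_trans (nrm_tri _ (\sum_(i <- B') f i) _) _; apply: lerD; last exact: ltW.
rewrite nrmBC (big_sub_split _ uA uB sA) addrAC subrr add0r.
apply: le_trans (nrm_sum _ _ _) _.
apply: (@le_trans _ _ (\sum_(i <- B' | i \notin A) m i)); first exact: ler_sum.
by move: h2; rewrite (big_sub_split _ uA uB sA) lerD2l.
Qed.

(** A large finite set [B] of pairs lies between the rectangles [Q], on [A] and [A'], and [P], on
    [B1] and [B2]. Over rectangles double sums factor: the norms over [P] exceed those over [Q] by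
    little, which controls the passage from [B] to [P], and the tail estimates of the two factors
    lead from [P] to [a * b]. *)
Lemma has_sum_mul (I J : eqType) (f : I -> C) (g : J -> C) a b (M N : R) :
  sum_bounded (nrm \o f) M -> sum_bounded (nrm \o g) N ->
  has_sum f a -> has_sum g b ->
  has_sum (fun x : I * J => f x.1 * g x.2) (a * b).
Proof.
move=> hM hN hf hg e e0.
have M0 : 0 <= M by have := hM.2 [::] isT; rewrite big_nil.
have N0 : 0 <= N by have := hN.2 [::] isT; rewrite big_nil.
(* Each of the two errors below is at most [d * (M + N + 1)]; [d <= 1] serves to absorb the term
   [d * d]. *)
pose d : R := Num.min 1 (e / (2 * (M + N + 1) + 1)).
have d0 : 0 < d by rewrite lt_min ltr01 divr_gt0 //; lra.
have d1 : d <= 1 by rewrite ge_min lexx.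
have de : d * (2 * (M + N + 1)) < e.
  have : d <= e / (2 * (M + N + 1) + 1) by rewrite ge_min lexx orbT.
  rewrite ler_pdivlMr; last lra.
  nra.
have [A [uA hA]] := sum_bounded_tail hM d0.
have [A' [uA' hA']] := sum_bounded_tail hN d0.
exists (allpairs pair A A') => B uB sB.
pose B1 := undup (A ++ map fst B); pose B2 := undup (A' ++ map snd B).
have s1 : {subset A <= B1} by move=> x xA; rewrite mem_undup mem_cat xA.
have s2 : {subset A' <= B2} by move=> x xA; rewrite mem_undup mem_cat xA.
have u1 : uniq B1 by exact: undup_uniq.
have u2 : uniq B2 by exact: undup_uniq.
pose P := [seq (x, y) | x <- B1, y <- B2].
have uP : uniq P by rewrite /P allpairs_uniq // => -[? ?] [? ?].
have sBP : {subset B <= P}.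
  move=> [x y] xy; apply/allpairsP; exists (x, y); split => //=;
    rewrite mem_undup mem_cat; apply/orP; right; apply/mapP; by exists (x, y).
pose Q := [seq (x, y) | x <- A, y <- A'].
have uQ : uniq Q by rewrite /Q allpairs_uniq // => -[? ?] [? ?].
pose F := fun x : I * J => f x.1 * g x.2.
have sumP (V : comPzRingType) (U : seq I) (W : seq J) (k : I -> V) (h : J -> V) :
   \sum_(x <- [seq (x, y) | x <- U, y <- W]) k x.1 * h x.2 =
   (\sum_(x <- U) k x) * (\sum_(y <- W) h y).
  rewrite big_allpairs_dep /= mulr_suml; apply: eq_bigr => x _.
  by rewrite mulr_sumr.
have e1 : nrm (\sum_(x <- B) F x - \sum_(x <- P) F x) <= d * (M + N + 1).
  rewrite nrmBC (big_sub_split _ uB uP sBP) addrAC subrr add0r.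
  apply: le_trans (nrm_sum _ _ _) _.
  have hh : \sum_(x <- P) nrm (F x) <= \sum_(x <- B) nrm (F x) + d * (M + N + 1).
    have h0 : \sum_(x <- Q) nrm (F x) <= \sum_(x <- B) nrm (F x).
      by apply: sum_bounded_mono => // i; exact: nrm_ge0.
    apply: (@le_trans _ _ (\sum_(x <- Q) nrm (F x) + d * (M + N + 1))); last by rewrite lerD2r.
    under eq_bigr do rewrite /F nrmM.
    under [X in _ <= X + _]eq_bigr do rewrite /F nrmM.
    rewrite !(sumP _ _ _ (nrm \o f) (nrm \o g)).
    have := hA _ u1 s1; have := hA' _ u2 s2.
    have := hM.2 A uA; have := hN.2 A' uA'.
    have : 0 <= \sum_(i <- A) nrm (f i) by apply: sumr_ge0 => *; exact: nrm_ge0.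
    have : 0 <= \sum_(i <- A') nrm (g i) by apply: sumr_ge0 => *; exact: nrm_ge0.
    have : 0 <= \sum_(i <- B1) nrm (f i) by apply: sumr_ge0 => *; exact: nrm_ge0.
    have : 0 <= \sum_(i <- B2) nrm (g i) by apply: sumr_ge0 => *; exact: nrm_ge0.
    rewrite /=; move: (\sum_(i <- A) _) (\sum_(i <- A') _) (\sum_(i <- B1) _) (\sum_(i <- B2) _).
    move=> a1 a2 b1 b2 b20 b10 a20 a10 a2N a1M b2a b1a.
    have : b1 * b2 <= (a1 + d) * (a2 + d) by apply: ler_pM.
    have : d * a1 <= d * M by rewrite ler_wpM2l // ltW.
    have : d * a2 <= d * N by rewrite ler_wpM2l // ltW.
    have : d * d <= d * 1 by rewrite ler_wpM2l // ltW.
    rewrite !mulrDr !mulrDl; lra.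
  move: hh; rewrite (big_sub_split _ uB uP sBP) lerD2l //.
have e2 : nrm (\sum_(x <- P) F x - a * b) <= d * (M + N + 1).
  rewrite (sumP _ _ _ f g).
  have tail1 : nrm (\sum_(i <- B1) f i - a) <= d.
    apply: (has_sum_near_partial (m := nrm \o f)) => // [i|D uD sD].
      exact: nrm_ge0.
    have := hA _ uD (fun x xA => sD x (s1 x xA)) => /le_trans; apply.
    by rewrite lerD2r; apply: sum_bounded_mono => // i; exact: nrm_ge0.
  have tail2 : nrm (\sum_(i <- B2) g i - b) <= d.
    apply: (has_sum_near_partial (m := nrm \o g)) => // [i|D uD sD].
      exact: nrm_ge0.
    have := hA' _ uD (fun x xA => sD x (s2 x xA)) => /le_trans; apply.
    by rewrite lerD2r; apply: sum_bounded_mono => // i; exact: nrm_ge0.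
  have aM : nrm a <= M by apply: (has_sum_norm_le (m := nrm \o f)) hf.
  have S2 : nrm (\sum_(i <- B2) g i) <= N.
    by apply: le_trans (nrm_sum _ _ _) _; apply: hN.2.
  set x := \sum_(i <- B1) _ in tail1 *; set y := \sum_(i <- B2) _ in tail2 S2 *.
  have -> : x * y - a * b = (x - a) * y + a * (y - b) by ring.
  apply: le_trans (nrmD _ _) _; rewrite !nrmM.
  have h1 : nrm (x - a) * nrm y <= d * N by apply: ler_pM; rewrite ?nrm_ge0.
  have h2 : nrm a * nrm (y - b) <= M * d by apply: ler_pM; rewrite ?nrm_ge0.
  rewrite !mulrDr; lra.
apply: le_lt_trans (nrm_tri _ (\sum_(x <- P) F x) _) _.
by apply: le_lt_trans (lerD e1 e2) _; rewrite -mulrDr; apply: le_lt_trans de; rewrite le_eqVlt; apply/orP; left; apply/eqP; ring.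
Qed.

(** A punctured limit: the value at [z0] is ignored, so quotients with a removable singularity can
    be used as they stand, and continuity at [z] reads [tends F z (F z)]. *)
Definition tends (F : C -> C) (z0 l : C) :=
  forall e : R, 0 < e -> exists2 d : R, 0 < d &
    forall z, z != z0 -> nrm (z - z0) < d -> nrm (F z - l) < e.

(** Dominated convergence: a finite set carries all of the majorant but [e / 4], and on it the limit
    is taken term by term. *)
Lemma has_sum_tends (I : eqType) (f : C -> I -> C) (F : C -> C) (g : I -> C)
    (z0 l : C) (d0 : R) (m : I -> R) (M : R) :
  0 < d0 -> sum_bounded m M ->
  (forall z, z != z0 -> nrm (z - z0) < d0 -> has_sum (f z) (F z)) ->
  (forall z i, z != z0 -> nrm (z - z0) < d0 -> nrm (f z i) <= m i) ->
  has_sum g l -> (forall i, nrm (g i) <= m i) ->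
  (forall i, tends (f^~ i) z0 (g i)) -> tends F z0 l.
Proof.
move=> d00 hm hf fm hg gm fg e e0.
have e40 : 0 < e / 4 by lra.
have [A [uA hA]] := sum_bounded_tail hm e40.
have [d dpos hd] : exists2 d : R, 0 < d & forall z, z != z0 -> nrm (z - z0) < d ->
    nrm (\sum_(i <- A) f z i - \sum_(i <- A) g i) < e / 4.
  elim: {uA hA} A (e / 4) e40 => [|i A IH] c c0.
    by exists 1 => // z _ _; rewrite !big_nil subrr nrm0.
  have c20 : 0 < c / 2 by lra.
  have [d1 d10 h1] := IH _ c20; have [d2 d20 h2] := fg i _ c20.
  exists (Num.min d1 d2); first by rewrite lt_min d10.
  move=> z zn; rewrite lt_min => /andP[z1 z2]; rewrite !big_cons opprD addrACA.
  by apply: le_lt_trans (nrmD _ _) _; rewrite [ltRHS](splitr c) ltrD // ?h1 ?h2.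
exists (Num.min d d0); first by rewrite lt_min dpos.
move=> z zn; rewrite lt_min => /andP[z1 z2].
have h1 := has_sum_near_partial (fun i => fm z i zn z2) hm.1 uA hA (hf z zn z2).
have h2 := has_sum_near_partial gm hm.1 uA hA hg.
have h3 := hd z zn z1.
have h4 := nrm_tri (F z) (\sum_(i <- A) f z i) l.
have h5 := nrm_tri (\sum_(i <- A) f z i) (\sum_(i <- A) g i) l.
move: h1; rewrite nrmBC; lra.
Qed.

End HasSum.

Section Tends.
Variable R : realType.
Local Notation C := R[i].
Local Notation nrm := (@Normc.normc R).

Lemma eq_tends (F G : C -> C) z0 l (d0 : R) : 0 < d0 ->
  (forall z, z != z0 -> nrm (z - z0) < d0 -> F z = G z) ->
  tends F z0 l -> tends G z0 l.
Proof.
move=> d00 h hF e e0; have [d dp hd] := hF e e0.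
exists (Num.min d d0); first by rewrite lt_min dp.
by move=> z zn; rewrite lt_min => /andP[z1 z2]; rewrite -h // hd.
Qed.

Lemma tends_cst (c : C) z0 : tends (fun=> c) z0 c.
Proof. by move=> e e0; exists 1 => // z _ _; rewrite subrr nrm0. Qed.

Lemma tends_id (z0 : C) : tends (fun z => z) z0 z0.
Proof. by move=> e e0; exists e. Qed.

Lemma tendsD (F G : C -> C) z0 l l' :
  tends F z0 l -> tends G z0 l' -> tends (fun z => F z + G z) z0 (l + l').
Proof.
move=> hF hG e e0; have e20 : 0 < e / 2 by lra.
have [d1 d10 h1] := hF _ e20; have [d2 d20 h2] := hG _ e20.
exists (Num.min d1 d2); first by rewrite lt_min d10.
move=> z zn; rewrite lt_min => /andP[z1 z2]; rewrite opprD addrACA.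
by apply: le_lt_trans (nrmD _ _) _; rewrite [ltRHS](splitr e) ltrD // ?h1 ?h2.
Qed.

Lemma tendsM (F G : C -> C) z0 l l' :
  tends F z0 l -> tends G z0 l' -> tends (fun z => F z * G z) z0 (l * l').
Proof.
move=> hF hG e e0.
pose k := nrm l + nrm l' + 1.
have k0 : 0 < k by rewrite /k; have := nrm_ge0 l; have := nrm_ge0 l'; lra.
pose c := Num.min 1 (e / (2 * k)).
have c0 : 0 < c by rewrite lt_min ltr01 divr_gt0 //; lra.
have c1 : c <= 1 by rewrite ge_min lexx.
have ce : c * (2 * k) <= e.
  by rewrite -ler_pdivlMr ?mulr_gt0 // /c ge_min lexx orbT.
have [d1 d10 h1] := hF _ c0; have [d2 d20 h2] := hG _ c0.
exists (Num.min d1 d2); first by rewrite lt_min d10.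
move=> z zn; rewrite lt_min => /andP[z1 z2].
have a1 := h1 z zn z1; have a2 := h2 z zn z2.
have -> : F z * G z - l * l' = (F z - l) * (G z - l') + l * (G z - l') + (F z - l) * l' by ring.
apply: le_lt_trans (nrmD _ _) _.
apply: le_lt_trans (lerD (nrmD _ _) (lexx _)) _; rewrite !nrmM.
have b1 : nrm (F z - l) * nrm (G z - l') <= c * 1.
  by apply: ler_pM; rewrite ?nrm_ge0 // ltW // ?(lt_le_trans a2).
have b2 : nrm l * nrm (G z - l') <= nrm l * c by rewrite ler_wpM2l ?nrm_ge0 // ltW.
have b3 : nrm (F z - l) * nrm l' <= c * nrm l' by rewrite ler_wpM2r ?nrm_ge0 // ltW.
apply: (lt_le_trans _ ce).
apply: (@le_lt_trans _ _ (c * k)).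
  by rewrite /k !mulrDr; lra.
by rewrite ltr_pM2l // ltr_pMl // ltr1n.
Qed.

Lemma tendsV (F : C -> C) z0 l : l != 0 -> tends F z0 l -> tends (fun z => (F z)^-1) z0 l^-1.
Proof.
move=> l0 hF e e0.
have nl : 0 < nrm l by rewrite nrm_gt0.
pose c := Num.min (nrm l / 2) (e * nrm l ^+ 2 / 2).
have c0 : 0 < c by rewrite lt_min !divr_gt0 // mulr_gt0 // exprn_gt0.
have [d dp hd] := hF _ c0; exists d => // z zn zd.
have h := hd z zn zd.
have h1 : nrm (F z - l) < nrm l / 2 by apply: (lt_le_trans h); rewrite ge_min lexx.
have h2 : nrm (F z - l) < e * nrm l ^+ 2 / 2.
  by apply: (lt_le_trans h); rewrite ge_min lexx orbT.
have hFz : nrm l / 2 < nrm (F z).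
  by have := nrm_lbound l (F z); rewrite nrmBC; lra.
have Fz0 : F z != 0 by rewrite -nrm_gt0; apply: lt_trans hFz; rewrite divr_gt0.
have -> : (F z)^-1 - l^-1 = (l - F z) * (F z)^-1 * l^-1 by field; apply/andP.
rewrite !nrmM !nrmV nrmBC.
rewrite ltr_pdivrMr // ltr_pdivrMr; last by rewrite nrm_gt0.
have : e * nrm l * (nrm l / 2) < e * nrm l * nrm (F z) by rewrite ltr_pM2l // mulr_gt0.
lra.
Qed.

Lemma tendsN (F : C -> C) z0 l : tends F z0 l -> tends (fun z => - F z) z0 (- l).
Proof.
by move=> h e e0; have [d dp hd] := h e e0; exists d => // z zn zd;
  rewrite -opprD nrmN hd.
Qed.

Lemma tendsB (F G : C -> C) z0 l l' :
  tends F z0 l -> tends G z0 l' -> tends (fun z => F z - G z) z0 (l - l').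
Proof. by move=> hF hG; apply: tendsD => //; apply: tendsN. Qed.

Lemma tendsX (F : C -> C) z0 l n : tends F z0 l -> tends (fun z => F z ^+ n) z0 (l ^+ n).
Proof.
move=> hF; elim: n => [|n IH]; first by rewrite expr0; apply: tends_cst.
rewrite exprS; apply: (eq_tends (F := fun z => F z * F z ^+ n) ltr01).
  by move=> z _ _; rewrite exprS.
exact: tendsM.
Qed.

Lemma tendsXz (F : C -> C) z0 l (n : int) : l != 0 ->
  tends F z0 l -> tends (fun z => F z ^ n) z0 (l ^ n).
Proof.
move=> l0 hF; case: n => n; first exact: tendsX.
rewrite NegzE -exprnN; apply: (eq_tends (F := fun z => (F z ^+ n.+1)^-1) ltr01).
  by move=> z _ _; rewrite -exprnN.
by apply: tendsV; [rewrite expf_neq0|exact: tendsX].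
Qed.

(** As limits are punctured and [G z] may equal [G z0] arbitrarily close to [z0], the outer function
    has to be continuous; a mere limit would not compose. *)
Lemma tends_comp (F G : C -> C) z0 l :
  tends F (G z0) (F (G z0)) -> l = F (G z0) -> tends G z0 (G z0) ->
  tends (fun z => F (G z)) z0 l.
Proof.
move=> hF -> hG e e0; have [d1 d10 h1] := hF _ e0; have [d2 d20 h2] := hG _ d10.
exists d2 => // z zn zd; have [->|ne] := eqVneq (G z) (G z0).
  by rewrite subrr nrm0.
by apply: h1 => //; apply: h2.
Qed.

Lemma tends_unique (F : C -> C) z0 l l' : tends F z0 l -> tends F z0 l' -> l = l'.
Proof.
move=> h h'; apply/eqP; rewrite -subr_eq0 -nrm_eq0; apply/eqP.
apply/le_anti; rewrite nrm_ge0 andbT; apply/ler_addgt0Pr => e e0.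
have e20 : 0 < e / 2 by lra.
have [d1 d10 h1] := h _ e20; have [d2 d20 h2] := h' _ e20.
have [d d0 [dd1 dd2]] : exists2 d : R, 0 < d & d <= d1 /\ d <= d2.
  by exists (Num.min d1 d2); rewrite ?lt_min ?d10 // !ge_min !lexx orbT.
pose z := z0 + real_complex R (d / 2).
have zz : z - z0 = real_complex R (d / 2) by rewrite /z addrAC subrr add0r.
have nz : nrm (z - z0) = d / 2 by rewrite zz nrm_real gtr0_norm // divr_gt0.
have zn : z != z0 by rewrite -subr_eq0 -nrm_eq0 nz gt_eqF // divr_gt0.
have b1 := h1 z zn; have b2 := h2 z zn.
have c1 : nrm (F z - l) < e / 2 by apply: b1; rewrite nz; lra.
have c2 : nrm (F z - l') < e / 2 by apply: b2; rewrite nz; lra.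
have := nrm_tri l (F z) l'; rewrite (nrmBC l (F z)); lra.
Qed.

Lemma tends_shift (F : C -> C) z0 l (c : C) : tends F (z0 + c) l -> tends (fun z => F (z + c)) z0 l.
Proof.
move=> h e e0; have [d d0 hd] := h _ e0; exists d => // z zn zd.
by apply: hd; rewrite ?(inj_eq (addIr _)) // opprD addrACA subrr addr0.
Qed.

Lemma tends_scale (F : C -> C) l (c : C) : c != 0 -> tends F 0 l -> tends (fun z => F (c * z)) 0 l.
Proof.
move=> c0 h e e0; have [d d0 hd] := h _ e0; exists (d / nrm c).
  by rewrite divr_gt0 ?nrm_gt0.
move=> z zn; rewrite subr0 ltr_pdivlMr ?nrm_gt0 // => zd.
by apply: hd; rewrite ?mulf_neq0 // subr0 nrmM mulrC.
Qed.

End Tends.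

(** * Laurent series with Gaussian decay *)

Section Gauss.
Variable R : realType.
Local Notation C := R[i].
Local Notation nrm := (@Normc.normc R).

(** The exponent is k (k - 1) with k = |n|: a lower bound for both n^2 and n^2 + n, attained by the
    latter at n <= 0, so that one notion covers all theta series. *)
Definition gauss (rho : R) (u : int -> C) :=
  forall n, nrm (u n) <= rho ^+ (`|n|%N * `|n|%N.-1).

Lemma sum_bounded_half : sum_bounded (fun n : int => (2^-1 : R) ^+ `|n|%N) 4.
Proof.
split=> [n|B uB]; first by rewrite exprn_ge0 // invr_ge0.
have half (D : seq nat) : uniq D -> \sum_(k <- D) (2^-1 : R) ^+ k <= 2.
  move=> uD; pose N := (\max_(k <- D) k).+1.
  apply: (@le_trans _ _ (\sum_(k <- index_iota 0 N) (2^-1 : R) ^+ k)).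
    apply: sum_bounded_mono => //; first by move=> k; rewrite exprn_ge0 // invr_ge0.
      exact: iota_uniq.
    by move=> k kD; rewrite mem_index_iota /= ltnS; apply: leq_bigmax_seq.
  rewrite big_mkord; elim: N => [|N IH]; first by rewrite big_ord0.
  rewrite big_ord_recl expr0 /=.
  under eq_bigr do rewrite /bump /= add1n exprS.
  rewrite -mulr_sumr; lra.
pose l (x : int) := if x is Posz i then Some i else None.
pose r (x : int) := if x is Negz i then Some i else None.
have -> : \sum_(n <- B) (2^-1 : R) ^+ `|n|%N =
   \sum_(k <- pmap l B) (2^-1 : R) ^+ k + \sum_(k <- pmap r B) (2^-1 : R) ^+ k.+1.
  elim: {uB} B => [|[k|k] B IH]; rewrite ?big_nil ?addr0 //= !big_cons IH; ring.
have h1 : \sum_(k <- pmap l B) (2^-1 : R) ^+ k <= 2.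
  by apply: half; apply: (@pmap_uniq _ _ l Posz) => // -[].
have h2 : \sum_(k <- pmap r B) (2^-1 : R) ^+ k.+1 <= 2.
  apply: (@le_trans _ _ (\sum_(k <- pmap r B) (2^-1 : R) ^+ k)).
    apply: ler_sum => k _; rewrite exprS ler_piMl ?exprn_ge0 ?invr_ge0 // invf_le1 //; lra.
  by apply: half; apply: (@pmap_uniq _ _ r Negz) => // -[].
lra.
Qed.

(** Once [rho ^+ N * W <= 2^-1], which Bernoulli's inequality provides, every term with k > N is at
    most 2^-k; the constant [K] absorbs the finitely many others. *)
Lemma gauss_majorant (rho W : R) : 0 <= rho < 1 -> 1 <= W -> exists K : R, 0 <= K /\
  forall k : nat, rho ^+ (k * k.-1) * W ^+ k <= K * 2^-1 ^+ k.
Proof.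
move=> /andP[r0 r1] W1; have W0 : 0 < W by lra.
have [N hN] : exists N, rho ^+ N * W <= 2^-1.
  have [->|rn0] := eqVneq rho 0; first by exists 1%N; rewrite expr1 mul0r invr_ge0.
  have rp : 0 < rho by rewrite lt0r rn0.
  have hi : 1 < rho^-1 by rewrite invf_gt1.
  pose N := Num.bound (2 * W / (rho^-1 - 1)); exists N.
  have bern : 1 + (rho^-1 - 1) *+ N <= rho^-1 ^+ N.
    elim: N => [|N IH]; first by rewrite mulr0n expr0 addr0.
    rewrite exprS; apply: (@le_trans _ _ (rho^-1 * (1 + (rho^-1 - 1) *+ N))).
      rewrite mulrS mulrDr mulr1.
      have : 0 <= (rho^-1 - 1) * ((rho^-1 - 1) *+ N).
        by rewrite mulr_ge0 ?mulrn_wge0 // subr_ge0 ltW.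
      rewrite mulrBl mul1r; lra.
    by rewrite ler_pM2l ?invr_gt0.
  have hb : 2 * W / (rho^-1 - 1) < N%:R.
    by rewrite /N; apply: archi_boundP; rewrite divr_ge0 ?mulr_ge0 ?subr_ge0 // ltW.
  move: hb; rewrite ltr_pdivrMr ?subr_gt0 // mulr_natl => hb.
  have : 2 * W < rho^-1 ^+ N by lra.
  rewrite exprVn -[X in _ < X]mul1r ltr_pdivlMr ?exprn_gt0 //; lra.
exists ((2 * W) ^+ N.+1); split; first by rewrite exprn_ge0 // mulr_ge0 // ltW.
move=> k; have [lk|lk] := leqP k N.
  apply: (@le_trans _ _ (W ^+ k)).
    by rewrite ler_piMl ?exprn_ge0 ?exprn_ile1 // ltW.
  have -> : W ^+ k = (2 * W) ^+ k * 2^-1 ^+ k by rewrite -exprMn; congr (_ ^+ _); lra.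
  rewrite ler_wpM2r ?exprn_ge0 ?invr_ge0 // ler_weXn2l ?(leq_trans lk) //; lra.
rewrite mulnC exprM -exprMn.
apply: (@le_trans _ _ (2^-1 ^+ k)).
  rewrite lerXn2r ?nnegrE ?mulr_ge0 ?exprn_ge0 ?invr_ge0 //; [exact: ltW|].
  apply: le_trans hN; rewrite ler_pM2r // ler_wiXn2l ?(ltW r1) // -ltnS prednK //.
  exact: leq_ltn_trans lk.
rewrite ler_peMl ?exprn_ge0 ?invr_ge0 // exprn_ege1 //; lra.
Qed.

Lemma gauss_bounded (rho W : R) : 0 <= rho < 1 -> 1 <= W -> exists M : R,
  sum_bounded (fun n : int => rho ^+ (`|n|%N * `|n|%N.-1) * W ^+ `|n|%N) M.
Proof.
move=> hr W1; have [K [K0 hK]] := gauss_majorant hr W1.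
exists (K * 4); apply: (@sum_bounded_le _ _ (fun n : int => K * 2^-1 ^+ `|n|%N)).
  move=> n; rewrite hK andbT mulr_ge0 ?exprn_ge0 //; last lra.
  by case/andP: hr.
have [h1 h2] := sum_bounded_half.
by split=> [n|B uB]; [rewrite mulr_ge0|rewrite -mulr_sumr ler_wpM2l ?h2].
Qed.

Lemma nrm_expz_le (w : C) (W : R) (n : int) : w != 0 -> 1 <= W ->
  nrm w <= W -> nrm w^-1 <= W -> nrm (w ^ n) <= W ^+ `|n|%N.
Proof.
move=> w0 W1 h1 h2; case: n => n; first by rewrite nrmX lerXn2r ?nnegrE ?nrm_ge0 //; lra.
rewrite NegzE -exprnN -exprVn nrmX /= lerXn2r ?nnegrE ?nrm_ge0 //; lra.
Qed.

Lemma gauss_term (rho : R) u (w : C) (W : R) (n : int) :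
  0 <= rho < 1 -> gauss rho u -> w != 0 -> 1 <= W -> nrm w <= W -> nrm w^-1 <= W ->
  nrm (u n * w ^ n) <= rho ^+ (`|n|%N * `|n|%N.-1) * W ^+ `|n|%N.
Proof.
move=> /andP[r0 _] gu w0 W1 h1 h2; rewrite nrmM; apply: ler_pM; rewrite ?nrm_ge0 //.
exact: nrm_expz_le.
Qed.

(** Makes the sum a total function, with default value 0 where the series has no sum, and hides it
    behind the only property needed later. *)
Lemma laurent_subproof : {f : (int -> C) -> C -> C |
  forall u w l, has_sum (fun n => u n * w ^ n) l -> f u w = l}.
Proof.
exists (fun u w => xget 0 [set l | has_sum (fun n => u n * w ^ n) l]%classic).
move=> u w l h.
have /(xgetPex 0) : exists x, [set x | has_sum (fun n => u n * w ^ n) x]%classic x.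
  by exists l.
by move/has_sum_unique; apply.
Qed.

Definition laurent : (int -> C) -> C -> C := sval laurent_subproof.

Lemma laurentE u w l : has_sum (fun n => u n * w ^ n) l -> laurent u w = l.
Proof. exact: (svalP laurent_subproof). Qed.

Definition radius (w : C) : R := 1 + nrm w + nrm w^-1.

Lemma radiusP w : [/\ 1 <= radius w, nrm w <= radius w & nrm w^-1 <= radius w].
Proof. by rewrite /radius; have := nrm_ge0 w; have := nrm_ge0 w^-1; split; lra. Qed.

Lemma laurent_bounded rho u w : 0 <= rho < 1 -> gauss rho u -> w != 0 ->
  exists M, sum_bounded (@Normc.normc R \o (fun n => u n * w ^ n)) M.
Proof.
move=> hr gu w0; have [W1 h1 h2] := radiusP w.
have [M hM] := gauss_bounded hr W1; exists M.
apply: sum_bounded_le hM => n; rewrite nrm_ge0 /=; exact: gauss_term.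
Qed.

Lemma has_laurent rho u w : 0 <= rho < 1 -> gauss rho u -> w != 0 ->
  has_sum (fun n => u n * w ^ n) (laurent u w).
Proof.
move=> hr gu w0; have [M hM] := laurent_bounded hr gu w0.
by have [l hl] := has_sum_exists hM; rewrite (laurentE hl).
Qed.

Lemma laurent_cont rho u w : 0 <= rho < 1 -> gauss rho u -> w != 0 ->
  tends (laurent u) w (laurent u w).
Proof.
move=> hr gu w0; have nw : 0 < nrm w by rewrite nrm_gt0.
(* On the disc of radius |w|/2 about [w] both |z| and |1/z| stay below this [W], so a single
   majorant serves the whole disc. *)
pose W := 1 + 2 * nrm w + 2 / nrm w.
have iw : 0 < 2 / nrm w by rewrite divr_gt0.
have W1 : 1 <= W by rewrite /W; lra.
have [M hM] := gauss_bounded hr W1.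
have d0 : 0 < nrm w / 2 by rewrite divr_gt0.
have near z : nrm (z - w) < nrm w / 2 -> [/\ z != 0, nrm z <= W & nrm z^-1 <= W].
  move=> zd; have h1 := nrm_lbound w z; have h2 := nrm_lbound z w.
  have hz : nrm w / 2 < nrm z by move: h1; rewrite nrmBC; lra.
  have z0 : z != 0 by rewrite -nrm_gt0; lra.
  split=> //; first by rewrite /W; lra.
  apply: (@le_trans _ _ (2 / nrm w)); last by rewrite /W; lra.
  rewrite nrmV -[2 / _]invrK lef_pV2 ?posrE ?invr_gt0 ?nrm_gt0 //.
  by rewrite invf_div ltW.
have [_ w1 w2] : [/\ w != 0, nrm w <= W & nrm w^-1 <= W].
  by apply: near; rewrite subrr nrm0.
apply: (has_sum_tends d0 hM) => [z zn zd|z i zn zd||i|i].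
- by have [? _ _] := near z zd; apply: (has_laurent hr gu).
- by have [? ? ?] := near z zd; apply: gauss_term.
- exact: (has_laurent hr gu).
- exact: gauss_term.
- by apply: tendsM; [exact: tends_cst|apply: tendsXz => //; exact: tends_id].
Qed.

(** Pairs of integers are split by the parity of their sum; each class is a copy of the plane
    lattice through n = i + j, m = i - j. The shift [c] recentres the odd class to suit the
    quadratic exponent: 0 in [theta3M], 1 in [theta2M]. *)
Lemma pair_split_bij (c : int) : bijective (fun x : (int * int) + (int * int) =>
  match x with inl ij => (ij.1 + ij.2, ij.1 - ij.2)
             | inr ij => (ij.1 + ij.2 + 1 - c, ij.1 - ij.2 - c) end).
Proof.
exists (fun nm : int * int => if ((nm.1 + nm.2) %% 2)%Z == 0
   then inl ((nm.1 + nm.2) %/ 2, (nm.1 - nm.2) %/ 2)%Z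
   else inr ((nm.1 + nm.2 - 1 + 2 * c) %/ 2, (nm.1 - nm.2 - 1) %/ 2)%Z).
  move=> [[i j]|[i j]] /=.
    have -> : ((i + j + (i - j)) %% 2)%Z == 0 by lia.
    by congr (inl (_, _)); lia.
  have -> : ((i + j + 1 - c + (i - j - c)) %% 2)%Z == 0 = false by lia.
  by congr (inr (_, _)); lia.
move=> [n m] /=; case: ifP => h /=; congr (_, _); lia.
Qed.

Lemma has_sum_mul_split (c : int) (f g f0 g0 f1 g1 : int -> C) a b a0 b0 a1 b1 k M N M0 N0 M1 N1 :
  sum_bounded (nrm \o f) M -> sum_bounded (nrm \o g) N ->
  sum_bounded (nrm \o f0) M0 -> sum_bounded (nrm \o g0) N0 ->
  sum_bounded (nrm \o f1) M1 -> sum_bounded (nrm \o g1) N1 ->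
  has_sum f a -> has_sum g b -> has_sum f0 a0 -> has_sum g0 b0 ->
  has_sum f1 a1 -> has_sum g1 b1 ->
  (forall i j, f (i + j) * g (i - j) = f0 i * g0 j) ->
  (forall i j, f (i + j + 1 - c) * g (i - j - c) = k * (f1 i * g1 j)) ->
  a * b = a0 * b0 + k * (a1 * b1).
Proof.
move=> hM hN hM0 hN0 hM1 hN1 hf hg hf0 hg0 hf1 hg1 e0 e1.
apply: (has_sum_unique (has_sum_reindex (pair_split_bij c) (has_sum_mul hM hN hf hg))).
apply: has_sum_sum.
  apply: eq_has_sum (has_sum_mul hM0 hN0 hf0 hg0) => -[i j] /=; by rewrite e0.
apply: eq_has_sum (has_sumZ k (has_sum_mul hM1 hN1 hf1 hg1)) => -[i j] /=.
by rewrite e1.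
Qed.

End Gauss.

(** * Theta functions *)

Section Theta.
Variable R : realType.
Local Notation C := R[i].
Local Notation nrm := (@Normc.normc R).

Definition nome (p : C) := (p != 0) && (nrm p < 1).

(** Here [w] stands for e^(2 i pi z) and [p] for the nome e^(i pi tau). The classical theta_2
    carries an extra factor p^(1/4) w^(1/2); dropping it keeps [theta2] and [theta1] single-valued,
    at the price of explicit powers of [p] and [w] in the relations. *)
Definition theta3 (p w : C) : C := laurent (fun n : int => p ^ (n * n)) w.
Definition theta2 (p w : C) : C := laurent (fun n : int => p ^ (n * n + n)) w.
Definition theta4 (p w : C) : C := theta3 p (- w).
Definition theta1 (p w : C) : C := theta2 p (- w).

Lemma nome_neq0 p : nome p -> p != 0. Proof. by case/andP. Qed.
Lemma nome_range p : nome p -> 0 <= nrm p < 1.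
Proof. by case/andP=> _ ->; rewrite nrm_ge0. Qed.
Lemma nome_sqr p : nome p -> nome (p ^+ 2).
Proof.
by case/andP=> p0 p1; rewrite /nome expf_neq0 // nrmX expr_lt1 // nrm_ge0.
Qed.
Lemma nome_iter p k : nome p -> nome (p ^+ (2 ^ k)).
Proof.
move=> hp; elim: k => [|k IH]; first by rewrite expr1.
by rewrite expnS mulnC exprM; apply: nome_sqr.
Qed.

Lemma gauss3 p : nome p -> gauss (nrm p) (fun n : int => p ^ (n * n)).
Proof.
case/andP=> p0 p1 n; have -> : n * n = Posz (absz n * absz n)%N by lia.
rewrite -exprnP nrmX ler_wiXn2l ?nrm_ge0 ?(ltW p1) // leq_mul2l leq_pred orbT //.
Qed.

Lemma gauss2 p : nome p -> gauss (nrm p) (fun n : int => p ^ (n * n + n)).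
Proof.
case/andP=> p0 p1 n.
have -> : n * n + n = Posz (absz (n * n + n)) by nia.
rewrite -exprnP nrmX ler_wiXn2l ?nrm_ge0 ?(ltW p1) //.
case: n => n /=; nia.
Qed.

Lemma has_theta3 p w : nome p -> w != 0 -> has_sum (fun n : int => p ^ (n * n) * w ^ n) (theta3 p w).
Proof. by move=> hp w0; apply: has_laurent (nome_range hp) (gauss3 hp) w0. Qed.
Lemma has_theta2 p w : nome p -> w != 0 -> has_sum (fun n : int => p ^ (n * n + n) * w ^ n) (theta2 p w).
Proof. by move=> hp w0; apply: has_laurent (nome_range hp) (gauss2 hp) w0. Qed.

Lemma theta3_cont p w : nome p -> w != 0 -> tends (theta3 p) w (theta3 p w).
Proof. by move=> hp w0; apply: laurent_cont (nome_range hp) (gauss3 hp) w0. Qed.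
Lemma theta2_cont p w : nome p -> w != 0 -> tends (theta2 p) w (theta2 p w).
Proof. by move=> hp w0; apply: laurent_cont (nome_range hp) (gauss2 hp) w0. Qed.
Lemma theta4_cont p w : nome p -> w != 0 -> tends (theta4 p) w (theta4 p w).
Proof.
move=> hp w0; rewrite /theta4; apply: (@tends_comp _ (theta3 p) -%R) => //.
  by apply: theta3_cont; rewrite ?oppr_eq0.
exact: tendsN (@tends_id _ _).
Qed.
Lemma theta1_cont p w : nome p -> w != 0 -> tends (theta1 p) w (theta1 p w).
Proof.
move=> hp w0; rewrite /theta1; apply: (@tends_comp _ (theta2 p) -%R) => //.
  by apply: theta2_cont; rewrite ?oppr_eq0.
exact: tendsN (@tends_id _ _).
Qed.

Section Monomials.
Variables (p w v : C).
Hypotheses (p0 : p != 0) (w0 : w != 0) (v0 : v != 0).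
(** Gathers all powers into one triple of exponents, so that identities between general terms of
    series become identities between integer polynomials. *)
Definition mono3 (a b c : int) := p ^ a * w ^ b * v ^ c.
Lemma mono3M a b c a' b' c' :
  mono3 a b c * mono3 a' b' c' = mono3 (a + a') (b + b') (c + c').
Proof. by rewrite /mono3 !expfzDr //; ring. Qed.
Lemma mono3p a : p ^ a = mono3 a 0 0. Proof. by rewrite /mono3 !expr0z !mulr1. Qed.
Lemma mono3pp a : (p ^+ 2) ^ a = mono3 (2 * a) 0 0.
Proof. by rewrite -mono3p [p ^+ 2]exprnP -exprz_exp. Qed.
Lemma mono3w a : w ^ a = mono3 0 a 0. Proof. by rewrite /mono3 !expr0z mul1r mulr1. Qed.
Lemma mono3v a : v ^ a = mono3 0 0 a. Proof. by rewrite /mono3 !expr0z !mul1r. Qed.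
Lemma mono3wv a : (w * v) ^ a = mono3 0 a a.
Proof. by rewrite expfzMl mono3w mono3v mono3M !addr0 !add0r. Qed.
Lemma mono3wV a : (w / v) ^ a = mono3 0 a (- a).
Proof. by rewrite expfzMl exprz_inv mono3w mono3v mono3M !addr0 !add0r. Qed.
End Monomials.

(** With n = i + j and m = i - j one has n^2 + m^2 = 2 (i^2 + j^2), whence the nome [p ^+ 2]; the
    pairs of odd sum produce the [theta2] terms. *)
Lemma theta3M p w v : nome p -> w != 0 -> v != 0 ->
  theta3 p w * theta3 p v = theta3 (p ^+ 2) (w * v) * theta3 (p ^+ 2) (w / v)
    + p * w * (theta2 (p ^+ 2) (w * v) * theta2 (p ^+ 2) (w / v)).
Proof.
move=> hp w0 v0; have p0 := nome_neq0 hp; have hp2 := nome_sqr hp.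
have wv0 : w * v != 0 by rewrite mulf_neq0.
have wV0 : w / v != 0 by rewrite mulf_neq0 ?invr_eq0.
have [M hM] := laurent_bounded (nome_range hp) (gauss3 hp) w0.
have [N hN] := laurent_bounded (nome_range hp) (gauss3 hp) v0.
have [M0 hM0] := laurent_bounded (nome_range hp2) (gauss3 hp2) wv0.
have [N0 hN0] := laurent_bounded (nome_range hp2) (gauss3 hp2) wV0.
have [M1 hM1] := laurent_bounded (nome_range hp2) (gauss2 hp2) wv0.
have [N1 hN1] := laurent_bounded (nome_range hp2) (gauss2 hp2) wV0.
apply: (has_sum_mul_split (c := 0) hM hN hM0 hN0 hM1 hN1); try exact: has_theta3;
  try exact: has_theta2.
- move=> i j; rewrite !(mono3pp p w v) ?(mono3p p w v) (mono3wv p0 w0 v0) (mono3wV p0 w0 v0).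
  rewrite (mono3w p w v) (mono3v p w v) !mono3M //; congr (mono3 _ _ _ _ _ _); ring.
- move=> i j; rewrite -[in RHS](expr1z p) -[in RHS](expr1z w).
  rewrite !(mono3pp p w v) ?(mono3p p w v) (mono3wv p0 w0 v0) (mono3wV p0 w0 v0).
  rewrite !(mono3w p w v) (mono3v p w v) !mono3M //; congr (mono3 _ _ _ _ _ _); ring.
Qed.

Lemma theta2M p w v : nome p -> w != 0 -> v != 0 ->
  theta2 p w * theta2 p v = theta2 (p ^+ 2) (w * v) * theta3 (p ^+ 2) (w / v)
    + v^-1 * (theta3 (p ^+ 2) (w * v) * theta2 (p ^+ 2) (w / v)).
Proof.
move=> hp w0 v0; have p0 := nome_neq0 hp; have hp2 := nome_sqr hp.
have wv0 : w * v != 0 by rewrite mulf_neq0.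
have wV0 : w / v != 0 by rewrite mulf_neq0 ?invr_eq0.
have [M hM] := laurent_bounded (nome_range hp) (gauss2 hp) w0.
have [N hN] := laurent_bounded (nome_range hp) (gauss2 hp) v0.
have [M0 hM0] := laurent_bounded (nome_range hp2) (gauss2 hp2) wv0.
have [N0 hN0] := laurent_bounded (nome_range hp2) (gauss3 hp2) wV0.
have [M1 hM1] := laurent_bounded (nome_range hp2) (gauss3 hp2) wv0.
have [N1 hN1] := laurent_bounded (nome_range hp2) (gauss2 hp2) wV0.
apply: (has_sum_mul_split (c := 1) hM hN hM0 hN0 hM1 hN1); try exact: has_theta3;
  try exact: has_theta2.
- move=> i j; rewrite !(mono3pp p w v) ?(mono3p p w v) (mono3wv p0 w0 v0) (mono3wV p0 w0 v0).
  rewrite (mono3w p w v) (mono3v p w v) !mono3M //; congr (mono3 _ _ _ _ _ _); ring.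
- move=> i j; rewrite -[v^-1]/(v ^ (-1)).
  rewrite !(mono3pp p w v) ?(mono3p p w v) (mono3wv p0 w0 v0) (mono3wV p0 w0 v0).
  rewrite !(mono3w p w v) !(mono3v p w v) !mono3M //; congr (mono3 _ _ _ _ _ _); ring.
Qed.

(* Replacing the summation index [n] by [-n] (resp. [-n-1]). *)
Lemma theta3V p w : nome p -> w != 0 -> theta3 p w^-1 = theta3 p w.
Proof.
move=> hp w0; apply: laurentE.
have hb : bijective (fun n : int => - n) by exists -%R; exact: opprK.
apply: eq_has_sum (has_sum_reindex hb (has_theta3 hp w0)) => n /=.
by rewrite mulrNN exprz_inv.
Qed.
Lemma theta2V p w : nome p -> w != 0 -> theta2 p w^-1 = w * theta2 p w.
Proof.
move=> hp w0; apply: laurentE.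
have hb : bijective (fun n : int => - n - 1) by exists (fun n : int => - n - 1) => n; ring.
apply: eq_has_sum (has_sumZ w (has_sum_reindex hb (has_theta2 hp w0))) => n /=.
have -> : (- n - 1) * (- n - 1) + (- n - 1) = n * n + n by ring.
by rewrite mulrCA -{1}[w]expr1z -expfzDr // exprz_inv; congr (_ * _ ^ _); ring.
Qed.
Lemma theta1V p w : nome p -> w != 0 -> theta1 p w^-1 = - w * theta1 p w.
Proof. by move=> hp w0; rewrite /theta1 -invrN theta2V ?oppr_eq0. Qed.
Lemma theta1_1 p : nome p -> theta1 p 1 = 0.
Proof.
move=> hp; have := theta1V hp (oner_neq0 C); rewrite invr1 mulN1r => /eqP.
by rewrite -addr_eq0 -mulr2n -mulr_natl mulf_eq0 pnatr_eq0 /= => /eqP.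
Qed.

(** Multiplying [w] by [p] translates z by tau/2. It exchanges 3 with 2 and 4 with 1; done twice, it
    gives the quasi-period [p ^+ 2]. *)
Lemma theta3_shift p w : nome p -> w != 0 -> theta3 p (p * w) = theta2 p w.
Proof.
move=> hp w0; have p0 := nome_neq0 hp; apply/esym/laurentE.
have pw0 : p * w != 0 by rewrite mulf_neq0.
apply: eq_has_sum (has_theta3 hp pw0) => n.
by rewrite expfzMl mulrA -expfzDr.
Qed.
Lemma theta2_shift p w : nome p -> w != 0 -> theta2 p (p * w) = (p * w)^-1 * theta3 p w.
Proof.
move=> hp w0; have p0 := nome_neq0 hp; apply: laurentE.
have hb : bijective (fun n : int => n + 1).
  by exists (fun n : int => n - 1) => n; ring.
apply: eq_has_sum (has_sumZ (p * w)^-1 (has_sum_reindex hb (has_theta3 hp w0))) => n /=.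
have -> : p ^ ((n + 1) * (n + 1)) = p ^ (n * n + n) * p ^ n * p.
  by rewrite -{4}[p]expr1z -!expfzDr //; congr (_ ^ _); ring.
have -> : w ^ (n + 1) = w ^ n * w by rewrite -{3}[w]expr1z -expfzDr.
rewrite expfzMl; move: (p ^ _) (p ^ _) (w ^ _) => a b c; field.
by apply/andP.
Qed.
Lemma theta4_shift p w : nome p -> w != 0 -> theta4 p (p * w) = theta1 p w.
Proof. by move=> hp w0; rewrite /theta4 /theta1 -mulrN theta3_shift ?oppr_eq0. Qed.
Lemma theta1_shift p w : nome p -> w != 0 -> theta1 p (p * w) = - (p * w)^-1 * theta4 p w.
Proof. by move=> hp w0; rewrite /theta4 /theta1 -mulrN theta2_shift ?oppr_eq0 // mulrN invrN. Qed.

End Theta.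

(** * Quadratic relations between the nomes p and p^2 *)

Section ThetaRelations.
Variable R : realType.
Local Notation C := R[i].
Local Notation nrm := (@Normc.normc R).
Variables (p : C) (hp : nome p).
Local Notation q := (p ^+ 2).

Lemma theta3_sqr w : w != 0 -> theta3 p w ^+ 2 =
  theta3 q 1 * theta3 q (w ^+ 2) + p * w * theta2 q 1 * theta2 q (w ^+ 2).
Proof.
by move=> w0; have := theta3M hp w0 w0; rewrite divff // -!expr2 => ->; ring.
Qed.

Lemma theta4_sqr w : w != 0 -> theta4 p w ^+ 2 =
  theta3 q 1 * theta3 q (w ^+ 2) - p * w * theta2 q 1 * theta2 q (w ^+ 2).
Proof.
by move=> w0; rewrite /theta4 theta3_sqr ?oppr_eq0 // sqrrN; ring.
Qed.

Lemma theta2_sqr w : w != 0 -> w * theta2 p w ^+ 2 =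
  theta3 q 1 * w * theta2 q (w ^+ 2) + theta2 q 1 * theta3 q (w ^+ 2).
Proof.
move=> w0; have := theta2M hp w0 w0; rewrite divff // -!expr2 => ->.
by rewrite mulrDr mulVKf //; ring.
Qed.

Lemma theta1_sqr w : w != 0 -> w * theta1 p w ^+ 2 =
  theta3 q 1 * w * theta2 q (w ^+ 2) - theta2 q 1 * theta3 q (w ^+ 2).
Proof.
move=> w0; have nw0 : - w != 0 by rewrite oppr_eq0.
apply: oppr_inj; rewrite /theta1 -mulNr theta2_sqr // sqrrN; ring.
Qed.

(** Together with [theta12], this describes w |-> w^2, the isogeny of degree 2 that doubles tau. The
    second term of the product formula disappears because [theta1] vanishes at 1. *)
Lemma theta34 w : w != 0 ->
  theta3 p w * theta4 p w = theta4 q 1 * theta4 q (w ^+ 2).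
Proof.
move=> w0; rewrite /theta4 theta3M ?oppr_eq0 // invrN !mulrN divff // -expr2.
by rewrite -[theta2 q (- 1)]/(theta1 q 1) theta1_1 ?nome_sqr //; ring.
Qed.

Lemma theta12 w : w != 0 ->
  theta1 p w * theta2 p w = theta4 q 1 * theta1 q (w ^+ 2).
Proof.
move=> w0; rewrite /theta1 theta2M ?oppr_eq0 // !mulNr divff // -expr2.
rewrite -[theta2 q (- 1)]/(theta1 q 1) theta1_1 ?nome_sqr // /theta4; ring.
Qed.

(** Here [w] is kept and only the nome changes: this and the next three relations describe the dual
    isogeny, whose composite with w |-> w^2 is multiplication by 2. *)
Lemma theta2_dup w : w != 0 ->
  theta2 p 1 * theta2 p w = 2 * theta2 q w * theta3 q w.
Proof.
by move=> w0; rewrite mulrC theta2M ?oner_neq0 // !mulr1 invr1 !mulr1; ring.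
Qed.

Lemma theta1_dup w : w != 0 ->
  theta2 p 1 * theta1 p w = 2 * theta1 q w * theta4 q w.
Proof. by move=> w0; rewrite /theta1 theta2_dup ?oppr_eq0. Qed.

Lemma theta3_dup w : w != 0 ->
  theta3 p 1 * theta3 p w = theta3 q w ^+ 2 + p * w * theta2 q w ^+ 2.
Proof.
by move=> w0; rewrite mulrC theta3M ?oner_neq0 // !mulr1 invr1 !mulr1; ring.
Qed.

Lemma theta4_dup w : w != 0 ->
  theta4 p 1 * theta4 p w = theta3 q w ^+ 2 - p * w * theta2 q w ^+ 2.
Proof.
move=> w0; rewrite mulrC /theta4 theta3M ?oppr_eq0 ?oner_neq0 //.
by rewrite mulrNN mulr1 invrN invr1 mulrNN mulr1; ring.
Qed.

(** This product turns out to be the numerator of [ell_x p w - ell_x p v], up to nonzero factors. *)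
Lemma theta1_add w v : w != 0 -> v != 0 ->
  theta1 p (w * v) * theta1 p (w / v) =
  theta2 q (w ^+ 2) * theta3 q (v ^+ 2) - v / w * (theta3 q (w ^+ 2) * theta2 q (v ^+ 2)).
Proof.
move=> w0 v0; rewrite /theta1 theta2M ?oppr_eq0 ?mulf_neq0 ?invr_eq0 //.
have -> : - (w * v) * - (w / v) = w ^+ 2 by field.
have -> : - (w * v) / - (w / v) = v ^+ 2 by field; apply/andP.
have -> : (- (w / v))^-1 = - (v / w) by field; apply/andP.
ring.
Qed.

Lemma theta3_1_sqr : theta3 p 1 ^+ 2 = theta3 q 1 ^+ 2 + p * theta2 q 1 ^+ 2.
Proof. by rewrite theta3_sqr ?oner_neq0 // expr1n; ring. Qed.
Lemma theta4_1_sqr : theta4 p 1 ^+ 2 = theta3 q 1 ^+ 2 - p * theta2 q 1 ^+ 2.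
Proof. by rewrite theta4_sqr ?oner_neq0 // expr1n; ring. Qed.
Lemma theta2_1_sqr : theta2 p 1 ^+ 2 = 2 * theta3 q 1 * theta2 q 1.
Proof. by have := theta2_sqr (oner_neq0 C); rewrite expr1n !mul1r => ->; ring. Qed.
Lemma theta34_1 : theta3 p 1 * theta4 p 1 = theta4 q 1 ^+ 2.
Proof. by rewrite theta34 ?oner_neq0 // expr1n. Qed.

End ThetaRelations.

(** * Nonvanishing of the theta constants *)

Section NonVanishing.
Variable R : realType.
Local Notation C := R[i].
Local Notation nrm := (@Normc.normc R).

(** Compares a series with its dominant terms; the factor 4 bounds the sum of 2^-|n| over the
    integers. *)
Lemma has_sum_near_finite (f : int -> C) (l : C) (S : seq int) (c : R) :
  has_sum f l -> uniq S -> 0 <= c ->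
  (forall n, n \notin S -> nrm (f n) <= c * 2^-1 ^+ `|n|%N) ->
  nrm (l - \sum_(i <- S) f i) <= c * 4.
Proof.
move=> hf uS c0 hc; apply/ler_addgt0Pr => e e0.
have [A hA] := hf _ e0.
pose B := undup (A ++ S).
have sA : {subset A <= B} by move=> x xA; rewrite mem_undup mem_cat xA.
have sS : {subset S <= B} by move=> x xA; rewrite mem_undup mem_cat xA orbT.
have uB : uniq B by exact: undup_uniq.
have h1 := hA _ uB sA.
apply: le_trans (nrm_tri _ (\sum_(i <- B) f i) _) _.
rewrite nrmBC addrC; apply: lerD; last exact: ltW.
rewrite (big_sub_split _ uS uB sS) addrAC subrr add0r.
apply: le_trans (nrm_sum _ _ _) _.
apply: (@le_trans _ _ (\sum_(i <- B | i \notin S) c * 2^-1 ^+ `|i|%N)); first exact: ler_sum.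
rewrite -mulr_sumr ler_wpM2l // -big_filter.
have [_ h] := sum_bounded_half R; apply: h.
exact: filter_uniq.
Qed.

Lemma nome_small (p : C) (e : R) : nome p -> 0 < e ->
  exists k, forall j, (k <= j)%N -> nrm (p ^+ (2 ^ j)) < e.
Proof.
move=> hp e0; have /andP[r0 r1] := nome_range hp.
have rp : 0 < nrm p by rewrite nrm_gt0; exact: nome_neq0.
have hi : 1 < (nrm p)^-1 by rewrite invf_gt1.
pose N := Num.bound (e^-1 / ((nrm p)^-1 - 1)); exists N => j Nj.
have bern : 1 + ((nrm p)^-1 - 1) *+ N <= (nrm p)^-1 ^+ N.
  elim: N {Nj} => [|N IH]; first by rewrite mulr0n expr0 addr0.
  rewrite exprS; apply: (@le_trans _ _ ((nrm p)^-1 * (1 + ((nrm p)^-1 - 1) *+ N))).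
    rewrite mulrS mulrDr mulr1.
    have : 0 <= ((nrm p)^-1 - 1) * (((nrm p)^-1 - 1) *+ N).
      by rewrite mulr_ge0 ?mulrn_wge0 // subr_ge0 ltW.
    rewrite mulrBl mul1r; lra.
  by rewrite ler_pM2l ?invr_gt0.
have hb : e^-1 / ((nrm p)^-1 - 1) < N%:R.
  by rewrite /N; apply: archi_boundP; rewrite divr_ge0 ?invr_ge0 ?subr_ge0 // ltW.
move: hb; rewrite ltr_pdivrMr ?subr_gt0 // mulr_natl => hb.
have : e^-1 < (nrm p)^-1 ^+ N by lra.
rewrite exprVn ltf_pV2 ?posrE ?exprn_gt0 // => hN.
apply: le_lt_trans hN; rewrite nrmX ler_wiXn2l // ?ltW //.
by apply: leq_trans Nj _; apply: ltnW; apply: ltn_expl.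
Qed.

(* Properties stable under [p |-> p ^+ 2] can be refuted for nomes close to 0. *)
Lemma nome_descent (Z : C -> Prop) (e : R) : 0 < e ->
  (forall p, nome p -> Z p -> Z (p ^+ 2)) ->
  (forall p, nome p -> nrm p < e -> ~ Z p) -> forall p, nome p -> ~ Z p.
Proof.
move=> e0 step small p hp Zp; have [k hk] := nome_small hp e0.
apply: (small (p ^+ (2 ^ k))) (hk _ (leqnn k)) _; first exact: nome_iter.
elim: k {hk} => [|k IH]; first by rewrite expr1.
by rewrite expnS mulnC exprM; apply: step => //; exact: nome_iter.
Qed.

Lemma small_pow (r : R) (a n : nat) : 0 <= r <= 2^-1 -> (n <= a)%N -> (0 < n)%N ->
  r ^+ a <= 2 * r * 2^-1 ^+ n.
Proof.
move=> /andP[r0 r1] na n0.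
apply: (@le_trans _ _ (r ^+ n)); first by rewrite ler_wiXn2l //; lra.
have -> : r ^+ n = (2 * r) ^+ n * 2^-1 ^+ n by rewrite -exprMn; congr (_ ^+ _); lra.
rewrite ler_wpM2r ?exprn_ge0 ?invr_ge0 //.
case: n n0 {na} => // n _; rewrite exprS ler_piMr ?mulr_ge0 // exprn_ile1 ?mulr_ge0 //; lra.
Qed.

(** By [theta34_1] a zero at [p] forces one at [p ^+ 2], while for a small nome the term n = 0
    dominates the series. *)
Lemma theta4_1_neq0 (p : C) : nome p -> theta4 p 1 != 0.
Proof.
move=> hp; apply/eqP; move: p hp.
apply: (@nome_descent (fun p : C => theta4 p 1 = 0) 16^-1); first by rewrite invr_gt0.
  move=> p hp h; apply/eqP; rewrite -sqrf_eq0 -theta34_1 //.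
  by rewrite h mulr0.
move=> p hp small h.
have n10 : (- 1 : C) != 0 by rewrite oppr_eq0 oner_neq0.
have := has_theta3 hp n10; rewrite -[theta3 p (- 1)]/(theta4 p 1) h => hs.
have := @has_sum_near_finite _ 0 [:: 0] (2 * nrm p) hs isT _.
rewrite big_seq1 mul0r !expr0z mul1r sub0r nrmN nrm1 => H.
suff : 1 <= 2 * nrm p * 4 by lra.
apply: H => [|n]; first by rewrite mulr_ge0 ?nrm_ge0.
rewrite inE => n0; rewrite nrmM !nrmXz nrmN nrm1 exp1rz mulr1.
have -> : n * n = Posz (absz n * absz n)%N by lia.
rewrite -exprnP; apply: small_pow; [rewrite nrm_ge0; lra|nia|lia].
Qed.

Lemma theta3_1_neq0 (p : C) : nome p -> theta3 p 1 != 0.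
Proof.
move=> hp; have : theta3 p 1 * theta4 p 1 != 0.
  by rewrite theta34_1 // expf_neq0 // theta4_1_neq0 // nome_sqr.
by apply: contra => /eqP ->; rewrite mul0r.
Qed.

(** The same descent through [theta2_1_sqr]; now the terms n = 0 and n = -1, both equal to 1,
    dominate. *)
Lemma theta2_1_neq0 (p : C) : nome p -> theta2 p 1 != 0.
Proof.
move=> hp; apply/eqP; move: p hp.
apply: (@nome_descent (fun p : C => theta2 p 1 = 0) 16^-1); first by rewrite invr_gt0.
  move=> p hp h; have := theta2_1_sqr hp; rewrite h expr0n /= => /esym/eqP.
  rewrite !mulf_eq0 pnatr_eq0 (negbTE (theta3_1_neq0 (nome_sqr hp))) /=.
  by move/eqP.
move=> p hp small h.
have hs := has_theta2 hp (oner_neq0 C); rewrite h in hs.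
have := @has_sum_near_finite _ 0 [:: 0; -1] (2 * nrm p) hs isT _.
rewrite big_cons big_seq1 !exp1rz !mulr1 -[_ ^ (0 * 0 + 0)]/1.
rewrite sub0r nrmN -[1 + 1]/(2%:R) nrm_nat => H.
suff : 2 <= 2 * nrm p * 4 by lra.
apply: H => [|n]; first by rewrite mulr_ge0 ?nrm_ge0.
rewrite !inE => n0; rewrite exp1rz mulr1 nrmXz.
have -> : n * n + n = Posz (absz (n * n + n)) by nia.
by rewrite -exprnP; apply: small_pow; [rewrite nrm_ge0; lra|nia|lia].
Qed.

End NonVanishing.

(** * Zeros of theta1 *)

Section Zeros.
Variable R : realType.
Local Notation C := R[i].
Local Notation nrm := (@Normc.normc R).

Lemma posz_sqrD (n : nat) : Posz n * Posz n + Posz n = Posz (n * n + n)%N.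
Proof. lia. Qed.
Lemma negz_sqrD (n : nat) : Negz n * Negz n + Negz n = Posz (n * n + n)%N.
Proof. lia. Qed.
Lemma leq_sqrD (n : nat) : (n <= n * n + n)%N.
Proof. lia. Qed.
Lemma leq_sqr_self (n : nat) : (n <= n * n)%N.
Proof. nia. Qed.

(** After multiplication by [v] the terms n = 0 and n = -1 of the series are [v] and -1; all the
    others together are of the order of [p] on the closed annulus. *)
Lemma theta1_zero_near1 (p v : C) : nome p -> nrm p <= 2^-1 ->
  nrm p <= nrm v <= 1 -> theta1 p v = 0 -> nrm (v - 1) <= 16 * nrm p.
Proof.
move=> hp p2 /andP[pv v1] h0; have p0 := nome_neq0 hp.
have np : 0 < nrm p by rewrite nrm_gt0.
have v0 : v != 0 by rewrite -nrm_gt0; lra.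
have nv : 0 < nrm v by rewrite nrm_gt0.
have nv0 : - v != 0 by rewrite oppr_eq0.
have := has_sumZ v (has_theta2 hp nv0); rewrite -[theta2 p (- v)]/(theta1 p v) h0 mulr0 => hs.
have := @has_sum_near_finite _ _ 0 [:: 0; -1] (4 * nrm p) hs isT _.
rewrite big_cons big_seq1 -[_ ^ (0 * 0 + 0)]/1 !mul1r expr0z mulr1.
have -> : v * (- v) ^ (-1) = -1 by rewrite -[_ ^ (-1)]/((- v)^-1) invrN mulrN divff.
rewrite sub0r nrmN => H; have -> : 16 * nrm p = 4 * nrm p * 4 by ring.
apply: H => [|n]; first by rewrite mulr_ge0 ?nrm_ge0.
rewrite !inE => n0; rewrite !nrmM !nrmXz nrmN.
have rr : 0 <= nrm p <= 2^-1 by rewrite nrm_ge0.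
case: n n0 => n n0.
  rewrite posz_sqrD.
  rewrite -!exprnP; apply: (@le_trans _ _ (nrm p ^+ (n * n + n)%N)).
    by rewrite mulrCA ler_piMr ?exprn_ge0 ?nrm_ge0 // -exprS exprn_ile1 // nrm_ge0.
  have hn : (0 < n)%N by move: n0; rewrite negb_or lt0n => /andP[].
  apply: le_trans (@small_pow _ (nrm p) (n * n + n)%N n rr (leq_sqrD n) hn) _.
  rewrite ler_wpM2r ?exprn_ge0 ?invr_ge0 //; lra.
have hn : (0 < n)%N by case: (n) n0.
rewrite negz_sqrD.
have -> : nrm v * (nrm p ^ Posz (n * n + n)%N * nrm v ^ Negz n) =
          nrm p ^+ (n * n)%N * (nrm p / nrm v) ^+ n.
  rewrite NegzE -exprnN -exprnP exprD expr_div_n exprS; field.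
  by rewrite expf_neq0 gt_eqF.
apply: (@le_trans _ _ (nrm p ^+ (n * n)%N)).
  rewrite ler_piMr ?exprn_ge0 ?nrm_ge0 // exprn_ile1 //.
    by rewrite divr_ge0 // nrm_ge0.
  by rewrite ler_pdivrMr // mul1r.
apply: le_trans (@small_pow _ (nrm p) (n * n)%N n rr (leq_sqr_self n) hn) _.
rewrite /= exprS; set x := _ ^+ n; lra.
Qed.

(** Squaring both [p] and [w] preserves the zero by [theta12], so the powers [w ^+ (2 ^ k)] come
    arbitrarily close to 1. Near 1, squaring does not decrease the distance to 1, hence one of these
    powers equals 1. Going back to [w], the square root -1 is excluded by [theta2_1_neq0]. *)
Lemma theta1_zero_annulus (p w : C) : nome p -> nrm p <= nrm w <= 1 ->
  theta1 p w = 0 -> w = 1.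
Proof.
move=> hp hw h0.
have w0 : w != 0.
  by rewrite -nrm_gt0; case/andP: hw => hw _; apply: lt_le_trans hw; rewrite nrm_gt0 nome_neq0.
have wk0 k : w ^+ (2 ^ k) != 0 by rewrite expf_neq0.
have pw k : (p ^+ (2 ^ k)) ^+ 2 = p ^+ (2 ^ k.+1) by rewrite -exprM expnS mulnC.
have ww k : (w ^+ (2 ^ k)) ^+ 2 = w ^+ (2 ^ k.+1) by rewrite -exprM expnS mulnC.
have zero k : theta1 (p ^+ (2 ^ k)) (w ^+ (2 ^ k)) = 0.
  elim: k => [|k IH]; first by rewrite !expr1.
  have := theta12 (nome_iter k hp) (wk0 k); rewrite IH mul0r pw ww => /esym/eqP.
  by rewrite mulf_eq0 (negbTE (theta4_1_neq0 (nome_iter _ hp))) => /eqP.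
have ann k : nrm (p ^+ (2 ^ k)) <= nrm (w ^+ (2 ^ k)) <= 1.
  case/andP: hw => h1 h2; rewrite !nrmX exprn_ile1 ?nrm_ge0 // andbT.
  by rewrite lerXn2r ?nnegrE ?nrm_ge0.
have c0 : 0 < 64^-1 :> R by rewrite invr_gt0.
have [k0 hk0] := nome_small hp c0.
have bound j : (k0 <= j)%N -> nrm (w ^+ (2 ^ j) - 1) <= 16 * nrm (p ^+ (2 ^ j)).
  move=> kj; apply: theta1_zero_near1 => //; first exact: nome_iter.
  have := hk0 j kj; lra.
have grow j : nrm (w ^+ (2 ^ k0) - 1) <= nrm (w ^+ (2 ^ (k0 + j)) - 1).
  elim: j => [|j IH]; first by rewrite addn0.
  apply: le_trans IH _; rewrite addnS -ww.
  set v := w ^+ _; have -> : v ^+ 2 - 1 = (v - 1) * (v + 1) by ring.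
  rewrite nrmM ler_peMr ?nrm_ge0 //.
  have h1 : nrm (v - 1) <= 16 * nrm (p ^+ (2 ^ (k0 + j))) by apply: bound; rewrite leq_addr.
  have h2 := hk0 (k0 + j)%N (leq_addr _ _).
  have := nrm_lbound 2 (1 - v); have -> : 2 - (1 - v) = v + 1 by ring.
  rewrite nrmBC -[2]/(2%:R) nrm_nat in h1 *; lra.
have wk1 : w ^+ (2 ^ k0) = 1.
  apply/eqP; rewrite -subr_eq0 -nrm_eq0; apply/eqP/le_anti; rewrite nrm_ge0 andbT.
  apply/ler_addgt0Pr => e e0; rewrite add0r.
  have e16 : 0 < e / 16 by rewrite divr_gt0.
  have [k1 hk1] := nome_small hp e16.
  apply: le_trans (grow k1) _; apply: le_trans (bound _ (leq_addr _ _)) _.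
  have := hk1 (k0 + k1)%N (leq_addl _ _); lra.
elim: k0 {hk0 bound grow} wk1 => [|k IH]; first by rewrite expr1.
rewrite -ww => /eqP; rewrite sqrf_eq1 => /orP[/eqP /IH //|/eqP e].
have := zero k; rewrite e /theta1 opprK => /eqP.
by rewrite (negbTE (theta2_1_neq0 (nome_iter _ hp))).
Qed.

End Zeros.

(** * Derivative of theta1 at its zero *)

Section Derivative.
Variable R : realType.
Local Notation C := R[i].
Local Notation nrm := (@Normc.normc R).

Definition dquot (z : C) (n : int) : C := (z ^ n - 1) / (z - 1).

Lemma dquot_nat z (n : nat) : z != 1 -> dquot z n = \sum_(i < n) z ^+ i.
Proof.
move=> z1; have z10 : z - 1 != 0 by rewrite subr_eq0.
by apply: (mulIf z10); rewrite /dquot divfK // -exprnP subrX1 mulrC.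
Qed.

Lemma dquot_neg z (n : nat) : z != 0 -> dquot z (- n%:Z) = - (z ^- n) * dquot z n.
Proof.
move=> z0; rewrite /dquot -exprnN -exprnP mulrA; congr (_ / _).
by rewrite mulrBr mulr1 mulNr mulVf ?expf_neq0 // opprK addrC.
Qed.

Lemma dquot_tends (n : int) : tends (dquot^~ n) 1 n%:~R.
Proof.
have nat (m : nat) : tends (dquot^~ m) 1 m%:R.
  have h : tends (fun z : C => \sum_(i < m) z ^+ i) 1 m%:R.
    elim: m => [|m IH].
      by apply: (eq_tends ltr01) (@tends_cst R 0 _) => z _ _; rewrite big_ord0.
    rewrite mulrSr; apply: (@eq_tends _ (fun z => \sum_(i < m) z ^+ i + z ^+ m) _ _ _ _ ltr01).
      by move=> z _ _; rewrite big_ord_recr.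
    apply: tendsD => //; rewrite -[X in tends _ _ X](expr1n _ m).
    exact: tendsX (@tends_id _ _).
  by apply: (eq_tends ltr01) h => z z1 _; rewrite dquot_nat.
case: n => n; first exact: nat.
rewrite NegzE; have e : (- n.+1%:Z)%:~R = - (1 ^- n.+1) * n.+1%:R :> C.
  by rewrite expr1n invr1 mulN1r rmorphN.
rewrite e; apply: (@eq_tends _ (fun z => - (z ^- n.+1) * dquot z n.+1) _ _ _ _ ltr01).
  move=> z _ z1; rewrite dquot_neg //; apply/eqP => z0; move: z1.
  by rewrite z0 sub0r nrmN nrm1 ltxx.
apply: tendsM => //; apply: tendsN; apply: tendsV; first by rewrite expr1n oner_neq0.
exact: tendsX (@tends_id _ _).
Qed.

Lemma dquot_bound z (n : int) (W : R) : z != 1 -> z != 0 -> 1 <= W -> nrm z <= W ->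
  nrm z^-1 <= W -> nrm (dquot z n) <= (2 * W) ^+ `|n|%N.
Proof.
move=> z1 z0 W1 h1 h2; have W0 : 0 <= W by lra.
have le2 (m : nat) : m%:R * W ^+ m <= (2 * W) ^+ m.
  rewrite exprMn ler_wpM2r ?exprn_ge0 // -natrX ler_nat ltnW // ltn_expl //.
have nat (m : nat) (c : C) : (forall i, (i < m)%N -> nrm (c * z ^+ i) <= W ^+ m) ->
    nrm (c * dquot z m) <= (2 * W) ^+ m.
  move=> h; apply: le_trans (le2 m); rewrite dquot_nat // mulr_sumr.
  apply: le_trans (nrm_sum _ _ _) _.
  apply: (@le_trans _ _ (\sum_(i < m) W ^+ m)); first by apply: ler_sum => i _; apply: h.
  by rewrite sumr_const card_ord mulr_natl.
case: n => n.
  rewrite -[dquot _ _]mul1r; apply: nat => i lin; rewrite mul1r nrmX.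
  apply: (@le_trans _ _ (W ^+ i)); first by rewrite lerXn2r ?nnegrE ?nrm_ge0.
  by rewrite ler_weXn2l // ltnW.
rewrite NegzE dquot_neg // abszN; apply: nat => i lin.
have -> : - z ^- n.+1 * z ^+ i = - (z^-1 ^+ (n.+1 - i)).
  rewrite mulNr exprVn; congr (- _).
  have -> : z ^+ n.+1 = z ^+ (n.+1 - i) * z ^+ i by rewrite -exprD (subnK (ltnW lin)).
  by field; rewrite !expf_neq0.
rewrite nrmN nrmX; apply: (@le_trans _ _ (W ^+ (n.+1 - i))).
  by rewrite lerXn2r ?nnegrE ?nrm_ge0.
by rewrite ler_weXn2l // leq_subr.
Qed.

Definition theta1_dterm (p : C) (n : int) : C := p ^ (n * n + n) * ((-1) ^ n * n%:~R).

Lemma theta1_dterm_bounded p : nome p -> exists M,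
  sum_bounded (fun n : int => nrm p ^+ (`|n|%N * `|n|%N.-1) * 4 ^+ `|n|%N) M /\
  forall n, nrm (theta1_dterm p n) <= nrm p ^+ (`|n|%N * `|n|%N.-1) * 4 ^+ `|n|%N.
Proof.
move=> hp; have W1 : 1 <= 4 :> R by rewrite ler1n.
have [M hM] := gauss_bounded (nome_range hp) W1; exists M; split=> // n.
rewrite nrmM; apply: ler_pM; rewrite ?nrm_ge0 //; first exact: gauss2.
rewrite nrmM nrmXz nrmN nrm1 exp1rz mul1r.
have -> : nrm (n%:~R : C) = `|n|%N%:R.
  by case: n => n; rewrite ?NegzE ?rmorphN ?nrmN /= nrm_nat.
by rewrite -natrX ler_nat ltnW // ltn_expl.
Qed.

(** As [theta1 p 1 = 0], the difference quotient at 1 is a series in the [dquot], and dominated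
    convergence applies with the bound of [dquot_bound] for W = 2. *)
Lemma theta1_deriv p : nome p -> exists l, has_sum (theta1_dterm p) l /\
  tends (fun w => theta1 p w / (w - 1)) 1 l.
Proof.
move=> hp; have [M [hM hb]] := theta1_dterm_bounded hp.
have [l hl] : exists l, has_sum (theta1_dterm p) l.
  by apply: (@has_sum_exists _ _ _ M); apply: sum_bounded_le hM => n; rewrite nrm_ge0 hb.
exists l; split=> //.
have d0 : 0 < 2^-1 :> R by rewrite invr_gt0.
pose f (z : C) (n : int) := p ^ (n * n + n) * ((-1) ^ n * dquot z n).
have near z : nrm (z - 1) < 2^-1 -> [/\ z != 0, nrm z <= 2 & nrm z^-1 <= 2].
  move=> zd; have h1 := nrm_lbound 1 z; have h2 := nrm_lbound z 1.
  rewrite nrm1 in h1 h2; rewrite nrmBC in h1.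
  have hz : 2^-1 < nrm z by lra.
  have z0 : z != 0 by rewrite -nrm_gt0; lra.
  split=> //; first lra.
  by rewrite nrmV -[2]invrK lef_pV2 ?posrE ?invr_gt0 ?nrm_gt0 ?ltW.
apply: (@has_sum_tends _ _ f _ (theta1_dterm p) _ _ _ _ M d0 hM) => // [z z1 zd|z n z1 zd|n].
- have [z0 _ _] := near z zd.
  have nz0 : - z != 0 by rewrite oppr_eq0.
  have n10 : (- 1 : C) != 0 by rewrite oppr_eq0 oner_neq0.
  have := has_sumZ (z - 1)^-1 (has_sumD (has_theta2 hp nz0) (has_sumZ (-1) (has_theta2 hp n10))).
  rewrite -[theta2 p (- 1)]/(theta1 p 1) theta1_1 // mulr0 addr0 mulrC.
  apply: eq_has_sum => n; rewrite /f /dquot -[- z]mulN1r expfzMl.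
  by rewrite mulN1r; ring.
- have [z0 h1 h2] := near z zd; rewrite /f nrmM; apply: ler_pM; rewrite ?nrm_ge0 //.
    exact: gauss2.
  rewrite nrmM nrmXz nrmN nrm1 exp1rz mul1r.
  have -> : 4 = 2 * 2 :> R by ring.
  by apply: dquot_bound => //; rewrite ler1n.
- apply: tendsM; first exact: tends_cst.
  apply: tendsM; [exact: tends_cst|exact: dquot_tends].
Qed.

Lemma tends_sqr1 (F : C -> C) l : tends F 1 l -> tends (fun w => F (w ^+ 2)) 1 l.
Proof.
move=> h e e0; have [d d0 hd] := h e e0; exists (Num.min 1 (d / 3)).
  by rewrite lt_min ltr01 divr_gt0.
move=> z z1; rewrite lt_min => /andP[h1 h2].
have hz : nrm (z + 1) <= 3.
  have := nrmD (z - 1) 2; rewrite -[X in nrm (_ + X)]/(2%:R) nrm_nat.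
  have -> : z - 1 + 2 = z + 1 by ring.
  lra.
apply: hd.
  rewrite sqrf_eq1 negb_or z1 /=; apply/eqP => e1; move: h1; rewrite e1.
  have -> : -1 - 1 = - 2%:R :> C by ring.
  by rewrite nrmN nrm_nat (ltr_nat R 2 1).
have -> : z ^+ 2 - 1 = (z - 1) * (z + 1) by ring.
rewrite nrmM; have : nrm (z - 1) * nrm (z + 1) <= nrm (z - 1) * 3.
  by rewrite ler_wpM2l ?nrm_ge0.
move: h2; rewrite ltr_pdivlMr //; lra.
Qed.

(** Dividing [theta12] by w^2 - 1 = (w - 1) (w + 1) shows that if the derivative vanishes at [p], it
    vanishes at [p ^+ 2]; for a small nome it is close to 1, the contribution of n = -1. *)
Lemma theta1_deriv_neq0 (p l : C) : nome p -> tends (fun w => theta1 p w / (w - 1)) 1 l -> l != 0.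
Proof.
move=> hp hl; apply/eqP => l0; rewrite {}l0 in hl; move: p hp hl.
apply: (@nome_descent _ (fun p : C => tends (fun w => theta1 p w / (w - 1)) 1 0) 64^-1).
- by rewrite invr_gt0.
- move=> p hp h; have [g [_ hg]] := theta1_deriv (nome_sqr hp).
  have d0 : 0 < 1 :> R by [].
  have t1 := tendsM h (theta2_cont hp (oner_neq0 C)).
  have t2 : tends (fun w => theta4 (p ^+ 2) 1 * (theta1 (p ^+ 2) (w ^+ 2) / (w ^+ 2 - 1)) * (w + 1))
    1 (theta4 (p ^+ 2) 1 * g * (1 + 1)).
    apply: tendsM; last by apply: tendsD; [exact: tends_id|exact: tends_cst].
    by apply: tendsM; [exact: tends_cst|exact: tends_sqr1 hg].
  have t3 : tends (fun w => theta1 p w / (w - 1) * theta2 p w) 1 (theta4 (p ^+ 2) 1 * g * (1 + 1)).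
    apply: (eq_tends d0) t2 => w w1; rewrite -[w - 1]/(w - 1) => wd.
    have w0 : w != 0 by apply/eqP => w0; move: wd; rewrite w0 sub0r nrmN nrm1 ltxx.
    have wn : w + 1 != 0.
      rewrite addr_eq0; apply/eqP => e1; move: wd; rewrite e1.
      have -> : -1 - 1 = - 2%:R :> C by ring.
      by rewrite nrmN nrm_nat (ltr_nat R 2 1).
    apply: esym; rewrite mulrAC (theta12 hp w0).
    have -> : w ^+ 2 - 1 = (w - 1) * (w + 1) by ring.
    by field; rewrite subr_eq0 w1 wn.
  have := tends_unique t1 t3; rewrite mul0r => /esym/eqP.
  rewrite !mulf_eq0 (negbTE (theta4_1_neq0 (nome_sqr hp))) /=.
  by rewrite -[1 + 1]/(2%:R) pnatr_eq0 orbF => /eqP g0; rewrite g0 in hg.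
move=> {}p hp small h; have [m [hs hm]] := theta1_deriv hp.
rewrite (tends_unique hm h) in hs.
have := @has_sum_near_finite _ _ 0 [:: 0; -1] (4 * nrm p) hs isT _.
have -> : \sum_(i <- [:: 0; -1]) theta1_dterm p i = 1.
  by rewrite big_cons big_seq1 /theta1_dterm mulr0z !mulr0 add0r -[p ^ _]/1 mul1r mulrN1z mulrN1 -[_ ^ (-1)]/((-1)^-1) invrN1 opprK.
rewrite sub0r nrmN nrm1 => H.
suff : 1 <= 4 * nrm p * 4 by lra.
apply: H => [|n]; first by rewrite mulr_ge0 ?nrm_ge0.
rewrite !inE => n0; rewrite /theta1_dterm nrmM !nrmXz nrmM nrmXz nrmN nrm1 exp1rz mul1r.
have -> : nrm (n%:~R : C) = `|n|%N%:R.
  by case: (n) => n1; rewrite ?NegzE ?rmorphN ?nrmN /= nrm_nat.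
have -> : n * n + n = Posz (absz (n * n + n)) by nia.
rewrite -exprnP; set a := absz (n * n + n).
have an : (absz n <= a)%N by rewrite /a; nia.
have n1 : (0 < absz n)%N by lia.
apply: (@le_trans _ _ ((2 * nrm p) ^+ a)).
  rewrite exprMn mulrC ler_wpM2r ?exprn_ge0 ?nrm_ge0 //.
  rewrite -natrX ler_nat; apply: leq_trans (ltnW (ltn_expl (absz n) (isT : 1 < 2)%N)) _.
  by rewrite leq_exp2l.
have rr : 0 <= 2 * nrm p <= 2^-1 by have := nrm_ge0 p; lra.
apply: le_trans (small_pow rr an n1) _; rewrite ler_wpM2r ?exprn_ge0 ?invr_ge0 //; lra.
Qed.

End Derivative.

(** * Elliptic functions *)

Lemma quartic_ratio (F : numFieldType) (p x y a b : F) : x ^+ 2 = a ^+ 2 + p * b ^+ 2 ->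
  y ^+ 2 = 2 * a * b -> a ^+ 2 + p * b ^+ 2 != 0 ->
  p * y ^+ 4 / (16 * x ^+ 4) = p * a ^+ 2 * b ^+ 2 / (4 * (a ^+ 2 + p * b ^+ 2) ^+ 2).
Proof.
have four z : z ^+ 4 = (z ^+ 2) ^+ 2 :> F by rewrite -exprM.
by move=> hx hy h0; rewrite (four x) (four y) hx hy; field.
Qed.

(** Stated with plain field variables, so that it is an identity of rational functions: [k] stands
    for the ratio of the squares of [theta4] and [theta3] at 1, [u] and [v] for [theta2] and
    [theta3] at the nome p^2 and the point w^2. *)
Lemma dup_ratio (F : numFieldType) (p a b w u v k x s : F) :
  a ^+ 2 + p * b ^+ 2 != 0 -> a * w * u - b * v != 0 -> v ^+ 2 - p * w ^+ 2 * u ^+ 2 != 0 ->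
  k = (a ^+ 2 - p * b ^+ 2) / (a ^+ 2 + p * b ^+ 2) ->
  x = a * b * (a * v - p * w * b * u) / (2 * (a ^+ 2 + p * b ^+ 2) * (a * w * u - b * v)) ->
  s = p * a ^+ 2 * b ^+ 2 / (4 * (a ^+ 2 + p * b ^+ 2) ^+ 2) ->
  k * ((v ^+ 2 + p * w ^+ 2 * u ^+ 2) / (v ^+ 2 - p * w ^+ 2 * u ^+ 2)) * (x ^+ 2 - s) =
    x ^+ 2 + 8 * s * x + s.
Proof. by move=> h0 h1 h2 -> -> ->; field; rewrite h0 h1 h2. Qed.

Section Functions.
Variable R : realType.
Local Notation C := R[i].

(** Because the factor p^(1/4) of theta_2 was dropped, this is lambda / 16 for the modular function
    lambda; its expansion starts with [p], so that it can be a unit at a place above 2. *)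
Definition ell_s (p : C) : C := p * theta2 p 1 ^+ 4 / (16 * theta3 p 1 ^+ 4).
Definition ell_mu (p : C) : C := theta3 (p ^+ 2) 1 ^+ 2 / theta3 p 1 ^+ 2.
(** x has a double pole at z = 0 and a double zero at tau/2; d has simple poles at these two points
    and simple zeros at 1/2 and (1 + tau)/2. The constant makes x(1/2) = -1/4 and x(z) x(z + tau/2)
    = s. *)
Definition ell_x (p w : C) : C :=
  theta2 p 1 ^+ 2 / (4 * theta3 p 1 ^+ 2) * (theta4 p w ^+ 2 / (w * theta1 p w ^+ 2)).
Definition ell_d (p w : C) : C :=
  theta4 p 1 ^+ 2 / theta3 p 1 ^+ 2 *
  (theta2 p w * theta3 p w / (theta1 p w * theta4 p w)).

Variables (p : C) (hp : nome p).
Local Notation a := (theta3 (p ^+ 2) 1).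
Local Notation b := (theta2 (p ^+ 2) 1).
(** The squares of the theta constants at [p] are polynomials in [a], [b] and [p], and the squares
    of the theta functions at [w] are rational in these, [w], [u] and [v] below. Most identities of
    this section thereby become identities of rational functions. *)
Let A2 : theta3 p 1 ^+ 2 = a ^+ 2 + p * b ^+ 2. Proof. exact: theta3_1_sqr. Qed.
Let C2 : theta4 p 1 ^+ 2 = a ^+ 2 - p * b ^+ 2. Proof. exact: theta4_1_sqr. Qed.
Let B2 : theta2 p 1 ^+ 2 = 2 * a * b. Proof. exact: theta2_1_sqr. Qed.
Let hp2 := nome_sqr hp.
Let a0 : a != 0. Proof. exact: theta3_1_neq0. Qed.
Let b0 : b != 0. Proof. exact: theta2_1_neq0. Qed.
Let p0 := nome_neq0 hp.
Let A0 : a ^+ 2 + p * b ^+ 2 != 0. Proof. exact: (eq_ind _ (fun z => z != 0) (expf_neq0 2 (theta3_1_neq0 hp)) _ A2). Qed.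
Let C0 : a ^+ 2 - p * b ^+ 2 != 0. Proof. exact: (eq_ind _ (fun z => z != 0) (expf_neq0 2 (theta4_1_neq0 hp)) _ C2). Qed.

Lemma ell_sE : ell_s p = p * a ^+ 2 * b ^+ 2 / (4 * (a ^+ 2 + p * b ^+ 2) ^+ 2).
Proof. exact: quartic_ratio A2 B2 A0. Qed.
Lemma ell_muE : ell_mu p = a ^+ 2 / (a ^+ 2 + p * b ^+ 2).
Proof. exact: (congr1 (fun z => a ^+ 2 / z) A2). Qed.
Lemma ell_s_neq0 : ell_s p != 0.
Proof.
rewrite ell_sE mulf_neq0 ?invr_eq0 ?mulf_neq0 ?expf_neq0 ?pnatr_eq0 //.
Qed.
Lemma ell_mu_neq0 : ell_mu p != 0.
Proof. by rewrite ell_muE mulf_neq0 ?invr_eq0 ?expf_neq0. Qed.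

(** For integral s this leaves only 0 and 1 for mu modulo 2. Once mu is known to be a unit, mu = 1
    modulo 2 and [ell_s_sqr] says that s is squared by the isogeny. *)
Lemma ell_mu_eq : ell_mu p ^+ 2 - ell_mu p + 4 * ell_s p = 0.
Proof. by rewrite ell_muE ell_sE; field. Qed.

Lemma ell_s_sqr : ell_s (p ^+ 2) * ell_mu p ^+ 4 = ell_s p ^+ 2.
Proof.
rewrite ell_muE ell_sE /ell_s ; field.
by rewrite A0 a0.
Qed.

Lemma ell_kappa : 1 - 16 * ell_s p = (theta4 p 1 ^+ 2 / theta3 p 1 ^+ 2) ^+ 2.
Proof. by rewrite ell_sE A2 C2; field. Qed.

Section AtPoint.
Variables (w : C) (w0 : w != 0).
Local Notation u := (theta2 (p ^+ 2) (w ^+ 2)).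
Local Notation v := (theta3 (p ^+ 2) (w ^+ 2)).
Let T3 : theta3 p w ^+ 2 = a * v + p * w * b * u. Proof. exact: theta3_sqr. Qed.
Let T4 : theta4 p w ^+ 2 = a * v - p * w * b * u. Proof. exact: theta4_sqr. Qed.
Let T2 : theta2 p w ^+ 2 = (a * w * u + b * v) / w.
Proof. by apply: (mulfI w0); rewrite [RHS]mulrC divfK // theta2_sqr. Qed.
Let T1 : theta1 p w ^+ 2 = (a * w * u - b * v) / w.
Proof. by apply: (mulfI w0); rewrite [RHS]mulrC divfK // theta1_sqr. Qed.

Let t1_neq0 : theta1 p w != 0 -> a * w * u - b * v != 0.
Proof. by move/(expf_neq0 2); rewrite T1 mulf_eq0 negb_or => /andP[]. Qed.
Let t2_neq0 : theta2 p w != 0 -> a * w * u + b * v != 0.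
Proof. by move/(expf_neq0 2); rewrite T2 mulf_eq0 negb_or => /andP[]. Qed.
Let t3_neq0 : theta3 p w != 0 -> a * v + p * w * b * u != 0.
Proof. by move/(expf_neq0 2); rewrite T3. Qed.
Let t4_neq0 : theta4 p w != 0 -> a * v - p * w * b * u != 0.
Proof. by move/(expf_neq0 2); rewrite T4. Qed.

Lemma ell_xE : theta1 p w != 0 -> ell_x p w =
  a * b * (a * v - p * w * b * u) / (2 * (a ^+ 2 + p * b ^+ 2) * (a * w * u - b * v)).
Proof.
move=> h; have h' := t1_neq0 h; rewrite /ell_x B2 A2 T4 T1; field.
by rewrite w0 h' A0.
Qed.

Lemma ell_x_eq0 : theta1 p w != 0 -> (ell_x p w == 0) = (theta4 p w == 0).
Proof.
move=> h; rewrite /ell_x !(mulf_eq0, invr_eq0) pnatr_eq0.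
rewrite (negbTE (theta2_1_neq0 hp)) (negbTE (theta3_1_neq0 hp)) (negbTE w0) (negbTE h) /=.
by rewrite orbb orbF.
Qed.

Lemma ell_x14 : theta1 p w != 0 -> 1 + 4 * ell_x p w =
  theta4 p 1 ^+ 2 * theta2 p w ^+ 2 / (theta3 p 1 ^+ 2 * theta1 p w ^+ 2).
Proof.
move=> h; have h' := t1_neq0 h; rewrite ell_xE // C2 A2 T2 T1; field.
by rewrite w0 h' A0.
Qed.

Lemma ell_x14_eq0 : theta1 p w != 0 -> (1 + 4 * ell_x p w == 0) = (theta2 p w == 0).
Proof.
move=> h; rewrite ell_x14 // !(mulf_eq0, invr_eq0).
rewrite (negbTE (theta3_1_neq0 hp)) (negbTE (theta4_1_neq0 hp)) (negbTE h) /=.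
by rewrite orbb orbF.
Qed.

Lemma ell_d_sqrE : theta1 p w != 0 -> theta4 p w != 0 -> ell_d p w ^+ 2 =
  (theta4 p 1 ^+ 2 / theta3 p 1 ^+ 2) ^+ 2 *
  (theta2 p w ^+ 2 * theta3 p w ^+ 2 / (theta1 p w ^+ 2 * theta4 p w ^+ 2)).
Proof. by move=> h1 h4; rewrite /ell_d; field; rewrite h1 h4 theta3_1_neq0. Qed.

Lemma ell_d_sqr : theta1 p w != 0 -> theta4 p w != 0 ->
  ell_d p w ^+ 2 * ell_x p w = (1 + 4 * ell_x p w) * (ell_x p w + 4 * ell_s p).
Proof.
move=> h1 h4; have h1' := t1_neq0 h1; have h4' := t4_neq0 h4.
rewrite ell_xE // ell_sE ell_d_sqrE // A2 C2 T1 T2 T3 T4; field.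
by rewrite w0 h1' h4' A0.
Qed.

Lemma ell_d_eq0 : theta1 p w != 0 -> theta4 p w != 0 ->
  (ell_d p w == 0) = (theta2 p w == 0) || (theta3 p w == 0).
Proof.
move=> h1 h4; rewrite /ell_d !(mulf_eq0, invr_eq0).
rewrite (negbTE (theta3_1_neq0 hp)) (negbTE (theta4_1_neq0 hp)) (negbTE h1) (negbTE h4) /=.
by rewrite orbF.
Qed.

Let C'2 : theta4 (p ^+ 2) 1 ^+ 2 = theta3 p 1 * theta4 p 1.
Proof. by rewrite theta34_1. Qed.
Let C'0 : theta4 (p ^+ 2) 1 != 0. Proof. exact: theta4_1_neq0. Qed.
Let t1' : theta1 (p ^+ 2) (w ^+ 2) = theta1 p w * theta2 p w / theta4 (p ^+ 2) 1.
Proof. by rewrite theta12 // mulrAC divff // mul1r. Qed.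
Let t4' : theta4 (p ^+ 2) (w ^+ 2) = theta3 p w * theta4 p w / theta4 (p ^+ 2) 1.
Proof. by rewrite theta34 // mulrAC divff // mul1r. Qed.

(** The isogeny z |-> 2z that doubles tau. With mu = 1 and 4 = 0 the formula becomes x' = x^2. *)
Lemma ell_x_isog : theta1 p w != 0 -> theta2 p w != 0 ->
  ell_x (p ^+ 2) (w ^+ 2) * (ell_mu p ^+ 2 * (1 + 4 * ell_x p w)) =
  ell_x p w * (ell_x p w + 4 * ell_s p).
Proof.
move=> h1 h2; have h1' := t1_neq0 h1; have h2' := t2_neq0 h2.
rewrite ell_xE // ell_muE ell_sE /ell_x t1' t4' .
have -> : (theta3 p w * theta4 p w / theta4 (p ^+ 2) 1) ^+ 2 /
  (w ^+ 2 * (theta1 p w * theta2 p w / theta4 (p ^+ 2) 1) ^+ 2) =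
  theta3 p w ^+ 2 * theta4 p w ^+ 2 / (w ^+ 2 * theta1 p w ^+ 2 * theta2 p w ^+ 2).
  by field; rewrite w0 C'0 h1 h2.
rewrite T1 T2 T3 T4; field.
by rewrite w0 h1' h2' A0 a0.
Qed.

Lemma ell_d_isog : theta1 p w != 0 -> theta2 p w != 0 -> theta3 p w != 0 -> theta4 p w != 0 ->
  2 * ell_mu p * ell_d p w * ell_d (p ^+ 2) (w ^+ 2) = ell_d p w ^+ 2 + (1 - 16 * ell_s p).
Proof.
move=> h1 h2 h3 h4.
have h1' := t1_neq0 h1; have h2' := t2_neq0 h2; have h3' := t3_neq0 h3; have h4' := t4_neq0 h4.
have e : ell_d p w * ell_d (p ^+ 2) (w ^+ 2) =
  theta4 p 1 ^+ 2 / theta3 p 1 ^+ 2 * (theta3 p 1 ^+ 2 * theta4 p 1 ^+ 2 / a ^+ 2) *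
  (u * v / (theta1 p w ^+ 2 * theta4 p w ^+ 2)).
  have C'4 : theta4 (p ^+ 2) 1 ^+ 2 * theta4 (p ^+ 2) 1 ^+ 2 = theta3 p 1 ^+ 2 * theta4 p 1 ^+ 2.
    by rewrite C'2; ring.
  rewrite /ell_d t1' t4'  -C'4; field.
  by rewrite h1 h2 h3 h4 C'0 a0 theta3_1_neq0.
rewrite -mulrA e ell_muE ell_kappa ell_d_sqrE // A2 C2 T1 T2 T3 T4.
by field; rewrite w0 h1' h4' A0 a0.
Qed.

Lemma ell_d_level2 : theta1 p w != 0 ->
  ell_d (p ^+ 2) w = theta4 (p ^+ 2) 1 ^+ 2 / a ^+ 2 * (theta2 p w / theta1 p w).
Proof.
move=> h1; have B0 := theta2_1_neq0 hp.
have e2 := theta2_dup hp w0; have e1 := theta1_dup hp w0.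
have n : theta1 (p ^+ 2) w * theta4 (p ^+ 2) w != 0.
  have : theta2 p 1 * theta1 p w != 0 by rewrite mulf_neq0.
  by rewrite e1 -mulrA mulf_eq0 negb_or => /andP[].
rewrite /ell_d ; congr (_ * _).
have -> : theta2 p w = 2 * theta2 (p ^+ 2) w * theta3 (p ^+ 2) w / theta2 p 1.
  by rewrite -e2 mulrAC divff // mul1r.
have -> : theta1 p w = 2 * theta1 (p ^+ 2) w * theta4 (p ^+ 2) w / theta2 p 1.
  by rewrite -e1 mulrAC divff // mul1r.
move: n; rewrite mulf_eq0 negb_or => /andP[n1 n2].
by field; rewrite n1 n2 B0.
Qed.

(** The dual isogeny: it writes 1 + 4x as a square at the doubled level. Inserting [ell_d_isog] for
    that d gives the duplication formula on a single torus. *)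
Lemma ell_x14_level2 : theta1 p w != 0 ->
  1 + 4 * ell_x p w = ell_mu p ^+ 2 * ell_d (p ^+ 2) w ^+ 2.
Proof.
move=> h1; rewrite ell_d_level2 // ell_x14 // /ell_mu .
rewrite C'2; field.
by rewrite h1 a0 theta3_1_neq0.
Qed.

End AtPoint.

Lemma ell_x_dup (w : C) : w != 0 -> theta1 p w != 0 -> theta2 p w != 0 ->
  theta3 p w != 0 -> theta4 p w != 0 -> theta1 p (w ^+ 2) != 0 ->
  (1 + 4 * ell_x p (w ^+ 2)) * (2 * ell_d p w) ^+ 2 = (ell_d p w ^+ 2 + (1 - 16 * ell_s p)) ^+ 2.
Proof.
move=> w0 h1 h2 h3 h4 h; rewrite ell_x14_level2 ?expf_neq0 // -ell_d_isog //; ring.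
Qed.

Lemma ell_d_dup (w : C) : w != 0 -> theta1 p w != 0 -> theta2 p w != 0 ->
  theta3 p w != 0 -> theta4 p w != 0 -> theta1 p (w ^+ 2) != 0 -> theta4 p (w ^+ 2) != 0 ->
  ell_d p (w ^+ 2) * (2 * ell_d p w * (ell_x p w ^+ 2 - ell_s p)) =
  (ell_d p w ^+ 2 + (1 - 16 * ell_s p)) * (ell_x p w ^+ 2 + 8 * ell_s p * ell_x p w + ell_s p).
Proof.
move=> w0 h1 h2 h3 h4 h1' h4'.
have ww0 : w ^+ 2 != 0 by rewrite expf_neq0.
rewrite -ell_d_isog // ell_d_level2 //.
have A00 := theta3_1_neq0 hp; have C00 := theta4_1_neq0 hp.
pose u := theta2 (p ^+ 2) (w ^+ 2); pose v := theta3 (p ^+ 2) (w ^+ 2).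
have e3 := theta3_dup hp ww0; have e4 := theta4_dup hp ww0.
have n4 : v ^+ 2 - p * w ^+ 2 * u ^+ 2 != 0 by rewrite -e4 mulf_neq0.
have -> : ell_d p (w ^+ 2) = (theta4 p 1 ^+ 2 / theta3 p 1 ^+ 2) ^+ 1 *
   (theta2 p (w ^+ 2) / theta1 p (w ^+ 2)) * (theta4 p 1 / theta3 p 1) *
   ((v ^+ 2 + p * w ^+ 2 * u ^+ 2) / (v ^+ 2 - p * w ^+ 2 * u ^+ 2)).
  by rewrite -e3 -e4 /ell_d; field; rewrite h1' h4' A00 C00.
have C'2 : theta4 (p ^+ 2) 1 ^+ 2 = theta3 p 1 * theta4 p 1 by rewrite theta34_1.
rewrite C'2 /ell_mu  expr1.
have key : (theta4 p 1 ^+ 2 / theta3 p 1 ^+ 2) *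
  ((v ^+ 2 + p * w ^+ 2 * u ^+ 2) / (v ^+ 2 - p * w ^+ 2 * u ^+ 2)) * (ell_x p w ^+ 2 - ell_s p) =
   ell_x p w ^+ 2 + 8 * ell_s p * ell_x p w + ell_s p.
  have h : a * w * u - b * v != 0.
    have := theta1_sqr hp w0; move=> <-.
    by rewrite mulf_neq0 // expf_neq0.
  have ex : ell_x p w = a * b * (a * v - p * w * b * u) / (2 * (a ^+ 2 + p * b ^+ 2) * (a * w * u - b * v)).
    exact: ell_xE w0 h1.
  exact: (dup_ratio A0 h n4 (congr2 (fun y z => y / z) C2 A2) ex ell_sE).
rewrite -key; field.
by rewrite h1' n4 A00 a0.
Qed.

Lemma ell_x_shift (w : C) : w != 0 -> theta1 p w != 0 -> theta4 p w != 0 ->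
  ell_x p (p * w) * ell_x p w = ell_s p.
Proof.
move=> w0 h1 h4; rewrite /ell_x /ell_s theta4_shift // theta1_shift //; field.
by rewrite w0 p0 h1 h4 theta3_1_neq0.
Qed.

Lemma ell_x_period (w : C) : w != 0 -> ell_x p (p ^+ 2 * w) = ell_x p w.
Proof.
move=> w0; have pw0 : p * w != 0 by rewrite mulf_neq0.
rewrite expr2 -mulrA /ell_x theta4_shift // !theta1_shift // theta4_shift //; congr (_ * _).
have [->|h1] := eqVneq (theta1 p w) 0; first by rewrite !(mulr0, expr0n, invr0).
by field; rewrite w0 p0 h1.
Qed.

Lemma ell_d_period (w : C) : w != 0 -> ell_d p (p ^+ 2 * w) = ell_d p w.
Proof.
move=> w0; have pw0 : p * w != 0 by rewrite mulf_neq0.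
rewrite expr2 -mulrA /ell_d theta4_shift // !theta1_shift // theta4_shift //.
rewrite !(theta2_shift, theta3_shift) //; congr (_ * _).
have [->|h1] := eqVneq (theta1 p w) 0; first by rewrite !(mulr0, mul0r, invr0).
have [->|h4] := eqVneq (theta4 p w) 0; first by rewrite !(mulr0, mul0r, invr0).
by field; rewrite w0 p0 h1 h4.
Qed.

Lemma ell_x_opp (w : C) : w != 0 -> theta1 p w != 0 -> theta2 p w != 0 ->
  ell_x p (- w) * (1 + 4 * ell_x p w) = - (ell_x p w + 4 * ell_s p).
Proof.
move=> w0 h1 h2; have nw0 : - w != 0 by rewrite oppr_eq0.
have h2' : theta1 p (- w) != 0 by rewrite /theta1 opprK.
have n2 := theta1_sqr hp nw0; have n1 := theta1_sqr hp w0; rewrite sqrrN in n2.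
pose u := theta2 (p ^+ 2) (w ^+ 2); pose v := theta3 (p ^+ 2) (w ^+ 2).
rewrite -/u -/v in n1 n2.
have k1 : a * w * u - b * v != 0 by rewrite -n1 mulf_neq0 // expf_neq0.
have k2 : a * - w * u - b * v != 0 by rewrite -n2 mulf_neq0 // expf_neq0.
rewrite !ell_xE // ell_sE sqrrN -/u -/v; field.
by rewrite k1 k2 A0.
Qed.

Lemma ell_x_inv (w : C) : w != 0 -> ell_x p w^-1 = ell_x p w.
Proof.
move=> w0; rewrite /ell_x theta1V // /theta4 -invrN theta3V ?oppr_eq0 //; congr (_ * _).
have [->|h1] := eqVneq (theta1 p w) 0; first by rewrite !(mulr0, expr0n, invr0).
by field; rewrite w0 h1.
Qed.

Lemma ell_d_inv (w : C) : w != 0 -> ell_d p w^-1 = - ell_d p w.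
Proof.
move=> w0; rewrite /ell_d theta1V // theta2V // theta3V // /theta4 -invrN theta3V ?oppr_eq0 //.
rewrite -mulrN; congr (_ * _).
have [->|h1] := eqVneq (theta1 p w) 0; first by rewrite !(mulr0, mul0r, invr0, oppr0).
have [->|h4] := eqVneq (theta3 p (- w)) 0; first by rewrite !(mulr0, mul0r, invr0, oppr0).
by field; rewrite w0 h1 h4.
Qed.

(** Cross-multiplication of the two values leaves, up to nonzero factors, the right-hand side of
    [theta1_add]. *)
Lemma ell_x_inj (w v : C) : w != 0 -> v != 0 -> theta1 p w != 0 -> theta1 p v != 0 ->
  ell_x p w = ell_x p v -> theta1 p (w * v) * theta1 p (w / v) = 0.
Proof.
move=> w0 v0 hw hv; rewrite !ell_xE //.
have kw : a * w * theta2 (p ^+ 2) (w ^+ 2) - b * theta3 (p ^+ 2) (w ^+ 2) != 0.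
  by have := theta1_sqr hp w0; move=> <-; rewrite mulf_neq0 // expf_neq0.
have kv : a * v * theta2 (p ^+ 2) (v ^+ 2) - b * theta3 (p ^+ 2) (v ^+ 2) != 0.
  by have := theta1_sqr hp v0; move=> <-; rewrite mulf_neq0 // expf_neq0.
rewrite theta1_add // => /eqP; rewrite eqr_div; last 2 first.
- by rewrite !mulf_neq0 ?pnatr_eq0.
- by rewrite !mulf_neq0 ?pnatr_eq0.
move: kw kv; set u1 := theta2 _ (w ^+ 2); set v1 := theta3 _ (w ^+ 2).
set u2 := theta2 _ (v ^+ 2); set v2 := theta3 _ (v ^+ 2) => _ _ /eqP e.
have : (a * b) * (2 * (a ^+ 2 + p * b ^+ 2)) * (a ^+ 2 - p * b ^+ 2) * (w * u1 * v2 - v * v1 * u2) = 0.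
  by move/eqP: e; rewrite -subr_eq0 => /eqP e; rewrite -[RHS]oppr0 -e; ring.
move/eqP; rewrite 3!mulf_eq0 [a * b == 0]mulf_eq0 (negbTE a0) (negbTE b0) (negbTE C0).
rewrite mulf_eq0 pnatr_eq0 (negbTE A0) /= => /eqP e2.
by apply: (mulfI w0); rewrite mulr0 -e2; field.
Qed.

End Functions.

Local Open Scope classical_set_scope.
Local Open Scope ring_scope.

(** * The exponential of 2 i pi z *)

Section RealDerivatives.
Variable R : realType.

Lemma deriv_eps (f : R -> R) (x df : R) : is_derive x (1 : R) f df ->
  forall e : R, 0 < e -> exists2 d : R, 0 < d &
    forall h : R, `|h| < d -> `|f (x + h) - f x - h * df| <= e * `|h|.
Proof.
move=> [der val] e e0.
have h1 := der; rewrite /derivable in h1.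
have h2 : (fun h : R => h^-1 *: ((f \o shift x) (h *: (1 : R)) - f x)) @ (0 : R)^' --> df.
  by rewrite -val.
have [d /= d0 hd] := (cvgrPdist_lt _ _).1 h2 e e0.
exists d => // h hh; have [->|hn0] := eqVneq h 0.
  by rewrite addr0 subrr mul0r subr0 normr0 mulr0.
have : `|df - h^-1 * (f (h * 1 + x) - f x)| < e.
  by apply: hd => //; rewrite /ball /= sub0r normrN.
have -> : f (x + h) - f x - h * df = - h * (df - h^-1 * (f (h * 1 + x) - f x)).
  by rewrite mulr1 [h + x]addrC; field.
move/ltW => h3; rewrite normrM normrN mulrC.
by apply: ler_wpM2r.
Qed.

(** After reduction to 0 <= u < 1, injectivity of the cosine on [0, pi] settles u <= 1/2, and
    replacing u by 1 - u settles the rest. *)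
Lemma cos_eq1 (t : R) : cos (2 * pi * t) = 1 -> exists n : int, t = n%:~R.
Proof.
have pi0 := @pi_gt0 R.
have cosN (k : nat) (u : R) : cos (2 * pi * (u + k%:R)) = cos (2 * pi * u).
  rewrite mulrDr -[RHS](periodicn (@cosD2pi R) k) mulr_natr; congr cos.
  by rewrite mulr2n mulrDl mul1r.
have cosZ (k : int) (u : R) : cos (2 * pi * (u + k%:~R)) = cos (2 * pi * u).
  case: k => k; first exact: cosN.
  by rewrite NegzE rmorphN /= -[LHS](cosN k.+1) subrK.
move=> h; pose n := Num.floor t; pose u := t - n%:~R.
have /andP[f1 f2] := floor_itv t; rewrite intrD in f2.
have u0 : 0 <= u by rewrite subr_ge0.
have u1 : u < 1 by rewrite ltrBlDl.
have hu : cos (2 * pi * u) = 1.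
  by rewrite -[LHS](cosZ n) /u subrK.
exists n; apply/eqP; rewrite -subr_eq0 -/u; apply/eqP.
have [hle|hgt] := leP u 2^-1.
  have : 2 * pi * u = 0.
    apply: cos_inj; rewrite ?in_itv /= ?lexx ?pi_ge0 //; last by rewrite hu cos0.
    apply/andP; split; [by rewrite !mulr_ge0 // ltW|].
    have : 0 <= pi * (2^-1 - u) by rewrite mulr_ge0 ?subr_ge0 // ltW.
    lra.
  by move/eqP; rewrite !mulf_eq0 pnatr_eq0 (gt_eqF pi0) => /eqP.
have : 2 * pi * (1 - u) = 0.
  apply: cos_inj; rewrite ?in_itv /= ?lexx ?pi_ge0 //.
    apply/andP; split; [by rewrite !mulr_ge0 // ?subr_ge0 ltW|].
    have : 0 <= pi * (u - 2^-1) by rewrite mulr_ge0 ?subr_ge0 // ltW.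
    lra.
  by rewrite cos0 addrC (cosN 1%N (- u)) mulrN trigo.cosN.
by move/eqP; rewrite !mulf_eq0 pnatr_eq0 (gt_eqF pi0) /=; lra.
Qed.

End RealDerivatives.

Section ComplexExp.
Variable R : realType.
Local Notation C := R[i].
Local Notation nrm := (@Normc.normc R).
Local Notation re := (@complex.Re R).
Local Notation im := (@complex.Im R).

(* z |-> e^(2 i pi z) *)
Definition ce (z : C) : C :=
  Complex (expR (- (2 * pi * im z)) * cos (2 * pi * re z))
          (expR (- (2 * pi * im z)) * sin (2 * pi * re z)).

Lemma ceD a b : ce (a + b) = ce a * ce b.
Proof.
case: a b => [a1 a2] [b1 b2]; rewrite /ce /=.
rewrite !mulrDr opprD expRD cosD sinD.
by apply/eqP; rewrite eq_complex /=; apply/andP; split; apply/eqP; ring.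
Qed.

Lemma ce0 : ce 0 = 1.
Proof. by rewrite /ce /= !mulr0 oppr0 expR0 cos0 sin0 mulr1 mulr0. Qed.

Lemma nrm_ce z : nrm (ce z) = expR (- (2 * pi * im z)).
Proof.
rewrite /ce /Normc.normc !exprMn -mulrDr cos2Dsin2 mulr1 sqrtr_sqr ger0_norm //.
exact: expR_ge0.
Qed.

Lemma ce_neq0 z : ce z != 0.
Proof. by rewrite -nrm_gt0 nrm_ce expR_gt0. Qed.

Lemma ceN z : ce (- z) = (ce z)^-1.
Proof.
by apply: (mulIf (ce_neq0 z)); rewrite mulVf ?ce_neq0 // -ceD addNr ce0.
Qed.

Lemma ce1 : ce 1 = 1.
Proof.
rewrite /ce /= mulr0 oppr0 expR0 mulr1 !mul1r.
by rewrite [2 * pi]mulr_natl cos2pi sin2pi.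
Qed.

Lemma ce_half : ce 2^-1 = -1.
Proof.
have -> : (2^-1 : C) = real_complex R 2^-1.
  by rewrite fmorphV rmorph_nat.
rewrite /ce /= mulr0 oppr0 expR0 !mul1r mulrAC divff ?pnatr_eq0 // mul1r cospi sinpi.
by apply/eqP; rewrite eq_complex /= oppr0 !eqxx.
Qed.

Lemma ce_nat (n : nat) z : ce (n%:R * z) = ce z ^+ n.
Proof.
elim: n => [|n IH]; first by rewrite mul0r ce0.
by rewrite mulrSr mulrDl mul1r ceD IH exprSr.
Qed.

Lemma ce_eq1 z : ce z = 1 -> exists n : int, z = n%:~R.
Proof.
move=> h; have pi0 := @pi_gt0 R.
have : nrm (ce z) = 1 by rewrite h nrm1.
rewrite nrm_ce => h0.
have e : - (2 * pi * im z) = 0 by apply: expR_inj; rewrite expR0.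
have imz : im z = 0.
  have k0 : 2 * pi != 0 :> R by rewrite mulf_neq0 ?pnatr_eq0 // gt_eqF.
  by apply: (mulfI k0); rewrite mulr0; apply: oppr_inj; rewrite e oppr0.
move: h; rewrite /ce imz mulr0 oppr0 expR0 !mul1r => /eqP.
rewrite eq_complex /= => /andP[/eqP /cos_eq1 [n hn] _]; exists n.
rewrite [z]complexE imz hn rmorph0 mulr0 addr0 rmorph_int //.
Qed.

Lemma nrm_le_ReIm (z : C) : nrm z <= `|re z| + `|im z|.
Proof.
rewrite [z in nrm z]complexE; apply: le_trans (nrmD _ _) _.
rewrite nrmM !nrm_real; have -> : nrm 'i%C = 1.
  by rewrite /Normc.normc /= expr0n /= add0r expr1n sqrtr1.
by rewrite mul1r.
Qed.

Lemma ce_deriv : tends (fun z => (ce z - 1) / z) 0 (2 * 'i%C * real_complex R pi).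
Proof.
move=> e e0; have pi0 := @pi_gt0 R.
pose k : R := 2 * pi; have k0 : 0 < k by rewrite mulr_gt0.
pose c := Num.min 1 (e / (4 * (3 * k + k * k) + 1)).
have K0 : 0 < 4 * (3 * k + k * k) + 1.
  by have := mulr_gt0 k0 k0; lra.
have c0 : 0 < c by rewrite lt_min ltr01 divr_gt0.
have c1 : c <= 1 by rewrite ge_min lexx.
have ce' : 4 * (3 * k + k * k) * c < e.
  have : c <= e / (4 * (3 * k + k * k) + 1) by rewrite ge_min lexx orbT.
  rewrite ler_pdivlMr // mulrDr mulr1; lra.
have [d1 d10 h1] := deriv_eps (is_derive_expR (0 : R)) c0.
have [d2 d20 h2] := deriv_eps (is_derive_sin (0 : R)) c0.
have [d3 d30 h3] := deriv_eps (is_derive_cos (0 : R)) c0.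
pose d := Num.min (c / (2 * k)) (Num.min (d1 / k) (Num.min (d2 / k) (d3 / k))).
exists d; first by rewrite !lt_min !divr_gt0 // mulr_gt0.
move=> z zn; rewrite subr0 !lt_min => /and4P[z0 z1 z2 z3].
set x := k * re z; set y := - (k * im z).
have nz : 0 < nrm z by rewrite nrm_gt0.
have bx : `|x| <= k * nrm z by rewrite normrM (gtr0_norm k0) ler_pM2l // nrm_Re.
have by_ : `|y| <= k * nrm z by rewrite normrN normrM (gtr0_norm k0) ler_pM2l // nrm_Im.
have zk0 : k * nrm z < c / 2.
  by move: z0; rewrite ltr_pdivlMr ?mulr_gt0 // ltr_pdivlMr //; lra.
have zk1 : k * nrm z < d1 by move: z1; rewrite ltr_pdivlMr // mulrC.
have zk2 : k * nrm z < d2 by move: z2; rewrite ltr_pdivlMr // mulrC.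
have zk3 : k * nrm z < d3 by move: z3; rewrite ltr_pdivlMr // mulrC.
have g1 := h1 y (le_lt_trans by_ zk1); have g2 := h2 x (le_lt_trans bx zk2).
have g3 := h3 x (le_lt_trans bx zk3).
rewrite !add0r expR0 mulr1 in g1; rewrite !add0r sin0 cos0 subr0 mulr1 in g2.
rewrite !add0r cos0 sin0 oppr0 mulr0 subr0 in g3.
set E := expR y in g1 *; set s := sin x in g2 *; set co := cos x in g3 *.
have -> : (ce z - 1) / z - 2 * 'i%C * real_complex R pi =
   Complex (E * co - 1 - y) (E * s - x) / z.
  have -> : (2 * 'i%C * real_complex R pi : C) = (2 * 'i%C * real_complex R pi) * z / z.
    by rewrite mulfK.
  rewrite -mulrBl; congr (_ / z).
  have -> : (2 * 'i%C * real_complex R pi : C) = Complex 0 k.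
    rewrite -(rmorph_nat (real_complex R)) /k.
    by apply/eqP; rewrite eq_complex /=; apply/andP; split; apply/eqP; ring.
  have -> : ce z = Complex (E * co) (E * s) by [].
  rewrite /x /y; move: (E * co) (E * s) => A B; case: (z) => z1' z2' /=.
  by apply/eqP; rewrite eq_complex /=; apply/andP; split; apply/eqP; ring.
rewrite nrmM nrmV ltr_pdivrMr //.
apply: le_lt_trans (nrm_le_ReIm _) _ => /=.
have E1 : `|E| <= 3.
  have -> : E = (E - 1 - y) + 1 + y by ring.
  apply: le_trans (ler_normD _ _) _; apply: le_trans (lerD (ler_normD _ _) (lexx _)) _.
  rewrite normr1; have : c * `|y| <= `|y| by rewrite ler_piMl.
  lra.
have s1 : `|E * co - 1 - y| <= c * `|y| + 3 * (c * `|x|).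
  have -> : E * co - 1 - y = (E - 1 - y) + E * (co - 1) by ring.
  apply: le_trans (ler_normD _ _) _; apply: lerD => //; rewrite normrM.
  by apply: ler_pM.
have s2 : `|E * s - x| <= 3 * (c * `|x|) + (c + 1) * `|y| * `|x|.
  have -> : E * s - x = E * (s - x) + (E - 1) * x by ring.
  apply: le_trans (ler_normD _ _) _; apply: lerD; rewrite normrM.
    by apply: ler_pM.
  rewrite ler_wpM2r //; have -> : E - 1 = (E - 1 - y) + y by ring.
  by apply: le_trans (ler_normD _ _) _; rewrite mulrDl mul1r lerD2r.
have cx : c * `|x| <= c * (k * nrm z) by rewrite ler_pM2l.
have cy : c * `|y| <= c * (k * nrm z) by rewrite ler_pM2l.
have yx : (c + 1) * `|y| * `|x| <= 2 * c * (k * nrm z).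
  have yc : `|y| <= c.
    apply: le_trans by_ _; apply: ltW; apply: lt_trans zk0 _.
    by rewrite ltr_pdivrMr // ltr_pMr // ltr1n.
  have c2 : c + 1 <= 2 by rewrite -[2]/(1 + 1) lerD2r.
  have c3 : 0 <= c + 1 by rewrite addr_ge0 // ltW.
  apply: ler_pM; [exact: mulr_ge0 | exact: normr_ge0 | | exact: bx].
  by apply: ler_pM => //; exact: normr_ge0.
have : 4 * (3 * k + k * k) * c * nrm z < e * nrm z by rewrite ltr_pM2r.
have : 0 <= k * k * c * nrm z by rewrite !mulr_ge0 // ltW.
have : 0 <= k * c * nrm z by rewrite !mulr_ge0 // ltW.
lra.
Qed.

Lemma ce_cont z : tends ce z (ce z).
Proof.
have h0 : tends ce 0 1.
  have h := tendsD (@tends_cst R 1 0) (tendsM ce_deriv (@tends_id R 0)).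
  rewrite mulr0 addr0 in h; apply: (eq_tends ltr01) h => y y0 _.
  by rewrite divfK // addrC subrK.
have h : tends (fun y => ce (y - z) * ce z) z (1 * ce z).
  apply: tendsM; last exact: tends_cst.
  by apply: (@tends_shift _ ce z 1 (- z)); rewrite subrr.
rewrite mul1r in h; apply: (eq_tends ltr01) h => y _ _.
by rewrite -ceD subrK.
Qed.

End ComplexExp.

Local Close Scope classical_set_scope.

(** * Functions on a complex torus *)

Local Open Scope classical_set_scope.
Local Open Scope ring_scope.

Section Lattice.
Variable R : realType.
Local Notation C := R[i].
Local Notation nrm := (@Normc.normc R).
Local Notation re := (@complex.Re R).
Local Notation im := (@complex.Im R).

Definition in_lat (tau z : C) : Prop := exists m n : int, z = m%:~R + n%:~R * tau.

Lemma in_lat0 tau : in_lat tau 0.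
Proof. by exists 0, 0; rewrite mul0r addr0. Qed.
Lemma in_latD tau x y : in_lat tau x -> in_lat tau y -> in_lat tau (x + y).
Proof.
by move=> [m [n ->]] [m' [n' ->]]; exists (m + m'), (n + n'); rewrite !rmorphD /=; ring.
Qed.
Lemma in_latN tau x : in_lat tau x -> in_lat tau (- x).
Proof. by move=> [m [n ->]]; exists (- m), (- n); rewrite !rmorphN /=; ring. Qed.
Lemma in_latB tau x y : in_lat tau x -> in_lat tau y -> in_lat tau (x - y).
Proof. by move=> hx hy; apply: in_latD => //; apply: in_latN. Qed.
Lemma in_lat_addr tau x y : in_lat tau x -> in_lat tau (x + y) <-> in_lat tau y.
Proof.
move=> hx; split=> [h|h]; last exact: in_latD.
by have := in_latB h hx; rewrite addrC addKr.
Qed.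
Lemma in_lat_int tau (m : int) : in_lat tau m%:~R.
Proof. by exists m, 0; rewrite mul0r addr0. Qed.
Lemma in_lat1 tau : in_lat tau 1.
Proof. exact: (in_lat_int tau 1). Qed.
Lemma in_lat_tau tau : in_lat tau tau.
Proof. by exists 0, 1; rewrite mul1r add0r. Qed.
Lemma lat_coord tau z : im tau != 0 ->
  z = real_complex R (re z - im z / im tau * re tau) + real_complex R (im z / im tau) * tau.
Proof.
move=> t0; case: z tau t0 => [a b] [c d] /= d0.
by apply/eqP; rewrite eq_complex /=; apply/andP; split; apply/eqP; field.
Qed.

Lemma lat_indep tau (x y : R) : im tau != 0 ->
  real_complex R x + real_complex R y * tau = 0 -> x = 0 /\ y = 0.
Proof.
case: tau => c d /= d0 /eqP; rewrite eq_complex /= => /andP[/eqP e1 /eqP e2].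
have y0 : y = 0.
  by apply: (mulIf d0); rewrite mul0r -e2; ring.
by split=> //; rewrite -e1 y0; ring.
Qed.

Lemma lat_reduce tau z : im tau != 0 -> exists l x y, [/\ in_lat tau l,
  0 <= x <= 1, 0 <= y <= 1 & z = l + (real_complex R x + real_complex R y * tau)].
Proof.
move=> t0; have := lat_coord z t0.
set a := _ - _ * _; set b := im z / im tau => ez.
have /andP[fa1 fa2] := floor_itv a; have /andP[fb1 fb2] := floor_itv b.
rewrite !intrD in fa2 fb2.
exists ((Num.floor a)%:~R + (Num.floor b)%:~R * tau), (a - (Num.floor a)%:~R), (b - (Num.floor b)%:~R).
split; [by exists (Num.floor a), (Num.floor b)|lra|lra|].
by rewrite {1}ez !rmorphB /= !rmorph_int; ring.
Qed.

Definition lat_periodic tau (f : C -> C) := forall l z, in_lat tau l -> f (l + z) = f z.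

(** Heine's theorem on the fundamental parallelogram. [P d v] speaks of arbitrary points near [g v],
    so only the first of the two points has to be brought into the parallelogram. *)
Lemma lat_uniform_cont tau (f : C -> C) : im tau != 0 -> lat_periodic tau f ->
  (forall z, tends f z (f z)) ->
  forall e : R, 0 < e -> exists2 d : R, 0 < d &
    forall z z', nrm (z - z') < d -> nrm (f z - f z') < e.
Proof.
move=> t0 per cont e e0; have e20 : 0 < e / 2 by rewrite divr_gt0.
pose g (v : R * R) : C := real_complex R v.1 + real_complex R v.2 * tau.
pose P (d : R) (v : R * R) := forall z z', nrm (z - g v) < d -> nrm (z' - g v) < d ->
   nrm (f z - f z') < e.
pose K : set (R * R) := `[0, 1]%classic `*` `[0, 1]%classic.
have cK : compact K by apply: compact_setX; apply: segment_compact.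
have nt0 : 0 <= nrm tau by exact: nrm_ge0.
have key : forall v, K v -> \forall v' \near v & d \near (0 : R)^'+, P d v'.
  move=> v _; have [eta eta0 h] := cont (g v) _ e20.
  have cl z : nrm (z - g v) < eta -> nrm (f z - f (g v)) < e / 2.
    by move=> hz; have [->|zn] := eqVneq z (g v); [rewrite subrr nrm0|exact: h].
  pose r : R := eta / (4 * (1 + nrm tau)).
  have r0 : 0 < r by rewrite divr_gt0 // mulr_gt0 //; lra.
  have re4 : r * (1 + nrm tau) = eta / 4.
    by rewrite /r; field; rewrite gt_eqF //; lra.
  exists (ball v r, [set d : R | 0 < d < eta / 2]).
    split; first exact: nbhsx_ballx.
    rewrite /= !nbhs_simpl; near=> d; apply/andP; split; near: d; first exact: nbhs_right_gt.
    by apply: nbhs_right_lt; rewrite divr_gt0.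
  move=> [v' d] /= [[b1 b2] /andP[d0 d1]] z z' hz hz'.
  have gg : nrm (g v' - g v) < eta / 2.
    have -> : g v' - g v = real_complex R (v'.1 - v.1) + real_complex R (v'.2 - v.2) * tau.
      by rewrite /g !rmorphB /=; ring.
    apply: le_lt_trans (nrmD _ _) _; rewrite nrmM !nrm_real.
    move: b1 b2; rewrite /ball /= => b1 b2.
    have c1 : `|v'.1 - v.1| <= r by rewrite distrC ltW.
    have c2 : `|v'.2 - v.2| * nrm tau <= r * nrm tau by rewrite ler_wpM2r // distrC ltW.
    have : r * (1 + nrm tau) < eta / 2 by rewrite re4; lra.
    rewrite mulrDr mulr1; lra.
  have a1 : nrm (f z - f (g v)) < e / 2.
    by apply: cl; apply: le_lt_trans (nrm_tri _ (g v') _) _; lra.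
  have a2 : nrm (f z' - f (g v)) < e / 2.
    by apply: cl; apply: le_lt_trans (nrm_tri _ (g v') _) _; lra.
  have := nrm_tri (f z) (f (g v)) (f z'); rewrite (nrmBC (f (g v))); lra.
have [d [d0 dK]] : exists d : R, 0 < d /\ K `<=` P d.
  have h : \forall d \near (0 : R)^'+, K `<=` P d by exact: (compact_near_coveringP K).1 cK R _ P _ key.
  have [d hd] := @filter_ex _ _ (at_right_proper_filter (0 : R)) _
    (filterI h (nbhs_right_gt (0 : R))).
  by exists d; split; [exact: hd.2|exact: hd.1].
exists d => // z z' zz.
have [l [x [y [hl hx hy ez]]]] := lat_reduce z t0.
have Kv : K (x, y) by split; rewrite /= in_itv.
have e1 : f z = f (g (x, y)) by rewrite ez per.
have e2 : f z' = f (z' - l) by rewrite -[in LHS](subrK l z') addrC per.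
rewrite e1 e2; apply: (dK _ Kv); first by rewrite subrr nrm0.
have -> : z' - l - g (x, y) = z' - z by rewrite ez /g /=; ring.
by rewrite nrmBC.
Unshelve. all: by end_near. Qed.

Lemma avg4_bound (a b c d w : C) (e : R) :
  a + b + c + d = 4 * w -> nrm a < e -> nrm b < e -> nrm c < e -> nrm d < e -> nrm w < e.
Proof.
move=> h ha hb hc hd.
have : nrm (4 * w) < 4 * e.
  rewrite -h; have := nrmD (a + b + c) d; have := nrmD (a + b) c; have := nrmD a b; lra.
by rewrite nrmM nrm_nat ltr_pM2l.
Qed.

Lemma lat_discrete tau : im tau != 0 ->
  exists2 r : R, 0 < r & forall z, z != 0 -> nrm z < r -> ~ in_lat tau z.
Proof.
move=> t0.
have it0 : 0 < `|im tau| by rewrite normr_gt0.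
exists (Num.min 1 `|im tau|); first by rewrite lt_min ltr01.
move=> z z0; rewrite lt_min => /andP[h1 h2] [m [n ez]].
have imz : im z = n%:~R * im tau.
  rewrite ez -!(rmorph_int (real_complex R)); case: (tau) => c d /=; ring.
have n0 : n = 0.
  apply/eqP; apply: contraTT h2 => n0; rewrite -leNgt.
  apply: le_trans (nrm_Im z); rewrite imz normrM ler_peMl // -intr_norm ler1z.
  by rewrite -gtz0_ge1 normr_gt0.
move: h1; rewrite ez n0 mul0r addr0 -(rmorph_int (real_complex R)) nrm_real -intr_norm.
have m0 : m != 0 by apply: contraNN z0 => /eqP m0; rewrite ez n0 m0 mul0r addr0.
by rewrite ltNge ler1z -gtz0_ge1 normr_gt0 m0.
Qed.

(* Herglotz' trick: [f] extends continuously to the torus, where its value at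
   [z] is the mean of its values at the four halves of [z]; iterating, the
   variation of [f] between two points is bounded by its variation at
   arbitrarily small distance. *)
Lemma herglotz tau (f : C -> C) : im tau != 0 -> lat_periodic tau f ->
  (forall z, ~ in_lat tau z -> tends f z (f z)) ->
  tends (fun z => z ^+ 2 * f z) 0 0 ->
  (forall z, ~ in_lat tau (2 * z) ->
     f z + f (z + 2^-1) + f (z + tau / 2) + f (z + (2^-1 + tau / 2)) = 4 * f (2 * z)) ->
  exists c, forall z, ~ in_lat tau z -> f z = c.
Proof.
move=> t0 per cont small avg.
have half_not (a b : bool) : a || b -> ~ in_lat tau ((if a then 2^-1 else 0) + (if b then tau / 2 else 0)).
  move=> ab [m [n e]].
  have ea : (if a then 2^-1 else 0 : C) = real_complex R (if a then 2^-1 else 0).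
    by case: a {ab e}; rewrite ?rmorph0 // fmorphV rmorph_nat.
  have eb : (if b then tau / 2 else 0 : C) = real_complex R (if b then 2^-1 else 0) * tau.
    by case: b {ab e}; rewrite ?rmorph0 ?mul0r // fmorphV rmorph_nat mulrC.
  have : real_complex R ((if a then 2^-1 else 0) - m%:~R) +
         real_complex R ((if b then 2^-1 else 0) - n%:~R) * tau = 0.
    by move: e; rewrite ea eb !rmorphB /= !rmorph_int => e; rewrite mulrBl addrACA e; ring.
  move=> /(lat_indep t0) [h1 h2].
  have odd_no (k : int) : 2^-1 - k%:~R = 0 :> R -> False.
    move=> h; have : (2 * k)%:~R = 1%:~R :> R by rewrite rmorphM /=; lra.
    by move/eqP; rewrite eqr_int => /eqP; lia.
  by case: a b ab {e ea eb} h1 h2 => [] [] // _ h1 h2; [apply: odd_no h1|apply: odd_no h1|apply: odd_no h2].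
have T1 : ~ in_lat tau 2^-1 by have := half_not true false isT; rewrite addr0.
have T2 : ~ in_lat tau (tau / 2) by have := half_not false true isT; rewrite add0r.
have T3 : ~ in_lat tau (2^-1 + tau / 2) by exact: (half_not true true isT).
pose S z := f (z + 2^-1) + f (z + tau / 2) + f (z + (2^-1 + tau / 2)).
have two0 : (2 : C) != 0 by rewrite pnatr_eq0.
have S_cont : tends S 0 (S 0).
  rewrite /S !add0r; apply: tendsD; last first.
    by apply: (@tends_shift _ f 0); rewrite add0r; apply: cont.
  by apply: tendsD; apply: (@tends_shift _ f 0); rewrite add0r; apply: cont.
have [r r0 hr] := lat_discrete t0.
(* The only value at 0 compatible with the averaging relation, whose limit there reads 4 c0 = c0 + S
   0. *)
pose c0 := S 0 / 3.
have three0 : (3 : C) != 0 by rewrite pnatr_eq0.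
have near0 : tends f 0 c0.
  move=> e e0; have e20 : 0 < e / 2 by lra.
  have [d d0 hd] := S_cont _ e20.
  exists (Num.min d (r / 2)); first by rewrite lt_min d0 divr_gt0.
  move=> z z0; rewrite subr0 lt_min => /andP[zd zr].
  pose u y := f y - c0.
  (* For f - c0 the relation at y/2 is a contraction by 4 up to a small error. After k halvings the
     leading term is 4^-k |u(z/2^k)|, which tends to 0 because z^2 u(z) does. *)
  have step y : y != 0 -> nrm y < Num.min d (r / 2) -> nrm (u y) <= (nrm (u (y / 2)) + e / 2) / 4.
    move=> y0; rewrite lt_min => /andP[yd yr].
    have y2 : nrm (y / 2) = nrm y / 2 by rewrite nrmM nrmV nrm_nat.
    have y20 : y / 2 != 0 by rewrite mulf_neq0 ?invr_eq0.
    have yy : 2 * (y / 2) = y by field.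
    have := avg (y / 2); rewrite yy => /(_ (hr _ y0 _)) h.
    have ey : 4 * u y = u (y / 2) + (S (y / 2) - S 0).
      rewrite /u mulrBr -h; last by have := nrm_ge0 y; lra.
      have -> : 4 * c0 = c0 + S 0 by rewrite /c0; field.
      rewrite /S; ring.
    have := nrmD (u (y / 2)) (S (y / 2) - S 0); rewrite -ey nrmM nrm_nat.
    have : nrm (S (y / 2) - S 0) < e / 2.
      by apply: hd => //; rewrite subr0 y2; have := nrm_ge0 y; lra.
    lra.
  have iter k : nrm (u z) <= (4^-1) ^+ k * nrm (u (z / 2 ^+ k)) + (1 - (4^-1) ^+ k) * (e / 6).
    elim: k => [|k IH]; first by rewrite !expr0 divr1 mul1r subrr mul0r addr0.
    apply: le_trans IH _.
    have zk0 : z / 2 ^+ k != 0 by rewrite mulf_neq0 ?invr_eq0 ?expf_neq0.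
    have zkd : nrm (z / 2 ^+ k) < Num.min d (r / 2).
      apply: (@le_lt_trans _ _ (nrm z)); last by rewrite lt_min zd.
      rewrite nrmM nrmV nrmX nrm_nat ler_piMr ?nrm_ge0 //.
      by rewrite invf_le1 ?exprn_gt0 // exprn_ege1 // ler1n.
    have := step _ zk0 zkd.
    have -> : z / 2 ^+ k / 2 = z / 2 ^+ k.+1 by rewrite exprSr; field; rewrite expf_neq0.
    set X := nrm (u (z / 2 ^+ k)); set Y := nrm (u (z / 2 ^+ k.+1)).
    rewrite [4^-1 ^+ k.+1]exprS.
    have q0 : 0 <= (4^-1 : R) ^+ k by rewrite exprn_ge0 // invr_ge0.
    move: ((4^-1 : R) ^+ k) q0 => q q0 hX.
    have : q * X <= q * ((Y + e / 2) / 4) by rewrite ler_wpM2l.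
    lra.
  have small_u : tends (fun y => y ^+ 2 * u y) 0 0.
    have h := tendsB small (tendsM (tendsX 2 (@tends_id R 0)) (@tends_cst R c0 0)).
    rewrite expr0n mul0r subrr in h; apply: (eq_tends ltr01) h => y _ _.
    by rewrite /u; ring.
  have nz : 0 < nrm z by rewrite nrm_gt0.
  have ez0 : 0 < nrm z ^+ 2 * (e / 2) by rewrite mulr_gt0 // exprn_gt0.
  have [d' d'0 hd'] := small_u _ ez0.
  have [k hk] : exists k : nat, nrm z / d' < 2 ^+ k.
    exists (Num.bound (nrm z / d')); apply: lt_trans (archi_boundP _) _; first by apply: divr_ge0; [exact: nrm_ge0|exact: ltW].
    by rewrite -natrX ltr_nat ltn_expl.
  have n2k : nrm (z / 2 ^+ k) = nrm z / 2 ^+ k.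
    by rewrite nrmM nrmV nrmX nrm_nat.
  have zk0 : z / 2 ^+ k != 0 by rewrite mulf_neq0 ?invr_eq0 ?expf_neq0.
  have := hd' (z / 2 ^+ k) zk0; rewrite !subr0 n2k.
  rewrite ltr_pdivrMr ?exprn_gt0 // mulrC -ltr_pdivrMr // => /(_ hk).
  have -> : nrm ((z / 2 ^+ k) ^+ 2 * u (z / 2 ^+ k)) =
      nrm z ^+ 2 * (4^-1 ^+ k * nrm (u (z / 2 ^+ k))).
    rewrite nrmM nrmX n2k expr_div_n mulrA; congr (_ * _ * _).
    by rewrite -exprM mulnC exprM -exprVn; congr (_ ^+ _); field.
  rewrite ltr_pM2l ?exprn_gt0 //.
  move=> hlast; have := iter k; have : 0 <= (4^-1 : R) ^+ k by rewrite exprn_ge0 // invr_ge0.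
  rewrite -/(u z); move: ((4^-1 : R) ^+ k) hlast => q hq q0 h.
  have : (1 - q) * (e / 6) <= e / 6.
    have : 0 <= q * (e / 6) by rewrite mulr_ge0 // divr_ge0 // ltW.
    lra.
  lra.
pose F z := if `[< in_lat tau z >] then c0 else f z.
have FE z : ~ in_lat tau z -> F z = f z by move=> h; rewrite /F; case: asboolP.
have FL z : in_lat tau z -> F z = c0 by move=> h; rewrite /F; case: asboolP.
have Fper : lat_periodic tau F.
  move=> l z hl; rewrite /F per //.
  by have -> : `[< in_lat tau (l + z) >] = `[< in_lat tau z >] by apply: asbool_equiv_eq; exact: in_lat_addr.
have Fcont z : tends F z (F z).
  have [h|h] := pselect (in_lat tau z).
    have F0 : tends F 0 c0.
      by apply: (eq_tends r0) near0 => y y0 yr; rewrite FE //; apply: hr => //; rewrite -[y]subr0.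
    rewrite (FL _ h); have : tends (fun y => F (y + (- z))) z c0.
      by apply: tends_shift; rewrite subrr.
    by apply: (eq_tends r0) => y _ _; rewrite -[LHS](Fper z _ h) addrC subrK.
  have [d d0 hd] : exists2 d : R, 0 < d & forall y, nrm (y - z) < d -> ~ in_lat tau y.
    have r20 : 0 < r / 2 by rewrite divr_gt0.
    have [[y0 [hy0 yr0]]|no] := pselect (exists y, in_lat tau y /\ nrm (y - z) < r / 2); last first.
      by exists (r / 2) => // y yr hy; apply: no; exists y.
    have y0z : y0 != z by apply/eqP => e; apply: h; rewrite -e.
    exists (Num.min (r / 2) (nrm (y0 - z))).
      by rewrite lt_min r20 nrm_gt0 subr_eq0.
    move=> y; rewrite lt_min => /andP[y1 y2] hy.
    have [e|ne] := eqVneq (y - y0) 0.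
      by move: y2; rewrite (subr0_eq e) ltxx.
    apply: (hr (y - y0)) => //; last exact: in_latB.
    by have := nrm_tri y z y0; rewrite (nrmBC z y0); lra.
  rewrite (FE _ h); apply: (eq_tends d0) (cont z h) => y _ yd.
  by rewrite FE //; apply: hd.
have Fcong x y : in_lat tau (x - y) -> F x = F y.
  by move=> h; rewrite -[x](subrK y) Fper.
(* When 2z is a lattice point, the four points are 0, 1/2, tau/2 and (1 + tau)/2 modulo the lattice,
   in an order depending on parities, so the relation extends to [F] by the choice of [c0]. *)
have Favg z : F z + F (z + 2^-1) + F (z + tau / 2) + F (z + (2^-1 + tau / 2)) = 4 * F (2 * z).
  have dbl e : in_lat tau (2 * e) -> in_lat tau (z + e) -> in_lat tau (2 * z).
    move=> he hz; have := in_latB (in_latD hz hz) he.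
    by congr (in_lat _ _); ring.
  have d1 : in_lat tau (2 * 2^-1) by rewrite divff //; exact: in_lat1.
  have d2 : in_lat tau (2 * (tau / 2)) by rewrite mulrC divfK //; exact: in_lat_tau.
  have d3 : in_lat tau (2 * (2^-1 + tau / 2)) by rewrite mulrDr; exact: in_latD.
  have [[m [n e]]|h] := pselect (in_lat tau (2 * z)); last first.
    have n0 : ~ in_lat tau z.
      by move=> hz; apply: h; apply: (dbl 0); rewrite ?mulr0 ?addr0 //; exact: in_lat0.
    have n1 : ~ in_lat tau (z + 2^-1) by move=> hz; apply: h; exact: dbl hz.
    have n2 : ~ in_lat tau (z + tau / 2) by move=> hz; apply: h; exact: dbl hz.
    have n3 : ~ in_lat tau (z + (2^-1 + tau / 2)) by move=> hz; apply: h; exact: dbl hz.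
    by rewrite !FE //; exact: avg.
  rewrite (FL (2 * z)); last by exists m, n.
  have -> : 4 * c0 = c0 + f 2^-1 + f (tau / 2) + f (2^-1 + tau / 2).
    have -> : 4 * c0 = c0 + S 0 by rewrite /c0; field.
    by rewrite /S !add0r; ring.
  rewrite -(FL 0 (in_lat0 tau)) -(FE _ T1) -(FE _ T2) -(FE _ T3).
  have par (k : int) : exists k', (k = 2 * k') \/ (k = 2 * k' + 1).
    by exists (k %/ 2)%Z; lia.
  have [m' em] := par m; have [n' en] := par n.
  have ez : z = (m%:~R + n%:~R * tau) / 2 by rewrite -e; field.
  have close x y a b : x - y = (m' + a)%:~R + (n' + b)%:~R * tau -> F x = F y.
    by move=> h; apply: Fcong; exists (m' + a), (n' + b).
  case: em en => em [] en; rewrite em en !(rmorphD, rmorphM) /= in ez.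
  - have a0 : F z = F (0) by apply: (close _ _ 0 0); rewrite ez !rmorphD /=; field.
    have a1 : F (z + 2^-1) = F (2^-1) by apply: (close _ _ 0 0); rewrite ez !rmorphD /=; field.
    have a2 : F (z + tau / 2) = F (tau / 2) by apply: (close _ _ 0 0); rewrite ez !rmorphD /=; field.
    have a3 : F (z + (2^-1 + tau / 2)) = F (2^-1 + tau / 2) by apply: (close _ _ 0 0); rewrite ez !rmorphD /=; field.
    by rewrite a0 a1 a2 a3; ring.
  - have a0 : F z = F (tau / 2) by apply: (close _ _ 0 0); rewrite ez !rmorphD /=; field.
    have a1 : F (z + 2^-1) = F (2^-1 + tau / 2) by apply: (close _ _ 0 0); rewrite ez !rmorphD /=; field.
    have a2 : F (z + tau / 2) = F (0) by apply: (close _ _ 0 1); rewrite ez !rmorphD /=; field.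
    have a3 : F (z + (2^-1 + tau / 2)) = F (2^-1) by apply: (close _ _ 0 1); rewrite ez !rmorphD /=; field.
    by rewrite a0 a1 a2 a3; ring.
  - have a0 : F z = F (2^-1) by apply: (close _ _ 0 0); rewrite ez !rmorphD /=; field.
    have a1 : F (z + 2^-1) = F (0) by apply: (close _ _ 1 0); rewrite ez !rmorphD /=; field.
    have a2 : F (z + tau / 2) = F (2^-1 + tau / 2) by apply: (close _ _ 0 0); rewrite ez !rmorphD /=; field.
    have a3 : F (z + (2^-1 + tau / 2)) = F (tau / 2) by apply: (close _ _ 1 0); rewrite ez !rmorphD /=; field.
    by rewrite a0 a1 a2 a3; ring.
  - have a0 : F z = F (2^-1 + tau / 2) by apply: (close _ _ 0 0); rewrite ez !rmorphD /=; field.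
    have a1 : F (z + 2^-1) = F (tau / 2) by apply: (close _ _ 1 0); rewrite ez !rmorphD /=; field.
    have a2 : F (z + tau / 2) = F (2^-1) by apply: (close _ _ 0 1); rewrite ez !rmorphD /=; field.
    have a3 : F (z + (2^-1 + tau / 2)) = F (0) by apply: (close _ _ 1 1); rewrite ez !rmorphD /=; field.
    by rewrite a0 a1 a2 a3; ring.
have close z z' : F z = F z'.
  apply/eqP; rewrite -subr_eq0 -nrm_eq0; apply/eqP/le_anti; rewrite nrm_ge0 andbT.
  apply/ler_addgt0Pr => e e0; rewrite add0r.
  have [d d0 hd] := lat_uniform_cont t0 Fper Fcont e0.
  (* Halving two points halves their distance, and the average of four differences below [e] is
     below [e]: the bound spreads from distance [d] to 2^k d without growing. *)
  have scale k : forall y y', nrm (y - y') < 2 ^+ k * d -> nrm (F y - F y') < e.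
    elim: k => [|k IH] y y' h; first by apply: hd; rewrite expr0 mul1r in h.
    have half : nrm (y / 2 - y' / 2) < 2 ^+ k * d.
      by rewrite -mulrBl nrmM nrmV nrm_nat; move: h; rewrite exprS; lra.
    have yy (x : C) : 2 * (x / 2) = x by field.
    have A1 := Favg (y / 2); have A2 := Favg (y' / 2); rewrite !yy in A1 A2.
    have tr (x x' : C) : nrm (x - x') < 2 ^+ k * d -> forall c, nrm (F (x + c) - F (x' + c)) < e.
      by move=> hx c; apply: IH; rewrite opprD addrACA subrr addr0.
    apply: (@avg4_bound _ _ _ _ _ e _ (IH _ _ half) (tr _ _ half 2^-1)
       (tr _ _ half (tau / 2)) (tr _ _ half (2^-1 + tau / 2))).
    by rewrite mulrBr -A1 -A2; ring.
  have [k hk] : exists k : nat, nrm (z - z') / d < 2 ^+ k.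
    exists (Num.bound (nrm (z - z') / d)); apply: lt_trans (archi_boundP _) _; first by apply: divr_ge0; [exact: nrm_ge0|exact: ltW].
    by rewrite -natrX ltr_nat ltn_expl.
  by apply/ltW/(scale k); rewrite -ltr_pdivrMr.
by exists (F 2^-1) => z hz; rewrite -(FE _ hz).
Qed.

End Lattice.

Local Close Scope classical_set_scope.

Section Periods.
Variables (R : realType) (T : Type) (f : R[i] -> T).

Lemma int_period (c : R[i]) : (forall y, f (c + y) = f y) ->
  forall (n : int) y, f (n%:~R * c + y) = f y.
Proof.
move=> h; have nat (k : nat) y : f ((Posz k)%:~R * c + y) = f y.
  elim: k y => [|k IH] y; first by rewrite mul0r add0r.
  by rewrite -addn1 PoszD rmorphD mulrDl mul1r -addrA IH h.
case=> n y; first exact: nat.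
have -> : (Negz n)%:~R * c + y = y - (Posz n.+1)%:~R * c.
  by rewrite NegzE rmorphN mulNr addrC.
by rewrite -(nat n.+1) addrC subrK.
Qed.

Lemma lattice_period (tau : R[i]) : (forall y, f (1 + y) = f y) ->
  (forall y, f (tau + y) = f y) -> forall l z, in_lat tau l -> f (l + z) = f z.
Proof.
move=> h1 h2 _ z [m [n ->]]; rewrite -addrA.
by have := int_period h1 m (n%:~R * tau + z); rewrite mulr1 int_period.
Qed.

End Periods.

Section Elliptic.
Variable R : realType.
Local Notation C := R[i].
Local Notation nrm := (@Normc.normc R).
Local Notation re := (@complex.Re R).
Local Notation im := (@complex.Im R).

(** The nome e^(i pi tau): translation of z by tau multiplies [ce z] by [qh tau ^+ 2], translation
    by tau/2 multiplies it by [qh tau]. *)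
Definition qh (tau : C) : C := ce (tau / 2).
Definition wx (tau z : C) : C := ell_x (qh tau) (ce z).
Definition wd (tau z : C) : C := ell_d (qh tau) (ce z).
Definition ws (tau : C) : C := ell_s (qh tau).
Definition wmu (tau : C) : C := ell_mu (qh tau).

Let two0 : (2 : C) != 0. Proof. by rewrite pnatr_eq0. Qed.
Let four0 : (4 : C) != 0. Proof. by rewrite pnatr_eq0. Qed.

Lemma im_div2 (z : C) : im (z / 2) = im z / 2.
Proof.
have -> : (2 : C)^-1 = real_complex R 2^-1 by rewrite fmorphV rmorph_nat.
by case: z => a b /=; ring.
Qed.

Lemma qh_nome tau : 0 < im tau -> nome (qh tau).
Proof.
move=> t0; rewrite /nome ce_neq0 nrm_ce im_div2 expR_lt1 oppr_lt0.
by rewrite !mulr_gt0 ?invr_gt0 // pi_gt0.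
Qed.

Lemma qh_dbl tau : qh (2 * tau) = qh tau ^+ 2.
Proof. by rewrite /qh -mulrA -[2]/(2%:R) ce_nat. Qed.

Lemma qh_sqr tau : qh tau ^+ 2 = ce tau.
Proof. by rewrite -qh_dbl /qh mulrAC divff // mul1r. Qed.

Section Fixed.
Variable tau : C.
Hypothesis t0 : 0 < im tau.
Let p := qh tau.
Let hp : nome p := qh_nome t0.
Let p0 : p != 0. Proof. exact: nome_neq0. Qed.
Let it0 : im tau != 0. Proof. by rewrite gt_eqF. Qed.

Lemma theta1_period w : w != 0 -> (theta1 p (p ^+ 2 * w) == 0) = (theta1 p w == 0).
Proof.
move=> w0; have pw0 : p * w != 0 by rewrite mulf_neq0.
rewrite expr2 -mulrA theta1_shift // theta4_shift // !mulf_eq0 oppr_eq0 invr_eq0.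
by rewrite mulf_eq0 (negbTE p0) (negbTE pw0).
Qed.

Lemma theta1_lat l z : in_lat tau l -> (theta1 p (ce (l + z)) == 0) = (theta1 p (ce z) == 0).
Proof.
apply: (@lattice_period R _ (fun y => theta1 p (ce y) == 0)) => y; rewrite ceD.
  by rewrite ce1 mul1r.
by rewrite -qh_sqr theta1_period ?ce_neq0.
Qed.

(** The strip 0 <= Im z <= Im tau / 2 corresponds to the annulus of [theta1_zero_annulus]. The other
    half of the parallelogram is brought there by z |-> tau - z, since a zero at w gives one at
    1/w. *)
Lemma theta1_eq0P z : reflect (in_lat tau z) (theta1 p (ce z) == 0).
Proof.
apply: (iffP idP) => [|h]; last first.
  by rewrite -[z]addr0 theta1_lat // ce0 theta1_1.
have strip z' : 0 <= im z' <= im tau / 2 -> theta1 p (ce z') = 0 -> in_lat tau z'.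
  move=> /andP[h1 h2] h; have pi0 := @pi_gt0 R.
  have [n ->] : exists n : int, z' = n%:~R; last exact: in_lat_int.
  apply: ce_eq1; apply: theta1_zero_annulus hp _ h.
  have k0 : 0 < 2 * pi :> R by rewrite mulr_gt0.
  rewrite /p /qh !nrm_ce im_div2 ler_expR lerN2 (ler_pM2l k0) h2 /=.
  by rewrite expR_le1 oppr_le0 mulr_ge0 // ltW.
move=> hz; have [l [x [y [hl hx /andP[y0 y1] ez]]]] := lat_reduce z it0.
set z' := real_complex R x + _ in ez.
have imz' : im z' = y * im tau by rewrite /z'; case: (tau) => c d /=; ring.
have hz' : theta1 p (ce z') = 0 by apply/eqP; rewrite -(theta1_lat z' hl) -ez.
rewrite ez in_lat_addr //; have [yl|yg] := leP y 2^-1.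
  apply: strip => //; rewrite imz' mulr_ge0 ?(ltW t0) //=.
  by rewrite mulrC ler_pM2l.
have -> : z' = tau - (tau - z') by rewrite opprB addrC subrK.
apply: in_latB; first exact: in_lat_tau.
apply: strip.
  have -> : im (tau - z') = im tau - im z' by case: (tau) (z') => [? ?] [? ?].
  rewrite imz'; have : (y - 2^-1) * im tau >= 0 by apply: mulr_ge0; rewrite ?subr_ge0 // ltW.
  have : (1 - y) * im tau >= 0 by apply: mulr_ge0; rewrite ?subr_ge0 // ltW.
  lra.
apply/eqP; rewrite theta1_lat; last exact: in_lat_tau.
by rewrite ceN theta1V ?ce_neq0 // hz' mulr0.
Qed.

Lemma theta2_eq0P z : reflect (in_lat tau (z + 2^-1)) (theta2 p (ce z) == 0).
Proof.
have -> : theta2 p (ce z) = theta1 p (ce (z + 2^-1)).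
  by rewrite ceD ce_half mulrN1 /theta1 opprK.
exact: theta1_eq0P.
Qed.

Lemma theta4_eq0P z : reflect (in_lat tau (z + tau / 2)) (theta4 p (ce z) == 0).
Proof.
have -> : (theta4 p (ce z) == 0) = (theta1 p (ce (z + tau / 2)) == 0).
  rewrite ceD mulrC theta1_shift ?ce_neq0 // mulf_eq0 oppr_eq0 invr_eq0.
  by rewrite mulf_eq0 (negbTE p0) (negbTE (ce_neq0 z)).
exact: theta1_eq0P.
Qed.

Lemma theta3_eq0P z : reflect (in_lat tau (z + (2^-1 + tau / 2))) (theta3 p (ce z) == 0).
Proof.
have -> : theta3 p (ce z) = theta4 p (ce (z + 2^-1)).
  by rewrite ceD ce_half mulrN1 /theta4 opprK.
by rewrite addrA; exact: theta4_eq0P.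
Qed.

Lemma theta1_n0 z : ~ in_lat tau z -> theta1 p (ce z) != 0.
Proof. by move=> h; apply/negP => /theta1_eq0P. Qed.
Lemma theta2_n0 z : ~ in_lat tau (z + 2^-1) -> theta2 p (ce z) != 0.
Proof. by move=> h; apply/negP => /theta2_eq0P. Qed.
Lemma theta3_n0 z : ~ in_lat tau (z + (2^-1 + tau / 2)) -> theta3 p (ce z) != 0.
Proof. by move=> h; apply/negP => /theta3_eq0P. Qed.
Lemma theta4_n0 z : ~ in_lat tau (z + tau / 2) -> theta4 p (ce z) != 0.
Proof. by move=> h; apply/negP => /theta4_eq0P. Qed.

Lemma in_lat_half_dbl e z : in_lat tau (2 * e) -> in_lat tau (z + e) -> in_lat tau (2 * z).
Proof.
by move=> he hz; have := in_latB (in_latD hz hz) he; congr (in_lat _ _); ring.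
Qed.
Let d1 : in_lat tau (2 * 2^-1). Proof. by rewrite divff //; exact: in_lat1. Qed.
Let d2 : in_lat tau (2 * (tau / 2)).
Proof. by rewrite mulrC divfK //; exact: in_lat_tau. Qed.
Let d3 : in_lat tau (2 * (2^-1 + tau / 2)). Proof. by rewrite mulrDr; exact: in_latD. Qed.

Lemma dbl_not_lat z : ~ in_lat tau (2 * z) ->
  [/\ theta1 p (ce z) != 0, theta2 p (ce z) != 0, theta3 p (ce z) != 0 & theta4 p (ce z) != 0].
Proof.
move=> h; split; [apply: theta1_n0|apply: theta2_n0|apply: theta3_n0|apply: theta4_n0].
- by move=> hz; apply: h; rewrite mulr_natl mulr2n; apply: in_latD.
- by move=> hz; apply: h; apply: in_lat_half_dbl hz.
- by move=> hz; apply: h; apply: in_lat_half_dbl hz.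
- by move=> hz; apply: h; apply: in_lat_half_dbl hz.
Qed.

Lemma wx_periodic : lat_periodic tau (wx tau).
Proof.
move=> l z; apply: lattice_period => y; rewrite /wx -/p ceD.
  by rewrite ce1 mul1r.
by rewrite -qh_sqr ell_x_period ?ce_neq0.
Qed.

Lemma wd_periodic : lat_periodic tau (wd tau).
Proof.
move=> l z; apply: lattice_period => y; rewrite /wd -/p ceD.
  by rewrite ce1 mul1r.
by rewrite -qh_sqr ell_d_period ?ce_neq0.
Qed.

Lemma wx_cont z : ~ in_lat tau z -> tends (wx tau) z (wx tau z).
Proof.
move=> h; have h1 := theta1_n0 h; have w0 := ce_neq0 z.
rewrite /wx; apply: (@tends_comp _ (ell_x p)) (ce_cont z) => //.
rewrite /ell_x; apply: tendsM; first exact: tends_cst.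
apply: tendsM; first by apply: tendsX; apply: theta4_cont.
apply: tendsV; first by rewrite mulf_neq0 // expf_neq0.
apply: tendsM; first exact: tends_id.
by apply: tendsX; apply: theta1_cont.
Qed.

Lemma wx_inj z z' : ~ in_lat tau z -> ~ in_lat tau z' -> wx tau z = wx tau z' ->
  in_lat tau (z + z') \/ in_lat tau (z - z').
Proof.
move=> h h' e.
have := ell_x_inj hp (ce_neq0 z) (ce_neq0 z') (theta1_n0 h) (theta1_n0 h') e.
move/eqP; rewrite mulf_eq0 -ceN -!ceD => /orP[/theta1_eq0P|/theta1_eq0P]; by [left|right].
Qed.

Lemma wxN z : wx tau (- z) = wx tau z.
Proof. by rewrite /wx ceN ell_x_inv ?ce_neq0. Qed.
Lemma wdN z : wd tau (- z) = - wd tau z.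
Proof. by rewrite /wd ceN ell_d_inv ?ce_neq0. Qed.

Lemma wx_tau2 z : ~ in_lat tau z -> ~ in_lat tau (z + tau / 2) ->
  wx tau (z + tau / 2) * wx tau z = ws tau.
Proof.
move=> h1 h4; rewrite /wx ceD mulrC [ce z * _]mulrC mulrC.
by apply: ell_x_shift; rewrite ?ce_neq0 ?theta1_n0 ?theta4_n0.
Qed.

Lemma wx_eq0 z : ~ in_lat tau z -> wx tau z = 0 <-> in_lat tau (z + tau / 2).
Proof.
move=> h; have e := ell_x_eq0 hp (ce_neq0 z) (theta1_n0 h); split.
  by move=> /eqP; rewrite /wx e => /theta4_eq0P.
by move=> /theta4_eq0P; rewrite -/p -e => /eqP.
Qed.

Lemma wd_sqr z : ~ in_lat tau z -> ~ in_lat tau (z + tau / 2) ->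
  wd tau z ^+ 2 * wx tau z = (1 + 4 * wx tau z) * (wx tau z + 4 * ws tau).
Proof. by move=> h1 h4; apply: ell_d_sqr; rewrite ?ce_neq0 ?theta1_n0 ?theta4_n0. Qed.

(** The translates are rational in x(z) and s, and x(2z) comes from duplication; eliminating d^2 by
    the curve equation leaves an identity in x and s. This is the averaging relation needed by
    [herglotz]. *)
Lemma wx_avg z : ~ in_lat tau (2 * z) ->
  wx tau z + wx tau (z + 2^-1) + wx tau (z + tau / 2) + wx tau (z + (2^-1 + tau / 2)) =
  4 * wx tau (2 * z).
Proof.
move=> h; have [h1 h2 h3 h4] := dbl_not_lat h; have w0 := ce_neq0 z.
have h2z := theta1_n0 h; move: h2z; rewrite /wx -/p -[2 * z]/(2%:R * z) ce_nat => h2z.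
have e10 : ce (z + 2^-1) = - ce z by rewrite ceD ce_half mulrN1.
have e20 : ce (z + tau / 2) = p * ce z by rewrite ceD mulrC.
have e30 : ce (z + (2^-1 + tau / 2)) = p * - ce z by rewrite addrA ceD e10 mulrC.
rewrite e10 e20 e30.
move: (ce z) w0 h1 h2 h3 h4 h2z => w w0 h1 h2 h3 h4 h2z.
have nw0 : - w != 0 by rewrite oppr_eq0.
have h1' : theta1 p (- w) != 0 by rewrite /theta1 opprK.
have h4' : theta4 p (- w) != 0 by rewrite /theta4 opprK.
have e1 := ell_x_opp hp w0 h1 h2; have e2 := ell_x_shift hp w0 h1 h4.
have e3 := ell_x_shift hp nw0 h1' h4'; have e4 := ell_d_sqr hp w0 h1 h4.
have e5 := ell_x_dup hp w0 h1 h2 h3 h4 h2z.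
have x0 : ell_x p w != 0 by rewrite ell_x_eq0.
have y0 : ell_x p (- w) != 0 by rewrite ell_x_eq0.
have d0 : ell_d p w != 0 by rewrite ell_d_eq0 // negb_or h2.
have f0 : 1 + 4 * ell_x p w != 0 by rewrite ell_x14_eq0.
move: (ell_s p) (ell_d p w) (ell_x p w) (ell_x p (- w)) (ell_x p (p * w)) (ell_x p (p * - w))
  (ell_x p (w ^+ 2)) e1 e2 e3 e4 e5 x0 y0 d0 f0.
move=> s D x y u v X e1 e2 e3 e4 e5 x0 y0 d0 f0.
have k0 : x + 4 * s != 0.
  have : D ^+ 2 * x != 0 by rewrite mulf_neq0 // expf_neq0.
  by rewrite e4 mulf_eq0 negb_or => /andP[].
have eu : u = s / x by rewrite -e2 mulfK.
have ey : y = - (x + 4 * s) / (1 + 4 * x) by rewrite -e1 mulfK.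
have ev : v = s / y by rewrite -e3 mulfK.
have eD : D ^+ 2 = (1 + 4 * x) * (x + 4 * s) / x by rewrite -e4 mulfK.
have eX : X = ((D ^+ 2 + (1 - 16 * s)) ^+ 2 / (4 * D ^+ 2) - 1) / 4.
  rewrite -e5; field; exact: d0.
rewrite eX eD ev ey eu; field.
rewrite x0 f0 k0 !andbT /= ?mulNr ?oppr_eq0 //.
Qed.

Lemma wd_dup z : ~ in_lat tau (2 * z) -> ~ in_lat tau (2 * z + tau / 2) ->
  wd tau (2 * z) * (2 * wd tau z * (wx tau z ^+ 2 - ws tau)) =
  (wd tau z ^+ 2 + (1 - 16 * ws tau)) * (wx tau z ^+ 2 + 8 * ws tau * wx tau z + ws tau).
Proof.
move=> h h'; have [h1 h2 h3 h4] := dbl_not_lat h; have w0 := ce_neq0 z.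
have h2z := theta1_n0 h; have h4z := theta4_n0 h'.
move: h2z h4z; rewrite /wx /wd -/p -[2 * z]/(2%:R * z) ce_nat => h2z h4z.
exact: ell_d_dup.
Qed.

Lemma theta1_ce_lim : exists2 l : C, l != 0 & tends (fun z => theta1 p (ce z) / z) 0 l.
Proof.
have [l [_ hl]] := theta1_deriv hp; have l0 := theta1_deriv_neq0 hp hl.
have pi0 := @pi_gt0 R.
exists (l * (2 * 'i%C * real_complex R pi)).
  rewrite !mulf_neq0 // ?eq_complex /= ?eqxx ?oner_eq0 //.
  by rewrite negb_and (gt_eqF pi0).
(* The quotient is completed by its limit at 1, which gives a continuous function to compose with
   [ce]. *)
pose F w := if w == 1 then l else theta1 p w / (w - 1).
have hF : tends F 1 (F 1).
  rewrite {2}/F eqxx; apply: (eq_tends ltr01) hl => w w1 _.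
  by rewrite /F (negbTE w1).
have hFe : tends (fun z => F (ce z)) 0 l.
  apply: (@tends_comp _ F (@ce R)); rewrite ?ce0 //; first by rewrite /F eqxx.
  by rewrite -[X in tends _ _ X]ce0; exact: ce_cont.
have := tendsM hFe (@ce_deriv R); apply: (eq_tends ltr01) => z z0; rewrite subr0 => zr.
have wn1 : ce z != 1.
  apply/eqP => /ce_eq1 [n en]; move: z0 zr; rewrite en intr_eq0 -(rmorph_int (real_complex R)).
  by rewrite nrm_real -intr_norm => n0; rewrite ltNge ler1z -gtz0_ge1 normr_gt0 n0.
rewrite /F (negbTE wn1) mulrA; congr (_ / _).
by rewrite divfK // subr_eq0.
Qed.

Let theta_at0 (F : C -> C) : (forall w, w != 0 -> tends F w (F w)) -> tends (fun z => F (ce z)) 0 (F 1).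
Proof.
move=> h; apply: tends_comp; [by apply: h; exact: ce_neq0|by rewrite ce0|exact: ce_cont].
Qed.

Lemma wx_lim : exists2 l : C, l != 0 & tends (fun z => z ^+ 2 * wx tau z) 0 l.
Proof.
have [L L0 hL] := theta1_ce_lim.
have h4 := theta_at0 (fun w w0 => theta4_cont hp w0).
exists (theta2 p 1 ^+ 2 / (4 * theta3 p 1 ^+ 2) * (theta4 p 1 ^+ 2 * (1 * L ^+ 2)^-1)).
  by rewrite !(mulf_neq0, invr_eq0, expf_neq0) ?oner_neq0 //;
    rewrite ?theta2_1_neq0 ?theta3_1_neq0 ?theta4_1_neq0.
have ce1 : tends (@ce R) 0 1 by have h := @ce_cont R 0; rewrite ce0 in h; exact: h.
have LL : 1 * L ^+ 2 != 0 by rewrite mul1r expf_neq0.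
have := tendsM (@tends_cst R (theta2 p 1 ^+ 2 / (4 * theta3 p 1 ^+ 2)) 0)
  (tendsM (tendsX 2 h4) (tendsV LL (tendsM ce1 (tendsX 2 hL)))).
apply: (eq_tends ltr01) => z z0 _; rewrite /wx /ell_x -/p.
have [->|t10] := eqVneq (theta1 p (ce z)) 0.
  by rewrite !(mul0r, expr0n, mulr0, invr0).
by field; rewrite z0 t10 ce_neq0 theta3_1_neq0.
Qed.

Lemma wd_lim : exists2 l : C, l != 0 & tends (fun z => z * wd tau z) 0 l.
Proof.
have [L L0 hL] := theta1_ce_lim.
have h4 := theta_at0 (fun w w0 => theta4_cont hp w0).
have h3 := theta_at0 (fun w w0 => theta3_cont hp w0).
have h2 := theta_at0 (fun w w0 => theta2_cont hp w0).
exists (theta4 p 1 ^+ 2 / theta3 p 1 ^+ 2 * (theta2 p 1 * theta3 p 1 * (L * theta4 p 1)^-1)).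
  by rewrite !(mulf_neq0, invr_eq0, expf_neq0) //;
    rewrite ?theta2_1_neq0 ?theta3_1_neq0 ?theta4_1_neq0.
have LL : L * theta4 p 1 != 0 by rewrite mulf_neq0 // theta4_1_neq0.
have := tendsM (@tends_cst R (theta4 p 1 ^+ 2 / theta3 p 1 ^+ 2) 0)
  (tendsM (tendsM h2 h3) (tendsV LL (tendsM hL h4))).
apply: (eq_tends ltr01) => z z0 _; rewrite /wd /ell_d -/p.
have [->|t10] := eqVneq (theta1 p (ce z)) 0.
  by rewrite !(mul0r, mulr0, invr0).
have [->|t40] := eqVneq (theta4 p (ce z)) 0.
  by rewrite !(mul0r, mulr0, invr0).
by field; rewrite z0 t10 t40 theta3_1_neq0.
Qed.

(** A value independent of tau: it fixes the multiplicative constant in [wx_base_change]. *)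
Lemma wx_half : wx tau 2^-1 = - 4^-1.
Proof.
have h1 : theta1 p (-1) != 0 by rewrite /theta1 opprK theta2_1_neq0.
have w0 : (-1 : C) != 0 by rewrite oppr_eq0 oner_neq0.
have := ell_x14_eq0 hp w0 h1.
rewrite -[theta2 p (-1)]/(theta1 p 1) theta1_1 // eqxx /wx ce_half -/p.
move=> /eqP h; have -> : ell_x p (-1) = ((1 + 4 * ell_x p (-1)) - 1) / 4 by field.
by rewrite h sub0r mulN1r.
Qed.

End Fixed.
End Elliptic.

(** * Invariance of x, s and d under base change in Gamma(2) *)

Section BaseChange.
Variable R : realType.
Local Notation C := R[i].
Local Notation nrm := (@Normc.normc R).
Local Notation im := (@complex.Im R).

Variables (tau tau' alpha : C) (a b c d : int).
Hypotheses (t0 : 0 < im tau) (t0' : 0 < im tau') (alpha0 : alpha != 0).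
Hypotheses (ealpha : alpha = (2 * d + 1)%:~R + (2 * c)%:~R * tau')
  (etau : alpha * tau = (2 * b)%:~R + (2 * a + 1)%:~R * tau')
  (det1 : (2 * a + 1) * (2 * d + 1) - (2 * b) * (2 * c) = 1).

Let it0 : im tau != 0. Proof. by rewrite gt_eqF. Qed.
Let two0 : (2 : C) != 0. Proof. by rewrite pnatr_eq0. Qed.

Let det1C : (2 * a%:~R + 1) * (2 * d%:~R + 1) - (2 * b%:~R) * (2 * c%:~R) = 1 :> C.
Proof. by have /(congr1 (fun x : int => x%:~R : C)) := det1; rewrite !(rmorphB, rmorphD, rmorphM). Qed.
Let ealphaC : alpha = 2 * d%:~R + 1 + 2 * c%:~R * tau'.
Proof. by rewrite ealpha !(rmorphD, rmorphM). Qed.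
Let etauC : alpha * tau = 2 * b%:~R + (2 * a%:~R + 1) * tau'.
Proof. by rewrite etau !(rmorphD, rmorphM). Qed.

(** The matrix with rows (2a + 1, 2b) and (2c, 2d + 1) has determinant 1, so alpha maps one lattice
    onto the other. Being the identity modulo 2, it also respects the classes of the half periods
    1/2 and tau/2, on which x, d and s depend. *)
Lemma lat_alpha z : in_lat tau z <-> in_lat tau' (alpha * z).
Proof.
split=> [[m [n ->]]|[m [n e]]].
  exists (m * (2 * d + 1) + n * (2 * b)), (m * (2 * c) + n * (2 * a + 1)).
  have -> : alpha * (m%:~R + n%:~R * tau) = m%:~R * alpha + n%:~R * (alpha * tau) by ring.
  by rewrite etauC ealphaC !(rmorphD, rmorphM) /=; ring.
exists (m * (2 * a + 1) - n * (2 * b)), (n * (2 * d + 1) - m * (2 * c)).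
apply: (mulfI alpha0); rewrite e !(rmorphB, rmorphD, rmorphM) /=.
have -> : alpha * (m%:~R * (2 * a%:~R + 1) - n%:~R * (2 * b%:~R) +
    (n%:~R * (2 * d%:~R + 1) - m%:~R * (2 * c%:~R)) * tau) =
   m%:~R * ((2 * a%:~R + 1) * alpha - 2 * c%:~R * (alpha * tau)) +
   n%:~R * ((2 * d%:~R + 1) * (alpha * tau) - 2 * b%:~R * alpha) by ring.
have -> : (2 * a%:~R + 1) * alpha - 2 * c%:~R * (alpha * tau) = 1.
  by rewrite etauC ealphaC -[RHS]det1C; ring.
have -> : (2 * d%:~R + 1) * (alpha * tau) - 2 * b%:~R * alpha = tau'.
  by rewrite etauC ealphaC -[RHS]mul1r -[X in _ = X * _]det1C; ring.
by rewrite mulr1.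
Qed.

Let half1 z : exists2 l, in_lat tau' l & alpha * (z + 2^-1) = l + (alpha * z + 2^-1).
Proof.
exists (d%:~R + c%:~R * tau'); first by exists d, c.
by rewrite mulrDr {2}ealphaC; field.
Qed.
Let half2 z : exists2 l, in_lat tau' l & alpha * (z + tau / 2) = l + (alpha * z + tau' / 2).
Proof.
exists (b%:~R + a%:~R * tau'); first by exists b, a.
by rewrite mulrDr mulrA etauC; field.
Qed.
Let half3 z : exists2 l, in_lat tau' l &
  alpha * (z + (2^-1 + tau / 2)) = l + (alpha * z + (2^-1 + tau' / 2)).
Proof.
have [l1 h1 e1] := half1 (z + tau / 2); have [l2 h2 e2] := half2 z.
exists (l1 + l2); first exact: in_latD.
by rewrite [2^-1 + tau / 2]addrC addrA e1 e2; ring.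
Qed.

Let f2 z := wx tau' (alpha * z).

Let f2_half1 z : f2 (z + 2^-1) = wx tau' (alpha * z + 2^-1).
Proof. by rewrite /f2; have [l h ->] := half1 z; rewrite wx_periodic. Qed.
Let f2_half2 z : f2 (z + tau / 2) = wx tau' (alpha * z + tau' / 2).
Proof. by rewrite /f2; have [l h ->] := half2 z; rewrite wx_periodic. Qed.
Let f2_half3 z : f2 (z + (2^-1 + tau / 2)) = wx tau' (alpha * z + (2^-1 + tau' / 2)).
Proof. by rewrite /f2; have [l h ->] := half3 z; rewrite wx_periodic. Qed.

Let half_not_lat : ~ in_lat tau 2^-1 /\ ~ in_lat tau (tau / 2).
Proof.
have odd_no (k : int) : 2^-1 - k%:~R = 0 :> R -> False.
  move=> h; have : (2 * k)%:~R = 1%:~R :> R by rewrite rmorphM /=; lra.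
  by move/eqP; rewrite eqr_int => /eqP; lia.
have e2 : (2 : C)^-1 = real_complex R 2^-1 by rewrite fmorphV rmorph_nat.
split=> -[m [n e]].
  have : real_complex R (2^-1 - m%:~R) + real_complex R (- n%:~R) * tau = 0.
    by rewrite rmorphB rmorphN /= !rmorph_int -e2 e; ring.
  by move/(lat_indep it0) => [/odd_no].
have : real_complex R (- m%:~R) + real_complex R (2^-1 - n%:~R) * tau = 0.
  rewrite rmorphB rmorphN /= !rmorph_int -e2 mulrBl [2^-1 * tau]mulrC e; ring.
by move/(lat_indep it0) => [_ /odd_no].
Qed.

(** Both functions have a double pole exactly on the lattice and satisfy the averaging relation. For
    the [k] that cancels the poles at 0, [herglotz] makes the difference constant; the common zero
    tau/2 shows that the constant is 0, and the common value at 1/2 that [k] is 1. *)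
Lemma wx_base_change z : ~ in_lat tau z -> wx tau' (alpha * z) = wx tau z.
Proof.
have [l1 l10 h1] := wx_lim t0; have [l2 l20 h2] := wx_lim t0'.
have h2' : tends (fun z => z ^+ 2 * f2 z) 0 (l2 / alpha ^+ 2).
  have := tendsM (tends_scale alpha0 h2) (@tends_cst R (alpha ^+ 2)^-1 0).
  by apply: (eq_tends ltr01) => y _ _; rewrite /f2; field.
pose k := l1 * alpha ^+ 2 / l2.
pose f y := wx tau y - k * f2 y.
have f2per : lat_periodic tau f2.
  move=> l y hl; rewrite /f2 mulrDr wx_periodic //; exact/lat_alpha.
have [||||cst hcst] := @herglotz R tau f it0.
- by move=> l y hl; rewrite /f f2per // wx_periodic.
- move=> y hy; rewrite /f; apply: tendsB; first exact: wx_cont.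
  apply: tendsM; first exact: tends_cst.
  rewrite /f2; apply: (@tends_comp _ (wx tau') (fun y => alpha * y)) => //.
    by apply: wx_cont => // /lat_alpha.
  by apply: tendsM; [exact: tends_cst|exact: tends_id].
- have := tendsB h1 (tendsM (@tends_cst R k 0) h2').
  have -> : l1 - k * (l2 / alpha ^+ 2) = 0 by rewrite /k; field; rewrite alpha0.
  by apply: (eq_tends ltr01) => y _ _; rewrite /f; ring.
- move=> y hy; rewrite /f f2_half1 f2_half2 f2_half3.
  have hy' : ~ in_lat tau' (2 * (alpha * y)).
    by move=> h; apply: hy; apply/lat_alpha; rewrite mulrCA.
  have A1 := wx_avg t0 hy; have A2 := wx_avg t0' hy'.
  have -> : f2 (2 * y) = wx tau' (2 * (alpha * y)) by rewrite /f2 mulrCA.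
  have -> : 4 * (wx tau (2 * y) - k * wx tau' (2 * (alpha * y))) =
      4 * wx tau (2 * y) - k * (4 * wx tau' (2 * (alpha * y))) by ring.
  rewrite -A1 -A2 /f2; ring.
have [n1 n2] := half_not_lat.
have z1 : wx tau (tau / 2) = 0 by apply/(wx_eq0 t0 n2); rewrite -splitr; exact: in_lat_tau.
have z2 : f2 (tau / 2) = 0.
  rewrite -[tau / 2]add0r f2_half2 mulr0 add0r.
  apply/(wx_eq0 t0'); last by rewrite -splitr; exact: in_lat_tau.
  move=> h; apply: n2; apply/lat_alpha.
  have [l hl e] := half2 0; rewrite add0r mulr0 add0r in e; rewrite e.
  exact: in_latD.
have c0 : cst = 0 by rewrite -(hcst _ n2) /f z1 z2 mulr0 subrr.
have f2h : f2 2^-1 = - 4^-1 by rewrite -[2^-1]add0r f2_half1 mulr0 add0r wx_half.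
have k1 : k = 1.
  have := hcst _ n1; rewrite c0 /f wx_half // f2h => e.
  have q0 : (4 : C) != 0 by rewrite pnatr_eq0.
  apply/eqP; rewrite -subr_eq0; apply/eqP.
  have -> : k - 1 = 4 * (- 4^-1 - k * - 4^-1) by field.
  by rewrite e mulr0.
move=> hz; have := hcst _ hz; rewrite c0 /f k1 mul1r => /eqP.
by rewrite subr_eq0 => /eqP.
Qed.

(** s is x(z) x(z + tau/2) at any z where this makes sense; z = 1/3 qualifies for every tau. *)
Lemma ws_base_change : ws tau' = ws tau.
Proof.
pose z : C := 3^-1.
have three0 : (3 : R) != 0 by rewrite pnatr_eq0.
have e3 : z = real_complex R 3^-1 by rewrite /z fmorphV rmorph_nat.
have e2 : (2 : C)^-1 = real_complex R 2^-1 by rewrite fmorphV rmorph_nat.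
have n1 : ~ in_lat tau z.
  move=> [m [n e]].
  have : real_complex R (3^-1 - m%:~R) + real_complex R (- n%:~R) * tau = 0.
    by rewrite rmorphB rmorphN /= !rmorph_int -e3 e; ring.
  move/(lat_indep it0) => [h _]; have : (3 * m)%:~R = 1%:~R :> R by rewrite rmorphM /=; lra.
  by move/eqP; rewrite eqr_int => /eqP; lia.
have n2 : ~ in_lat tau (z + tau / 2).
  move=> [m [n e]].
  have : real_complex R (3^-1 - m%:~R) + real_complex R (2^-1 - n%:~R) * tau = 0.
    rewrite !rmorphB /= !rmorph_int -e3 -e2 mulrBl [2^-1 * tau]mulrC addrACA e; ring.
  move/(lat_indep it0) => [h _]; have : (3 * m)%:~R = 1%:~R :> R by rewrite rmorphM /=; lra.
  by move/eqP; rewrite eqr_int => /eqP; lia.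
rewrite -(wx_tau2 t0 n1 n2) -!wx_base_change //.
have -> : wx tau' (alpha * (z + tau / 2)) = wx tau' (alpha * z + tau' / 2) by exact: f2_half2.
rewrite wx_tau2 //; first by move/lat_alpha.
move=> h; apply: n2; apply/lat_alpha; have [l hl ->] := half2 z; exact: in_latD.
Qed.

(** The curve equation determines d^2 from x and s, so the two functions agree up to a sign at each
    point. Near 0 the sign is read off the leading coefficients; as d(2z) changes sign with d(z) in
    [wd_dup], it spreads to all z. The last clause later evaluates the product of the multipliers
    mu. *)
Lemma wd_base_change : exists sg : C, [/\ sg = 1 \/ sg = -1,
  forall z, ~ in_lat tau z -> ~ in_lat tau (z + tau / 2) -> wd tau' (alpha * z) = sg * wd tau z &
  forall l l', tends (fun z => z * wd tau z) 0 l -> tends (fun z => z * wd tau' z) 0 l' ->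
     l' = sg * alpha * l].
Proof.
have lat' z : ~ in_lat tau z -> ~ in_lat tau' (alpha * z) by move=> h /lat_alpha.
have lat'2 z : ~ in_lat tau (z + tau / 2) -> ~ in_lat tau' (alpha * z + tau' / 2).
  move=> h h'; apply: h; apply/lat_alpha; have [l hl ->] := half2 z; exact: in_latD.
have sq z : ~ in_lat tau z -> ~ in_lat tau (z + tau / 2) ->
    wd tau' (alpha * z) = wd tau z \/ wd tau' (alpha * z) = - wd tau z.
  move=> h1 h2; have x0 : wx tau z != 0 by apply/eqP => /(wx_eq0 t0 h1).
  have : wd tau' (alpha * z) ^+ 2 = wd tau z ^+ 2.
    have h := wd_sqr t0' (lat' _ h1) (lat'2 _ h2).
    rewrite (wx_base_change h1) ws_base_change in h.
    by apply: (mulIf x0); rewrite h (wd_sqr t0 h1 h2).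
  by move/eqP; rewrite eqf_sqr => /orP[/eqP|/eqP]; [left|right].
have [l1 l10 h1] := wd_lim t0; have [l2 l20 h2] := wd_lim t0'.
have h2' : tends (fun z => z * wd tau' (alpha * z)) 0 (l2 / alpha).
  have := tendsM (tends_scale alpha0 h2) (@tends_cst R alpha^-1 0).
  by apply: (eq_tends ltr01) => y _ _; field.
pose sg := l2 / alpha / l1.
have hq : tends (fun z => (z * wd tau' (alpha * z)) / (z * wd tau z)) 0 sg.
  by apply: tendsM h2' _; apply: tendsV.
have [r1 r10 hr1] : exists2 r : R, 0 < r & forall z, z != 0 -> nrm z < r -> wd tau z != 0.
  have n1 : 0 < nrm l1 by rewrite nrm_gt0.
  have [r r0 hr] := h1 _ n1; exists r => // z z0 zr; apply/eqP => e.
  by have := hr z z0; rewrite subr0 e mulr0 sub0r nrmN ltxx => /(_ zr).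
have dvals z : z != 0 -> wd tau z != 0 -> ~ in_lat tau z /\ ~ in_lat tau (z + tau / 2).
  move=> z0 d0; split=> h; move: d0; rewrite /wd /ell_d.
    by move/(theta1_eq0P t0): h => /eqP ->; rewrite mul0r invr0 !mulr0 eqxx.
  by move/(theta4_eq0P t0): h => /eqP ->; rewrite mulr0 invr0 !mulr0 eqxx.
have quot z : z != 0 -> wd tau z != 0 ->
    (z * wd tau' (alpha * z)) / (z * wd tau z) = 1 \/ (z * wd tau' (alpha * z)) / (z * wd tau z) = -1.
  move=> z0 d0; have [n1 n2] := dvals z z0 d0.
  case: (sq z n1 n2) => ->; [left|right]; first by rewrite divff // mulf_neq0.
  by rewrite mulrN mulNr divff // mulf_neq0.
(* the quotient is locally constant near 0, equal to its limit *)
have [r [r0 hr sg1]] : exists r : R, [/\ 0 < r,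
    forall z, z != 0 -> nrm z < r -> wd tau' (alpha * z) = sg * wd tau z & sg = 1 \/ sg = -1].
  have half0 : 0 < 2^-1 :> R by rewrite invr_gt0.
  have [r r0 hr] := hq _ half0; exists (Num.min r r1).
  have near1 z : z != 0 -> nrm z < Num.min r r1 -> (sg = 1 \/ sg = -1) ->
      (z * wd tau' (alpha * z)) / (z * wd tau z) = sg.
    move=> z0; rewrite lt_min => /andP[zr zr1] sg1.
    have d0 := hr1 z z0 zr1; have := hr z z0; rewrite subr0 => /(_ zr).
    case: (quot z z0 d0) => ->; case: sg1 => -> //.
      by move=> h; exfalso; move: h; rewrite opprK -[1 + 1]/(2%:R) nrm_nat; lra.
    by move=> h; exfalso; move: h; rewrite -opprD nrmN -[1 + 1]/(2%:R) nrm_nat; lra.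
  have sg1 : sg = 1 \/ sg = -1.
    have hq2 := tendsM hq hq.
    have h1' : tends (fun=> 1) 0 (sg * sg).
      apply: (eq_tends r10) hq2 => z z0; rewrite subr0 => zr.
      by case: (quot z z0 (hr1 z z0 zr)) => ->; rewrite ?mulrNN mulr1.
    have := tends_unique h1' (@tends_cst R 1 0); rewrite -expr2 => /eqP.
    by rewrite sqrf_eq1 => /orP[/eqP|/eqP]; [left|right].
  split=> //; first by rewrite lt_min r0.
  move=> z z0 zr; have := near1 z z0 zr sg1.
  have d0 : wd tau z != 0 by apply: hr1 => //; move: zr; rewrite lt_min => /andP[].
  move=> <-; field; by rewrite d0.
exists sg; split=> //; last first.
  move=> l l' hl hl'; rewrite (tends_unique hl h1) (tends_unique hl' h2) /sg.
  by field; rewrite l10 alpha0.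
have step k z : nrm z < 2 ^+ k * r -> ~ in_lat tau z -> ~ in_lat tau (z + tau / 2) ->
    wd tau' (alpha * z) = sg * wd tau z.
  elim: k z => [|k IH] z zr n1 n2.
    apply: hr; last by rewrite expr0 mul1r in zr.
    by apply/eqP => z0; apply: n1; rewrite z0; exact: in_lat0.
  pose y := z / 2; have ezy : z = 2 * y by rewrite /y mulrC divfK.
  rewrite ezy in n1 n2 *.
  have [g1 g2 g3 g4] := dbl_not_lat t0 n1.
  have ny : ~ in_lat tau y by move=> /(theta1_eq0P t0); rewrite (negbTE g1).
  have ny2 : ~ in_lat tau (y + tau / 2) by move=> /(theta4_eq0P t0); rewrite (negbTE g4).
  have yr : nrm y < 2 ^+ k * r.
    rewrite /y nrmM nrmV nrm_nat; move: zr; rewrite exprS; lra.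
  have iy := IH y yr ny ny2.
  have d0 : wd tau y != 0 by rewrite /wd (ell_d_eq0 (qh_nome t0) g1 g4) negb_or g2 g3.
  have x0 : wx tau y != 0 by apply/eqP => /(wx_eq0 t0 ny).
  have xs0 : wx tau y ^+ 2 - ws tau != 0.
    apply/eqP => e; have e' : wx tau (y + tau / 2) = wx tau y.
      apply: (mulIf x0); rewrite (wx_tau2 t0 ny ny2) -expr2.
      by apply/eqP; rewrite eq_sym -subr_eq0 e.
    have [h|h] := wx_inj t0 ny2 ny e'.
      by apply: n2; congr (in_lat _ _): h; ring.
    have [_ nh] := half_not_lat; apply: nh; congr (in_lat _ _): h; ring.
  have D1 := wd_dup t0 n1 n2.
  have n1' : ~ in_lat tau' (2 * (alpha * y)) by rewrite mulrCA; exact: lat'.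
  have n2' : ~ in_lat tau' (2 * (alpha * y) + tau' / 2) by rewrite mulrCA; exact: lat'2.
  have D2 := wd_dup t0' n1' n2'.
  rewrite (wx_base_change ny) ws_base_change iy in D2.
  rewrite mulrCA.
  have ss : sg ^+ 2 = 1 by case: sg1 => ->; rewrite ?expr1n ?sqrrN ?expr1n.
  have K0 : 2 * (sg * wd tau y) * (wx tau y ^+ 2 - ws tau) != 0.
    have sg0 : sg != 0 by case: sg1 => ->; rewrite ?oppr_eq0 oner_neq0.
    by apply: mulf_neq0 => //; apply: mulf_neq0 => //; apply: mulf_neq0.
  apply: (mulIf K0); rewrite D2 exprMn ss mul1r -D1.
  have -> : sg * wd tau (2 * y) * (2 * (sg * wd tau y) * (wx tau y ^+ 2 - ws tau)) =
     sg ^+ 2 * (wd tau (2 * y) * (2 * wd tau y * (wx tau y ^+ 2 - ws tau))) by ring.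
  by rewrite ss mul1r.
move=> z; have [k hk] : exists k : nat, nrm z / r < 2 ^+ k.
  exists (Num.bound (nrm z / r)); apply: lt_trans (archi_boundP _) _.
    by apply: divr_ge0; [exact: nrm_ge0|exact: ltW].
  by rewrite -natrX ltr_nat ltn_expl.
by apply: (step k); rewrite -ltr_pdivrMr.
Qed.

End BaseChange.

(** * Complex multiplication *)

(* The coordinates of a point along the chain of 2-isogenies
   C/<1,2^i tau> -> C/<1,2^(i+1) tau>, z |-> 2z, closing up after n steps. *)
Record orbit (F : fieldType) (n : nat) (s mu : nat -> F) (x d : nat -> F) (eps : F) : Prop := Orbit {
  orbit_x_neq0 : forall i, (i <= n)%N -> x i != 0;
  orbit_14_neq0 : forall i, (i < n)%N -> 1 + 4 * x i != 0;
  orbit_x : forall i, (i < n)%N ->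
    x i.+1 * (mu i ^+ 2 * (1 + 4 * x i)) = x i * (x i + 4 * s i);
  orbit_d_sqr : forall i, (i <= n)%N ->
    d i ^+ 2 * x i = (1 + 4 * x i) * (x i + 4 * s i);
  orbit_d : forall i, (i < n)%N ->
    2 * mu i * d i * d i.+1 = d i ^+ 2 + (1 - 16 * s i);
  orbit_d_neq0 : forall i, (i < n)%N -> d i != 0;
  orbit_x_cycle : x n = x 0;
  orbit_d_cycle : d n = eps * d 0
}.

(** The part of the data that does not depend on a point. [chain_prod] compares the leading
    coefficient of d at 0 before and after the n isogenies, with the sign of the base change squared
    away. *)
Record chain (F : fieldType) (n : nat) (s mu : nat -> F) (alpha : F) : Prop := Chain {
  chain_s_neq0 : forall i, s i != 0;
  chain_mu_neq0 : forall i, mu i != 0;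
  chain_mu : forall i, mu i ^+ 2 - mu i + 4 * s i = 0;
  chain_s : forall i, s i.+1 * mu i ^+ 4 = s i ^+ 2;
  chain_cycle : s n = s 0;
  chain_prod : (alpha * \prod_(i < n) mu i) ^+ 2 = 1
}.

Section CM.
Variable R : realType.
Local Notation C := R[i].
Local Notation nrm := (@Normc.normc R).
Local Notation im := (@complex.Im R).

Lemma im_natM (k : nat) (z : C) : im (k%:R * z) = k%:R * im z.
Proof.
by rewrite -(rmorph_nat (real_complex R)); case: z => a b /=; rewrite mul0r addr0.
Qed.

Lemma im_expM (k : nat) (z : C) : im (2 ^+ k * z) = 2 ^+ k * im z.
Proof. by rewrite -natrX im_natM natrX. Qed.

Section Chain.
Variable tau : C.
Hypothesis t0 : 0 < im tau.
Let ti i := 2 ^+ i * tau.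
Let ti0 i : 0 < im (ti i).
Proof. by rewrite im_expM mulr_gt0 // exprn_gt0. Qed.
Let tiS i : ti i.+1 = 2 * ti i. Proof. by rewrite /ti exprS mulrA. Qed.
Let two0 : (2 : C) != 0. Proof. by rewrite pnatr_eq0. Qed.

(** Leading terms of [ell_d_isog] at 0: 2 mu (l/z) (l'/(2z)) against l^2/z^2. *)
Lemma wd_lim_dbl i l l' : tends (fun z => z * wd (ti i) z) 0 l ->
  tends (fun z => z * wd (ti i.+1) z) 0 l' -> l != 0 -> l' = l / wmu (ti i).
Proof.
move=> hl hl' l0; have hp := qh_nome (ti0 i).
have mu0 := ell_mu_neq0 hp; rewrite -/(wmu _) in mu0.
have it0 : im (ti i) != 0 by rewrite gt_eqF.
have [r r0 hr] := lat_discrete it0.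
have h2 := tends_scale two0 hl'.
have h1 := tendsD (tendsM hl (@tends_cst R (wmu (ti i))^-1 0))
  (tendsM (tendsM (@tends_cst R ((1 - 16 * ws (ti i)) / wmu (ti i)) 0) (tendsX 2 (@tends_id R 0)))
     (tendsV l0 hl)).
rewrite expr0n mulr0 mul0r addr0 in h1; apply: tends_unique h2 _.
have r20 : 0 < r / 2 by rewrite divr_gt0.
apply: (eq_tends r20) h1 => z z0; rewrite subr0 => zr.
have z20 : 2 * z != 0 by rewrite mulf_neq0.
have n2 : ~ in_lat (ti i) (2 * z).
  by apply: hr => //; rewrite nrmM nrm_nat; lra.
have [h1 h2' h3 h4] := dbl_not_lat (ti0 i) n2.
have := ell_d_isog hp (ce_neq0 z) h1 h2' h3 h4.
have d0 : wd (ti i) z != 0 by rewrite /wd (ell_d_eq0 hp h1 h4) negb_or h2' h3.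
rewrite -qh_dbl -tiS -ce_nat -/(wd _ z) -/(wd _ (2%:R * z)) -/(wmu _) -/(ws _) => e.
have -> : wd (ti i.+1) (2 * z) = (wd (ti i) z ^+ 2 + (1 - 16 * ws (ti i))) / (2 * wmu (ti i) * wd (ti i) z).
  by rewrite -e; field; rewrite mu0 d0.
by field; rewrite z0 mu0 d0.
Qed.

Lemma chain_props i : [/\ ws (ti i) != 0, wmu (ti i) != 0,
  wmu (ti i) ^+ 2 - wmu (ti i) + 4 * ws (ti i) = 0 &
  ws (ti i.+1) * wmu (ti i) ^+ 4 = ws (ti i) ^+ 2].
Proof.
have hp := qh_nome (ti0 i); split.
- exact: ell_s_neq0.
- exact: ell_mu_neq0.
- exact: ell_mu_eq.
- by rewrite tiS /ws qh_dbl; apply: ell_s_sqr.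
Qed.

Lemma orbit_step i (y : C) : ~ in_lat (ti i) y -> ~ in_lat (ti i) (y + ti i / 2) ->
  ~ in_lat (ti i.+1) (2 * y) -> ~ in_lat (ti i.+1) (2 * y + ti i.+1 / 2) ->
  [/\ 1 + 4 * wx (ti i) y != 0, wd (ti i) y != 0,
   wx (ti i.+1) (2 * y) * (wmu (ti i) ^+ 2 * (1 + 4 * wx (ti i) y)) =
     wx (ti i) y * (wx (ti i) y + 4 * ws (ti i)) &
   2 * wmu (ti i) * wd (ti i) y * wd (ti i.+1) (2 * y) = wd (ti i) y ^+ 2 + (1 - 16 * ws (ti i))].
Proof.
move=> n1 n4 m1 m4; have hp := qh_nome (ti0 i).
have sub l : in_lat (ti i) l -> in_lat (ti i.+1) (2 * l).
  move=> [a [b ->]]; exists (2 * a), b; rewrite tiS rmorphM /=; ring.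
have n2 : ~ in_lat (ti i) (y + 2^-1).
  move=> /sub h; apply: m1; have := in_latB h (in_lat1 _).
  by congr (in_lat _ _); rewrite mulrDr divff //; ring.
have n3 : ~ in_lat (ti i) (y + (2^-1 + ti i / 2)).
  move=> /sub h; apply: m4; have := in_latB h (in_lat1 _).
  by congr (in_lat _ _); rewrite tiS; field.
have h1 := theta1_n0 (ti0 i) n1; have h2 := theta2_n0 (ti0 i) n2.
have h3 := theta3_n0 (ti0 i) n3; have h4 := theta4_n0 (ti0 i) n4.
rewrite tiS /wx /wd /wmu /ws qh_dbl -[2 * y]/(2%:R * y) ce_nat; split.
- by rewrite (ell_x14_eq0 hp _ h1) ?ce_neq0.
- by rewrite (ell_d_eq0 hp h1 h4) negb_or h2.
- exact: ell_x_isog (ce_neq0 y) h1 h2.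
- exact: ell_d_isog (ce_neq0 y) h1 h2 h3 h4.
Qed.

End Chain.
End CM.

Lemma count_le1 (T : eqType) (s : seq T) (P : pred T) : uniq s ->
  (forall x y, x \in s -> y \in s -> P x -> P y -> x = y) -> (count P s <= 1)%N.
Proof.
move=> us h; rewrite -size_filter.
have ufs : uniq (seq.filter P s) by exact: filter_uniq.
case e : (seq.filter P s) ufs => [//|x [//|y l]] /= /andP[].
have hx : x \in seq.filter P s by rewrite e inE eqxx.
have hy : y \in seq.filter P s by rewrite e !inE eqxx orbT.
move: hx hy; rewrite !mem_filter => /andP[px xs] /andP[py ys].
by rewrite (h x y) // inE eqxx.
Qed.

Lemma count_orb_le (T : Type) (s : seq T) (P Q S : pred T) :
  (forall x, P x -> Q x || S x) -> (count P s <= count Q s + count S s)%N.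
Proof.
move=> h; elim: s => //= x s IH; have := h x; case: (P x) (Q x) (S x) => [] [] [] //= hx;
  try (by have := hx isT); lia.
Qed.

Section CMData.
Variable R : realType.
Local Notation C := R[i].
Local Notation nrm := (@Normc.normc R).
Local Notation im := (@complex.Im R).

Variables (n : nat) (e : int).
Let q : int := 2 ^+ n.
Let t : int := 4 * e + 1 + q.
Hypothesis ht : t ^+ 2 < 4 * q.

Let qR : R := q%:~R.
Let eR : R := e%:~R.
Let tR : R := t%:~R.
Let q0 : (0 < q). Proof. by rewrite exprn_gt0. Qed.
Let qR0 : 0 < qR. Proof. by rewrite ltr0z. Qed.
Let tRE : tR = 4 * eR + 1 + qR. Proof. by rewrite /tR /t !(rmorphD, rmorphM). Qed.
Let disc : 0 < 4 * qR - tR ^+ 2.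
Proof.
have : (t ^+ 2)%:~R < (4 * q)%:~R :> R by rewrite ltr_int.
by rewrite rmorphXn rmorphM /= subr_gt0.
Qed.
Let rt := Num.sqrt (4 * qR - tR ^+ 2).
Let rt2 : rt ^+ 2 = 4 * qR - tR ^+ 2. Proof. by rewrite sqr_sqrtr // ltW. Qed.
Let rt0 : 0 < rt. Proof. by rewrite sqrtr_gt0. Qed.

(** The root in the upper half plane of 2q tau^2 + (4e + 1 - q) tau - 2e, of discriminant t^2 - 4q.
    This equation gives alpha = (4e + 1) + 2 (q tau) and alpha tau = 2e + q tau, a base change that
    is the identity modulo 2. The form t = 4e + 1 + q expresses t = 1 mod 4 when 4 divides q. *)
Definition cm_tau : C := Complex ((qR - 4 * eR - 1) / (4 * qR)) (rt / (4 * qR)).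
Local Notation tau := cm_tau.

Let t0 : 0 < im tau. Proof. by rewrite /= divr_gt0 // mulr_gt0. Qed.
Let it0 : im tau != 0. Proof. by rewrite gt_eqF. Qed.

Let qC : C := q%:~R.
Let eC : C := e%:~R.
Let tC : C := t%:~R.
Let qCE : qC = real_complex R qR. Proof. by rewrite rmorph_int. Qed.
Let eCE : eC = real_complex R eR. Proof. by rewrite rmorph_int. Qed.
Let tCE : tC = 4 * eC + 1 + qC. Proof. by rewrite /tC /t !(rmorphD, rmorphM). Qed.
Let qC2 : qC = 2 ^+ n. Proof. by rewrite /qC /q rmorphXn. Qed.

Lemma cm_tau_eq : 2 * qC * tau ^+ 2 + (4 * eC + 1 - qC) * tau - 2 * eC = 0.
Proof.
have two : (2 : C) = real_complex R 2 by rewrite rmorph_nat.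
have four : (4 : C) = real_complex R 4 by rewrite rmorph_nat.
have h : rt ^+ 2 = 4 * qR - (4 * eR + 1 + qR) ^+ 2 by rewrite rt2 tRE.
have qn : qR != 0 by rewrite gt_eqF.
rewrite two four qCE eCE expr2.
apply/eqP; rewrite eq_complex /=; apply/andP; split; apply/eqP.
  have -> : rt / (4 * qR) * (rt / (4 * qR)) = rt ^+ 2 / (16 * qR ^+ 2) by field.
  by rewrite h; field.
by field.
Qed.

Definition cm_alpha : C := 2 * qC * tau + 4 * eC + 1.
Local Notation alpha := cm_alpha.

Lemma cm_alpha_tau : alpha * tau = qC * tau + 2 * eC.
Proof. by apply/eqP; rewrite -subr_eq0 -cm_tau_eq; apply/eqP; rewrite /cm_alpha; ring. Qed.

Lemma cm_alpha_eq : alpha ^+ 2 - tC * alpha + qC = 0.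
Proof.
have -> : alpha ^+ 2 = 2 * qC * (alpha * tau) + (4 * eC + 1) * alpha.
  by rewrite /cm_alpha; ring.
by rewrite cm_alpha_tau tCE /cm_alpha; ring.
Qed.

Let ab := tC - alpha.
Let abE : ab = qC - 2 * qC * tau. Proof. by rewrite /ab tCE /cm_alpha; ring. Qed.
Let alpha_ab : alpha * ab = qC.
Proof.
have := cm_alpha_eq; rewrite /ab => h.
by apply/eqP; rewrite -subr_eq0; apply/eqP; rewrite -[RHS]oppr0 -h; ring.
Qed.
Let ab_tau : ab * tau = (4 * eC + 1) * tau - 2 * eC.
Proof.
apply/eqP; rewrite -subr_eq0; apply/eqP; rewrite -[RHS]oppr0 -cm_tau_eq abE; ring.
Qed.
Let qCn0 : qC != 0. Proof. by rewrite qC2 expf_neq0 // pnatr_eq0. Qed.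
Let alpha0 : alpha != 0.
Proof. by apply: contraNN qCn0 => /eqP h; rewrite -alpha_ab h mul0r. Qed.

Let ti i : C := 2 ^+ i * tau.
Let ti0 i : 0 < im (ti i).
Proof. by rewrite im_expM mulr_gt0 // exprn_gt0. Qed.
Let ti_0 : ti 0 = tau. Proof. by rewrite /ti expr0 mul1r. Qed.
Let tiS i : ti i.+1 = 2 * ti i. Proof. by rewrite /ti exprS mulrA. Qed.
Let tiq : ti n = qC * tau. Proof. by rewrite qC2. Qed.

Let ealpha : alpha = (2 * (2 * e) + 1)%:~R + (2 * 1)%:~R * ti n.
Proof. by rewrite tiq !(rmorphD, rmorphM) /= -/eC /cm_alpha; ring. Qed.
Let etau : alpha * tau = (2 * e)%:~R + (2 * 0 + 1)%:~R * ti n.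
Proof. by rewrite cm_alpha_tau tiq !(rmorphD, rmorphM) /= -/eC; ring. Qed.
Let det1 : (2 * 0 + 1) * (2 * (2 * e) + 1) - (2 * e) * (2 * 1) = 1 :> int.
Proof. by ring. Qed.

Let lat_a z := @lat_alpha R tau (ti n) alpha 0 e 1 (2 * e) alpha0 ealpha etau det1 z.

Lemma cm_chain : chain n (fun i => ws (ti i)) (fun i => wmu (ti i)) alpha.
Proof.
have h i := chain_props t0 i; split=> [i|i|i|i||]; try by case: (h i).
  by rewrite ti_0; exact: (ws_base_change t0 (ti0 n) alpha0 ealpha etau det1).
have [sg [hsg _ hl]] := wd_base_change t0 (ti0 n) alpha0 ealpha etau det1.
have [l0 l00 h0] := wd_lim t0; have [ln ln0 hn] := wd_lim (ti0 n).
have prod k : tends (fun z => z * wd (ti k) z) 0 (l0 / \prod_(i < k) wmu (ti i)).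
  elim: k => [|k IH]; first by rewrite big_ord0 divr1 ti_0.
  have [l' l'0 hl'] := wd_lim (ti0 k.+1).
  have pn0 : \prod_(i < k) wmu (ti i) != 0.
    by apply/prodf_neq0 => i _; case: (h i).
  have lk0 : l0 / \prod_(i < k) wmu (ti i) != 0 by rewrite mulf_neq0 ?invr_eq0.
  have := wd_lim_dbl t0 IH hl' lk0 => e1.
  by rewrite big_ord_recr /= invfM mulrA -e1.
have := hl _ _ h0 (prod n) => e1.
have pn0 : \prod_(i < n) wmu (ti i) != 0.
  by apply/prodf_neq0 => i _; case: (h i).
have e2 : (alpha * \prod_(i < n) wmu (ti i)) * sg = 1.
  apply: (mulIf l00); rewrite mul1r -[RHS](divfK pn0) e1; ring.
have ss : sg ^+ 2 = 1 by case: hsg => ->; rewrite ?sqrrN expr1n.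
have : (alpha * \prod_(i < n) wmu (ti i) * sg) ^+ 2 = 1 by rewrite e2 expr1n.
by rewrite exprMn ss mulr1.
Qed.

Let good z := ~ in_lat tau z /\ ~ in_lat tau (z + tau / 2).
Let sub i l : in_lat (ti i) l -> in_lat (ti i.+1) (2 * l).
Proof. by move=> [a [b ->]]; exists (2 * a), b; rewrite tiS rmorphM /=; ring. Qed.
Let subn_ i k l : in_lat (ti i) l -> in_lat (ti (k + i)) (2 ^+ k * l).
Proof.
move=> h; elim: k => [|k IH]; first by rewrite expr0 mul1r.
by rewrite addSn exprS -mulrA; apply: sub.
Qed.

(** Modulo the lattice [ab] acts on [z] as the sign [eps], and a half period [c] equals its
    opposite. *)
Lemma in_lat_sign (eps z c : C) : eps = 1 \/ eps = -1 -> in_lat tau (2 * c) ->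
  in_lat tau (ab * z - eps * z) -> in_lat tau (ab * z + c) -> in_lat tau (z + c).
Proof.
move=> he hc h1 h2; case: he => he; rewrite he in h1.
  have := in_latB h2 h1; congr (in_lat _ _); ring.
have := in_latD (in_latN (in_latB h2 h1)) hc; congr (in_lat _ _); ring.
Qed.

(** A bad value at step i persists up to step n, where 2^n z = alpha (ab z). Removing alpha by base
    change brings it back to the initial torus, and there ab z is z up to sign. *)
Lemma orbit_good (eps z : C) i : eps = 1 \/ eps = -1 -> (i <= n)%N -> good z ->
  in_lat tau (ab * z - eps * z) ->
  ~ in_lat (ti i) (2 ^+ i * z) /\ ~ in_lat (ti i) (2 ^+ i * z + ti i / 2).
Proof.
move=> he lin [g1 g2] hz.
have e2 : 2 ^+ n * z = alpha * (ab * z) by rewrite mulrA alpha_ab qC2.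
have e3 : alpha * (ab * z + tau / 2) = eC + (2 ^+ n * z + ti n / 2).
  by rewrite mulrDr -e2 mulrA cm_alpha_tau tiq; field.
split=> h.
  case: g1; rewrite -[z]addr0; apply: (in_lat_sign he) hz _; first by rewrite mulr0; exact: in_lat0.
  rewrite addr0; apply/lat_a; rewrite -e2.
  by have := subn_ (n - i) h; rewrite mulrA -exprD subnK.
apply: g2; apply: (in_lat_sign he) hz _.
  by rewrite mulrC divfK ?pnatr_eq0 //; exact: in_lat_tau.
apply/lat_a; rewrite e3; apply: in_latD; first exact: in_lat_int.
have := subn_ (n - i) h; rewrite subnK // mulrDr mulrA -exprD subnK //.
by rewrite /ti mulrA [2 ^+ (n - i) * _]mulrA -exprD subnK.
Qed.

(** The orbit closes up because 2^n z = alpha (ab z): base change removes alpha, and ab z = eps z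
    modulo the lattice. The function x is even; d is odd and may be flipped by the base change,
    whence the final sign [sg * eps]. *)
Lemma cm_orbit : exists2 sg : C, sg = 1 \/ sg = -1 & forall eps z, eps = 1 \/ eps = -1 ->
  good z -> in_lat tau (ab * z - eps * z) ->
  orbit n (fun i => ws (ti i)) (fun i => wmu (ti i))
    (fun i => wx (ti i) (2 ^+ i * z)) (fun i => wd (ti i) (2 ^+ i * z)) (sg * eps).
Proof.
have [sg [hsg hd _]] := wd_base_change t0 (ti0 n) alpha0 ealpha etau det1.
exists sg => // eps z he gz hz.
have gi i : (i <= n)%N -> _ /\ _ := fun lin => orbit_good he lin gz hz.
have E i : 2 ^+ i.+1 * z = 2 * (2 ^+ i * z) by rewrite exprS mulrA.
have step i : (i < n)%N -> [/\ 1 + 4 * wx (ti i) (2 ^+ i * z) != 0, wd (ti i) (2 ^+ i * z) != 0,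
   wx (ti i.+1) (2 ^+ i.+1 * z) * (wmu (ti i) ^+ 2 * (1 + 4 * wx (ti i) (2 ^+ i * z))) =
     wx (ti i) (2 ^+ i * z) * (wx (ti i) (2 ^+ i * z) + 4 * ws (ti i)) &
   2 * wmu (ti i) * wd (ti i) (2 ^+ i * z) * wd (ti i.+1) (2 ^+ i.+1 * z) =
     wd (ti i) (2 ^+ i * z) ^+ 2 + (1 - 16 * ws (ti i))].
  move=> lin; have [a1 a2] := gi i (ltnW lin); have [b1 b2] := gi i.+1 lin.
  by rewrite E in b1 b2 *; apply: orbit_step.
have e2 : 2 ^+ n * z = alpha * (ab * z) by rewrite mulrA alpha_ab qC2.
have [g1 g2] := gz.
have na : ~ in_lat tau (ab * z).
  move=> h; apply: g1; rewrite -[z]addr0; apply: (in_lat_sign he) hz _; rewrite ?addr0 //.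
  by rewrite mulr0; exact: in_lat0.
have na2 : ~ in_lat tau (ab * z + tau / 2).
  move=> h; apply: g2; apply: (in_lat_sign he) hz _ => //.
  by rewrite mulrC divfK ?pnatr_eq0 //; exact: in_lat_tau.
have red (f : C -> C) : lat_periodic tau f -> f (ab * z) = f (eps * z).
  by move=> hf; rewrite -(hf _ (eps * z) hz) subrK.
split.
- move=> i lin; have [a1 a2] := gi i lin.
  by apply/eqP => /(wx_eq0 (ti0 i) a1).
- by move=> i lin; have [h _ _ _] := step i lin; exact: h.
- by move=> i lin; have [_ _ h _] := step i lin; exact: h.
- by move=> i lin; have [a1 a2] := gi i lin; apply: wd_sqr.
- by move=> i lin; have [_ _ _ h] := step i lin; exact: h.
- by move=> i lin; have [_ h _ _] := step i lin; exact: h.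
- rewrite e2 (wx_base_change t0 (ti0 n) alpha0 ealpha etau det1 na) expr0 mul1r ti_0.
  rewrite (red _ (wx_periodic t0)); case: he => ->; rewrite ?mul1r // mulN1r wxN //.
- rewrite e2 (hd _ na na2) expr0 mul1r ti_0 (red _ (wd_periodic t0)) -mulrA; congr (_ * _).
  by case: he => ->; rewrite ?mul1r // !mulN1r wdN.
Qed.

(* The points killed by [ab - eps]. *)
Let pt (eps : int) (i j : nat) : C := (i%:R * (1 - 2 * tau) + j%:R * tau) / (ab - eps%:~R).

Let absub_neq0 (eps : int) : ab - eps%:~R != 0.
Proof.
apply/eqP => h; have : real_complex R (qR - eps%:~R) + real_complex R (- 2 * qR) * tau = 0.
  rewrite -h abE rmorphB rmorphM rmorphN /= rmorph_nat !rmorph_int -/qC; ring.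
move=> /(lat_indep it0) [_ /eqP]; rewrite mulf_eq0 oppr_eq0 pnatr_eq0 /=.
by rewrite gt_eqF.
Qed.

Let pt_lat (eps : int) i j : in_lat tau (ab * pt eps i j - eps%:~R * pt eps i j).
Proof.
rewrite -mulrBl /pt mulrC divfK ?absub_neq0 //.
exists (Posz i), (Posz j - 2 * Posz i); rewrite rmorphB rmorphM /=; ring.
Qed.

(** In the basis 1 - 2 tau, tau the lattice (ab - eps) <1, tau> is generated by h (1 - 2 tau) and (q
    - eps) (1 - 2 tau) - 2 eps tau. It has index 2h = q + 1 - eps t, and the pairs with i < h and j
    < 2 represent the classes. *)
Let pt_inj (eps : int) (h : nat) i j i' j' : (eps = 1 /\ h%:Z = - 2 * e) \/ (eps = -1 /\ h%:Z = q + 1 + 2 * e) ->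
  (i < h)%N -> (i' < h)%N -> (j < 2)%N -> (j' < 2)%N ->
  in_lat tau (pt eps i j - pt eps i' j') -> i = i' /\ j = j'.
Proof.
move=> he ih ih' j2 j2' [m [k hmk]].
have e1 : (i%:R - i'%:R) * (1 - 2 * tau) + (j%:R - j'%:R) * tau = (ab - eps%:~R) * (m%:~R + k%:~R * tau) :> C.
  by rewrite -hmk /pt; field; exact: absub_neq0.
have e2 : (ab - eps%:~R) * (m%:~R + k%:~R * tau) =
   m%:~R * (qC - eps%:~R) - 2 * eC * k%:~R + ((4 * eC + 1 - eps%:~R) * k%:~R - 2 * qC * m%:~R) * tau.
  have -> : (ab - eps%:~R) * (m%:~R + k%:~R * tau) = m%:~R * ab + k%:~R * (ab * tau) - eps%:~R * (m%:~R + k%:~R * tau) by ring.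
  by rewrite ab_tau abE; ring.
pose u : int := Posz i - Posz i' - (m * (q - eps) - 2 * e * k).
pose v : int := (Posz j - Posz j') - 2 * (Posz i - Posz i') - ((4 * e + 1 - eps) * k - 2 * q * m).
have : real_complex R u%:~R + real_complex R v%:~R * tau = 0.
  rewrite !rmorph_int /u /v !(rmorphB, rmorphD, rmorphM) /= -/qC -/eC.
  apply/eqP; rewrite -[X in _ == X](subrr ((ab - eps%:~R) * (m%:~R + k%:~R * tau))).
  by rewrite -{1}e1 e2; apply/eqP; ring.
move=> /(lat_indep it0) [/eqP hu /eqP hv]; move: hu hv; rewrite !intr_eq0 => /eqP hu /eqP hv.
have {}hu : Posz i - Posz i' = m * (q - eps) - 2 * e * k by apply/eqP; rewrite -subr_eq0 -/u hu.
have {}hv : Posz j - Posz j' = 2 * (Posz i - Posz i') + ((4 * e + 1 - eps) * k - 2 * q * m).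
  by apply/eqP; rewrite -subr_eq0 opprD addrA -/v hv.
rewrite hu in hv.
clear - he ih ih' j2 j2' hu hv.
case: he => -[he hh]; rewrite he in hu hv.
  have m0 : m = 0 by lia.
  rewrite m0 in hu hv.
  have k0 : k = 0.
    have : Posz i - Posz i' = h%:Z * k by rewrite hu hh; ring.
    move: ih ih'; clear; nia.
  rewrite k0 in hu hv; lia.
have mk : k = - m by lia.
rewrite mk in hu hv.
have m0 : m = 0.
  have : Posz i - Posz i' = h%:Z * m by rewrite hu hh; ring.
  move: ih ih'; clear; nia.
rewrite m0 in hu; lia.
Qed.

(** Of the 2h points at most two are discarded, those where x has its pole or its zero. As x takes
    the same value only at z and -z, its fibres have at most two elements. *)
Lemma cm_points (eps : int) (h : nat) :
  (eps = 1 /\ h%:Z = - 2 * e) \/ (eps = -1 /\ h%:Z = q + 1 + 2 * e) ->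
  exists zs : seq C, [/\ uniq zs, (2 * h - 2 <= size zs)%N,
    forall z, z \in zs -> good z /\ in_lat tau (ab * z - eps%:~R * z) &
    forall z, z \in zs -> (count (fun z' => wx tau z' == wx tau z) zs <= 2)%N].
Proof.
move=> he.
pose l := [seq pt eps i j | i <- iota 0 h, j <- iota 0 2].
have inl z : z \in l -> exists i j, [/\ (i < h)%N, (j < 2)%N & z = pt eps i j].
  by move/allpairsP => [[i j] [ih jh ->]]; exists i, j; move: ih jh; rewrite !mem_iota !add0n => /andP[_ ih] /andP[_ jh]; split.
have sep z z' : z \in l -> z' \in l -> in_lat tau (z - z') -> z = z'.
  move=> /inl [i [j [ih j2 ->]]] /inl [i' [j' [ih' j2' ->]]] hl.
  by have [-> ->] := pt_inj he ih ih' j2 j2' hl.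
have ul : uniq l.
  apply: allpairs_uniq; rewrite ?iota_uniq // => -[i j] [i' j'].
  move=> /allpairsP [[a b] [ah bh [-> ->]]] /allpairsP [[a' b'] [ah' bh' [-> ->]]] /= heq.
  move: ah bh ah' bh'; rewrite !mem_iota !add0n => /andP[_ ah] /andP[_ bh] /andP[_ ah'] /andP[_ bh'].
  have [|/= -> -> //] := pt_inj he ah ah' bh bh'; rewrite heq subrr; exact: in_lat0.
have sl : size l = (2 * h)%N by rewrite size_allpairs !size_iota mulnC.
pose P z := `[< good z >].
exists (seq.filter P l); split.
- exact: filter_uniq.
- rewrite size_filter -sl -(count_predC P l).
  have bad1 : (count (fun z => `[< in_lat tau z >]) l <= 1)%N.
    apply: count_le1 => // z z' zl zl' /asboolP hz /asboolP hz'.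
    by apply: sep => //; exact: in_latB.
  have bad2 : (count (fun z => `[< in_lat tau (z + tau / 2)%R >]) l <= 1)%N.
    apply: count_le1 => // z z' zl zl' /asboolP hz /asboolP hz'.
    by apply: sep => //; have := in_latB hz hz'; congr (in_lat _ _); ring.
  have : (count (predC P) l <= count (fun z => `[< in_lat tau z >]) l +
      count (fun z => `[< in_lat tau (z + tau / 2)%R >]) l)%N.
    apply: count_orb_le => z /=; rewrite /P => /asboolP hn.
    apply/orP; have [h1|h1] := pselect (in_lat tau z); first by left; apply/asboolP.
    right; apply/asboolP; have [//|h2] := pselect (in_lat tau (z + tau / 2)).
    by exfalso; apply: hn.
  lia.
- move=> z; rewrite mem_filter => /andP[/asboolP gz /inl [i [j [_ _ ez]]]]; split=> //.
  by rewrite ez; exact: pt_lat.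
- move=> z; rewrite mem_filter => /andP[/asboolP [g1 g2] zl].
  apply: (@leq_trans (count (fun z' => `[< in_lat tau (z' - z)%R >]) (seq.filter P l) +
      count (fun z' => `[< in_lat tau (z' + z)%R >]) (seq.filter P l))); last first.
    have uf : uniq (seq.filter P l) by exact: filter_uniq.
    apply: (@leq_add _ _ 1 1); apply: count_le1 => // y y'; rewrite !mem_filter;
      move=> /andP[_ yl] /andP[_ yl'] /asboolP hy /asboolP hy'; apply: sep => //;
      have := in_latB hy hy'; congr (in_lat _ _); ring.
  have := @count_orb_le C (seq.filter P l) (fun z' => P z' && (wx tau z' == wx tau z))
     (fun z' => `[< in_lat tau (z' - z)%R >]) (fun z' => `[< in_lat tau (z' + z)%R >]).
  have -> : count (fun z' => P z' && (wx tau z' == wx tau z)) (seq.filter P l) =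
      count (fun z' => wx tau z' == wx tau z) (seq.filter P l).
    apply: eq_in_count => y; rewrite mem_filter => /andP[-> _] //.
  apply=> y /andP[/asboolP [y1 y2] /eqP ey].
  apply/orP; have [h1|h1] := wx_inj t0 y1 g1 ey; [right|left]; exact/asboolP.
Qed.

End CMData.

(** * Reduction at a place above 2 *)

Local Open Scope classical_set_scope.
Local Open Scope ring_scope.

Record subring (F : fieldType) (V : set F) : Prop := Subring {
  subring1 : V 1;
  subringB : forall x y, V x -> V y -> V (x - y);
  subringM : forall x y, V x -> V y -> V (x * y)
}.

Section Subring.
Variables (F : fieldType) (V : set F).
Hypothesis hV : subring V.

Lemma subring0 : V 0.
Proof. by rewrite -(subrr 1); apply: subringB => //; exact: subring1. Qed.

Lemma subringN x : V x -> V (- x).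
Proof. by move=> h; rewrite -[- x]add0r; apply: subringB => //; exact: subring0. Qed.

Lemma subringD x y : V x -> V y -> V (x + y).
Proof. by move=> h h'; rewrite -[y]opprK; apply: subringB => //; exact: subringN. Qed.

Lemma subringX x n : V x -> V (x ^+ n).
Proof.
move=> h; elim: n => [|n IH]; first by rewrite expr0; exact: subring1.
by rewrite exprS; apply: subringM.
Qed.

Lemma subring_nat n : V n%:R.
Proof.
elim: n => [|n IH]; first exact: subring0.
by rewrite -addn1 natrD; apply: subringD => //; exact: subring1.
Qed.

Lemma subring_int (m : int) : V m%:~R.
Proof.
by case: m => n; [exact: subring_nat | rewrite NegzE rmorphN; apply: subringN; exact: subring_nat].
Qed.

Lemma subring_sum (I : Type) (r : seq I) (P : pred I) (f : I -> F) :
  (forall i, P i -> V (f i)) -> V (\sum_(i <- r | P i) f i).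
Proof. by move=> h; elim/big_ind: _ => //; [exact: subring0 | exact: subringD]. Qed.

Lemma subring_prod (I : Type) (r : seq I) (P : pred I) (f : I -> F) :
  (forall i, P i -> V (f i)) -> V (\prod_(i <- r | P i) f i).
Proof. by move=> h; elim/big_ind: _ => //; [exact: subring1 | apply: subringM]. Qed.

Lemma subring_ext x : subring [set y | exists2 p : {poly F}, (forall i, V p`_i) & y = p.[x]].
Proof.
split=> [|y z [p hp ->] [r hr ->]|y z [p hp ->] [r hr ->]].
- exists 1%:P; rewrite ?hornerC // => i; rewrite coefC.
  by case: ifP => _; [exact: subring1 | exact: subring0].
- exists (p - r); rewrite ?hornerD ?hornerN // => i; rewrite coefB; exact: subringB.
- exists (p * r); rewrite ?hornerM // => i; rewrite coefM.
  by apply: subring_sum => j _; apply: subringM.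
Qed.

End Subring.

Record valuation_ring (F : fieldType) (V : set F) : Prop := ValuationRing {
  valuation_subring : subring V;
  valuation_total : forall x, V x \/ V x^-1
}.

Section Dominate.
Variables (F : fieldType) (A0 : set F) (a : F).
Hypotheses (hA0 : subring A0) (a0 : a != 0) (Aa : A0 a) (na : ~ A0 a^-1).

Let good (V : set F) := [/\ subring V, A0 `<=` V & ~ V a^-1].

Let maximal : exists2 V, good V & forall W, good W -> V `<=` W -> W `<=` V.
Proof.
have [|V [hV mV]] := @Zorn_bigcup F (fun V => V = classical_sets.set0 \/ good V).
  move=> S hS tot; have [[W [SW gW]]|no] := pselect (exists W, S W /\ good W); last first.
    left; apply/seteqP; split=> [x [W SW Wx]|x []] //=.
    case: (hS _ SW) => [e|gW]; first by rewrite e in Wx.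
    by case: no; exists W.
  right.
  have gS X x : S X -> X x -> good X.
    by move=> SX Xx; case: (hS _ SX) => // e; rewrite e in Xx.
  have pair x y : (\bigcup_(X in S) X) x -> (\bigcup_(X in S) X) y ->
      exists X, [/\ S X, good X, X x & X y].
    move=> [X SX Xx] [Y SY Yy]; case: (tot _ _ SX SY) => h.
      by exists Y; split=> //; [exact: gS Yy | exact: h].
    by exists X; split=> //; [exact: gS Xx | exact: h].
  split; first split.
  - by exists W => //; case: gW => /subring1.
  - by move=> x y hx hy; have [X [SX [gX _ _] Xx Xy]] := pair _ _ hx hy; exists X => //; exact: subringB.
  - by move=> x y hx hy; have [X [SX [gX _ _] Xx Xy]] := pair _ _ hx hy; exists X => //; exact: subringM.
  - by move=> x Ax; exists W => //; case: gW => _ + _; apply.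
  - by move=> [X SX Xa]; case: (gS _ _ SX Xa).
have gA0 : good A0 by split.
have mV' W : good W -> V `<=` W -> W `<=` V.
  move=> gW VW x Wx; apply: contrapT => nVx; apply: (mV W); last by right.
  by split=> // h; apply: nVx; exact: h.
case: hV => [e|gV]; last by exists V.
exfalso; have := mV' _ gA0; rewrite e => h; have := h _ 1 (subring1 hA0); apply.
by move=> x [].
Qed.

(* Chevalley: a maximal element among the subrings omitting [a^-1]. *)
Lemma dominating_valuation :
  exists V, [/\ valuation_ring V, A0 `<=` V & ~ V a^-1].
Proof.
have [V [hV AV nV] mV] := maximal.
have Va : V a by exact: AV.
(* Adjoining the inverses of all 1 - a c with c in [V] still does not produce a^-1, so by maximality
   these inverses are already in [V]. *)
have unit d : V d -> V (1 - a * d)^-1.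
  move=> Vd.
  have n0 c : V c -> 1 - a * c != 0.
    move=> Vc; apply/eqP => /eqP; rewrite subr_eq0 => /eqP h; apply: nV.
    by rewrite -[a^-1]mulr1 h mulKf.
  pose W := [set x : F | exists v c, [/\ V v, V c & x = v / (1 - a * c)]].
  have VW x : V x -> W x.
    by move=> Vx; exists x, 0; split=> //; [exact: subring0 | rewrite mulr0 subr0 divr1].
  apply: (mV W _ VW); last first.
    by exists 1, d; split=> //; [exact: subring1 | rewrite mul1r].
  have den c c' : V c -> V c' -> V (c + c' - a * c * c').
    by move=> h h'; apply: (subringB hV); [exact: subringD | do 2?apply: subringM].
  split; last 2 first.
  - by move=> x /AV; exact: VW.
  - move=> [v [c [Vv Vc e]]]; apply: nV.
    have -> : a^-1 = v + c; last exact: subringD.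
    have := n0 c Vc => nc; apply: (mulfI a0); rewrite divff //.
    have : a * a^-1 * (1 - a * c) = a * v by rewrite e mulrA divfK.
    by rewrite divff // mul1r mulrDr => <-; rewrite subrK.
  split.
  - by apply: VW; exact: subring1.
  - move=> x y [v [c [Vv Vc ->]]] [w [b [Vw Vb ->]]].
    exists (v * (1 - a * b) - w * (1 - a * c)), (c + b - a * c * b); split.
    + have V1 := subring1 hV.
      by apply: (subringB hV); apply: (subringM hV) => //; apply: (subringB hV) => //; apply: subringM.
    + exact: den.
    + have -> : 1 - a * (c + b - a * c * b) = (1 - a * c) * (1 - a * b) by ring.
      by field; rewrite !n0.
  - move=> x y [v [c [Vv Vc ->]]] [w [b [Vw Vb ->]]].
    exists (v * w), (c + b - a * c * b); split; [exact: subringM | exact: den |].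
    have -> : 1 - a * (c + b - a * c * b) = (1 - a * c) * (1 - a * b) by ring.
    by field; rewrite !n0.
exists V; split=> //; split=> // x; apply: contrapT => /not_orP [nx nx'].
(* If y is outside [V], maximality puts a^-1 in V[y], that is 1 = a p(y). [P y m] records such a
   relation of length at most m; minimal lengths for x and 1/x will be compared. *)
pose P y m := exists p : {poly F}, [/\ forall i, V p`_i, (size p <= m)%N & a * p.[y] = 1].
have exP y : ~ V y -> exists m, `[< P y m >].
  move=> ny; pose W := [set z | exists2 p : {poly F}, (forall i, V p`_i) & z = p.[y]].
  have VW z : V z -> W z.
    move=> Vz; exists z%:P; rewrite ?hornerC // => i; rewrite coefC.
    by case: ifP => _ //; exact: subring0.
  have Wy : W y.
    exists 'X; rewrite ?hornerX // => i; rewrite coefX; exact: subring_nat.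
  have : ~ good W by move=> gW; apply: ny; exact: (mV W gW VW y Wy).
  move=> /not_and3P [] h.
  - by case: h; exact: subring_ext.
  - by case: h => z /AV; exact: VW.
  - move/contrapT: h => [p hp e]; exists (size p); apply/asboolP; exists p.
    by split=> //; rewrite -e divff.
(* Multiplied by a power of y, the relation in 1/y expresses that power through lower ones, since 1
   - a r_0 is invertible in [V]. Substitution in the top term shortens the relation in y. *)
have main y m l : ~ V y -> (l <= m)%N -> P y m -> P y^-1 l -> P y m.-1.
  move=> ny lm [p [Vp sp ep]] [r [Vr sr er]].
  case: m lm sp => [|m] lm sp; first by exists p.
  have y0 : y != 0 by apply/eqP => h; apply: ny; rewrite h; exact: subring0.
  have Vu := unit _ (Vr 0); set u := (1 - a * r`_0)^-1 in Vu.
  have u0 : 1 - a * r`_0 != 0.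
    apply/eqP => /eqP; rewrite subr_eq0 => /eqP h; apply: nV.
    by rewrite -[a^-1]mulr1 h mulKf.
  exists (\poly_(i < m) (p`_i + a * p`_m * u * r`_(m - i))); split.
  - move=> i; rewrite coef_poly; case: ifP => _; last exact: subring0.
    by apply: subringD => //; do !apply: (subringM hV).
  - exact: size_poly.
  have e1 : r.[y^-1] * y ^+ m = r`_0 * y ^+ m + \sum_(i < m) r`_(m - i) * y ^+ i.
    rewrite (horner_coef_wide _ (leq_trans sr lm)) mulr_suml big_ord_recl expr0 mulr1.
    congr (_ + _); rewrite (reindex_inj rev_ord_inj) /=; apply: eq_bigr => i _.
    have im := ltn_ord i; rewrite /bump /= add1n subnSK // -mulrA exprVn; congr (_ * _).
    have -> : y ^+ m = y ^+ (m - i) * y ^+ i by rewrite -exprD subnK // ltnW.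
    by rewrite mulKf ?expf_neq0.
  rewrite -ep (horner_coef_wide _ sp) big_ord_recr /= horner_poly; congr (_ * _).
  transitivity (\sum_(i < m) (p`_i * y ^+ i + a * p`_m * u * (r`_(m - i) * y ^+ i))).
    by apply: eq_bigr => i _; rewrite mulrDl mulrA.
  rewrite big_split /= -mulr_sumr; congr (_ + _).
  have e2 : a * \sum_(i < m) r`_(m - i) * y ^+ i = y ^+ m * (1 - a * r`_0).
    rewrite mulrBr mulr1 -{1}[y ^+ m]mul1r -er -mulrA e1; ring.
  rewrite -[RHS](mulfK u0) -/u.
  transitivity (p`_m * u * (a * \sum_(i < m) r`_(m - i) * y ^+ i)); first by ring.
  by rewrite e2; ring.
have [m /asboolP Pm mm] := ex_minnP (exP _ nx).
have [l /asboolP Pl ml] := ex_minnP (exP _ nx').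
have pos y k : P y k -> (0 < k)%N.
  case: k => // -[p [_ + e]]; rewrite leqn0 size_poly_eq0 => /eqP p0.
  by move/eqP: e; rewrite p0 horner0 mulr0 eq_sym oner_eq0.
have := pos _ _ Pm; have := pos _ _ Pl => l0 m0.
case: (leqP l m) => lm.
  have := mm m.-1; move/(_ (introT (asboolP _) (main _ _ _ nx lm Pm Pl))); lia.
have := ml l.-1; rewrite -[x]invrK in Pm.
move/(_ (introT (asboolP _) (main _ _ _ nx' (ltnW lm) Pl Pm))); lia.
Qed.

End Dominate.

Local Close Scope classical_set_scope.

Local Open Scope classical_set_scope.
Local Open Scope ring_scope.

(** * Closed chains of isogenies modulo the maximal ideal *)

Section Valuation.
Variables (F : fieldType) (V : set F).
Hypothesis hV : valuation_ring V.
Let sV : subring V := valuation_subring hV.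

(** Membership in the maximal ideal. Zero is listed apart because [0^-1 = 0] lies in [V]. *)
Definition nonunit (x : F) : Prop := x = 0 \/ ~ V x^-1.
Local Notation m := nonunit.

Ltac vr := repeat first [assumption | exact: (subring1 sV) | exact: (subring0 sV)
  | exact: (subring_nat sV) | apply: (subringB sV) | apply: (subringD sV) | apply: (subringN sV)
  | apply: (subringX sV) | apply: (subringM sV)].

Lemma nonunit_val x : m x -> V x.
Proof.
case=> [->|nx]; first exact: subring0.
by case: (valuation_total hV x).
Qed.

Lemma nonunit0 : m 0. Proof. by left. Qed.

Lemma nonunit1 : ~ m 1.
Proof.
case=> [/eqP|]; first by rewrite oner_eq0.
by rewrite invr1; apply; exact: subring1.
Qed.

Lemma not_val x : ~ V x -> m x^-1.
Proof. by move=> nx; right; rewrite invrK. Qed.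

Lemma val_unit x : ~ m x -> V x -> V x^-1.
Proof. by move=> nx Vx; apply: contrapT => h; apply: nx; right. Qed.

Lemma nonunitM x y : V x -> m y -> m (x * y).
Proof.
move=> Vx [->|ny]; first by rewrite mulr0; left.
have [->|x0] := eqVneq x 0; first by rewrite mul0r; left.
have [->|y0] := eqVneq y 0; first by rewrite mulr0; left.
right=> h; apply: ny; have := subringM sV Vx h.
by rewrite invfM mulrA divff // mul1r.
Qed.

Lemma nonunitMr x y : V x -> m y -> m (y * x).
Proof. by move=> *; rewrite mulrC; exact: nonunitM. Qed.

Lemma nonunitN x : m x -> m (- x).
Proof. by move=> h; rewrite -mulN1r; apply: nonunitM => //; vr. Qed.

Lemma nonunitD x y : m x -> m y -> m (x + y).
Proof.
have [->|x0] := eqVneq x 0; first by rewrite add0r.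
have [->|y0] := eqVneq y 0; first by rewrite addr0.
wlog h : x y x0 y0 / V (x / y).
  move=> H mx my; case: (valuation_total hV (x / y)) => h; first exact: H.
  by rewrite addrC; apply: H => //; rewrite -[y / x]invrK invf_div.
move=> mx my; have -> : x + y = (x / y + 1) * y by field.
by apply: nonunitM => //; vr.
Qed.

Lemma nonunitB x y : m x -> m y -> m (x - y).
Proof. by move=> hx hy; apply: nonunitD => //; exact: nonunitN. Qed.

Lemma nonunitX x n : (0 < n)%N -> m x -> m (x ^+ n).
Proof.
by case: n => // n _ h; rewrite exprSr; apply: nonunitM => //; apply: (subringX sV); exact: nonunit_val.
Qed.

Lemma nonunit_unit x y : V x -> ~ m x -> m (x * y) -> m y.
Proof.
move=> Vx nx h; have x0 : x != 0 by apply/eqP => e; apply: nx; left.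
by rewrite -(mulKf x0 y); apply: nonunitM => //; exact: val_unit.
Qed.

Lemma nonunit_prime x y : V x -> m (x * y) -> m x \/ m y.
Proof.
by move=> Vx h; have [?|nx] := pselect (m x); [left | right; exact: nonunit_unit nx h].
Qed.

Lemma nonunit_expr x n : V x -> m (x ^+ n) -> m x.
Proof.
move=> Vx; elim: n => [|n IH]; first by rewrite expr0 => /nonunit1.
by rewrite exprS => /(nonunit_prime Vx) [].
Qed.

Lemma nonunit1D x : m x -> ~ m (1 + x).
Proof.
by move=> h h'; apply: nonunit1; rewrite -(addrK x 1); exact: nonunitB.
Qed.

Lemma nonunit_trans y x z : m (x - y) -> m (y - z) -> m (x - z).
Proof. by move=> h h'; have := nonunitD h h'; congr (m _); ring. Qed.

Lemma nonunit_sym x y : m (x - y) -> m (y - x).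
Proof. by move=> /nonunitN; congr (m _); ring. Qed.

Lemma nonunit_congX x y n : V x -> V y -> m (x - y) -> m (x ^+ n - y ^+ n).
Proof.
move=> Vx Vy h; rewrite subrXX; apply: nonunitMr => //.
by apply: (subring_sum sV) => i _; vr.
Qed.

(** Over one turn y 0 is multiplied by an element c of the maximal ideal, and y = c y forces y = 0.
    The units s and x and the separation of orbits rest on this; no completeness is involved. *)
Lemma nonunit_cycle n (y : nat -> F) : (0 < n)%N ->
  (forall i, (i < n)%N -> m (y i) -> exists2 c, m c & y i.+1 = c * y i) ->
  y n = y 0 -> m (y 0) -> y 0 = 0.
Proof.
case: n => // n _ h yn m0.
have H i : (i <= n)%N -> exists2 c, m c & y i.+1 = c * y 0.
  elim: i => [|i IH] lin; first exact: h.
  have [c mc e] := IH (ltnW lin).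
  have mi : m (y i.+1) by rewrite e; apply: nonunitMr => //; exact: nonunit_val.
  have [c' mc' e'] := h _ (lin : (i.+1 < n.+1)%N) mi.
  by exists (c' * c); [apply: nonunitM => //; exact: nonunit_val | rewrite e' e mulrA].
have [c mc] := H n (leqnn n); rewrite yn => e.
have [//|y0] := eqVneq (y 0) 0; case: nonunit1.
by rewrite -(divff y0) {1}e mulfK.
Qed.

Section Chain.
Variables (n : nat) (s mu : nat -> F) (alpha : F).
Hypotheses (n0 : (0 < n)%N) (hc : chain n s mu alpha).
Hypotheses (Va : V alpha) (na : ~ m alpha) (m2 : m 2) (two0 : (2 : F) != 0).

Let m4 : m 4.
Proof. have -> : (4 : F) = 2 * 2 by ring. by apply: nonunitM => //; exact: nonunit_val. Qed.
Let four0 : (4 : F) != 0.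
Proof. have -> : (4 : F) = 2 * 2 by ring. by rewrite mulf_neq0. Qed.
Let s0 i : s i != 0. Proof. exact: chain_s_neq0 hc i. Qed.
Let mu0 i : mu i != 0. Proof. exact: chain_mu_neq0 hc i. Qed.
Let s4 i : 4 * s i = mu i * (1 - mu i).
Proof. by apply/eqP; rewrite -subr_eq0 -[X in _ == X](chain_mu hc i); apply/eqP; ring. Qed.

Let Vmu i : V (4 * s i) <-> V (mu i).
Proof.
split=> [h|h]; last by rewrite s4; vr.
apply: contrapT => /not_val mi; apply: (nonunit1D (nonunitN mi)).
have -> : 1 - (mu i)^-1 = - (4 * s i) * (mu i)^-1 * (mu i)^-1 by rewrite s4; field.
apply: nonunitM => //; apply: (subringM sV); last exact: nonunit_val.
by vr.
Qed.

(* If [mu i] had a pole then [4 * s i.+1] would be a unit divided by 4, so the pole would propagate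
   along the whole cycle, against [chain_prod]. *)
Let bad_step i : ~ V (4 * s i) -> ~ V (4 * s i.+1).
Proof.
move=> /Vmu /not_val mi h; have m1 := nonunit1D (nonunitN mi); apply: m1.
apply: (@nonunit_expr _ 2); first by vr; exact: nonunit_val.
have -> : (1 - (mu i)^-1) ^+ 2 = (4 * s i.+1) * 4; last by apply: nonunitM.
have -> : s i.+1 = s i ^+ 2 / mu i ^+ 4 by rewrite -(chain_s hc) mulfK ?expf_neq0.
have -> : s i = mu i * (1 - mu i) / 4 by rewrite -s4; field.
by field; rewrite mu0 four0.
Qed.

Let prod_sqr : (\prod_(i < n) (mu i)^-1) ^+ 2 = alpha ^+ 2.
Proof.
have pn0 : \prod_(i < n) mu i != 0 by apply/prodf_neq0 => i _.
by apply: (mulIf (expf_neq0 2 pn0)); rewrite -!exprMn (chain_prod hc) prodfV mulVf // expr1n.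
Qed.

Let V4s i : (i <= n)%N -> V (4 * s i).
Proof.
move=> lin; apply: contrapT => nV.
have up k : ~ V (4 * s (k + i)) by elim: k => // k IH; exact: bad_step.
have b0 : ~ V (4 * s 0) by rewrite -(chain_cycle hc) -(subnK lin).
have all k : ~ V (4 * s k) by elim: k => // k IH; exact: bad_step.
have mm k : m (mu k)^-1 by apply: not_val => /Vmu; exact: all.
apply: na; apply: (@nonunit_expr _ 2) => //; rewrite -prod_sqr; apply: nonunitX => //.
case: (n) n0 => // n' _; rewrite big_ord_recl; apply: nonunitMr => //.
by apply: (subring_prod sV) => j _; exact: nonunit_val.
Qed.

Let Vm i : (i <= n)%N -> V (mu i). Proof. by move/V4s/Vmu. Qed.

(** The product of the integral mu i with the integral alpha is a sign, so no factor can be a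
    nonunit. *)
Let nm i : (i < n)%N -> ~ m (mu i).
Proof.
move=> lin mi; have a2 : alpha ^+ 2 * (\prod_(i < n) mu i) ^+ 2 = 1.
  by rewrite -exprMn (chain_prod hc).
apply: nonunit1; rewrite -a2; apply: nonunitM; first by vr.
apply: nonunitX => //; rewrite (bigD1 (Ordinal lin)) //=; apply: nonunitMr => //.
by apply: (subring_prod sV) => j _; apply: Vm; exact: ltnW.
Qed.

Let Vmi i : (i < n)%N -> V (mu i)^-1.
Proof. by move=> lin; apply: val_unit; [exact: nm | apply: Vm; exact: ltnW]. Qed.

Let sS i : s i.+1 = s i ^+ 2 * (mu i)^-1 ^+ 4.
Proof. by rewrite -(chain_s hc) exprVn mulfK // expf_neq0. Qed.

(** If s 0 or its inverse were a nonunit, the relation s' = s^2 / mu^4 with mu a unit would multiply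
    it by a nonunit at each step; [nonunit_cycle] excludes both. *)
Lemma chain_unit i : (i <= n)%N -> V (s i) /\ ~ m (s i).
Proof.
elim: i => [|i IH] lin; last first.
  have [Vs ns] := IH (ltnW lin); have Vi := Vmi lin; split; first by rewrite sS; vr.
  move=> h; apply: ns; apply: (@nonunit_expr _ 2) => //; rewrite -(chain_s hc).
  by apply: nonunitMr => //; have := Vm (ltnW lin) => ?; vr.
clear lin; split.
  apply: contrapT => /not_val h.
  suff /eqP : (s 0)^-1 = 0 by rewrite invr_eq0 (negPf (s0 0)).
  apply: (nonunit_cycle (y := fun i => (s i)^-1) n0 _ (congr1 _ (chain_cycle hc)) h) => i lin mi.
  exists ((s i)^-1 * mu i ^+ 4); last by rewrite sS; field; rewrite s0 mu0.
  by apply: nonunitMr => //; have := Vm (ltnW lin) => ?; vr.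
move=> h; suff /eqP : s 0 = 0 by rewrite (negPf (s0 0)).
apply: (nonunit_cycle (y := s) n0 _ (chain_cycle hc) h) => i lin mi.
exists (s i * (mu i)^-1 ^+ 4); last by rewrite sS; ring.
by apply: nonunitMr => //; have := Vmi lin => ?; vr.
Qed.

Lemma chain_mu1 i : (i < n)%N -> m (mu i - 1).
Proof.
move=> lin; have [Vs _] := chain_unit (ltnW lin).
have -> : mu i - 1 = - (s i * (mu i)^-1) * 4.
  by apply: (mulfI (mu0 i)); rewrite -[LHS]opprK -mulrN opprB -s4; field.
by apply: nonunitM => //; have := Vmi lin => ?; vr.
Qed.

Lemma chain_s_frob i : (i <= n)%N -> m (s i - s 0 ^+ (2 ^ i)).
Proof.
elim: i => [|i IH] lin; first by rewrite expn0 expr1 subrr; exact: nonunit0.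
have [V0 _] := chain_unit (leq0n n); have [Vi _] := chain_unit (ltnW lin); have [Vi' _] := chain_unit lin.
apply: (@nonunit_trans (s i ^+ 2)); last first.
  by rewrite expnSr exprM; apply: nonunit_congX => //; [vr | apply: IH; exact: ltnW].
have Vmi' := Vm (ltnW lin).
have -> : s i.+1 - s i ^+ 2 = - (s i.+1 * (mu i + 1) * (mu i ^+ 2 + 1)) * (mu i - 1).
  by rewrite -(chain_s hc); ring.
by apply: nonunitM; [vr | exact: chain_mu1].
Qed.

Section Orbit.
Variables (x d : nat -> F) (eps : F).
Hypothesis ho : orbit n s mu x d eps.

Let x0 i : (i <= n)%N -> x i != 0. Proof. by move=> h; exact: (orbit_x_neq0 ho h). Qed.
Let xS i : (i < n)%N -> x i.+1 = x i * (x i + 4 * s i) * (mu i)^-1 ^+ 2 / (1 + 4 * x i).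
Proof.
move=> lin; have n4 := orbit_14_neq0 ho lin; apply: (mulIf n4); rewrite divfK //.
apply: (mulIf (expf_neq0 2 (mu0 i))); rewrite -mulrA [_ * mu i ^+ 2]mulrC (orbit_x ho lin).
by rewrite exprVn divfK // expf_neq0.
Qed.

Let V14 y : V y -> V (1 + 4 * y)^-1.
Proof.
move=> Vy; apply: val_unit; last by vr.
by apply: nonunit1D; exact: nonunitMr.
Qed.

(** Near infinity the isogeny contracts 1/x, against the closing of the orbit. For [nx0] the same
    argument applies to x near 0. *)
Let Vx0 : V (x 0).
Proof.
apply: contrapT => /not_val h.
suff /eqP : (x 0)^-1 = 0 by rewrite invr_eq0 (negPf (x0 _)).
apply: (nonunit_cycle (y := fun i => (x i)^-1) n0 _ (congr1 _ (orbit_x_cycle ho)) h) => i lin mi.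
have xi0 := x0 (ltnW lin); have n4 := orbit_14_neq0 ho lin.
have [Vs _] := chain_unit (ltnW lin); have Vmu' := Vm (ltnW lin).
have Vi := nonunit_val mi.
have Vy : V (s i * (x i)^-1) by vr.
have n4s : x i + 4 * s i != 0.
  have := x0 lin; rewrite xS // !mulf_eq0 !negb_or; by case/andP => /andP[/andP[_ ->]].
exists (((x i)^-1 + 4) * mu i ^+ 2 / (1 + 4 * (s i * (x i)^-1))).
  apply: nonunitMr; first exact: V14.
  by apply: nonunitMr; [vr | exact: nonunitD].
by rewrite xS //; field; rewrite xi0 mu0 n4 n4s.
Qed.

Let Vx i : (i <= n)%N -> V (x i).
Proof.
elim: i => // i IH lin; have Vi := IH (ltnW lin); rewrite xS //.
have [Vs _] := chain_unit (ltnW lin); have Vmu' := Vmi lin; have := V14 Vi => ?.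
by vr.
Qed.

Let nx0 : ~ m (x 0).
Proof.
move=> h; suff /eqP : x 0 = 0 by rewrite (negPf (x0 _)).
apply: (nonunit_cycle (y := x) n0 _ (orbit_x_cycle ho) h) => i lin mi.
have [Vs _] := chain_unit (ltnW lin); have Vmu' := Vmi lin; have := V14 (nonunit_val mi) => ?.
exists ((x i + 4 * s i) * ((mu i)^-1 ^+ 2 / (1 + 4 * x i))).
  by apply: nonunitMr; [vr | apply: nonunitD => //; exact: nonunitMr].
by rewrite xS //; field; rewrite mu0 (orbit_14_neq0 ho lin).
Qed.

Let mu_sqr i : (i < n)%N -> m (mu i ^+ 2 - 1).
Proof.
move=> lin; rewrite subr_sqr_1; apply: nonunitMr; last exact: chain_mu1.
by have := Vm (ltnW lin) => ?; vr.
Qed.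

Lemma orbit_x_frob i : (i <= n)%N -> m (x i - x 0 ^+ (2 ^ i)).
Proof.
elim: i => [|i IH] lin; first by rewrite expn0 expr1 subrr; exact: nonunit0.
have Vi := Vx (ltnW lin); have Vi' := Vx lin; have V0 := Vx (leq0n n).
have [Vs _] := chain_unit (ltnW lin); have Vmi' := Vm (ltnW lin).
apply: (@nonunit_trans (x i ^+ 2)); last first.
  by rewrite expnSr exprM; apply: nonunit_congX => //; [vr | apply: IH; exact: ltnW].
have -> : x i.+1 - x i ^+ 2 = x i * s i * 4 - x i.+1 * (mu i ^+ 2 - 1) - x i.+1 * mu i ^+ 2 * x i * 4.
  have := orbit_x ho lin => e; apply/eqP; rewrite -subr_eq0; apply/eqP.
  transitivity (x i.+1 * (mu i ^+ 2 * (1 + 4 * x i)) - x i * (x i + 4 * s i)); first by ring.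
  by rewrite e subrr.
apply: nonunitB; [apply: nonunitB | by apply: nonunitM => //; vr].
  by apply: nonunitM => //; vr.
by apply: nonunitM => //; exact: mu_sqr.
Qed.

Let nx i : (i <= n)%N -> ~ m (x i).
Proof.
move=> lin mi; apply: nx0; apply: (@nonunit_expr _ (2 ^ i)) => //.
by have := nonunitB mi (orbit_x_frob lin); congr (m _); ring.
Qed.

Let y i := (d i - 1) / 2.

Let ysq i : (i <= n)%N -> y i ^+ 2 + y i = x i + s i / x i + 4 * s i.
Proof.
move=> lin; have xi0 := x0 lin; apply: (mulIf xi0).
transitivity ((d i ^+ 2 * x i - x i) / 4); first by rewrite /y; field; rewrite two0 four0.
by rewrite (orbit_d_sqr ho lin); field; rewrite xi0 four0.
Qed.

Let Vsx i : (i <= n)%N -> V (s i / x i).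
Proof.
by move=> lin; have [Vs _] := chain_unit lin; have := val_unit (nx lin) (Vx lin) => ?; vr.
Qed.

(** A pole of y would be one of y^2 + y, which equals the integral x + s/x + 4s. *)
Let Vy i : (i <= n)%N -> V (y i).
Proof.
move=> lin; apply: contrapT => ny; have mi := not_val ny.
have y0 : y i != 0 by apply/eqP => e; apply: ny; rewrite e; exact: subring0.
apply: (nonunit1D mi).
have -> : 1 + (y i)^-1 = (y i)^-1 * (y i ^+ 2 + y i) * (y i)^-1 by field.
apply: nonunitM => //; rewrite ysq //; have [Vs _] := chain_unit lin.
by have := Vsx lin; have := Vx lin; have := nonunit_val mi => *; vr.
Qed.

Let yS i : (i < n)%N -> m (y i.+1 - y i ^+ 2).
Proof.
move=> lin; have lin' := ltnW lin; have xi0 := x0 lin'; have di := orbit_d_neq0 ho lin.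
have [Vs ns] := chain_unit lin'; have Vi := Vmi lin; have Vmm := Vm lin'; have V1 := Vy lin'; have V2 := Vy lin.
have V3 := Vsx lin'; have V4 := Vx lin'.
(* This is [orbit_d] with d = 1 + 2y, divided by 4; the constant terms combine through 4s/mu = 1 -
   mu. *)
have e1 : mu i * (y i + y i.+1 + 2 * y i * y i.+1) = 2 * s i * (mu i)^-1 + x i + s i / x i.
  have e4 : d i ^+ 2 + (1 - 16 * s i) = 2 + 4 * x i + 4 * (s i / x i).
    have -> : d i ^+ 2 = 1 + 4 * (y i ^+ 2 + y i) by rewrite /y; field; rewrite two0.
    by rewrite ysq //; ring.
  have e2 := orbit_d ho lin; rewrite e4 in e2.
  have e3 : 4 * s i * (mu i)^-1 = 1 - mu i by rewrite s4; field.
  apply: (mulfI four0).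
  transitivity (2 * mu i * d i * d i.+1 - 2 * mu i); first by rewrite /y; field; rewrite two0.
  rewrite e2; transitivity (2 * (4 * s i * (mu i)^-1) + 4 * x i + 4 * (s i / x i)); last by ring.
  by rewrite e3; ring.
have -> : y i.+1 - y i ^+ 2 = (s i * (mu i)^-1 - mu i * y i * y i.+1 - 2 * s i) * 2 - (y i + y i.+1) * (mu i - 1).
  transitivity (mu i * (y i + y i.+1 + 2 * y i * y i.+1) - (y i ^+ 2 + y i)
    - 2 * mu i * y i * y i.+1 - (y i + y i.+1) * (mu i - 1)); first by ring.
  by rewrite e1 ysq //; ring.
by apply: nonunitB; apply: nonunitM => //; [vr | vr | exact: chain_mu1].
Qed.

Let y_frob i : (i <= n)%N -> m (y i - y 0 ^+ (2 ^ i)).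
Proof.
elim: i => [|i IH] lin; first by rewrite expn0 expr1 subrr; exact: nonunit0.
have V1 := Vy (ltnW lin); have V0 := Vy (leq0n n).
apply: (nonunit_trans (yS lin)); rewrite expnSr exprM; apply: nonunit_congX => //; first by vr.
exact: IH (ltnW lin).
Qed.

(** The last two clauses carry the trace condition. For eps = 1 the reduction of y0 lies in the
    field with 2^n elements. For eps = -1 the orbit ends at -d, that is at -1 - y, so y0 and its
    Frobenius image differ by 1 and the equation has no root in that field. *)
Lemma orbit_reduce : [/\ V (x 0), ~ m (x 0), m (x 0 ^+ (2 ^ n) - x 0) &
  exists y0, [/\ V y0, m (y0 ^+ 2 + y0 - (x 0 + s 0 / x 0)),
    eps = 1 -> m (y0 ^+ (2 ^ n) - y0) & eps = -1 -> m (y0 ^+ (2 ^ n) - y0 - 1)]].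
Proof.
split=> //.
  by have := orbit_x_frob (leqnn n); rewrite (orbit_x_cycle ho) => /nonunit_sym.
have V0 := Vy (leq0n n); have [Vs _] := chain_unit (leq0n n).
exists (y 0); split=> // [|e|e].
- by rewrite ysq // addrC addKr; apply: nonunitMr.
- have := y_frob (leqnn n) => /nonunit_sym; congr (m (_ - _)).
  by rewrite /y (orbit_d_cycle ho) e mul1r.
- have h := nonunit_sym (y_frob (leqnn n)).
  have e1 : y n = - 1 - y 0.
    by rewrite /y (orbit_d_cycle ho) e; field; rewrite two0.
  have -> : y 0 ^+ (2 ^ n) - y 0 - 1 = (y 0 ^+ (2 ^ n) - y n) - (y 0 + 1) * 2 by rewrite e1; ring.
  by apply: nonunitB => //; apply: nonunitM => //; vr.
Qed.

End Orbit.

(* Modulo the maximal ideal the isogeny is the Frobenius, whose derivative vanishes: it contracts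
   residue discs, so that a disc contains at most one periodic point. *)
Lemma orbit_separated x d eps x' d' eps' : orbit n s mu x d eps -> orbit n s mu x' d' eps' ->
  m (x 0 - x' 0) -> x 0 = x' 0.
Proof.
move=> ho ho' h; suff /eqP : x 0 - x' 0 = 0 by rewrite subr_eq0 => /eqP.
have e : x n - x' n = x 0 - x' 0 by rewrite (orbit_x_cycle ho) (orbit_x_cycle ho').
apply: (nonunit_cycle (y := fun i => x i - x' i) n0 _ e h) => i lin mi.
have [V0 _ _ _] := orbit_reduce ho; have [V0' _ _ _] := orbit_reduce ho'.
have Vi : V (x i).
  have := nonunit_val (orbit_x_frob ho (ltnW lin)) => h1.
  by rewrite -(subrK (x 0 ^+ (2 ^ i)) (x i)); vr.
have Vi' : V (x' i).
  have := nonunit_val (orbit_x_frob ho' (ltnW lin)) => h1.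
  by rewrite -(subrK (x' 0 ^+ (2 ^ i)) (x' i)); vr.
have n4 := orbit_14_neq0 ho lin; have n4' := orbit_14_neq0 ho' lin.
have V14 z : V z -> V (1 + 4 * z)^-1.
  move=> Vz; apply: val_unit; last by vr.
  by apply: nonunit1D; exact: nonunitMr.
have W := V14 _ Vi; have W' := V14 _ Vi'; have Wm := Vmi lin.
have [Vs _] := chain_unit (ltnW lin).
have xE z z' : 1 + 4 * z != 0 -> z' * (mu i ^+ 2 * (1 + 4 * z)) = z * (z + 4 * s i) ->
    z' = z * (z + 4 * s i) / (mu i ^+ 2 * (1 + 4 * z)).
  by move=> hz <-; rewrite mulfK // mulf_neq0 // expf_neq0.
exists (((x i - x' i) + 2 * x' i + 4 * (x i * x' i) + 4 * s i) * ((mu i)^-1 ^+ 2 * (1 + 4 * x i)^-1 * (1 + 4 * x' i)^-1)).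
  apply: nonunitMr; first by vr.
  by do 3?apply: nonunitD => //; apply: nonunitMr => //; vr.
rewrite (xE _ _ n4 (orbit_x ho lin)) (xE _ _ n4' (orbit_x ho' lin)); field.
by rewrite n4 n4' mu0.
Qed.

End Chain.
End Valuation.

Local Close Scope classical_set_scope.

Local Open Scope classical_set_scope.
Local Open Scope ring_scope.

Lemma finField_generator (k : finFieldType) :
  exists g : k, forall a, a != 0 -> exists j, a = g ^+ j.
Proof.
have /cyclicP [x hx] := field_unit_group_cyclic [set: {unit k}]%G.
exists (val x) => a a0; have ua : a \is a GRing.unit by rewrite unitfE.
have : FinRing.unit k ua \in [set: {unit k}]%G by rewrite inE.
rewrite hx => /cycleP [j e]; exists j.
by rewrite -FinRing.val_unitX -e.
Qed.

(** * A copy of the finite field in the residue field *)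

Section Lift.
Import Pdiv.CommonRing Pdiv.RingMonic.
Variables (F : closedFieldType) (V : set F).
Hypothesis hV : valuation_ring V.
Let sV : subring V := valuation_subring hV.
Local Notation m := (nonunit V).
Hypothesis m2 : m 2.
Variable k : finFieldType.
Hypothesis k2 : (2 : k) = 0.

(** If z had a pole, dividing by its highest power would write 1 as a combination of positive powers
    of 1/z with integer coefficients, a nonunit. *)
Lemma integral_val (f : {poly int}) (z : F) : f \is monic -> (map_poly intr f).[z] = 0 -> V z.
Proof.
move=> fm fz; apply: contrapT => nz; have mz := not_val nz.
have z0 : z != 0 by apply/eqP => e; apply: nz; rewrite e; exact: subring0.
have [d sf] : exists d, size f = d.+1.
  by exists (size f).-1; rewrite prednK // size_poly_gt0 monic_neq0.
have hs : (size (map_poly (intr : int -> F) f) <= d.+1)%N by rewrite -sf size_poly.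
have fd : f`_d = 1 by move/monicP: fm; rewrite /lead_coef sf.
move: fz; rewrite (horner_coef_wide _ hs) big_ord_recr /= !coef_map /= fd mul1r => e.
apply: (nonunit1 hV); have -> : 1 = - (\sum_(i < d) (f`_i)%:~R * z^-1 ^+ (d - i)).
  apply: (mulIf (expf_neq0 d z0)); rewrite mul1r mulNr mulr_suml.
  move/eqP: e; rewrite addrC addr_eq0 => /eqP e; rewrite {1}e; congr (- _).
  apply: eq_bigr => i _; rewrite coef_map /= -mulrA; congr (_ * _).
  have -> : z ^+ d = z ^+ (d - i) * z ^+ i by rewrite -exprD subnK // ltnW.
  by rewrite exprVn mulKf ?expf_neq0.
apply: (nonunitN hV); elim/big_ind: _ => [||i _]; first exact: nonunit0.
  exact: nonunitD.
apply: (nonunitM hV); first exact: subring_int.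
by apply: nonunitX => //; rewrite subn_gt0.
Qed.

Variable g : k.
Hypothesis hg : forall a, a != 0 -> exists j, a = g ^+ j.
Let evk : {rmorphism {poly int} -> k} := horner_eval g \o map_poly intr.

Let even_ev (h : {poly int}) : (forall i, (2 %| h`_i)%Z) -> evk h = 0.
Proof.
move=> h2; rewrite /evk /= /horner_eval horner_coef big1 // => i _.
rewrite coef_map /=; have /dvdzP [c ->] := h2 i.
by rewrite intrM [2%:~R]k2 mulr0 mul0r.
Qed.

Let exf : exists d, `[< exists f : {poly int}, [/\ f \is monic, size f = d.+1 & evk f = 0] >].
Proof.
exists #|k|; apply/asboolP; exists ('X^#|k| - 'X).
have q1 : (1 < #|k|)%N := finNzRing_gt1 k.
have sz : size ('X^#|k| - 'X : {poly int}) = #|k|.+1.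
  by rewrite size_polyDl ?size_polyXn // size_polyN size_polyX.
split=> //.
  by rewrite monicE lead_coefDl ?size_polyXn ?size_polyN ?size_polyX // lead_coefXn.
by rewrite /evk /= /horner_eval rmorphB /= map_polyXn map_polyX hornerD hornerN hornerXn hornerX expf_card subrr.
Qed.

(* By minimality of the degree of [f], an integer polynomial vanishing at [g] is even modulo [f]. *)
Let xiP : exists xi : F, V xi /\ forall h : {poly int}, evk h = 0 -> m (map_poly intr h).[xi].
Proof.
have [d /asboolP [f [fm sf ef]] dm] := ex_minnP exf.
have d0 : (0 < d)%N.
  case: d sf {dm} => // sf; have f1 : f = 1.
    by move/monicP: fm; rewrite /lead_coef sf /= => e; rewrite (size1_polyC (eq_leq sf)) e.
  by move/eqP: ef; rewrite f1 rmorph1 oner_eq0.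
have [xi hxi] : exists xi : F, root (map_poly intr f) xi.
  apply/closed_rootP; rewrite size_map_poly_id0 ?sf; first by case: (d) d0.
  by rewrite (monicP fm) oner_neq0.
have Vxi : V xi by apply: (integral_val fm); exact/eqP.
exists xi; split=> // h hh.
pose r := rmodp h f.
have er : h = rdivp h f * f + r by exact: rdivp_eq.
have sr : (size r < d.+1)%N by rewrite -sf ltn_rmodpN0 // monic_neq0.
have evr : evk r = 0.
  by move: hh; rewrite er rmorphD rmorphM ef mulr0 add0r.
have r2 i : (2 %| r`_i)%Z.
  apply: contrapT => /negP ni.
  pose odd_at := fun j : nat => ~~ (2 %| r`_j)%Z.
  have bnd j : odd_at j -> (j <= d)%N.
    rewrite /odd_at; apply: contraNT; rewrite -ltnNge => jd.
    by rewrite nth_default ?dvdz0 // (leq_trans _ jd) // ltnW.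
  (* The last odd coefficient of the remainder. Truncating there, with leading coefficient 1, gives
     a monic polynomial of degree j < d that still vanishes at [g]. *)
  have [j oj jm] := ex_maxnP (ex_intro odd_at i ni) bnd.
  have jd : (j < d)%N.
    have := sr; rewrite ltnS => sr'; case: (ltnP j (size r)) => h1; first exact: leq_trans h1 sr'.
    by move: oj; rewrite /odd_at nth_default ?dvdz0.
  have := dm j; rewrite leqNgt jd => H; suff : ~~ true by []; apply: H; apply/asboolP.
  pose p : {poly int} := \poly_(l < j) r`_l.
  pose f' : {poly int} := 'X^j + p.
  have sp : (size p < size ('X^j : {poly int}))%N.
    by rewrite size_polyXn ltnS size_poly.
  exists f'; split.
  - by rewrite monicE lead_coefDl // lead_coefXn.
  - by rewrite size_polyDl // size_polyXn.
  - have -> : f' = r + (f' - r) by rewrite addrC subrK.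
    rewrite rmorphD evr add0r; apply: even_ev => l.
    rewrite coefB coefD coefXn coef_poly; case: (ltngtP l j) => lj.
    + by rewrite add0r subrr dvdz0.
    + rewrite addr0 sub0r rpredN; apply: contraLR lj => ol.
      by rewrite -leqNgt; apply: jm.
    + rewrite lj addr0; move: oj; rewrite /odd_at; clear; lia.
rewrite er rmorphD rmorphM /= hornerD hornerM (eqP hxi) mulr0 add0r horner_coef.
elim/big_ind: _ => [||i _]; first exact: nonunit0.
  exact: nonunitD.
rewrite coef_map /=; have /dvdzP [c ->] := r2 i.
rewrite intrM; apply: nonunitMr => //; first exact: subringX.
by apply: nonunitM => //; exact: subring_int.
Qed.

(** The residue field is never formed: [psi] takes values in [V] and is a ring morphism only modulo
    the maximal ideal. It sends a polynomial expression in [g] to the same expression in [xi]. The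
    last clause says that it reaches all roots of X^q - X. *)
Lemma residue_lift : exists psi : k -> F, [/\ forall a, V (psi a),
  forall a b, m (psi (a + b) - (psi a + psi b)),
  forall a b, m (psi (a * b) - psi a * psi b) &
  m (psi 1 - 1)] /\
  forall x, V x -> m (x ^+ #|k| - x) -> exists a, m (x - psi a).
Proof.
have [xi [Vxi hxi]] := xiP.
pose evF : {rmorphism {poly int} -> F} := horner_eval xi \o map_poly intr.
have Vev h : V (evF h).
  rewrite /evF /= /horner_eval horner_coef; apply: subring_sum => // i _.
  by rewrite coef_map; apply: subringM => //; [exact: subring_int | exact: subringX].
have sur a : exists h, evk h = a.
  have [->|a0] := eqVneq a 0; first by exists 0; rewrite rmorph0.
  have [j ->] := hg a0; exists 'X^j.
  by rewrite /evk /= /horner_eval map_polyXn hornerXn.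
have [ch hch] := choice sur.
have evB h h' : evk h = evk h' -> m (evF h - evF h').
  move=> e; rewrite -rmorphB; apply: hxi.
  by rewrite rmorphB e subrr.
exists (fun a => evF (ch a)); split; first split=> [a|a b|a b|].
- exact: Vev.
- by rewrite -rmorphD; apply: evB; rewrite rmorphD !hch.
- by rewrite -rmorphM; apply: evB; rewrite rmorphM !hch.
- by rewrite -(rmorph1 evF); apply: evB; rewrite rmorph1 hch.
move=> x Vx hx.
(* Over [k] the product and X^q - X coincide, so each coefficient of [B] vanishes at [g]; by the
   choice of [xi], [B] then takes values in the maximal ideal. *)
pose B : {poly {poly int}} := \prod_(a : k) ('X - (ch a)%:P) - ('X^#|k| - 'X).
have Bk : map_poly evk B = 0.
  rewrite rmorphB rmorph_prod /= rmorphB /= map_polyXn map_polyX.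
  rewrite finField_genPoly; apply/eqP; rewrite subr_eq0; apply/eqP; apply: eq_bigr => a _.
  by rewrite rmorphB /= map_polyX map_polyC; congr (_ - _%:P); exact: hch.
have mB : m (map_poly evF B).[x].
  rewrite horner_coef; elim/big_ind: _ => [||i _]; first exact: nonunit0.
    exact: nonunitD.
  rewrite coef_map; apply: nonunitMr => //; first exact: subringX.
  by apply: hxi; have := congr1 (fun p : {poly k} => p`_i) Bk; rewrite coef_map coef0.
have : m (\prod_(a : k) (x - evF (ch a))).
  have -> : \prod_(a : k) (x - evF (ch a)) = (map_poly evF B).[x] + (x ^+ #|k| - x).
    rewrite rmorphB rmorph_prod /= rmorphB /= map_polyXn map_polyX.
    rewrite hornerD hornerN horner_prod hornerD hornerN hornerXn hornerX subrK.
    by apply: eq_bigr => a _; rewrite rmorphB /= map_polyX map_polyC /= hornerXsubC.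
  exact: nonunitD.
move=> mp; apply: contrapT => no.
suff [_] : V (\prod_(a : k) (x - evF (ch a))) /\ ~ m (\prod_(a : k) (x - evF (ch a))) by [].
elim/big_ind: _ => [|y z [Vy ny] [Vz nz]|a _].
- by split; [exact: subring1 | exact: nonunit1].
- by split=> [|h]; [exact: subringM | apply: nz; exact: (nonunit_unit hV Vy ny h)].
- by split=> [|h]; [exact: subringB | apply: no; exists a].
Qed.
End Lift.

Local Close Scope classical_set_scope.

Local Open Scope classical_set_scope.
Local Open Scope ring_scope.

Lemma size_le_fibers (T U : eqType) (f : T -> U) (c : nat) (s : seq T) :
  (forall x, x \in s -> (count (fun y => f y == f x) s <= c)%N) ->
  (size s <= c * size (undup (map f s)))%N.
Proof.
move=> h.
have H (r : seq U) (l : seq T) : uniq r -> {subset map f l <= r} ->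
    size l = (\sum_(v <- r) count (fun y => f y == v) l)%N.
  move=> ur; elim: l => [|x l IH] sub /=; first by rewrite big1.
  rewrite big_split /= -IH; last by move=> v hv; apply: sub; rewrite inE hv orbT.
  rewrite -add1n; congr (_ + _)%N.
  have xr : f x \in r by apply: sub; rewrite inE eqxx.
  by rewrite (bigD1_seq (f x)) //= eqxx big1 // => v; rewrite eq_sym => /negPf ->.
rewrite (H (undup (map f s)) s) ?undup_uniq //; last by move=> v; rewrite mem_undup.
rewrite mulnC -sum1_size big_distrl /= !big_seq; apply: leq_sum => v.
by rewrite mem_undup => /mapP [x xs ->]; rewrite mul1n; exact: h.
Qed.

(** * The place above the conjugate of alpha, and reduction of the points *)

Section QuadPlace.
Variables (F : numFieldType) (t q : int) (z : F).
Hypotheses (hz : z ^+ 2 = t%:~R * z - q%:~R) (ht : t ^+ 2 < 4 * q) (q2 : 2 <= q).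

Let z0 : z != 0.
Proof.
apply/eqP => h; move/eqP: hz; rewrite h mulr0 expr0n sub0r eq_sym oppr_eq0 intr_eq0.
by move/eqP => q0; move: q2; rewrite q0.
Qed.

Lemma quad_irr (a b : int) : a%:~R * z + b%:~R = 0 -> a = 0 /\ b = 0.
Proof.
move=> h; have h1 : a%:~R * z = - b%:~R by apply/eqP; rewrite -addr_eq0 h.
have : ((2 * b + t * a) ^+ 2)%:~R = (((t ^+ 2 - 4 * q) * a ^+ 2)%:~R : F).
  apply/eqP; rewrite -subr_eq0; apply/eqP.
  rewrite !(rmorphXn, rmorphB, rmorphM, rmorphD) /=.
  have -> : b%:~R = - (a%:~R * z) by rewrite h1 opprK.
  transitivity (4 * a%:~R ^+ 2 * (z ^+ 2 - (t%:~R * z - q%:~R))); first by ring.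
  by rewrite hz subrr mulr0.
move/eqP; rewrite eqr_int => /eqP h2.
have a0 : a = 0.
  apply/eqP; apply: contraT => na; have : 0 < a ^+ 2 by rewrite exprn_even_gt0.
  have := sqr_ge0 (2 * b + t * a); rewrite h2 => h3 h4; exfalso.
  have h5 : t ^+ 2 - 4 * q < 0 by rewrite subr_lt0.
  have := mulr_lt0 (t ^+ 2 - 4 * q) (a ^+ 2); rewrite h5 (gt_eqF h4) /=.
  by have := nmulr_rlt0 (a ^+ 2) h5; rewrite h4 ltNge h3.
split=> //; move: h1; rewrite a0 mul0r => /esym/eqP; rewrite oppr_eq0 intr_eq0 => /eqP //.
Qed.

Let A0 : set F := [set x | exists a b : int, x = a%:~R * z + b%:~R].

(** The norm q >= 2 of z prevents 1/z from lying in Z[z], so a valuation ring dominating Z[z] at z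
    exists. *)
Lemma quad_place : exists V : set F, [/\ valuation_ring V, V z & nonunit V z].
Proof.
have A1 : A0 z by exists 1, 0; rewrite mul1r addr0.
have sA : subring A0.
  split.
  - by exists 0, 1; rewrite mul0r add0r.
  - by move=> x y [a [b ->]] [c [d ->]]; exists (a - c), (b - d); rewrite !rmorphB /=; ring.
  - move=> x y [a [b ->]] [c [d ->]]; exists (a * c * t + a * d + b * c), (b * d - a * c * q).
    rewrite !(rmorphB, rmorphD, rmorphM) /=.
    transitivity (a%:~R * c%:~R * z ^+ 2 + a%:~R * d%:~R * z + b%:~R * c%:~R * z + b%:~R * d%:~R); first by ring.
    by rewrite hz; ring.
have nA : ~ A0 z^-1.
  move=> [a [b h]].
  have h1 : z * (a%:~R * z + b%:~R) - 1 = 0 by rewrite -h divff // subrr.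
  have : (a * t + b)%:~R * z + (- (a * q) - 1)%:~R = 0.
    rewrite -h1 !(rmorphB, rmorphN, rmorphD, rmorphM) /=.
    transitivity (a%:~R * (t%:~R * z - q%:~R) + b%:~R * z - 1); first by ring.
    by rewrite -hz; ring.
  move=> /quad_irr [_] h2; have h3 : a * q = - 1 by apply/eqP; rewrite -addr_eq0 -oppr_eq0 opprD h2.
  have : `|a * q| = 1 by rewrite h3.
  rewrite normrM => h4; case: (eqVneq a 0) => [a0|na]; first by rewrite a0 mul0r in h3.
  have : 1 * 2 <= `|a| * `|q|.
    by apply: ler_pM => //; [rewrite -gtz0_ge1 normr_gt0 | apply: le_trans q2 (ler_norm _)].
  by rewrite h4.
have [V [hV AV nV]] := dominating_valuation sA z0 A1 nA.
by exists V; split=> //; [exact: AV | right].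
Qed.

End QuadPlace.

Section Param.
Variables (k : finFieldType) (n : nat) (e : int).
Let q : int := 2 ^+ n.
Let t : int := 4 * e + 1 + q.
Hypotheses (n0 : (0 < n)%N) (ht : t ^+ 2 < 4 * q) (kq : #|k| = (2 ^ n)%N) (k2 : (2 : k) = 0).
Local Notation F := (Rdefinitions.R)[i].

Let alpha : F := @cm_alpha Rdefinitions.R n e.
Let ab : F := t%:~R - alpha.

Let q2 : 2 <= q.
Proof. by rewrite /q; case: (n) n0 => // n' _; rewrite exprS ler_peMr // exprn_ege1. Qed.

Let alpha_eq : alpha ^+ 2 - t%:~R * alpha + q%:~R = 0.
Proof. exact: (@cm_alpha_eq Rdefinitions.R n e ht). Qed.

Let qF : q%:~R = 2 ^+ n :> F. Proof. by rewrite /q rmorphXn. Qed.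

Let ab_prod : alpha * ab = 2 ^+ n.
Proof.
apply/eqP; rewrite -subr_eq0; apply/eqP; rewrite -[RHS]oppr0 -alpha_eq /ab qF; ring.
Qed.

Let two0 : (2 : F) != 0. Proof. by rewrite pnatr_eq0. Qed.
Let ab_eq : ab ^+ 2 = t%:~R * ab - q%:~R.
Proof.
by rewrite qF -ab_prod /ab; ring.
Qed.

(* After division by [x] the equation is [y ^+ 2 + y = x + s / x]. *)
Definition split_pts (s : k) (b : bool) : {set k} :=
  [set x | (x != 0) && ([exists y : k, (y ^+ 2 + y) * x == x ^+ 2 + s] == b)]%SET.

(** The good points with ab z = z, and those with ab z = -z, give distinct reduced x in one class
    each, according to whether the reduced y is fixed by the Frobenius. The undetermined sign [sg]
    decides which goes where, whence the disjunction. *)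
Lemma exists_param (h1 h2 : nat) : h1%:Z = - 2 * e -> h2%:Z = q + 1 + 2 * e ->
  exists2 s : k, s != 0 &
   (h1.-1 <= #|split_pts s true|)%N /\ (h2.-1 <= #|split_pts s false|)%N \/
   (h1.-1 <= #|split_pts s false|)%N /\ (h2.-1 <= #|split_pts s true|)%N.
Proof.
move=> eh1 eh2; have [V [hV Vab mab]] := quad_place ab_eq ht q2.
have sV := valuation_subring hV.
have Va : V alpha.
  have -> : alpha = t%:~R - ab by rewrite /ab opprB addrC subrK.
  by apply: subringB => //; exact: subring_int.
have m2 : nonunit V 2.
  apply: (@nonunit_expr _ _ hV _ n); first exact: subring_nat.
  by rewrite -ab_prod; apply: nonunitM.
(* t is odd: if alpha lay in the maximal ideal along with [ab] and 2, so would 1. *)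
have na : ~ nonunit V alpha.
  move=> ma; apply: (nonunit1 hV).
  have -> : 1 = (alpha + ab) - (2 * e)%:~R * 2 - 2 ^+ n.
    rewrite -qF /ab /t !(rmorphD, rmorphM) /=; ring.
  apply: nonunitB => //; last exact: nonunitX.
  by apply: nonunitB => //; [exact: nonunitD | apply: nonunitM => //; exact: subring_int].
pose tau := @cm_tau Rdefinitions.R n e.
pose s_ i : F := ws (2 ^+ i * tau); pose mu_ i : F := wmu (2 ^+ i * tau).
have hc : chain n s_ mu_ alpha := @cm_chain Rdefinitions.R n e ht.
have [sg hsg ho] := @cm_orbit Rdefinitions.R n e ht.
have pts (eps : int) (h : nat) :
    (eps = 1 /\ h%:Z = - 2 * e) \/ (eps = -1 /\ h%:Z = q + 1 + 2 * e) ->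
    exists xs : seq F, [/\ uniq xs, (h.-1 <= size xs)%N & forall X, X \in xs ->
      exists x d, orbit n s_ mu_ x d (sg * eps%:~R) /\ x 0 = X].
  move=> he; have [zs [uz sz hz fz]] := @cm_points Rdefinitions.R n e ht eps h he.
  exists (undup (map (wx tau) zs)); split; first exact: undup_uniq.
    have H : (size zs <= 2 * size (undup (map (wx tau) zs)))%N := size_le_fibers fz.
    by move: sz H; move: (size zs) (size (undup _)) => a b; clear; lia.
  move=> X; rewrite mem_undup => /mapP [z zz ->]; have [gz lz] := hz z zz.
  do 2!eexists; split.
    apply: (ho eps%:~R z _ gz lz).
    by case: he => -[-> _]; [left | right].
  by rewrite /= expr0 !mul1r.
have [g hg] := finField_generator k.
have [psi [[Vpsi psiD psiM psi1] psi_sur]] := residue_lift hV m2 k2 hg.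
pose cg u v := nonunit V (u - v).
have cgt u v w : cg u v -> cg v w -> cg u w := @nonunit_trans F V hV v u w.
have cgs u v : cg u v -> cg v u := @nonunit_sym F V hV u v.
have cgD u v u' v' : cg u v -> cg u' v' -> cg (u + u') (v + v').
  by move=> h h'; have := nonunitD hV h h'; rewrite /cg; congr (nonunit V _); ring.
have cgM u v u' v' : V u' -> V v -> cg u v -> cg u' v' -> cg (u * u') (v * v').
  move=> Vu Vv h h'; rewrite /cg; have -> : u * u' - v * v' = (u - v) * u' + v * (u' - v') by ring.
  by apply: nonunitD => //; [exact: nonunitMr | exact: nonunitM].
have psi0 : nonunit V (psi 0).
  have := psiD 0 0; rewrite addr0 => /(nonunitN hV); congr (nonunit V _); ring.
have psi_inj a b : cg (psi a) (psi b) -> a = b.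
  move=> h; apply/eqP; rewrite -subr_eq0; apply: contraT => nz.
  have k1 : nonunit V (psi (a - b)).
    have := nonunitD hV h (nonunit_sym hV (psiD (a - b) b)).
    by rewrite subrK; congr (nonunit V _); ring.
  have k2' := psiM (a - b) (a - b)^-1; rewrite divff // in k2'.
  case: (nonunit1 hV).
  have := nonunitB hV (nonunitD hV k2' (nonunitMr hV (Vpsi (a - b)^-1) k1)) psi1.
  by congr (nonunit V _); ring.
have psiX a j : cg (psi (a ^+ j)) (psi a ^+ j).
  elim: j => [|j IH]; first by rewrite !expr0; exact: psi1.
  rewrite !exprS; apply: (cgt _ _ _ (psiM a (a ^+ j))); apply: (cgM _ _ _ _) => //.
  by rewrite /cg subrr; left.
have psi_frob a : cg (psi a ^+ (2 ^ n)) (psi a).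
  by have := cgs _ _ (psiX a (2 ^ n)%N); rewrite -kq expf_card.
have [Vs0 ns0] := chain_unit hV n0 hc Va na m2 two0 (leq0n n).
have [s hs] : exists s, cg (s_ 0) (psi s).
  apply: psi_sur => //; rewrite kq; apply: nonunit_sym => //.
  by have := chain_s_frob hV n0 hc Va na m2 two0 (leqnn n); rewrite (chain_cycle hc).
have s0 : s != 0.
  apply/eqP => e0; apply: ns0; have := nonunitD hV hs psi0; rewrite e0.
  by congr (nonunit V _); ring.
exists s => //.
have main (xs : seq F) (b : bool) : uniq xs -> (forall X, X \in xs ->
      exists x d, orbit n s_ mu_ x d (if b then 1 else -1) /\ x 0 = X) ->
    (size xs <= #|split_pts s b|)%N.
  move=> uxs hxs.
  have hch X : exists a, X \in xs -> cg X (psi a).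
    case: (boolP (X \in xs)) => [/hxs [x [d [hor <-]]]|_]; last by exists 0.
    have [V0 _ h0 _] := orbit_reduce hV n0 hc Va na m2 two0 hor.
    by have [|a ha] := psi_sur _ V0; [rewrite kq | exists a].
  have [ch hch'] := choice hch.
  rewrite -(size_map ch) cardE; apply: uniq_leq_size.
    rewrite map_inj_in_uniq // => X X' hX hX' e0.
    have [x [d [hor eX]]] := hxs _ hX; have [x' [d' [hor' eX']]] := hxs _ hX'.
    rewrite -eX -eX'; apply: (orbit_separated hV n0 hc Va na m2 two0 hor hor').
    rewrite eX eX'; apply: (cgt _ (psi (ch X))); first exact: hch'.
    by rewrite e0; apply: (cgs _ _); exact: hch'.
  move=> _ /mapP [X hX ->]; rewrite mem_enum.
  have [x [d [hor eX]]] := hxs _ hX; have ha := hch' _ hX; set a := ch X in ha *.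
  have [V0 nx0 h0 [y0 [Vy hy hy1 hy2]]] := orbit_reduce hV n0 hc Va na m2 two0 hor.
  rewrite eX in V0 nx0 h0 hy.
  have X0 : X != 0 by apply/eqP => e0; apply: nx0; left.
  have VXi := val_unit nx0 V0.
  have a0 : a != 0.
    apply/eqP => e0; apply: nx0; have := nonunitD hV ha psi0; rewrite e0.
    by congr (nonunit V _); ring.
  have e1 : cg ((y0 ^+ 2 + y0) * X) (X ^+ 2 + s_ 0).
    have -> : X ^+ 2 + s_ 0 = (X + s_ 0 / X) * X by field.
    by rewrite /cg -mulrBl; apply: nonunitMr.
  have e2 : cg (X ^+ 2 + s_ 0) (psi (a ^+ 2 + s)).
    apply: (cgs _ _); apply: (cgt _ _ _ (psiD _ _)); apply: (cgD _ _ _ _); last exact: cgs.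
    by apply: (cgt _ _ _ (psiX _ _)); apply: nonunit_congX => //; apply: (cgs _ _).
  have e3 c : cg (psi ((c ^+ 2 + c) * a)) ((psi c ^+ 2 + psi c) * X).
    apply: (cgt _ _ _ (psiM _ _)); apply: (cgM _ _ _ _) => //; last exact: cgs.
      by apply: (subringD sV) => //; exact: subringX.
    apply: (cgt _ _ _ (psiD _ _)); apply: (cgD _ _ _ _); first exact: psiX.
    by rewrite /cg subrr; left.
  rewrite finset.in_set a0 /=; case: b hor hy1 hy2 {hxs} => hor hy1 hy2.
    rewrite eqb_id; have [|c hc'] := psi_sur _ Vy; first by rewrite kq; exact: hy1.
    apply/existsP; exists c; apply/eqP; apply: psi_inj.
    apply: (cgt _ _ _ (e3 c)); apply: (cgt _ _ _ _ e2); apply: (cgt _ _ _ _ e1).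
    apply: (cgM _ _ _ _) => //; last by rewrite /cg subrr; left.
    by apply: (subringD sV) => //; exact: subringX.
    apply: (cgD _ _ _ _); last exact: cgs.
    by apply: nonunit_congX => //; exact: cgs.
  apply/eqP/negbTE/negP => /existsP [c /eqP ec].
  (* Whatever is congruent to some [psi c'] is fixed by the power 2^n modulo the ideal, whereas y0
     moves by 1. *)
  have bad c' : ~ cg y0 (psi c').
    move=> h; apply: (nonunit1 hV).
    have k1 := hy2 erefl.
    have k2' : cg (y0 ^+ (2 ^ n)) y0.
      apply: (cgt _ (psi c' ^+ (2 ^ n))); first exact: nonunit_congX.
      by apply: (cgt _ _ _ (psi_frob _)); exact: cgs.
    by have := nonunitB hV k2' k1; congr (nonunit V _); ring.
  have e4 : cg ((y0 ^+ 2 + y0) * X) ((psi c ^+ 2 + psi c) * X).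
    apply: (cgt _ _ _ e1); apply: (cgt _ _ _ e2); rewrite -ec; exact: e3.
  have e5 : nonunit V (X * ((y0 - psi c) * (y0 + psi c + 1))).
    by have := e4; rewrite /cg; congr (nonunit V _); ring.
  have e6 := nonunit_unit hV V0 nx0 e5.
  have [h|h] := nonunit_prime hV (subringB sV Vy (Vpsi c)) e6; first by apply: bad h.
  (* The second root of the quadratic: modulo 2, y0 + psi c + 1 is y0 - psi (c + 1). *)
  apply: (bad (c + 1)).
  have h3 := nonunitD hV (psiD c 1) psi1.
  have h4 := nonunitMr hV (subringD sV (Vpsi c) (subring1 sV)) m2.
  have := nonunitB hV (nonunitB hV h h3) h4; rewrite /cg; congr (nonunit V _); ring.
have [xs1 [u1 z1 o1]] := pts 1 h1 (or_introl (conj erefl eh1)).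
have [xs2 [u2 z2 o2]] := pts (-1) h2 (or_intror (conj erefl eh2)).
have lem (xs : seq F) (c : F) b h : (h <= size xs)%N -> uniq xs -> (forall X, X \in xs ->
      exists x d, orbit n s_ mu_ x d c /\ x 0 = X) -> c = (if b then 1 else -1) ->
      (h <= #|split_pts s b|)%N.
  by move=> hz hu hx ec; apply: (leq_trans hz); apply: main => //; rewrite -ec.
case: hsg => es; rewrite es in o1 o2; [left | right]; split.
- by apply: lem z1 u1 o1 _; rewrite mul1r.
- by apply: lem z2 u2 o2 _; rewrite mul1r.
- by apply: lem z1 u1 o1 _; rewrite mulr1.
- by apply: lem z2 u2 o2 _; rewrite mulrNN mulr1.
Qed.
End Param.

Local Close Scope classical_set_scope.

(** * Kloosterman sums in characteristic 2 *)

Definition artin_schreier (k : finFieldType) (z : k) : bool := [exists y : k, y ^+ 2 + y == z].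

(* [(-1)^(Tr z)], as [z] has trace 0 iff it is of the form [y ^+ 2 + y]. *)
Definition chi (k : finFieldType) (z : k) : int := if artin_schreier z then 1 else -1.

Definition kloosterman (k : finFieldType) (s : k) : int := \sum_(x : k | x != 0) chi (x + s / x).

(** Outside its fixed points an involution pairs the elements; this is a tool for parities. *)
Lemma card_involution (T : finType) (f : T -> T) (A : {set T}) :
  (forall x, x \in A -> f x \in A /\ f (f x) = x) ->
  exists c, #|A| = (2 * c + #|[set x in A | f x == x]|)%N.
Proof.
have [m] := ubnP #|A|; elim: m A => // m IH A Am hA.
have [/existsP [x /andP[xA fx]]|] := boolP [exists x, (x \in A) && (f x != x)]; last first.
  rewrite negb_exists => /forallP h; exists 0%N; rewrite muln0 add0n; apply: eq_card => x.
  by rewrite !inE; have := h x; case: (x \in A) => //=; rewrite negbK => ->.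
have [fA ff] := hA x xA; pose B := A :\: [set x; f x].
have cA : #|A| = (#|B| + 2)%N.
  rewrite -(cardsID [set x; f x] A) addnC; congr (_ + _)%N.
  have -> : A :&: [set x; f x] = [set x; f x].
    by apply/finset.setIidPr/fintype.subsetP => y; rewrite !inE => /orP[] /eqP ->.
  by rewrite cards2 eq_sym fx.
have [|y|c hc] := IH B; first by move: Am; rewrite cA; lia.
  rewrite !inE negb_or => /andP[/andP[y1 y2] yA]; have [h1 h2] := hA y yA; split=> //.
  rewrite h1 andbT negb_or; apply/andP; split; apply/eqP => h.
    by move: y2; rewrite -h h2 eqxx.
  by move: y1; rewrite -h2 h ff eqxx.
exists c.+1; have -> : [set y in A | f y == y] = [set y in B | f y == y].
  apply/setP => y; rewrite !inE; case: eqP => [fy|_]; last by rewrite !andbF.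
  rewrite !andbT; case yA: (y \in A); rewrite ?andbF // andbT; apply/esym/norP; split; apply/eqP => h.
    by case/eqP: fx; rewrite -h.
  by case/eqP: fx; rewrite -ff -h fy.
by rewrite cA hc; lia.
Qed.

Section Char2.
Variable k : finFieldType.
Hypothesis k2 : (2 : k) = 0.
Local Notation AS := (@artin_schreier k).
Local Notation q := #|k|.

Lemma addkk (x : k) : x + x = 0. Proof. by rewrite -mulr2n -mulr_natr k2 mulr0. Qed.
Lemma oppk (x : k) : - x = x. Proof. by apply/eqP; rewrite eq_sym -addr_eq0 addkk. Qed.
Lemma sqrkD (x y : k) : (x + y) ^+ 2 = x ^+ 2 + y ^+ 2.
Proof. by rewrite sqrrD -mulr_natr k2 mulr0 addr0. Qed.
Lemma addkI (x y : k) : x + y = 0 -> x = y.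
Proof. by move=> /eqP; rewrite addr_eq0 oppk => /eqP. Qed.

Lemma sqrk_inj : injective (fun x : k => x ^+ 2).
Proof.
move=> x y /= h; apply: addkI; apply/eqP; rewrite -sqrf_eq0 sqrkD h addkk //.
Qed.

Lemma sqrk_bij : bijective (fun x : k => x ^+ 2).
Proof. exact: injF_bij sqrk_inj. Qed.

Lemma ASD a b : AS a -> AS b -> AS (a + b).
Proof.
move=> /existsP [x /eqP <-] /existsP [y /eqP <-]; apply/existsP; exists (x + y).
by rewrite sqrkD addrACA.
Qed.

Lemma AS_root (x y : k) : (y ^+ 2 + y == x ^+ 2 + x) = (y == x) || (y == x + 1).
Proof.
rewrite -subr_eq0; have -> : y ^+ 2 + y - (x ^+ 2 + x) = (y - x) * (y - (x + 1)) + (y - x) * (x * 2 + 2) by ring.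
by rewrite !k2 mulr0 addr0 mulr0 addr0 mulf_eq0 !subr_eq0.
Qed.

Lemma card_AS_fiber z : #|[set y : k | y ^+ 2 + y == z]| = if AS z then 2 else 0.
Proof.
case: ifP => [/existsP [x /eqP <-]|h].
  have -> : [set y : k | y ^+ 2 + y == x ^+ 2 + x] = [set x; x + 1].
    by apply/setP => y; rewrite !inE AS_root.
  by rewrite cards2 -subr_eq0 opprD addrA subrr sub0r oppr_eq0 oner_eq0.
apply/eqP; rewrite cards_eq0; apply/eqP/setP => y; rewrite !inE; apply/negbTE.
by apply: contraFN h => h; apply/existsP; exists y.
Qed.

Lemma card_AS : (2 * #|[set z | AS z]|)%N = q.
Proof.
pose fib z := [set y : k | y ^+ 2 + y == z].
have -> : q = (\sum_(z : k) #|fib z|)%N.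
  rewrite -sum1_card (partition_big (fun y : k => y ^+ 2 + y) predT) //=.
  by apply: eq_bigr => z _; rewrite -sum1_card; apply: eq_bigl => y; rewrite inE.
rewrite /fib; under eq_bigr do rewrite card_AS_fiber.
rewrite -big_mkcond /= sum_nat_const mulnC; congr (_ * _)%N.
by apply: eq_card => z; rewrite inE.
Qed.

(** The image of y |-> y^2 + y is a subgroup of index 2, so it and its translate by [a] cover the
    field. *)
Lemma ASN a b : ~~ AS a -> ~~ AS b -> AS (a + b).
Proof.
move=> na nb; pose A := [set z | AS z]; pose B := [set a + z | z in A].
have cB : #|B| = #|A| by rewrite card_imset //; exact: addrI.
have dis : [disjoint A & B].
  rewrite disjoint_sym; apply/pred0P => z /=; apply/negbTE/negP => /andP[/imsetP [c]].
  rewrite !inE => hc -> h; case/negP: na; have := ASD h hc.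
  by rewrite -addrA addkk addr0.
have : A :|: B = setT.
  apply/eqP; rewrite eqEcard subsetT cardsT cardsU.
  move: dis; rewrite -setI_eq0 => /eqP ->; rewrite cards0 subn0 cB /=; rewrite addnn -mul2n; exact: eq_leq (esym card_AS).
move/setP/(_ b); rewrite !inE (negPf nb) /= => /imsetP [c]; rewrite inE => hc ->.
by rewrite addrA addkk add0r.
Qed.

Lemma chiD (a b : k) : chi (a + b) = chi a * chi b.
Proof.
rewrite /chi; case: (boolP (AS a)) (boolP (AS b)) => [ha [hb|hb]|ha [hb|hb]].
- by rewrite ASD.
- case: ifP => // h; case/negP: hb; have := ASD ha h; by rewrite addrA addkk add0r.
- case: ifP => // h; case/negP: ha; have := ASD h hb; by rewrite -addrA addkk addr0.
- by rewrite ASN.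
Qed.

Lemma chi_sqr (a : k) : chi (a ^+ 2) = chi a.
Proof.
have -> : a ^+ 2 = (a ^+ 2 + a) + a by rewrite -addrA addkk addr0.
rewrite chiD [X in X * _](_ : _ = 1) ?mul1r //.
by rewrite /chi ifT //; apply/existsP; exists a.
Qed.

Lemma chi0 : chi (0 : k) = 1.
Proof. by rewrite /chi ifT //; apply/existsP; exists 0; rewrite expr0n addr0. Qed.

Lemma card_AS_chi z : (#|[set y : k | y ^+ 2 + y == z]|)%:Z = 1 + chi z.
Proof. by rewrite card_AS_fiber /chi; case: ifP. Qed.

Lemma card_quad (u R : k) : u != 0 ->
  (#|[set y : k | y ^+ 2 + u * y == R]|)%:Z = 1 + chi (R / u ^+ 2).
Proof.
move=> u0; rewrite -card_AS_chi; congr Posz.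
rewrite -[RHS](card_imset _ (mulfI u0)); apply: eq_card => y; rewrite inE.
apply/eqP/imsetP => [h|[z + ->]].
  exists (y / u); last by rewrite mulrC divfK.
  by rewrite inE -h; apply/eqP; field.
by rewrite inE => /eqP h; rewrite -(divfK (expf_neq0 2 u0) R) -h; ring.
Qed.

Lemma sum_chi : \sum_(z : k) chi z = 0.
Proof.
rewrite (eq_bigr (fun z => (if AS z then 2 else 0) - 1)); last by move=> z _; rewrite /chi; case: ifP.
by rewrite sumrB -big_mkcond /= !sumr_const -[X in _ - 1 *+ X]card_AS cardsE mulrnA subrr.
Qed.

Lemma divdiv (s x : k) : s != 0 -> s / (s / x) = x.
Proof. by move=> s0; rewrite invf_div mulrCA divff ?mulr1. Qed.

Lemma sum_chi_inv (s : k) : s != 0 -> \sum_(x : k | x != 0) chi (s / x) = -1.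
Proof.
move=> s0; rewrite (reindex_onto (fun x => s / x) (fun x => s / x)) /=; last first.
  by move=> x x0; rewrite invf_div mulrC divfK.
have := sum_chi; rewrite (bigD1 0) //= chi0 => /eqP; rewrite addrC addr_eq0 => /eqP <-.
have e (x : k) : (s / x != 0) && (s / (s / x) == x) = (x != 0).
  have [->|x0] := eqVneq x 0; first by rewrite invr0 mulr0 eqxx.
  by rewrite divdiv // eqxx andbT mulf_neq0 ?invr_eq0.
apply: eq_big => x; rewrite e // => x0.
by rewrite invf_div mulrC divfK.
Qed.

Lemma kloosterman_sqr (s : k) : kloosterman (s ^+ 2) = kloosterman s.
Proof.
rewrite /kloosterman (reindex_inj sqrk_inj) /=; apply: eq_big => x; first by rewrite sqrf_eq0.
by move=> _; rewrite -[RHS]chi_sqr sqrkD expr_div_n.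
Qed.

Section Arith.
Variable s : k.
Hypothesis s0 : s != 0.
Let N i j := #|[set x : k | [&& x != 0, AS x == i & AS (s / x) == j]]|.

Let invol i j : N i j = N j i.
Proof.
have inj : injective (fun x : k => s / x).
  by move=> x y /(mulfI s0) /invr_inj.
rewrite /N -(card_imset _ inj); apply: eq_card => y; rewrite !inE.
apply/imsetP/idP => [[x + ->]|/and3P[y0 h1 h2]].
  rewrite inE => /and3P[x0 h1 h2]; rewrite divdiv // h1 h2.
  by rewrite mulf_neq0 ?invr_eq0.
exists (s / y); last by rewrite invf_div mulrC divfK.
by rewrite inE divdiv // h1 h2 mulf_neq0 ?invr_eq0.
Qed.

Let card_nAS : (2 * (N true false + N false false))%N = q.
Proof.
have -> : (N true false + N false false)%N = #|[set z | ~~ AS z]|.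
  have inj : injective (fun x : k => s / x).
    by move=> x y /(mulfI s0) /invr_inj.
  rewrite -(card_imset _ inj) /N -cardsUI.
  have -> : [set x : k | [&& x != 0, AS x == true & AS (s / x) == false]] :&:
    [set x | [&& x != 0, AS x == false & AS (s / x) == false]] = set0.
    by apply/setP => x; rewrite !inE; case: (AS x); rewrite /= !andbF.
  rewrite cards0 addn0; apply: eq_card => y; rewrite !inE.
  apply/idP/imsetP => [h|[x + ->]].
    exists (s / y).
      by rewrite inE; case/orP: h => /and3P[_ _ /eqP ->].
    have y0 : y != 0 by case/orP: h => /andP[].
    by rewrite invf_div mulrC divfK.
  rewrite inE => h; have x0 : x != 0.
    by apply: contraNneq h => ->; apply/existsP; exists 0; rewrite expr0n addr0.
  have -> : s / x != 0 by rewrite mulf_neq0 ?invr_eq0.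
  by rewrite !divdiv // (negPf h); case: (AS (s / x)).
by have := card_AS; rewrite -(cardsC [set z | AS z]) => h; have -> : [set z | ~~ AS z] = ~: [set z | AS z];
  [apply/setP => z; rewrite !inE | move: h; lia].
Qed.

(** chi x chi (s/x) is -1 exactly on the two mixed classes, which x |-> s/x exchanges; this accounts
    for the factor 4. *)
Let kloosE : kloosterman s = q%:Z - 1 - 4 * (N true false)%:Z.
Proof.
have -> : kloosterman s = \sum_(x : k | x != 0) (1 - 2 * ((AS x == true) && (AS (s / x) == false) : nat)%:Z
     - 2 * ((AS x == false) && (AS (s / x) == true) : nat)%:Z).
  by apply: eq_bigr => x _; rewrite chiD /chi; case: (AS x) (AS (s / x)) => [] [].
rewrite !sumrB -!mulr_sumr.
have cnt i j : \sum_(x : k | x != 0) ((AS x == i) && (AS (s / x) == j) : nat)%:Z = (N i j)%:Z.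
  rewrite /N -[RHS]natz -sum1_card natr_sum [RHS]big_mkcond [LHS]big_mkcond /=; apply: eq_bigr => x _.
  by rewrite inE; case: (x != 0); case: (AS x == i); case: (AS (s / x) == j).
rewrite !cnt invol sumr_const.
have -> : #|[pred x : k | x != 0]| = q.-1 by rewrite -(cardC1 (0 : k)); apply: eq_card => x; rewrite !inE.
have : (0 < q)%N by rewrite (cardD1 0) inE.
rewrite -[1 *+ q.-1]/(q.-1%:R) natz; move: (N _ _) => a; case: (q) => // c _ /=; lia.
Qed.

Lemma kloosterman_mod4 : (4 %| q)%N -> exists c : int, kloosterman s = 4 * c + 3.
Proof. by move=> /dvdnP [c ec]; exists (c%:Z - 1 - (N true false)%:Z); rewrite kloosE ec; lia. Qed.

(** The involution x |-> s/x acts on the set counted here, and its only possible fixed point is the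
    square root of s, which has the same trace as s. *)
Let N11 : exists c, N false false = (2 * c + ~~ AS s)%N.
Proof.
have [|c hc] := @card_involution k (fun x => s / x) [set x : k | [&& x != 0, AS x == false & AS (s / x) == false]].
  move=> x; rewrite !inE => /and3P[x0 h1 h2]; rewrite !divdiv // h1 h2.
  by rewrite mulf_neq0 ?invr_eq0.
exists c; rewrite /N hc; congr (_ + _)%N.
have [g _ gK] := sqrk_bij.
have gs : g s ^+ 2 = s := gK s.
have g0 : g s != 0 by apply: contraNneq s0 => h; rewrite -gs h expr0n.
have gg : s / g s = g s by rewrite -{1}gs expr2 mulfK.
have ASg : AS (g s) = AS s.
  by have := chi_sqr (g s); rewrite gs /chi; case: (AS s) (AS (g s)) => [] [].
have fix_ x : x != 0 -> (s / x == x) = (x == g s).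
  move=> x0; apply/eqP/eqP => [h|->]; last exact: gg.
  by apply: sqrk_inj; rewrite gs /= expr2 -{1}h divfK.
case: (boolP (AS s)) => hs.
  apply/eqP; rewrite cards_eq0; apply/eqP/setP => x; rewrite !inE.
  apply/negbTE/negP => /andP[/and3P[x0 h1 _]]; rewrite fix_ // => /eqP e.
  by move: h1; rewrite e ASg hs.
have -> : [set x in [set x | [&& x != 0, AS x == false & AS (s / x) == false]] | s / x == x] = [set g s].
  apply/setP => x; rewrite !inE; apply/idP/eqP => [/andP[/and3P[x0 _ _]]|->].
    by rewrite fix_ // => /eqP.
  by rewrite gg g0 ASg (negPf hs) !eqxx.
by rewrite cards1.
Qed.

(** When 8 divides q, [card_nAS] gives [N true false] and [N false false] the same parity. The first
    is even because K = 7 mod 8, and the second is even exactly when Tr s = 0. *)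
Lemma kloosterman_mod8 (c : int) : (8 %| q)%N -> kloosterman s = 8 * c + 7 -> chi s = 1.
Proof.
move=> /dvdnP [d ed] h; have [b hb] := N11; have := card_nAS; move: h; rewrite kloosE hb /chi.
by case: (AS s) => //=; lia.
Qed.
End Arith.
End Char2.

Section Exists.
Variable k : finFieldType.
Hypothesis k2 : (2 : k) = 0.

Lemma split_ptsE (s : k) b : split_pts s b = [set x | (x != 0) && (artin_schreier (x + s / x) == b)].
Proof.
apply/setP => x; rewrite !inE; case: eqVneq => //= x0; congr (_ == _).
apply: eq_existsb => y; rewrite -[RHS](inj_eq (mulIf x0)).
by rewrite [(x + _) * _]mulrDl divfK // [x ^+ 2]expr2.
Qed.

Lemma kloosterman_split (s : k) :
  kloosterman s = #|split_pts s true|%:Z - #|split_pts s false|%:Z /\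
  (#|split_pts s true| + #|split_pts s false|).+1 = #|k|.
Proof.
rewrite !split_ptsE; split.
  have cnt b : (#|[set x | (x != 0) && (artin_schreier (x + s / x) == b)]|)%:Z =
      \sum_(x : k | x != 0) (artin_schreier (x + s / x) == b : nat)%:Z.
    rewrite -[LHS]natz -sum1_card natr_sum [LHS]big_mkcond [RHS]big_mkcond /=; apply: eq_bigr => x _.
    by rewrite inE; case: (x != 0); case: (_ == b).
  rewrite !cnt -sumrB; apply: eq_bigr => x _; rewrite /chi.
  by case: artin_schreier.
rewrite -cardsUI.
have -> : [set x | (x != 0) && (artin_schreier (x + s / x) == true)] :&:
   [set x | (x != 0) && (artin_schreier (x + s / x) == false)] = set0.
  by apply/setP => x; rewrite !inE; case: artin_schreier; rewrite /= !andbF.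
rewrite cards0 addn0.
have -> : [set x | (x != 0) && (artin_schreier (x + s / x) == true)] :|:
   [set x | (x != 0) && (artin_schreier (x + s / x) == false)] = [set~ 0].
  by apply/setP => x; rewrite !inE; case: artin_schreier; case: (x == 0).
rewrite cardsC1 prednK //; apply/card_gt0P; by exists 0.
Qed.

(** The lower bounds h1 - 1 and h2 - 1 add up to q - 1, so they are attained and K is -t or t. Since
    t = 1 mod 4, the congruence K = 3 mod 4 selects -t. *)
Lemma exists_kloosterman (n : nat) (e : int) : (2 <= n)%N -> #|k| = (2 ^ n)%N ->
  (4 * e + 1 + 2 ^+ n) ^+ 2 < 4 * 2 ^+ n :> int ->
  exists2 s : k, s != 0 & kloosterman s = - (4 * e + 1 + 2 ^+ n).
Proof.
move=> n2 kq ht; set Q : int := 2 ^+ n in ht *.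
have [d hd] : exists d : nat, (2 ^ n = 4 * d)%N by exists (2 ^ (n - 2))%N; rewrite -(expnD 2 2) subnKC.
have eQ : Q = 4 * d%:Z by rewrite /Q -[2]/(2%:Z) -rmorphXn /= -PoszM -hd; congr Posz; rewrite natrXE.
have d0 : (0 < d)%N by move: (expn_gt0 2 n); rewrite hd; lia.
(* From t^2 < 4q <= (q + 1)^2 one gets |t| < q + 1, which amounts to h1 > 0 and h2 > 0. *)
have e0 : e < 0.
  rewrite ltNge; apply/negP => e0; move: ht; apply/negP; rewrite -leNgt.
  apply: (@le_trans _ _ ((Q + 1) ^+ 2)).
    rewrite -subr_ge0; have -> : (Q + 1) ^+ 2 - 4 * Q = (Q - 1) ^+ 2 by ring.
    exact: sqr_ge0.
  by rewrite ler_sqr ?nnegrE; lia.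
have e1 : 0 < Q + 1 + 2 * e.
  rewrite ltNge; apply/negP => e1; move: ht; apply/negP; rewrite -leNgt.
  apply: (@le_trans _ _ ((Q + 1) ^+ 2)).
    rewrite -subr_ge0; have -> : (Q + 1) ^+ 2 - 4 * Q = (Q - 1) ^+ 2 by ring.
    exact: sqr_ge0.
  rewrite -[leRHS]sqrrN ler_sqr ?nnegrE; lia.
have [||s s0 hs] := @exists_param k n e (ltnW n2) ht kq k2 `|(- 2 * e)%R|%N `|(Q + 1 + 2 * e)%R|%N; [by lia | by rewrite -/Q; lia |].
exists s => //; have [hk hsum] := kloosterman_split s.
have [c hc] : exists c : int, kloosterman s = 4 * c + 3.
  by apply: kloosterman_mod4 => //; rewrite kq hd dvdn_mulr.
move: hs hk hsum hc; rewrite kq hd eQ; rewrite eQ in e1.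
move: (#|split_pts s true|) (#|split_pts s false|) (kloosterman s) => P M K.
clear - e0 e1 d0; lia.
Qed.

End Exists.

(** * A family of plane quartics *)

Definition quartic (A : comNzRingType) (a b c x y z : A) : A :=
  z ^+ 4 + (x ^+ 2 + x * y + y ^+ 2) * z ^+ 2 + x * y * (x + y) * z +
  a * (x ^+ 2 + x * y) ^+ 2 + b * (x ^+ 2 + x * y) * y ^+ 2 + c * y ^+ 4.

Section Count.
Variable k : finFieldType.
Hypothesis k2 : (2 : k) = 0.
Local Notation q := #|k|.
Local Notation chi := (@chi k).

Lemma card_sqr_fiber c : (#|[set z : k | z ^+ 4 + z ^+ 2 == c]|)%:Z = 1 + chi c.
Proof.
have [g _ gK] := sqrk_bij k2; rewrite -(gK c) (chi_sqr k2) -(card_AS_chi k2); congr Posz.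
apply: eq_card => z; rewrite !inE -[RHS](inj_eq (@sqrk_inj k k2)) (sqrkD k2) -exprM.
by rewrite [X in _ == X]gK.
Qed.

(** The additive polynomial is the composite of z^2 + x z and w^2 + (x + 1) w. The number of z above
    a root w depends on chi (w/x^2), which does not depend on the root, so the count is a product (1
    + A) (1 + B). *)
Lemma card_quartic_fiber (x R : k) : x != 0 -> x != 1 ->
  (#|[set z : k | z ^+ 4 + (x ^+ 2 + x + 1) * z ^+ 2 + (x ^+ 2 + x) * z == R]|)%:Z =
  1 + chi (R / (x + 1) ^+ 2) + chi (R / (x ^+ 2 + x) ^+ 2) + chi (R / x ^+ 2).
Proof.
move=> x0 x1; have x10 : x + 1 != 0 by rewrite addr_eq0 (oppk k2).
have g0 : x ^+ 2 + x != 0 by rewrite expr2 -[X in _ + X]mulr1 -mulrDr mulf_neq0.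
pose W := [set w : k | w ^+ 2 + (x + 1) * w == R].
pose f z := z ^+ 2 + x * z; pose S w := [set z : k | f z == w].
have cW w : w \in W -> chi (w / x ^+ 2) = chi (R / (x ^+ 2 + x) ^+ 2).
  rewrite inE => /eqP <-.
  have -> : (w ^+ 2 + (x + 1) * w) / (x ^+ 2 + x) ^+ 2 = (w / (x ^+ 2 + x)) ^+ 2 + w * (x + 1) / (x ^+ 2 + x) ^+ 2.
    by field.
  rewrite chiD // chi_sqr // -chiD //; congr chi.
  have -> : w / (x ^+ 2 + x) + w * (x + 1) / (x ^+ 2 + x) ^+ 2 = w / x ^+ 2 * ((x ^+ 2 + x + x + 1) * (x + 1) / (x + 1) ^+ 3).
    by field; rewrite x0 x10 g0.
  have -> : x ^+ 2 + x + x + 1 = (x + 1) ^+ 2 by ring.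
  by rewrite -exprSr divff ?mulr1 // expf_neq0.
have fE z : f z ^+ 2 + (x + 1) * f z = z ^+ 4 + (x ^+ 2 + x + 1) * z ^+ 2 + (x ^+ 2 + x) * z.
  transitivity (z ^+ 4 + (x ^+ 2 + x + 1) * z ^+ 2 + (x ^+ 2 + x) * z + 2 * (x * z ^+ 3)); first by rewrite /f; ring.
  by rewrite k2 mul0r addr0.
transitivity (\sum_(w in W) (#|S w|)%:Z).
  rewrite -[LHS]natz -sum1_card natr_sum (partition_big f (mem W)) /=.
    apply: eq_bigr => w; rewrite inE => /eqP wW; rewrite -[RHS]natz -sum1_card natr_sum; apply: eq_bigl => z; rewrite !inE.
    case: (eqVneq (f z) w) => [e|]; rewrite ?andbF // andbT.
    by rewrite -fE e; apply/eqP.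
  move=> z; rewrite !inE => /eqP <-; by rewrite fE.
rewrite (eq_bigr (fun _ => 1 + chi (R / (x ^+ 2 + x) ^+ 2))); last first.
  by move=> w wW; rewrite card_quad // cW.
rewrite sumr_const -mulr_natl -/W natz card_quad //.
set A := chi _; set B := chi _; transitivity (1 + A + B + A * B); first by ring.
congr (_ + _); rewrite -chiD //; congr chi.
have -> : R / (x + 1) ^+ 2 + R / (x ^+ 2 + x) ^+ 2 = R / x ^+ 2 * ((x ^+ 2 + 1) / (x + 1) ^+ 2).
  by field; rewrite x0 x10 g0.
by rewrite -[X in _ + X](expr1n _ 2) -(sqrkD k2) divff ?mulr1 // expf_neq0.
Qed.

(** The trace of 1 is n: a root y of y^2 + y = 1 satisfies y^(2^j) = y + j, against y^q = y when n
    is odd. *)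
Lemma chi1 n : #|k| = (2 ^ n)%N -> odd n -> chi 1 = -1.
Proof.
move=> kq on; rewrite /chi; case: ifP => // /existsP [y /eqP hy].
have y2 : y ^+ 2 = y + 1 by rewrite -hy addrCA (addkk k2) addr0.
have frob j : y ^+ (2 ^ j) = y + (odd j)%:R.
  elim: j => [|j IH]; first by rewrite addr0.
  rewrite expnSr exprM IH (sqrkD k2) y2 -addrA /=; congr (_ + _).
  by case: (odd j); rewrite /= ?expr1n ?(addkk k2) // expr0n addr0.
have := expf_card y; rewrite kq frob on => /eqP.
by rewrite -subr_eq0 addrC addKr oner_eq0.
Qed.

Definition quartic_points (a b c : k) : nat :=
  #|[set v : k * k | quartic a b c v.1 1 v.2 == 0]| + #|[set z : k | quartic a b c 1 0 z == 0]|.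

(** The separate terms are the points with y = 0, counted by 1 + chi a, and those above x = 0 and x
    = 1, where the additive polynomial degenerates to z^4 + z^2. *)
Lemma quartic_pointsE a b c (R := fun x => a * (x ^+ 2 + x) ^+ 2 + b * (x ^+ 2 + x) + c) :
  (quartic_points a b c)%:Z = 1 + chi a + 2 * (1 + chi c) +
    \sum_(x : k | (x != 0) && (x != 1))
       (1 + chi (R x / (x + 1) ^+ 2) + chi (R x / (x ^+ 2 + x) ^+ 2) + chi (R x / x ^+ 2)).
Proof.
have inf : [set z : k | quartic a b c 1 0 z == 0] = [set z | z ^+ 4 + z ^+ 2 == a].
  apply/setP => z; rewrite !inE -[RHS]subr_eq0 (oppk k2); congr (_ == _); rewrite /quartic; ring.
pose S x := [set z : k | quartic a b c x 1 z == 0].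
have aff : #|[set v : k * k | quartic a b c v.1 1 v.2 == 0]| = (\sum_(x : k) #|S x|)%N.
  rewrite -sum1_card; under [RHS]eq_bigr do rewrite -sum1_card.
  rewrite pair_big_dep /=; apply: eq_bigl => v; by rewrite !inE.
have SE x : S x = [set z | z ^+ 4 + (x ^+ 2 + x + 1) * z ^+ 2 + (x ^+ 2 + x) * z == R x].
  apply/setP => z; rewrite !inE -[RHS]subr_eq0 (oppk k2); congr (_ == _); rewrite /quartic /R; ring.
have S01 x : x ^+ 2 + x = 0 -> (#|S x|)%:Z = 1 + chi c.
  move=> hx; rewrite SE hx /R hx -card_sqr_fiber; congr Posz; apply: eq_card => z.
  by rewrite !inE; congr (_ == _); ring.
rewrite /quartic_points inf aff PoszD card_sqr_fiber -natz natr_sum.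
rewrite (eq_bigr (fun x => (#|S x|)%:Z)); last by move=> x _; rewrite natz.
rewrite (bigD1 0) // (bigD1 1) ?oner_neq0 //= !S01 ?expr0n ?addr0 ?expr1n ?(addkk k2) //.
rewrite [X in _ + (_ + X)](eq_bigr (fun x => 1 + chi (R x / (x + 1) ^+ 2) + chi (R x / (x ^+ 2 + x) ^+ 2) + chi (R x / x ^+ 2))).
  by ring.
by move=> x /andP[x0 x1]; rewrite SE card_quartic_fiber.
Qed.

Lemma sum_shift (F : k -> int) :
  \sum_(x : k | (x != 0) && (x != 1)) F (x + 1) = \sum_(x : k | (x != 0) && (x != 1)) F x.
Proof.
rewrite [RHS](reindex_inj (addIr 1)) /=; apply: eq_bigl => x.
by rewrite andbC -[x + 1 == 1]subr_eq0 addrK addr_eq0 (oppk k2).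
Qed.

Lemma sum_neq01 (F : k -> int) :
  \sum_(x : k | (x != 0) && (x != 1)) F x = \sum_(x : k | x != 0) F x - F 1.
Proof. by rewrite [in RHS](bigD1 1) ?oner_neq0 //= addrAC subrr add0r. Qed.

Lemma sum_const_neq01 : \sum_(x : k | (x != 0) && (x != 1)) (1 : int) = q%:Z - 2.
Proof.
rewrite sum_neq01; have : \sum_(x : k) (1 : int) = q%:Z by rewrite sumr_const natz.
by rewrite (bigD1 0) //= => <-; ring.
Qed.

Lemma sum_AS (F : k -> int) :
  \sum_(x : k | (x != 0) && (x != 1)) F (x ^+ 2 + x) = \sum_(u : k | u != 0) F u * (1 + chi u).
Proof.
have e (x : k) : (x ^+ 2 + x != 0) = (x != 0) && (x != 1).
  have -> : x ^+ 2 + x = x * (x + 1) by ring.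
  by rewrite mulf_eq0 negb_or addr_eq0 (oppk k2).
rewrite (partition_big (fun x : k => x ^+ 2 + x) (fun u => u != 0)) /=; last by move=> x; rewrite e.
apply: eq_bigr => u u0; rewrite -(card_AS_chi k2) -natz -sum1_card natr_sum mulr_sumr.
apply: eq_big => x; last by move=> /andP[_ /eqP <-]; rewrite mulr1.
by rewrite inE -e; case: (eqVneq (x ^+ 2 + x) u) => [->|]; rewrite ?andbF // u0.
Qed.

Lemma sum_chi_AS s : s != 0 ->
  \sum_(x : k | (x != 0) && (x != 1)) chi (s / (x ^+ 2 + x)) = kloosterman s - 1.
Proof.
move=> s0; rewrite (sum_AS (fun u => chi (s / u))).
under eq_bigr do rewrite mulrDr mulr1 -(chiD k2).
rewrite big_split /= (sum_chi_inv k2 s0) addrC; congr (_ - _).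
by apply: eq_bigr => u _; rewrite addrC.
Qed.

(** Replacing squares by their roots, which does not affect chi, makes each of the three arguments 1
    plus an argument whose sum is K up to a constant; chi 1 = -1 gives the minus sign. *)
Lemma quartic_points1 n (s : k) : #|k| = (2 ^ n)%N -> odd n -> s != 0 ->
  (quartic_points 1 0 (s ^+ 2))%:Z = q%:Z + 1 - 3 * kloosterman s.
Proof.
move=> kq on s0; have c1 := chi1 kq on.
rewrite quartic_pointsE c1 (chi_sqr k2).
rewrite (eq_bigr (fun x => 1 - chi ((x + 1) + s / (x + 1)) - chi (s / (x ^+ 2 + x)) - chi (x + s / x))).
  rewrite !sumrB sum_const_neq01 (sum_shift (fun x => chi (x + s / x))) sum_neq01 (sum_chi_AS s0) -/(kloosterman s).
  by rewrite divr1 (chiD k2) c1; ring.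
move=> x /andP[x0 x1]; have x10 : x + 1 != 0 by rewrite addr_eq0 (oppk k2).
have g0 : x ^+ 2 + x != 0 by rewrite expr2 -[X in _ + X]mulr1 -mulrDr mulf_neq0.
rewrite mul1r mul0r addr0; congr (_ + _ + _ + _).
- have -> : ((x ^+ 2 + x) ^+ 2 + s ^+ 2) / (x + 1) ^+ 2 = (x + s / (x + 1)) ^+ 2 - 2 * (x * s / (x + 1)) by field.
  rewrite k2 mul0r subr0 (chi_sqr k2) -addrA [1 + _]addrC addrA (chiD k2 _ 1) c1; ring.
- have -> : ((x ^+ 2 + x) ^+ 2 + s ^+ 2) / (x ^+ 2 + x) ^+ 2 = 1 + (s / (x ^+ 2 + x)) ^+ 2 by field.
  by rewrite (chiD k2) (chi_sqr k2) c1; ring.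
- have -> : ((x ^+ 2 + x) ^+ 2 + s ^+ 2) / x ^+ 2 = (x + 1 + s / x) ^+ 2 - 2 * ((x + 1) * s / x) by field.
  by rewrite k2 mul0r subr0 (chi_sqr k2) addrAC (chiD k2 _ 1) c1; ring.
Qed.

Lemma quartic_points2 (r : k) : r != 0 -> chi r = 1 ->
  (quartic_points (r ^+ 2) r 0)%:Z = q%:Z + 1 + 3 * kloosterman r.
Proof.
move=> r0 cr; rewrite quartic_pointsE (chi_sqr k2) (chi0 k) cr.
pose h x := chi (r * x + r / x).
have sh : \sum_(x : k | (x != 0) && (x != 1)) h x = kloosterman r - 1.
  rewrite sum_neq01 /h mulr1 divr1 (addkk k2) (chi0 k) -(kloosterman_sqr k2); congr (_ - _).
  rewrite /kloosterman [RHS](reindex_inj (mulfI r0)) /=; apply: eq_big => x; first by rewrite mulf_eq0 (negPf r0).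
  by move=> x0; congr chi; field; rewrite x0 r0.
rewrite (eq_bigr (fun x => 1 + h (x + 1) + chi (r / (x ^+ 2 + x)) + h x)).
  by rewrite !big_split /= sum_const_neq01 (sum_shift h) sh (sum_chi_AS r0); ring.
move=> x /andP[x0 x1]; have x10 : x + 1 != 0 by rewrite addr_eq0 (oppk k2).
have g0 : x ^+ 2 + x != 0 by rewrite expr2 -[X in _ + X]mulr1 -mulrDr mulf_neq0.
rewrite addr0; congr (_ + _ + _ + _).
- have -> : (r ^+ 2 * (x ^+ 2 + x) ^+ 2 + r * (x ^+ 2 + x)) / (x + 1) ^+ 2 = (r * x) ^+ 2 + (r - r / (x + 1)) by field.
  rewrite (oppk k2) (chiD k2) (chi_sqr k2) -(chiD k2); congr chi; by rewrite mulrDr mulr1 addrA.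
- have -> : (r ^+ 2 * (x ^+ 2 + x) ^+ 2 + r * (x ^+ 2 + x)) / (x ^+ 2 + x) ^+ 2 = r ^+ 2 + r / (x ^+ 2 + x) by field.
  by rewrite (chiD k2) (chi_sqr k2) cr mul1r.
- have -> : (r ^+ 2 * (x ^+ 2 + x) ^+ 2 + r * (x ^+ 2 + x)) / x ^+ 2 = (r * (x + 1)) ^+ 2 + (r + r / x) by field.
  rewrite (chiD k2) (chi_sqr k2) -(chiD k2); congr chi.
  by rewrite mulrDr mulr1 addrA -[r * x + r + r]addrA (addkk k2) addr0.
Qed.

End Count.

(** * Irreducibility of an affine quartic over the rational functions *)

Local Open Scope quotient_scope.
Local Open Scope ring_scope.

Lemma fraction_div (R : idomainType) (x : {fraction R}) :
  exists n d : R, d != 0 /\ x = tofrac n / tofrac d.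
Proof.
elim/quotW: x => r; exists (frac r).1, (frac r).2; split; first exact: denom_ratioP.
have d0 := denom_ratioP r.
apply/eqP; rewrite -(inj_eq (mulIf (_ : tofrac (frac r).2 != 0))) ?tofrac_eq0 // divfK ?tofrac_eq0 //.
rewrite /tofrac; unlock; rewrite -[X in X == _]/(FracField.mul _ _) !piE.
rewrite /FracField.mulf /= FracField.equivfE.
rewrite !(numer_Ratio, denom_Ratio) ?oner_neq0 ?mulr1 ?mulf_neq0 ?oner_neq0 //.
by rewrite mulrC.
Qed.

Local Close Scope quotient_scope.

Lemma clear_denominator (F : fieldType) (n m g d r : F) : m * g != 0 ->
  (n * g / (m * g)) ^+ 2 + d * (n * g / (m * g)) = r -> n ^+ 2 + d * n * m = r * m ^+ 2.
Proof.
rewrite mulf_eq0 negb_or => /andP[m0 g0] <-; by field; rewrite m0 g0.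
Qed.

(** Comparing the coefficients of (z^2 + u z + v) (z^2 + u' z + v') gives u' = u and (u + 1) (u + X)
    (u + X + 1) = 0; the three values of u are the three cases. *)
Lemma two_quadratics (F : fieldType) (X S u u' v v' : F) : (2 : F) = 0 -> u + u' = 0 ->
  v + v' + u * u' = X ^+ 2 + X + 1 -> v * u' + v' * u = X ^+ 2 + X -> v * v' = S ->
  [\/ v ^+ 2 + (X ^+ 2 + X) * v = S, v ^+ 2 + (X + 1) * v = S | v ^+ 2 + X * v = S].
Proof.
move=> F2 h3 h2 h1 h0.
have eu : u' = u.
  apply/eqP; rewrite -subr_eq0; apply/eqP; transitivity (u + u' - 2 * u); first by ring.
  by rewrite h3 F2 mul0r subr0.
rewrite eu in h1 h2.
have hD : v + v' = X ^+ 2 + X + 1 + u ^+ 2.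
  transitivity (v + v' + u * u + u ^+ 2 - 2 * u ^+ 2); first by ring.
  by rewrite h2 F2 mul0r subr0.
have sol D : v + v' = D -> v ^+ 2 + D * v = S.
  move=> <-; transitivity (v * v' + 2 * v ^+ 2); first by ring.
  by rewrite F2 mul0r addr0.
have : (u + 1) * ((u + X) * (u + X + 1)) = 0.
  transitivity (u * (v + v') + (X ^+ 2 + X) + 2 * ((X + 1) * u ^+ 2 + X * u)); first by rewrite hD; ring.
  have -> : u * (v + v') = X ^+ 2 + X by rewrite -h1; ring.
  by rewrite F2 mul0r addr0 -mulr2n -mulr_natr F2 mulr0.
move=> /eqP; rewrite !mulf_eq0.
have add2 (x y : F) : (x + y == 0) -> x = y.
  move=> /eqP e; apply/eqP; rewrite -subr_eq0; apply/eqP; transitivity (x + y - 2 * y); first by ring.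
  by rewrite e F2 mul0r subr0.
case/or3P => [/add2 e | /add2 e | ].
- constructor 1; apply: sol; rewrite hD e.
  transitivity (X ^+ 2 + X + 2); first by ring.
  by rewrite F2 addr0.
- constructor 2; apply: sol; rewrite hD e.
  transitivity (X + 1 + 2 * X ^+ 2); first by ring.
  by rewrite F2 mul0r addr0.
rewrite -addrA => /add2 e; constructor 3; apply: sol; rewrite hD e.
transitivity (X + 2 * (X ^+ 2 + X + 1)); first by ring.
by rewrite F2 mul0r addr0.
Qed.

Section Irreducible.
Variables (K : fieldType) (R : {poly K}).
Hypothesis k2 : (2 : K) = 0.
Hypothesis hR0 : R.[0] != R^`().[0] ^+ 2.
Hypothesis hR1 : R.[1] != R^`().[1] ^+ 2.
Local Notation P := {poly K}.
Local Notation E := {fraction {poly K}}.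

Let P2 : (2 : P) = 0.
Proof. by rewrite -[2]/(2%:R) -polyC_natr k2 polyC0. Qed.
Let E2 : (2 : E) = 0.
Proof. by have := congr1 (@tofrac P) P2; rewrite rmorph_nat rmorph0. Qed.

(** Differentiation of d^2 + D d = R in characteristic 2 gives d = R' at the zero x0 of D, while the
    equation itself gives d^2 = R there. *)
Let conic_root (D d : P) x0 : D.[x0] = 0 -> D^`().[x0] = 1 -> d ^+ 2 + D * d = R ->
  R.[x0] = R^`().[x0] ^+ 2.
Proof.
move=> h0 h1 e; have <- : d.[x0] = R^`().[x0].
  rewrite -e derivD expr2 !derivM !hornerE h0 h1 /=.
  transitivity (d.[x0] + 2 * (d^`().[x0] * d.[x0])); last by ring.
  by rewrite k2 mul0r addr0.
by rewrite -e !hornerE h0 mul0r addr0.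
Qed.

(** Polynomials are integrally closed: in lowest terms the denominator divides the square of the
    numerator, hence is constant. *)
Let conic_integral (D : P) (d : E) : d ^+ 2 + tofrac D * d = tofrac R ->
  exists d0 : P, d0 ^+ 2 + D * d0 = R.
Proof.
have [n [m [m0 ->]]] := fraction_div d => h.
have M0 : tofrac m != 0 by rewrite tofrac_eq0.
pose g := gcdp n m; have g0 : g != 0 by rewrite gcdp_eq0 negb_and m0 orbT.
have en : n = n %/ g * g by rewrite divpK // dvdp_gcdl.
have em : m = m %/ g * g by rewrite divpK // dvdp_gcdr.
have cop : coprimep (n %/ g) (m %/ g).
  by apply: coprimep_div_gcd; rewrite m0 orbT.
move: M0 h; set N := n %/ g in en cop; set M := m %/ g in em cop; rewrite en em => M0 h.
have Mn0 : M != 0 by apply: contraNneq m0 => e; rewrite em e mul0r.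
have e1 : N ^+ 2 + D * N * M = R * M ^+ 2.
  rewrite !tofracM in h M0; apply/eqP.
  rewrite -tofrac_eq tofracD [tofrac (R * _)]tofracM !tofracXn [tofrac (D * _ * _)]tofracM [tofrac (D * _)]tofracM; apply/eqP; exact: clear_denominator M0 h.
have dM : M %| N ^+ 2.
  have -> : N ^+ 2 = (R * M - D * N) * M by rewrite mulrBl -[R * M * M]mulrA -expr2 -e1; ring.
  exact: dvdp_mull.
have sM : size M == 1%N.
  have : M %| N ^+ 2 := dM.
  rewrite expr2 Gauss_dvdpr ?[coprimep M _]coprimep_sym // => dM'.
  by have := coprimepP _ _ cop; move/(_ M dM' (dvdpp M)); rewrite -size_poly_eq1.
have /size_poly1P [c c0 ec] := sM.
exists (c^-1 *: N); move: e1; rewrite ec => e1.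
have cP : c^-1%:P * c%:P = 1 by rewrite -polyCM mulVf.
have -> : R = c^-1%:P ^+ 2 * (R * c%:P ^+ 2).
  transitivity (R * (c^-1%:P * c%:P) ^+ 2); last by ring.
  by rewrite cP expr1n mulr1.
rewrite -e1 -mul_polyC.
transitivity (c^-1%:P ^+ 2 * N ^+ 2 + D * N * c^-1%:P * (c^-1%:P * c%:P)); last by ring.
by rewrite cP; ring.
Qed.

Let D (i : nat) : P := nth 0 [:: 'X ^+ 2 + 'X; 'X + 1; 'X] i.
Let no_conic i (d : E) : (i < 3)%N -> d ^+ 2 + tofrac (D i) * d <> tofrac R.
Proof.
move=> i3 /conic_integral [d0 e].
case: i i3 e => [|[|[|//]]] _ e; have := conic_root (x0 := 0) _ _ e; have := conic_root (x0 := 1) _ _ e.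
- move=> _ h; case/eqP: hR0; apply: h; rewrite /D /=; first by rewrite !hornerE /= ?expr0n ?addr0 ?mulr0.
  by rewrite derivD derivX expr2 derivM derivX !hornerE.
- move=> h _; case/eqP: hR1; apply: h; rewrite /D /=; first by rewrite !hornerE -mulr2n.
  by rewrite derivD derivX derivC addr0 hornerE.
- by move=> _ h; case/eqP: hR0; apply: h; rewrite /D /= ?derivX hornerE.
Qed.

Definition plane_quartic : {poly P} :=
  'X ^+ 4 + ('X ^+ 2 + 'X + 1)%:P * 'X ^+ 2 + ('X ^+ 2 + 'X)%:P * 'X + R%:P.
Local Notation f := plane_quartic.

Lemma plane_quarticE : f = \poly_(i < 5) nth 0 [:: R; 'X ^+ 2 + 'X; 'X ^+ 2 + 'X + 1; 0; 1] i.
Proof.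
apply/polyP => i; rewrite coef_poly !coefD coefXn !coefCM coefXn coefX coefC.
by case: i => [|[|[|[|[|i]]]]] /=; rewrite ?mulr0 ?mulr1 ?addr0 ?add0r.
Qed.

Lemma size_plane_quartic : size f = 5.
Proof. by rewrite plane_quarticE size_poly_eq //= oner_neq0. Qed.

Lemma plane_quartic_monic : f \is monic.
Proof. by rewrite monicE /lead_coef size_plane_quartic plane_quarticE coef_poly. Qed.

Let size_tofrac (p : {poly P}) : size (map_poly (@tofrac P) p) = size p.
Proof.
apply: size_map_inj_poly; last exact: tofrac0.
by move=> x y /eqP; rewrite tofrac_eq => /eqP.
Qed.

Let fE := map_poly (@tofrac P) f.
Let size_fE : size fE = 5.
Proof. by rewrite size_tofrac size_plane_quartic. Qed.
Let coef_fE i : fE`_i = tofrac (nth 0 [:: R; 'X ^+ 2 + 'X; 'X ^+ 2 + 'X + 1; 0; 1] i).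
Proof.
rewrite coef_map /= plane_quarticE coef_poly.
by case: i => [|[|[|[|[|i]]]]] //=; rewrite nth_nil.
Qed.

Let X : E := tofrac 'X.
(** In characteristic 2 the quartic at r is d^2 + (X^2 + X) d + R with d = r^2 + r, the first of the
    excluded conics. *)
Let fE_root (r : E) : ~ root fE r.
Proof.
move=> /eqP; rewrite (horner_coef_wide _ (eq_leq size_fE)) !big_ord_recl big_ord0 /= !coef_fE /=.
rewrite !(rmorphD, rmorph1, rmorph0, rmorphXn) /= -/X => h.
apply: (no_conic (i := 0) (d := r ^+ 2 + r)) => //=; rewrite !(rmorphD, rmorphXn) /= -/X.
apply/eqP; rewrite -subr_eq0; apply/eqP; rewrite -h.
set S := tofrac R.
transitivity ((S + (X ^+ 2 + X) * r + (X ^+ 2 + X + 1) * r ^+ 2 + r ^+ 4) + 2 * (r ^+ 3 - S)); first by ring.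
by rewrite E2; ring.
Qed.

(** A proper factor gives a root, if it or its cofactor is linear, or else a product of two
    quadratics, which [two_quadratics] turns into one of the excluded conics. *)
Let fE_div p : p %| fE -> (1 < size p)%N -> size p = 5.
Proof.
move=> /dvdpP [h e] sp; have fn0 : fE != 0 by rewrite -size_poly_eq0 size_fE.
have [h0 p0] : h != 0 /\ p != 0 by apply/andP; rewrite -negb_or -mulf_eq0 -e.
have ss : (size h + size p).-1 = 5 by rewrite -size_mul // -e size_fE.
have sh0 : (0 < size h)%N by rewrite size_poly_gt0.
have lin (u : {poly E}) : size u = 2 -> u %| fE -> False.
  move=> su du; have [r hr] := poly2_root su.
  by move: du => /dvdpP [w ew]; apply: (@fE_root r); rewrite ew rootM hr orbT.
have hp : p %| fE by rewrite e dvdp_mulIr.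
have hh : h %| fE by rewrite e dvdp_mulIl.
have [s2|n2] := eqVneq (size p) 2; first by case: (lin p).
have [s2|n2'] := eqVneq (size h) 2; first by case: (lin h).
have [s3|n3] := eqVneq (size p) 3; last by move: ss sp sh0 n2 n2' n3; lia.
exfalso; have s3' : size h = 3 by move: ss; rewrite s3; lia.
have c i : fE`_i = \sum_(j < i.+1) h`_j * p`_(i - j) by rewrite e coefM.
have hz j : (2 < j)%N -> h`_j = 0 by move=> j2; rewrite nth_default ?s3'.
have pz j : (2 < j)%N -> p`_j = 0 by move=> j2; rewrite nth_default ?s3.
move: (c 0%N) (c 1%N) (c 2%N) (c 3%N) (c 4%N).
rewrite !big_ord_recl !big_ord0 /= /bump /= !coef_fE /= ?(hz 3) ?(hz 4) ?(pz 3) ?(pz 4) // !addn0.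
rewrite !(rmorphD, rmorph1, rmorph0, rmorphXn) /= -/X => c0 c1 c2 c3 c4.
have {}c0 : tofrac R = h`_0 * p`_0 + 0 := c0.
have {}c1 : X ^+ 2 + X = h`_0 * p`_1 + (h`_1 * p`_0 + 0) := c1.
have {}c2 : X ^+ 2 + X + 1 = h`_0 * p`_2 + (h`_1 * p`_1 + (h`_2 * p`_0 + 0)) := c2.
have {}c3 : 0 = h`_0 * 0 + (h`_1 * p`_2 + (h`_2 * p`_1 + (0 * p`_0 + 0))) := c3.
have {}c4 : 1 = h`_0 * 0 + (h`_1 * 0 + (h`_2 * p`_2 + (0 * p`_1 + (0 * p`_0 + 0)))) := c4.
have e4 : h`_2 * p`_2 = 1 by rewrite [RHS]c4; ring.
have [|||| hh1|hh1|hh1] := @two_quadratics E X (tofrac R) (p`_1 * h`_2) (h`_1 * p`_2) (p`_0 * h`_2) (h`_0 * p`_2) E2.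
- by rewrite [RHS]c3; ring.
- transitivity (p`_0 * h`_2 + h`_0 * p`_2 + p`_1 * h`_1 * (h`_2 * p`_2)); first by ring.
  by rewrite e4 c2; ring.
- transitivity ((p`_0 * h`_1 + h`_0 * p`_1) * (h`_2 * p`_2)); first by ring.
  by rewrite e4 c1; ring.
- transitivity (p`_0 * h`_0 * (h`_2 * p`_2)); first by ring.
  by rewrite e4 c0; ring.
- by apply: (no_conic (i := 0) (d := p`_0 * h`_2) isT); rewrite /D /= tofracD tofracXn.
- by apply: (no_conic (i := 1) (d := p`_0 * h`_2) isT); rewrite /D /= tofracD tofrac1.
- by apply: (no_conic (i := 2) (d := p`_0 * h`_2) isT).
Qed.

(** The resultant eliminates z. If it is nonzero it serves as [r]; otherwise f and G share a factor
    over the rational functions, so f divides G by irreducibility, without denominators because f is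
    monic. Geometrically, G vanishes on the whole curve or above finitely many X only. *)
Lemma plane_quartic_dichotomy (G : {poly P}) : (exists Q, G = Q * f) \/
  exists r u v, r != 0 /\ r%:P = u * f + v * G.
Proof.
have [->|G0] := eqVneq G 0; first by left; exists 0; rewrite mul0r.
have [G1|G1] := leqP (size G) 1.
  right; exists G`_0, 0, 1; rewrite mul0r add0r mul1r -(size1_polyC G1); split=> //.
  by apply: contraNneq G0 => e; rewrite (size1_polyC G1) e.
have sf : (1 < size f)%N by rewrite size_plane_quartic.
have [r0|r0] := eqVneq (resultant f G) 0; last first.
  by right; have [[u v] [_ _ /= e]] := resultant_in_ideal sf G1; exists (resultant f G), u, v.
left; have sg : (1 < size (gcdp f G))%N by rewrite -resultant_eq0 r0.
set g := gcdp f G in sg; pose gE := map_poly (@tofrac P) g.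
have transfer (p : {poly P}) : g %| p -> gE %| map_poly (@tofrac P) p.
  move=> /Pdiv.Idomain.dvdpP [[c w] /= c0 e].
  have e2 := congr1 (map_poly (@tofrac P)) e; rewrite rmorphM /= map_polyZ /= in e2.
  have c0' : tofrac c != 0 by rewrite tofrac_eq0.
  by rewrite -(dvdpZr _ _ c0') e2 dvdp_mull.
have gf : gE %| fE by apply: transfer; exact: dvdp_gcdl.
have gG := transfer _ (dvdp_gcdr f G).
have s5 : size gE = 5 by apply: fE_div => //; rewrite size_tofrac.
have eqp : gE %= fE by rewrite -dvdp_size_eqp // s5 size_fE.
rewrite (eqp_dvdl _ eqp) in gG.
have mf := plane_quartic_monic.
have eG := Pdiv.RingMonic.rdivp_eq mf G.
exists (Pdiv.CommonRing.rdivp G f); set r := Pdiv.CommonRing.rmodp G f in eG.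
suff r_0 : r = 0 by rewrite {1}eG r_0 addr0.
have sr : (size r < size f)%N by rewrite Pdiv.CommonRing.ltn_rmodpN0 // monic_neq0.
apply/eqP; rewrite -size_poly_eq0 -size_tofrac size_poly_eq0.
have dr : fE %| map_poly (@tofrac P) r.
  have -> : r = G - Pdiv.CommonRing.rdivp G f * f by rewrite {1}eG addrC addKr.
  by rewrite rmorphB rmorphM /= dvdp_sub // dvdp_mull.
apply: contraTT dr => rn0; apply/negP => /(dvdp_leq rn0).
by rewrite !size_tofrac leqNgt sr.
Qed.
End Irreducible.

Lemma rmorph_quartic (A B : comNzRingType) (h : {rmorphism A -> B}) (a b c x y z : A) :
  h (quartic a b c x y z) = quartic (h a) (h b) (h c) (h x) (h y) (h z).
Proof. by rewrite /quartic !(rmorphD, rmorphM, rmorphXn). Qed.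

(** Valid for any derivation killing the coefficients, hence for all partial derivatives at once;
    [2 * H] collects what disappears in characteristic 2. *)
Lemma quartic_derivation (A : comNzRingType) (D : A -> A) (a b c x y z : A) :
  {morph D : u v / u + v} -> (forall u v, D (u * v) = D u * v + u * D v) ->
  D a = 0 -> D b = 0 -> D c = 0 ->
  exists H, D (quartic a b c x y z) = y * (z ^+ 2 + y * z + b * y ^+ 2) * D x +
    x * (z ^+ 2 + x * z + b * y ^+ 2) * D y + x * y * (x + y) * D z + 2 * H.
Proof.
move=> hD hM ha hb hc.
have D2 u : D (u ^+ 2) = 2 * u * D u by rewrite expr2 hM; ring.
have D4 u : D (u ^+ 4) = 4 * u ^+ 3 * D u.
  have -> : u ^+ 4 = (u ^+ 2) ^+ 2 by rewrite -exprM.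
  by rewrite D2 D2; ring.
exists ((2 * z ^+ 3 + (x ^+ 2 + x * y + y ^+ 2) * z) * D z +
  (x * z ^+ 2 + x * y * z + a * (x ^+ 2 + x * y) * (2 * x + y) + b * x * y ^+ 2) * D x +
  (y * z ^+ 2 + x * y * z + a * (x ^+ 2 + x * y) * x + b * (x ^+ 2 + x * y) * y + 2 * c * y ^+ 3) * D y).
by rewrite /quartic !(hD, hM, D2, D4) ha hb hc; ring.
Qed.

(** * The projective quartic: Hilbert polynomial, irreducibility, smoothness *)

Section Poly.
Variable K : fieldType.
Let i0 : 'I_3 := @Ordinal 3 0 isT.
Let i1 : 'I_3 := @Ordinal 3 1 isT.
Let i2 : 'I_3 := @Ordinal 3 2 isT.

Definition quartic_mp (a b c : K) : {mpoly K[3]} :=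
  quartic a%:MP b%:MP c%:MP 'X_i0 'X_i1 'X_i2.

Lemma meval_quartic (a b c : K) (v : 'I_3 -> K) :
  (quartic_mp a b c).@[v] = quartic a b c (v i0) (v i1) (v i2).
Proof. by rewrite /quartic_mp rmorph_quartic /= !mevalC !mevalXU. Qed.

Lemma quartic_homog (a b c : K) : quartic_mp a b c \is 4.-homog.
Proof.
have hX i : ('X_i : {mpoly K[3]}) \is 1.-homog by rewrite dhomogX; apply/eqP; exact: mdeg1.
have hX2 i : ('X_i ^+ 2 : {mpoly K[3]}) \is 2.-homog by exact: (dhomogMn 2 (hX i)).
have hXX i j : ('X_i * 'X_j : {mpoly K[3]}) \is 2.-homog by exact: (dhomogM (hX i) (hX j)).
have hC (d : K) p k : p \is k.-homog -> (d%:MP * p : {mpoly K[3]}) \is k.-homog.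
  by move=> h; rewrite mul_mpolyC; apply: dhomogZ.
have hg : ('X_i0 ^+ 2 + 'X_i0 * 'X_i1 : {mpoly K[3]}) \is 2.-homog by exact: dhomogD.
rewrite /quartic_mp /quartic; do !apply: dhomogD.
- exact: (dhomogMn 4 (hX i2)).
- by apply: (@dhomogM _ _ _ 2 _ 2) => //; apply: dhomogD.
- by apply: (@dhomogM _ _ _ 3 _ 1) => //; apply: (@dhomogM _ _ _ 2 _ 1) => //; apply: dhomogD.
- by apply: hC; exact: (dhomogMn 2 hg).
- by rewrite -mulrA; apply: hC; apply: (@dhomogM _ _ _ 2 _ 2).
- by apply: hC; exact: (dhomogMn 4 (hX i1)).
Qed.

Lemma quartic_mp_neq0 (a b c : K) : quartic_mp a b c != 0.
Proof.
apply/eqP => h; have : (quartic_mp a b c).@[fun i => (i == i2)%:R] = 0 by rewrite h meval0.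
rewrite meval_quartic -[LHS]/(quartic a b c 0 0 1).
have -> : quartic a b c 0 0 1 = 1 by rewrite /quartic; ring.
by move/eqP; rewrite oner_eq0.
Qed.

Lemma mderiv_quartic (a b c : K) (v : 'I_3 -> K) i : (2 : K) = 0 ->
  (quartic_mp a b c)^`M(i).@[v] =
    nth 0 [:: v i1 * (v i2 ^+ 2 + v i1 * v i2 + b * v i1 ^+ 2);
              v i0 * (v i2 ^+ 2 + v i0 * v i2 + b * v i1 ^+ 2);
              v i0 * v i1 * (v i0 + v i1)] i.
Proof.
move=> k2; have dX j : ('X_j)^`M(i).@[v] = (i == j)%:R.
  rewrite mderivX mevalZ mnmE eq_sym; case: eqP => [->|_]; last by rewrite mul0r.
  have -> : (U_(j) - U_(j) = 0 :> 'X_{1..3})%MM by apply/mnmP => l; rewrite !mnmE subnn.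
  by rewrite mpolyX0 meval1 mulr1.
have [|||||H ->] := @quartic_derivation _ (mderiv i) a%:MP b%:MP c%:MP 'X_i0 'X_i1 'X_i2;
  rewrite ?mderivC //; [exact: mderivD | exact: mderivM |].
rewrite mevalD; have -> : (2 * H).@[v] = 0 by rewrite mevalM rmorph_nat k2 mul0r.
rewrite addr0 !(mevalD, mevalM, rmorphXn) /= !dX !mevalXU !mevalC.
by case: i dX H => [[|[|[|//]]] hi] dX H /=; rewrite ?mulr0 ?mulr1 ?addr0 ?add0r.
Qed.

Lemma quartic_ideal (a b c : K) (p : {mpoly K[3]}) :
  in_ideal [:: quartic_mp a b c] p <-> exists g, p = g * quartic_mp a b c.
Proof.
split=> [[g ->]|[g ->]]; first by exists (g ord0); rewrite big_ord_recl big_ord0 addr0.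
by exists (fun _ => g); rewrite big_ord_recl big_ord0 addr0.
Qed.

(** In the component of degree d + e of the product only the component of g in degree d
    contributes. *)
Lemma homog_factor (n d e : nat) (p g F : {mpoly K[n]}) : F \is e.-homog -> p \is (d + e)%N.-homog ->
  p = g * F -> p = pihomog mdeg d g * F.
Proof.
move=> hF hp e1; rewrite -[LHS](pihomog_dE hp) {1}e1.
rewrite {1}(pihomog_partitionE (leqnn (msize g))) mulr_suml raddf_sum /=.
have [dg|dg] := ltnP d (msize g).
  rewrite (bigD1 (Ordinal dg)) //= big1 ?addr0 => [|i].
    by apply: pihomog_dE; apply: dhomogM => //; exact: pihomogP.
  rewrite -val_eqE /= => ne; apply: (@pihomog_ne0 _ _ _ (i + e)%N); last by apply: dhomogM => //; exact: pihomogP.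
  by rewrite eqn_add2r.
rewrite big1 => [|i _]; last first.
  apply: (@pihomog_ne0 _ _ _ (i + e)%N); last by apply: dhomogM => //; exact: pihomogP.
  by rewrite eqn_add2r ltn_eqF // (leq_trans (ltn_ord i)).
have -> : pihomog mdeg d g = 0; last by rewrite mul0r.
rewrite pihomogE big_seq_cond big1 // => m /andP[mg /eqP md].
by have := msize_mdeg_lt mg; rewrite md ltnNge dg.
Qed.

Lemma dim_dhomog d : \dim {: dhomog 3 K d} = 'C(d + 2, d).
Proof. by rewrite dimvf. Qed.

Let bin_diff d : (4 * d + 14 + 'C(d + 2, d) = 'C(d + 4 + 2, d + 4))%N.
Proof.
have bin2E e : 'C(e + 2, e) = ((e + 2) * (e + 1) %/ 2)%N.
  by rewrite -bin_sub ?leq_addr // addKn bin2 addn2 /= addn1 divn2.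
by rewrite !bin2E; lia.
Qed.

(** Multiplication by the quartic is injective and maps degree d onto the part of degree d + 4 of
    the ideal. The difference of binomials is 4 (d + 4) - 2, so P(0) = -2 and the genus is 3. *)
Lemma quartic_hilbert_value (a b c : K) (d : nat) :
  hilbert_value [:: quartic_mp a b c] (d + 4) (4 * d + 14).
Proof.
set F := quartic_mp a b c; have hF : F \is 4.-homog := quartic_homog a b c.
have hm (p : dhomog 3 K d) : val p * F \is (d + 4)%N.-homog by apply: dhomogM => //; exact: valP.
pose f (p : dhomog 3 K d) : dhomog 3 K (d + 4) := DHomog (hm p).
have lf : linear f.
  by move=> t p r; apply: val_inj; rewrite /= mulrDl -scalerAl.
pose L := GRing.isLinear.Build _ _ _ _ f lf.
pose fL : {linear dhomog 3 K d -> dhomog 3 K (d + 4)} := HB.pack f L.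
exists (limg (linfun fL)) => [p|].
  rewrite quartic_ideal; split=> [/memv_imgP [r _ ->]|[g hg]].
    by exists (val r); rewrite lfunE.
  have e := homog_factor hF (valP p) hg.
  have hg' : pihomog mdeg d g \is d.-homog by exact: pihomogP.
  apply/memv_imgP; exists (DHomog hg'); first exact: memvf.
  by apply: val_inj; rewrite lfunE.
have kf : lker (linfun fL) = 0%VS.
  apply/eqP; rewrite -subv0; apply/subvP => p; rewrite memv_ker lfunE => /eqP h.
  rewrite memv0; apply/eqP/val_inj/eqP; have /eqP := congr1 val h.
  by rewrite /= mulf_eq0 (negPf (quartic_mp_neq0 a b c)) orbF.
have dL : \dim (limg (linfun fL)) = \dim {: dhomog 3 K d}.
  by apply: limg_dim_eq; rewrite kf capv0.
by rewrite dL (dim_dhomog d) (dim_dhomog (d + 4)) bin_diff.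
Qed.

Lemma quartic_hilbert (a b c : K) : hilbert_polynomial [:: quartic_mp a b c] (4 *: 'X - 2%:P).
Proof.
exists 4 => d d4; have [e ->] : exists e, d = (e + 4)%N by exists (d - 4)%N; rewrite subnK.
exists (4 * e + 14)%N; first exact: quartic_hilbert_value.
by rewrite !hornerE (natrD _ e 4) (natrD _ (4 * e)%N 14) (natrM _ 4 e); ring.
Qed.

End Poly.

Definition row3 (K : fieldType) (x y z : K) : 'rV[K]_3 := \row_i nth 0 [:: x; y; z] i.

Section Row.
Variables (K : fieldType) (a b c : K).

Lemma row3_eta (v : 'rV[K]_3) :
  v = row3 (v 0 (@Ordinal 3 0 isT)) (v 0 (@Ordinal 3 1 isT)) (v 0 (@Ordinal 3 2 isT)).
Proof.
apply/rowP => -[[|[|[|//]]] hi]; rewrite mxE /=; congr (v _ _); exact: val_inj.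
Qed.

Lemma row3_eq0 (x y z : K) : (row3 x y z == 0) = [&& x == 0, y == 0 & z == 0].
Proof.
apply/eqP/and3P => [/rowP h|[/eqP -> /eqP -> /eqP ->]].
  by split; apply/eqP; [have := h (@Ordinal 3 0 isT) | have := h (@Ordinal 3 1 isT) | have := h (@Ordinal 3 2 isT)]; rewrite !mxE.
by apply/rowP => -[[|[|[|//]]] hi]; rewrite !mxE.
Qed.

Lemma scale_row3 (t x y z : K) : t *: row3 x y z = row3 (t * x) (t * y) (t * z).
Proof. by apply/rowP => -[[|[|[|//]]] hi]; rewrite !mxE. Qed.

Lemma quartic_row3 (x y z : K) : (quartic_mp a b c).@[row3 x y z 0] = quartic a b c x y z.
Proof. by rewrite meval_quartic !mxE. Qed.

Lemma proj_zero_quartic (x y z : K) : proj_zero [:: quartic_mp a b c] (row3 x y z) =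
  (row3 x y z != 0) && (quartic a b c x y z == 0).
Proof. by rewrite /proj_zero /= quartic_row3 andbT. Qed.

Lemma meval_scale n d (p : {mpoly K[n]}) (t : K) (v : 'rV[K]_n) : p \is d.-homog ->
  p.@[(t *: v) 0] = t ^+ d * p.@[v 0].
Proof.
move=> hp; rewrite !mevalE mulr_sumr big_seq [RHS]big_seq; apply: eq_bigr => m hm.
rewrite mulrCA; congr (_ * _).
have <- : mdeg m = d by exact: (dhomog_mf hp).
rewrite mdegE -prodrXr -big_split /=; apply: eq_bigr => i _.
by rewrite mxE exprMn.
Qed.

Lemma rmorph_mmap n (A B : comNzRingType) (h : {rmorphism A -> B}) (f : K -> A) (u : 'I_n -> A) (p : {mpoly K[n]}) :
  h (mmap f u p) = mmap (h \o f) (h \o u) p.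
Proof.
rewrite /mmap rmorph_sum; apply: eq_bigr => m _; rewrite rmorphM; congr (_ * _).
by rewrite /mmap1 rmorph_prod; apply: eq_bigr => i _; rewrite rmorphXn.
Qed.

End Row.

Section Irreducible.
Variables (K : closedFieldType) (a b c : K).
Hypotheses (k2 : (2 : K) = 0) (a0 : a != 0) (bc : c != b ^+ 2).
Local Notation F := (quartic a b c).

Definition eval2 (x z : K) : {rmorphism {poly {poly K}} -> K} :=
  horner_eval z \o map_poly (horner_eval x).

Lemma eval2C x z p : eval2 x z p%:P = p.[x].
Proof. by rewrite /eval2 /= map_polyC /horner_eval hornerC. Qed.

Lemma eval2X x z : eval2 x z 'X = z.
Proof. by rewrite /eval2 /= map_polyX /horner_eval hornerX. Qed.

Let rmorph_quartic_form (A B : comNzRingType) (h : {rmorphism A -> B}) (z p r s : A) :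
  h (z ^+ 4 + p * z ^+ 2 + r * z + s) = h z ^+ 4 + h p * h z ^+ 2 + h r * h z + h s.
Proof. by rewrite !(rmorphD, rmorphM, rmorphXn). Qed.

Lemma eval2_quartic (R : {poly K}) x z : eval2 x z (plane_quartic R) =
  z ^+ 4 + (x ^+ 2 + x + 1) * z ^+ 2 + (x ^+ 2 + x) * z + R.[x].
Proof.
by rewrite /plane_quartic rmorph_quartic_form !eval2X !eval2C !hornerE.
Qed.

Lemma eval2_mmap n (u : 'I_n -> {poly {poly K}}) (g : {mpoly K[n]}) x z :
  eval2 x z (mmap (polyC \o polyC) u g) = g.@[eval2 x z \o u].
Proof.
rewrite rmorph_mmap /meval /mmap; apply: eq_bigr => m _; congr (_ * _).
by rewrite [LHS]eval2C hornerC.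
Qed.

Lemma plane_quartic_root (R : {poly K}) x : exists z, eval2 x z (plane_quartic R) = 0.
Proof.
have [|z /rootP hz] := closed_rootP (map_poly (horner_eval x) (plane_quartic R)) _; last by exists z.
rewrite size_map_poly_id0 ?size_plane_quartic //.
by rewrite (monicP (plane_quartic_monic R)) /= /horner_eval hornerC oner_neq0.
Qed.

Let dich (R : {poly K}) (u : 'I_3 -> {poly {poly K}}) (g : {mpoly K[3]}) :
  R.[0] != R^`().[0] ^+ 2 -> R.[1] != R^`().[1] ^+ 2 ->
  (forall x z, eval2 x z (plane_quartic R) = 0 -> g.@[eval2 x z \o u] = 0) \/
  exists2 r : {poly K}, r != 0 & forall x z, eval2 x z (plane_quartic R) = 0 ->
     g.@[eval2 x z \o u] = 0 -> r.[x] = 0.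
Proof.
move=> h0 h1; have [[Q hQ]|[r [w [w' [r0 hr]]]]] := plane_quartic_dichotomy k2 h0 h1 (mmap (polyC \o polyC) u g).
  by left=> x z hf; rewrite -eval2_mmap hQ rmorphM hf mulr0.
right; exists r => // x z hf hg; have := congr1 (eval2 x z) hr.
by rewrite rmorphD !rmorphM hf eval2_mmap hg !mulr0 addr0 eval2C.
Qed.

(** The constant terms in the charts y = 1 and, next, x = 1. The two conditions on R at 0 and 1
    become c != b^2 twice in the first chart, a != 0 and c != b^2 in the second. *)
Let RY : {poly K} := a%:P * ('X ^+ 2 + 'X) ^+ 2 + b%:P * ('X ^+ 2 + 'X) + c%:P.
Let RX : {poly K} := a%:P * (1 + 'X) ^+ 2 + b%:P * ('X ^+ 2 + 'X ^+ 3) + c%:P * 'X ^+ 4.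

Let evalY x z : eval2 x z (plane_quartic RY) = F x 1 z.
Proof. by rewrite eval2_quartic /RY /quartic !(hornerD, hornerM, horner_exp, hornerC, hornerX); ring. Qed.

Let evalX y z : eval2 y z (plane_quartic RX) = F 1 y z.
Proof. by rewrite eval2_quartic /RX /quartic !(hornerD, hornerM, horner_exp, hornerC, hornerX); ring. Qed.

Let dRY x : RY^`().[x] = b.
Proof.
rewrite /RY !exprS !expr0 !(derivD, derivM, derivC, derivX) !(hornerD, hornerM, hornerC, hornerX).
transitivity (b + 2 * (a * (x ^+ 2 + x) * (2 * x + 1) + b * x)); first by ring.
by rewrite k2 mul0r addr0.
Qed.

Let dRX x : RX^`().[x] = b * x ^+ 2.
Proof.
rewrite /RX !exprS !expr0 !(derivD, derivM, derivC, derivX) !(hornerD, hornerM, hornerC, hornerX).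
transitivity (b * x ^+ 2 + 2 * (a * (1 + x) + b * (x + x ^+ 2) + 2 * c * x ^+ 3)); first by ring.
set A := (X in 2 * X); by rewrite k2 mul0r addr0 mulr1 expr2.
Qed.

Let dichY (g : {mpoly K[3]}) : (forall x z, F x 1 z = 0 -> g.@[row3 x 1 z 0] = 0) \/
  exists2 r : {poly K}, r != 0 & forall x z, F x 1 z = 0 -> g.@[row3 x 1 z 0] = 0 -> r.[x] = 0.
Proof.
pose u (i : 'I_3) : {poly {poly K}} := nth 0 [:: 'X%:P; 1; 'X] i.
have hu x z : g.@[eval2 x z \o u] = g.@[row3 x 1 z 0].
  apply: meval_eq => -[[|[|[|//]]] hi]; rewrite mxE /= /u /=; first by rewrite [LHS]eval2C hornerX.
    by rewrite [LHS]eval2C hornerC.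
  exact: eval2X.
have [||h|[r r0 hr]] := @dich RY u g.
- rewrite dRY /RY !(hornerD, hornerM, horner_exp, hornerC, hornerX).
  by rewrite [X in X != _](_ : _ = c) //; ring.
- rewrite dRY /RY !(hornerD, hornerM, horner_exp, hornerC, hornerX).
  rewrite [X in X != _](_ : _ = c + 2 * (2 * a + b)); last by ring.
  by rewrite k2 mul0r addr0.
- by left=> x z hF; rewrite -hu; apply: h; rewrite evalY.
- by right; exists r => // x z hF hg; apply: (hr x z); rewrite ?evalY ?hu.
Qed.

Let dichX (g : {mpoly K[3]}) : (forall y z, F 1 y z = 0 -> g.@[row3 1 y z 0] = 0) \/
  exists2 r : {poly K}, r != 0 & forall y z, F 1 y z = 0 -> g.@[row3 1 y z 0] = 0 -> r.[y] = 0.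
Proof.
pose u (i : 'I_3) : {poly {poly K}} := nth 0 [:: 1; 'X%:P; 'X] i.
have hu x z : g.@[eval2 x z \o u] = g.@[row3 1 x z 0].
  apply: meval_eq => -[[|[|[|//]]] hi]; rewrite mxE /= /u /=; first by rewrite [LHS]eval2C hornerC.
    by rewrite [LHS]eval2C hornerX.
  exact: eval2X.
have [||h|[r r0 hr]] := @dich RX u g.
- rewrite dRX /RX !(hornerD, hornerM, horner_exp, hornerC, hornerX).
  rewrite [X in X != _](_ : _ = a); last by ring.
  by rewrite [X in _ != X](_ : _ = 0) //; ring.
- rewrite dRX /RX !(hornerD, hornerM, horner_exp, hornerC, hornerX).
  rewrite [X in X != _](_ : _ = c + 2 * (2 * a + b)); last by ring.
  by rewrite k2 mul0r addr0 expr1n mulr1.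
- by left=> x z hF; rewrite -hu; apply: h; rewrite evalX.
- by right; exists r => // x z hF hg; apply: (hr x z); rewrite ?evalX ?hu.
Qed.

(** If g vanished on the chart y = 1, then v would have y = 0, and [dichX] would leave g only
    finitely many values of y for its zeros in the chart x = 1. But there g would vanish at the
    points with y = t for every t != 0. *)
Let cutout (g : {mpoly K[3]}) d (v : 'rV[K]_3) : g \is d.-homog -> proj_zero [:: quartic_mp a b c] v ->
  g.@[v 0] != 0 ->
  exists2 r : {poly K}, r != 0 & forall x z, F x 1 z = 0 -> g.@[row3 x 1 z 0] = 0 -> r.[x] = 0.
Proof.
move=> hg; rewrite (row3_eta v).
set x := v 0 (@Ordinal 3 0 isT); set y := v 0 (@Ordinal 3 1 isT); set z := v 0 (@Ordinal 3 2 isT).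
clearbody x y z.
rewrite proj_zero_quartic => /andP[n0 /eqP hF] gn.
have [vY|//] := dichY g; exfalso.
have vanY x' y' z' : y' != 0 -> F x' y' z' = 0 -> g.@[row3 x' y' z' 0] = 0.
  move=> y0 hF'.
  have -> : row3 x' y' z' = y' *: row3 (x' / y') 1 (z' / y') by rewrite scale_row3 mulr1 ![y' * (_ / _)]mulrC !divfK.
  rewrite (meval_scale _ _ hg) vY ?mulr0 //.
  have : (quartic_mp a b c).@[(y' *: row3 (x' / y') 1 (z' / y')) 0] = 0.
    by rewrite scale_row3 mulr1 ![y' * (_ / _)]mulrC !divfK // quartic_row3.
  rewrite (meval_scale _ _ (quartic_homog a b c)) quartic_row3 => /eqP.
  by rewrite mulf_eq0 expf_eq0 (negPf y0) => /eqP.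
have [y0|y0] := eqVneq y 0; last by move: gn; rewrite vanY ?eqxx.
have x0 : x != 0.
  apply: contraNneq n0 => x0; rewrite x0 y0 row3_eq0 eqxx /=.
  have : z ^+ 4 = 0 by rewrite -hF x0 y0 /quartic; ring.
  by move/eqP; rewrite expf_eq0.
have sc : row3 x y z = x *: row3 1 0 (z / x) by rewrite y0 scale_row3 mulr1 mulr0 mulrC divfK.
have hF1 : F 1 0 (z / x) = 0.
  have : (quartic_mp a b c).@[(x *: row3 1 0 (z / x)) 0] = 0 by rewrite -sc quartic_row3.
  rewrite (meval_scale _ _ (quartic_homog a b c)) quartic_row3 => /eqP.
  by rewrite mulf_eq0 expf_eq0 (negPf x0) => /eqP.
have [vX|[r r0 hr]] := dichX g.
  by move: gn; rewrite sc (meval_scale _ _ hg) (vX _ _ hF1) mulr0 eqxx.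
have [|t] := closed_nonrootP (r * 'X) _; first by rewrite mulf_neq0 ?polyX_eq0.
rewrite rootM negb_or rootX => /andP[rt t0].
have [w hw] := plane_quartic_root RX t; rewrite evalX in hw.
by move: rt; rewrite /root (hr _ _ hw) ?eqxx //; apply: vanY.
Qed.

(** A form from each closed subset that is nonzero somewhere on the curve vanishes above finitely
    many x only. Over an algebraically closed field some x avoids both sets, and a point above it
    lies in neither subset. *)
Lemma quartic_irreducible : proj_irreducible [:: quartic_mp a b c].
Proof.
split.
  have [z hz] := plane_quartic_root RX 0; rewrite evalX in hz.
  by exists (row3 1 0 z); rewrite proj_zero_quartic hz eqxx row3_eq0 oner_eq0.
move=> s1 s2 h1 h2 cov.
have half (s : seq {mpoly K[3]}) : all_homog s ->
    (forall v, proj_zero [:: quartic_mp a b c] v -> proj_zero s v) \/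
    exists g (r : {poly K}), [/\ g \in s, r != 0 &
      forall x z, F x 1 z = 0 -> g.@[row3 x 1 z 0] = 0 -> r.[x] = 0].
  move=> hs; case: (boolp.pselect (exists g v, [/\ g \in s, proj_zero [:: quartic_mp a b c] v & g.@[v 0] != 0])).
    move=> [g [v [gs hv gv]]]; have [d hg] := hs g gs; have [r r0 hr] := cutout hg hv gv.
    by right; exists g, r.
  move=> no; left=> v hv; apply/andP; split; first by case/andP: hv.
  apply/allP => g gs; apply/eqP/eqP; apply: contraT => gv.
  by case: no; exists g, v.
have [|[g1 [r1 [g1s r10 hr1]]]] := half s1 h1; first by left.
have [|[g2 [r2 [g2s r20 hr2]]]] := half s2 h2; first by right.
exfalso; have [|x] := closed_nonrootP (r1 * r2) _; first by rewrite mulf_neq0.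
rewrite rootM negb_or => /andP[n1 n2].
have [z hz] := plane_quartic_root RY x; rewrite evalY in hz.
have [|/andP[_ /allP h]|/andP[_ /allP h]] := cov (row3 x 1 z).
- by rewrite proj_zero_quartic hz eqxx row3_eq0 oner_eq0 andbF.
- by move: n1; rewrite /root (hr1 x z hz) ?eqxx //; apply/eqP/(h g1).
- by move: n2; rewrite /root (hr2 x z hz) ?eqxx //; apply/eqP/(h g2).
Qed.
End Irreducible.

(** The z-derivative confines a singular point to x y (x + y) = 0. On these lines the quartic is the
    square of a factor that the other derivatives force to vanish, plus (c + b^2) y^4 if y != 0, or
    plus a x^4 if y = 0. *)
Lemma quartic_smooth (K : fieldType) (a b c : K) (v : 'rV[K]_3) :
  (2 : K) = 0 -> a != 0 -> c != b ^+ 2 -> proj_zero [:: quartic_mp a b c] v ->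
  \rank (Defs.jacobian [:: quartic_mp a b c] v) = 1%N.
Proof.
move=> k2 a0 bc; rewrite (row3_eta v).
set x := v 0 (@Ordinal 3 0 isT); set y := v 0 (@Ordinal 3 1 isT); set z := v 0 (@Ordinal 3 2 isT).
clearbody x y z; rewrite proj_zero_quartic => /andP[n0 /eqP hF].
have -> : \rank (Defs.jacobian [:: quartic_mp a b c] (row3 x y z)) =
    (Defs.jacobian [:: quartic_mp a b c] (row3 x y z) != 0) :> nat by exact: rank_rV.
rewrite [X in nat_of_bool X](_ : _ = true) //; apply/eqP => /matrixP h.
have D i := h ord0 i.
have e1 : y * (z ^+ 2 + y * z + b * y ^+ 2) = 0.
  by have := D (@Ordinal 3 0 isT); rewrite !mxE /= mderiv_quartic //= !mxE.
have e2 : x * (z ^+ 2 + x * z + b * y ^+ 2) = 0.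
  by have := D (@Ordinal 3 1 isT); rewrite !mxE /= mderiv_quartic //= !mxE.
have e3 : x * y * (x + y) = 0.
  by have := D (@Ordinal 3 2 isT); rewrite !mxE /= mderiv_quartic //= !mxE.
have kk (u : K) : u + u = 0 by rewrite -mulr2n -mulr_natr k2 mulr0.
have yb : y != 0 -> x ^+ 2 + x * y = 0 -> False.
  move=> y0 hxy; move/eqP: e1; rewrite mulf_eq0 (negPf y0) /= => /eqP e1.
  have : (c + b ^+ 2) * y ^+ 4 = 0.
    transitivity (quartic a b c x y z - (z ^+ 2 + y * z + b * y ^+ 2) ^+ 2
      - (x ^+ 2 + x * y) * (z ^+ 2 + y * z + a * (x ^+ 2 + x * y) + b * y ^+ 2)
      + 2 * (y * z ^+ 3 + b * y ^+ 2 * z ^+ 2 + b * y ^+ 3 * z + b ^+ 2 * y ^+ 4)).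
      by rewrite /quartic; ring.
    by rewrite hF e1 hxy k2; ring.
  move/eqP; rewrite mulf_eq0 expf_eq0 (negPf y0) orbF => /eqP cb.
  by case/eqP: bc; rewrite -[LHS]addr0 -(kk (b ^+ 2)) addrA cb add0r.
have [y0|y0] := eqVneq y 0.
  have e4 : x * (z ^+ 2 + x * z) = 0 by rewrite -[RHS]e2 y0; ring.
  have [x0|x0] := eqVneq x 0.
    have : z ^+ 4 = 0 by rewrite -hF x0 y0 /quartic; ring.
    move/eqP; rewrite expf_eq0 /= => /eqP z0.
    by move: n0; rewrite row3_eq0 x0 y0 z0 eqxx.
  move/eqP: e4; rewrite mulf_eq0 (negPf x0) /= => /eqP e4.
  have : a * x ^+ 4 = 0.
    transitivity (quartic a b c x 0 z - (z ^+ 2 + x * z) ^+ 2 + 2 * (x * z ^+ 3)).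
      by rewrite /quartic; ring.
    by rewrite -{1}y0 hF e4 k2; ring.
  by move/eqP; rewrite mulf_eq0 (negPf a0) expf_eq0 (negPf x0).
apply: (yb y0); move/eqP: e3; rewrite mulrAC mulf_eq0 (negPf y0) orbF => /eqP e3.
by rewrite -e3; ring.
Qed.

Section Points.
Variables (k : finFieldType) (a b c : k).
Local Notation F := (quartic a b c).
Let cls (x : 'rV[k]_3) : {set 'rV[k]_3} := [set t *: x | t : k & t != 0].

Let cls_scale t x : t != 0 -> cls (t *: x) = cls x.
Proof.
move=> t0; apply/setP => y; apply/imsetP/imsetP => -[s]; rewrite inE => s0 ->.
  by exists (s * t); rewrite ?inE ?mulf_neq0 // scalerA.
by exists (s / t); rewrite ?inE ?mulf_neq0 ?invr_eq0 // scalerA divfK.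
Qed.

Let cls_eq x y : cls x = cls y -> exists2 t, t != 0 & y = t *: x.
Proof.
move=> e; have : y \in cls y by apply/imsetP; exists 1; rewrite ?inE ?oner_eq0 ?scale1r.
by rewrite -e => /imsetP [t]; rewrite inE => t0 ->; exists t.
Qed.

Let row3_inj (x y z x' y' z' : k) : row3 x y z = row3 x' y' z' -> [/\ x = x', y = y' & z = z'].
Proof.
move=> /rowP h; have h0 := h (@Ordinal 3 0 isT); have h1 := h (@Ordinal 3 1 isT); have h2 := h (@Ordinal 3 2 isT).
by rewrite !mxE in h0 h1 h2.
Qed.

(** Each class has a unique representative with y = 1 or, if y = 0, with x = 1; a point with x = y =
    0 would have z^4 = 0. *)
Lemma card_quartic_points :
  #|[set [set t *: x | t : k & t != 0] | x : 'rV[k]_3 & proj_zero [:: quartic_mp a b c] x]|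
  = quartic_points a b c.
Proof.
pose A := [set v : k * k | F v.1 1 v.2 == 0]; pose B := [set z : k | F 1 0 z == 0].
pose f (v : k * k) := cls (row3 v.1 1 v.2); pose g (z : k) := cls (row3 1 0 z).
have fI : injective f.
  move=> [x z] [x' z'] /cls_eq [t t0]; rewrite scale_row3 => /row3_inj [/= -> e ->].
  by have -> : t = 1; [rewrite e mulr1 | rewrite !mul1r].
have gI : injective g.
  move=> z z' /cls_eq [t t0]; rewrite scale_row3 => /row3_inj [e _ ->].
  by have -> : t = 1; [rewrite e mulr1 | rewrite mul1r].
have dis : f @: A :&: g @: B = set0.
  apply/setP => w; rewrite !inE; apply/negbTE/negP => /andP[/imsetP [v _ ->] /imsetP [z _]].
  move=> /cls_eq [t t0]; rewrite scale_row3 => /row3_inj [_ /esym/eqP].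
  by rewrite mulr1 (negPf t0).
rewrite /quartic_points -/A -/B -(card_imset (mem A) fI) -(card_imset (mem B) gI) -cardsUI dis cards0 addn0.
apply: eq_card => w; apply/imsetP/setUP => [[v]|].
  rewrite inE (row3_eta v).
  set x := v 0 (@Ordinal 3 0 isT); set y := v 0 (@Ordinal 3 1 isT); set z := v 0 (@Ordinal 3 2 isT).
  clearbody x y z; rewrite proj_zero_quartic => /andP[n0 /eqP hF ->].
  have hs t x' y' z' : t != 0 -> F (t * x') (t * y') (t * z') = 0 -> F x' y' z' = 0.
    move=> t0; rewrite -!quartic_row3 -scale_row3 (meval_scale _ _ (quartic_homog a b c)) => /eqP.
    by rewrite mulf_eq0 expf_eq0 (negPf t0) => /eqP.
  have [y0|y0] := eqVneq y 0; [right|left].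
    have x0 : x != 0.
      apply: contraNneq n0 => x0; have : z ^+ 4 = 0 by rewrite -hF x0 y0 /quartic; ring.
      by move/eqP; rewrite expf_eq0 x0 y0 row3_eq0 eqxx.
    have e : row3 x y z = x *: row3 1 0 (z / x) by rewrite y0 scale_row3 mulr1 mulr0 mulrC divfK.
    apply/imsetP; exists (z / x); last by rewrite /g -(cls_scale _ x0) -e.
    rewrite inE; apply/eqP/(hs x) => //.
    by rewrite mulr1 mulr0 [x * _]mulrC divfK // -{1}y0.
  have e : row3 x y z = y *: row3 (x / y) 1 (z / y) by rewrite scale_row3 mulr1 ![y * (_ / _)]mulrC !divfK.
  apply/imsetP; exists (x / y, z / y); last by rewrite /f -(cls_scale _ y0) -e.
  rewrite inE; apply/eqP/(hs y) => //.
  by rewrite mulr1 ![y * (_ / _)]mulrC !divfK.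
case=> /imsetP [v]; rewrite inE => hv ->.
  by exists (row3 v.1 1 v.2) => //; rewrite inE proj_zero_quartic hv row3_eq0 oner_eq0 andbF.
by exists (row3 1 0 v) => //; rewrite inE proj_zero_quartic hv row3_eq0 oner_eq0.
Qed.

End Points.

Lemma map_quartic_mp (K L : fieldType) (h : {rmorphism K -> L}) (a b c : K) :
  map_mpoly h (quartic_mp a b c) = quartic_mp (h a) (h b) (h c).
Proof. by rewrite /quartic_mp rmorph_quartic /= !map_mpolyC !map_mpolyX. Qed.

Lemma exists_quartic_curve (k : finFieldType) (a b c : k) : (2 : k) = 0 -> a != 0 -> c != b ^+ 2 ->
  exists2 C : curve k, has_genus C 3 & #|rational_points C| = quartic_points a b c.
Proof.
move=> k2 a0 bc.
have K2 : (2 : kbar k) = 0 by rewrite -(rmorph_nat (to_kbar k)) k2 rmorph0.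
have a0' : to_kbar k a != 0 by rewrite fmorph_eq0.
have bc' : to_kbar k c != to_kbar k b ^+ 2 by rewrite -rmorphXn (inj_eq (fmorph_inj _)).
have geom : map (map_mpoly (to_kbar k)) [:: quartic_mp a b c] =
    [:: quartic_mp (to_kbar k a) (to_kbar k b) (to_kbar k c)] by rewrite /= map_quartic_mp.
have hom4 : all_homog [:: quartic_mp a b c].
  by move=> p; rewrite inE => /eqP ->; exists 4; exact: quartic_homog.
have hilb := quartic_hilbert a b c.
have sz : size (4 *: 'X - 2%:P : {poly rat}) = 2.
  by rewrite -mul_polyC -polyCN size_MXaddC; rewrite ?polyC_eq0 ?size_polyC.
have irr : proj_irreducible (map (map_mpoly (to_kbar k)) [:: quartic_mp a b c]).
  by rewrite geom; apply: quartic_irreducible.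
have smooth x : proj_zero (map (map_mpoly (to_kbar k)) [:: quartic_mp a b c]) x ->
    (\rank (Defs.jacobian (map (map_mpoly (to_kbar k)) [:: quartic_mp a b c]) x)).+1 = 2.
  by rewrite geom => hx; rewrite quartic_smooth.
exists (@Curve k 2 [:: quartic_mp a b c] hom4 (ex_intro2 _ _ _ hilb sz) irr smooth).
  by exists (4 *: 'X - 2%:P) => //; rewrite !hornerE.
exact: card_quartic_points.
Qed.

(** * Choice of the trace and conclusion *)

Lemma weil_m_sqr (q : nat) : weil_m q ^+ 2 <= 4 * q%:Z /\ 0 <= weil_m q.
Proof.
have x0 : 0 <= 2 * sqrtC (q%:R : algC) by rewrite mulr_ge0 ?ler0n // sqrtC_ge0 ler0n.
have xr := ger0_real x0.
have m0 : 0 <= weil_m q by rewrite real_floor_ge0.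
split=> //; rewrite -(ler_int algC) rmorphXn rmorphM /=.
have -> : (4%:~R : algC) * (q%:Z)%:~R = (2 * sqrtC (q%:R : algC)) ^+ 2.
  by rewrite exprMn sqrtCK -natrX.
by rewrite ler_pXn2r ?nnegrE ?ler0z // real_floor_le.
Qed.

(** For t = 1 mod 4 an s with K(s) = -t feeds the first family. For t = 7 mod 8 it is -t that is 1
    mod 4, so K(s) = t, and [kloosterman_mod8] supplies the trace condition of the second family.
    The bound 2 < n makes 8 divide q. *)
Lemma exists_curve_odd_trace (n : nat) (k : finFieldType) (t : int) : #|k| = (2 ^ n)%N -> odd n -> (2 < n)%N ->
  t ^+ 2 < 4 * 2 ^+ n -> (t = 1 %[mod 8])%Z \/ (t = 5 %[mod 8])%Z \/ (t = 7 %[mod 8])%Z ->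
  exists2 C : curve k, has_genus C 3 & #|rational_points C|%:Z = #|k|%:Z + 1 + 3 * t.
Proof.
move=> kq on n2 ht hm.
have k2 : (2 : k) = 0 by apply: pcharf0; apply: card_finPcharP kq _.
have [d hd] : exists d : nat, (2 ^ n = 8 * d)%N by exists (2 ^ (n - 3))%N; rewrite -(expnD 2 3) subnKC.
have q8 : (8 %| #|k|)%N by rewrite kq hd dvdn_mulr.
pose Q : int := 2 ^+ n.
have eQ : Q = 8 * d%:Z by rewrite /Q -[2]/(2%:Z) -rmorphXn /= -PoszM -hd; congr Posz; rewrite natrXE.
have mod4 : (exists e, t = 4 * e + 1 + Q) \/ ((exists e, - t = 4 * e + 1 + Q) /\ exists c, t = 8 * c + 7).
  case: hm => [h|[h|h]].
  - by left; exists ((t - 1 - Q) %/ 4)%Z; rewrite eQ; lia.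
  - by left; exists ((t - 1 - Q) %/ 4)%Z; rewrite eQ; lia.
  - by right; split; [exists ((- t - 1 - Q) %/ 4)%Z; rewrite eQ; lia | exists (t %/ 8)%Z; lia].
case: mod4 => [[e et]|[[e et] [c tc]]].
  have [|s s0 hs] := exists_kloosterman k2 (ltnW n2) kq (e := e); first by rewrite -/Q -et.
  have [||C gC nC] := @exists_quartic_curve k 1 0 (s ^+ 2) k2; rewrite ?oner_neq0 // ?expr0n ?sqrf_eq0 //.
  exists C => //; rewrite nC (quartic_points1 k2 kq on s0) hs -/Q -et; ring.
have [|s s0 hs] := exists_kloosterman k2 (ltnW n2) kq (e := e); first by rewrite -/Q -et sqrrN.
rewrite -/Q -et opprK in hs.
have cs : chi s = 1 by apply: (kloosterman_mod8 k2 s0 (c := c) q8); rewrite hs.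
have [||C gC nC] := @exists_quartic_curve k (s ^+ 2) s 0 k2; rewrite ?sqrf_eq0 // ?[0 == _]eq_sym ?sqrf_eq0 //.
by exists C => //; rewrite nC (quartic_points2 k2 s0 cs) hs.
Qed.

Theorem theorem4p1 (n q : nat) (k : finFieldType) (m : int)
    (hq : q = (2 ^ n)%N) (hq2 : (2 < q)%N)
    (hsq : ~ exists s : nat, q = (s ^ 2)%N)
    (hk : #|k| = q)
    (hm : m = weil_m q) :
  ((m = 1 %[mod 8])%Z \/ (m = 5 %[mod 8])%Z \/ (m = 7 %[mod 8])%Z ->
     exists C : curve k,
       [/\ has_genus C 3,
           #|rational_points C|%:Z = q%:Z + 1 + 3 * m
         & defect C = 0]) /\
  ((m = 0 %[mod 8])%Z \/ (m = 2 %[mod 8])%Z \/ (m = 6 %[mod 8])%Z ->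
     exists C : curve k,
       [/\ has_genus C 3,
           #|rational_points C|%:Z = q%:Z + 1 + 3 * m - 3
         & defect C = 3]).
Proof.
have on : odd n.
  apply: contraT => en; case: hsq; exists (2 ^ n./2)%N.
  by rewrite hq -expnM muln2 halfK (negPf en) subn0.
have n2 : (2 < n)%N.
  by case: (n) on hq => [|[|[|n']]] //= _ hq'; rewrite hq' in hq2.
have kq : #|k| = (2 ^ n)%N by rewrite hk.
have [m2 m0] := weil_m_sqr q; rewrite -hm in m2 m0.
have eq : 4 * q%:Z = 4 * 2 ^+ n by rewrite hq -[2 in RHS]/(2%:Z) -rmorphXn natrXE.
(* For odd t the square is 1 mod 4, so it differs from 4q. The case m = 0 is treated apart, because
   then t may be -1. *)
have bound t : t = m \/ t = m - 1 -> (2 %| t)%Z = false -> t ^+ 2 < 4 * 2 ^+ n.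
  move=> tm odd_t; rewrite -eq lt_neqAle; apply/andP; split.
    apply/eqP; have [u ->] : exists u, t = 2 * u + 1 by exists (t %/ 2)%Z; lia.
    have -> : (2 * u + 1) ^+ 2 = 4 * (u ^+ 2 + u) + 1 by ring.
    by move: (u ^+ 2 + u) => w; lia.
  case: tm => -> //; have [m1|m1] := leP 1 m.
    by apply: le_trans m2; rewrite ler_sqr ?nnegrE; lia.
  have -> : m = 0 by lia.
  by rewrite sub0r sqrrN expr1n; lia.
split=> h.
  have [|C gC nC] := @exists_curve_odd_trace n k m kq on n2 _ h.
    by apply: bound; [left | lia].
  exists C; split; rewrite ?nC ?hk // /defect nC hk -hm; ring.
(* For m = 0, 2, 6 mod 8 the trace m - 1 is 7, 1, 5 mod 8, and 3 (m - 1) = 3m - 3. *)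
have [||C gC nC] := @exists_curve_odd_trace n k (m - 1) kq on n2.
- by apply: bound; [right | lia].
- lia.
exists C; split; rewrite ?nC ?hk //; first by ring.
by rewrite /defect nC hk -hm; ring.
Qed.
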